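(* Finite-quotient stability for affinoid perfectoid spaces does not extend to affinoid sousperfectoid spaces, even for a cyclic group of prime order, and stable uniformity and sheafiness of the source do not suffice to make the quotient adic. Precisely: for every prime $p$ and every perfectoid field $K$ of characteristic $p$, the pair $(R,R^\circ)$ with the $C_p$-action described in the context is sousperfectoid, stably uniform and sheafy, and the quotient $\operatorname{Spa}(R,R^\circ)/C_p$ in the category of $v$-ringed spaces is not an adic space; in particular, the ring $R$ is sousperfectoid but not perfectoid.
   Context: Let $K$ be a perfectoid field of characteristic $p$ and choose $\pi\in K$ with $0<|\pi|<1$. Let $\mathbf z=\{x_{j,\ast}:j\ge0\}\amalg\{x_{j,n}:j,n\ge0\}\amalg\{y_{j,n}:j,n\ge0\}$ be a countable set of variables. $K\langle T,s,\mathbf z\rangle$ is the completion of the polynomial algebra $K[T,s,\mathbf z]$ for the Gauss norm. Let $J\subset K\langle T,s,\mathbf z\rangle$ be the closed ideal of series all of whose monomials have positive total degree in the variables $\mathbf z$, and let $R=K\langle T,s\rangle+sJ\subset K\langle T,s,\mathbf z\rangle$, with the restricted Gauss norm. $R^\circ$ is the subring of power-bounded elements. Action: a generator $\sigma$ of $C_p$ acts continuously on $K\langle T,s,\mathbf z\rangle$ by fixing $K,T,s$ and $\sigma(x_{j,\ast})=x_{j,\ast}-\pi^jy_{j,0}$, $\sigma(x_{j,n})=x_{j,n}+\pi^jy_{j,n}-Ty_{j,n+1}$, $\sigma(y_{j,n})=y_{j,n}$; this preserves $R$ and $R^\circ$, and hence acts on $\operatorname{Spa}(R,R^\circ)$.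 A complete Tate ring $R$ is sousperfectoid if there is a perfectoid Tate ring $\widetilde R$ and an injection $R\hookrightarrow\widetilde R$ of topological rings that splits as a map of topological $R$-modules. A Huber pair is sheafy if the structure presheaf on its adic spectrum is a sheaf; it is stably uniform if the section ring of every rational subset is uniform (its power-bounded elements form a bounded subset). A $v$-ringed space is a triple $(Y,\mathcal O_Y,(v_y)_{y\in Y})$ with $Y$ a topological space, $\mathcal O_Y$ a sheaf of complete topological rings with local stalks, and $v_y$ an equivalence class of valuations on the residue field at $y$; adic spaces are those locally isomorphic to $\operatorname{Spa}(A,A^+)$ with $(A,A^+)$ sheafy. For a finite group $G$ acting on an adic space $X$, the quotient $q\colon X\to X/G$ in $v$-ringed spaces has underlying space $|X|/G$, structure sheaf $U\mapsto\mathcal O_X(q^{-1}(U))^G$, and valuations obtained by restriction. ''Finite-quotient stability'' for a class of affinoid spaces means that quotients of its members by (base-field-linear) finite group actions are adic. *)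

(* Defs.v *)
From HB Require Import structures.
From mathcomp Require Import all_boot all_order all_algebra all_fingroup finmap.
From mathcomp Require Import all_classical reals topology tvs.
From mathcomp Require Import monalg lra.

Set SsrOldRewriteGoalsOrder.
Set Implicit Arguments.
Unset Strict Implicit.
Unset Printing Implicit Defensive.

Import Order.TTheory GRing.Theory Num.Theory.

Local Open Scope classical_set_scope.
Local Open Scope ring_scope.

HB.mixin Record TopologicalZmodule_isTopologicalComRing A
    of TopologicalZmodule A & GRing.ComPzRing A := {
  mulr_continuous : continuous (fun x : A * A => x.1 * x.2)
}.

#[short(type="topComRingType")]
HB.structure Definition TopologicalComRing :=
  {A of TopologicalZmodule A & GRing.ComPzRing A
      & TopologicalZmodule_isTopologicalComRing A}.

HB.factory Record NASeminorm_isTopologicalComRing (RR : realType) A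
    of GRing.ComPzRing A := {
  sn : A -> RR;
  sn_ge0 : forall x, 0 <= sn x;
  sn0 : sn 0 = 0;
  snB : forall x y, sn (x - y) <= Num.max (sn x) (sn y);
  snM : forall x y, sn (x * y) <= sn x * sn y
}.

HB.builders Context RR A of NASeminorm_isTopologicalComRing RR A.

Definition ball_nbhs (x : A) : set_system A :=
  [set B | exists2 e : RR, 0 < e & forall y, sn (y - x) < e -> B y].

HB.instance Definition _ := hasNbhs.Build A ball_nbhs.

Let snN x : sn (- x) <= sn x.
Proof. by rewrite -sub0r (le_trans (snB _ _)) // sn0 ge_max sn_ge0 lexx. Qed.

Let snD x y : sn (x + y) <= Num.max (sn x) (sn y).
Proof.
rewrite -[y in x + y]opprK (le_trans (snB _ _)) // ge_max !le_max lexx /=.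
by rewrite snN orbT.
Qed.

Let ball_filter (x : A) : ProperFilter (ball_nbhs x).
Proof.
apply: Build_ProperFilter_ex.
  by move=> B [e e0 Be]; exists x; apply: Be; rewrite subrr sn0.
split.
- by exists 1.
- move=> P Q [e e0 Pe] [d d0 Qd]; exists (Num.min e d).
    by rewrite lt_min e0 d0.
  by move=> y; rewrite lt_min => /andP[ye yd]; split; [exact: Pe|exact: Qd].
- by move=> P Q PQ [e e0 Pe]; exists e => // y /Pe /PQ.
Qed.

Let ball_singleton (x : A) B : ball_nbhs x B -> B x.
Proof. by move=> [e e0 Be]; apply: Be; rewrite subrr sn0. Qed.

Let ball_nbhs_nbhs (x : A) B : ball_nbhs x B -> ball_nbhs x (ball_nbhs^~ B).
Proof.
move=> [e e0 Be]; exists e => // y yx; exists e => // z zy; apply: Be.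
have -> : z - x = (z - y) + (y - x) by rewrite addrA subrK.
by rewrite (le_lt_trans (snD _ _)) // gt_max zy yx.
Qed.

HB.instance Definition _ := Nbhs_isNbhsTopological.Build A
  ball_filter ball_singleton ball_nbhs_nbhs.

Let sub_cont : continuous (fun x : A * A => x.1 - x.2).
Proof.
move=> [x y] B [e e0 Be] /=.
exists ([set a | sn (a - x) < e], [set b | sn (b - y) < e]).
  by split; exists e.
move=> [a b] [/= ax yb]; apply: Be.
rewrite [X in sn X](_ : _ = (a - x) - (b - y)); last first.
  by rewrite !opprB addrACA [RHS]addrACA [- b + _]addrC.
by rewrite (le_lt_trans (snB _ _)) // gt_max ax yb.
Qed.

HB.instance Definition _ :=
  PreTopologicalNmodule_isTopologicalZmodule.Build A sub_cont.

Let mul_cont : continuous (fun x : A * A => x.1 * x.2).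
Proof.
move=> [x y] B [e e0 Be] /=.
set c := 1 + sn x + sn y + e.
have sx0 := sn_ge0 x; have sy0 := sn_ge0 y.
have c1 : 1 <= c by rewrite /c; lra.
have c0 : 0 < c by rewrite /c; lra.
have ec0 : 0 < e / c by rewrite divr_gt0.
exists ([set a | sn (a - x) < e / c], [set b | sn (b - y) < e / c]).
  by split; exists (e / c).
move=> [a b] [/= ax yb]; apply: Be.
have sx : sn x <= c by rewrite /c; lra.
have sy : sn y <= c by rewrite /c; lra.
have eE : e = e / c * c by rewrite divfK // gt_eqF.
have sb : sn b <= c.
  rewrite -[b](subrK y) (le_trans (snD _ _)) // ge_max sy andbT.
  rewrite (le_trans (ltW yb)) // ler_pdivrMr //.
  by apply: le_trans (_ : e <= c) _; [rewrite /c; lra|rewrite ler_peMr // ltW].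
have -> : a * b - x * y = (a - x) * b + x * (b - y).
  by rewrite mulrBl mulrBr addrA subrK.
rewrite (le_lt_trans (snD _ _)) // gt_max; apply/andP; split.
  rewrite (le_lt_trans (snM _ _)) // (@le_lt_trans _ _ (sn (a - x) * c)) //.
    by rewrite ler_wpM2l // sn_ge0.
  by rewrite [ltRHS]eE ltr_pM2r.
rewrite (le_lt_trans (snM _ _)) // (@le_lt_trans _ _ (c * sn (b - y))) //.
  by rewrite ler_wpM2r // sn_ge0.
by rewrite [ltRHS]eE mulrC ltr_pM2r.
Qed.

HB.instance Definition _ :=
  TopologicalZmodule_isTopologicalComRing.Build A mul_cont.

HB.end.

Record absval (RR : realType) (K : fieldType) := AbsVal {
  av :> K -> RR;
  av_ge0 : forall x, 0 <= av x;
  av_eq0 : forall x, av x = 0 <-> x = 0;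
  avM : forall x y, av (x * y) = av x * av y;
  av_ultra : forall x y, av (x + y) <= Num.max (av x) (av y)
}.

Section AbsvalTheory.
Context (RR : realType) (K : fieldType) (v : absval RR K).

Lemma av0 : v 0 = 0. Proof. exact/av_eq0. Qed.

Lemma av1 : v 1 = 1.
Proof.
have /eqP : v 1 * v 1 = v 1 * 1 by rewrite -avM !mulr1.
rewrite -subr_eq0 -mulrBr mulf_eq0 subr_eq0 => /orP[/eqP/av_eq0/eqP|/eqP//].
by rewrite oner_eq0.
Qed.

Lemma avN x : v (- x) = v x.
Proof.
have vN1 : v (- 1) = 1.
  have /eqP : v (- 1) * v (- 1) = 1 by rewrite -avM mulrNN mulr1 av1.
  rewrite -expr2 sqrf_eq1 => /orP[/eqP//|/eqP h].
  by have := av_ge0 v (- 1); rewrite h; lra.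
by rewrite -mulN1r avM vN1 mul1r.
Qed.

Lemma avB x y : v (x - y) <= Num.max (v x) (v y).
Proof. by rewrite -(avN y) av_ultra. Qed.

Lemma av_sum_ge (I : eqType) (r : seq I) (F : I -> K) (e : RR) :
  0 < e -> e <= v (\sum_(i <- r) F i) -> exists2 i, i \in r & e <= v (F i).
Proof.
move=> e0; elim: r => [|i r IH].
  by rewrite big_nil av0 leNgt e0.
rewrite big_cons => /le_trans /(_ (av_ultra _ _ _)).
rewrite le_max => /orP[h|/IH [j jr h]].
  by exists i => //; rewrite mem_head.
by exists j => //; rewrite inE jr orbT.
Qed.

End AbsvalTheory.

Section Monomials.
Context (V : choiceType).
Implicit Types a b c m : {cmonom V}.

Definition mdivides a m := forall i, (a i <= m i)%N.

Lemma finite_mdivides m : finite_set [set a | mdivides a m].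
Proof.
pose B := (\max_(i <- finsupp m) m i).+1.
pose g (f : {ffun finsupp m -> 'I_B}) : {cmonom V} :=
  [cmonom (f i : nat) | i : finsupp m]%M.
apply: (@sub_finite_set _ _ (range g)); last exact: finite_image.
move=> a am.
have aB (i : finsupp m) : (a (val i) < B)%N.
  by rewrite ltnS (leq_trans (am _)) // (bigmaxn_sup_seq (val i)) // fsvalP.
exists [ffun i => Ordinal (aB i)] => //.
apply/eqP/cmP => i; rewrite cmE fsfun_ffun; case: insubP => [j _ <-|].
  by rewrite /= ffunE.
by rewrite -cmE_eq0 => /eqP mi /=; have := am i; rewrite mi leqn0 => /eqP.
Qed.

Definition mdivisors m : {fset {cmonom V}} := fset_set [set a | mdivides a m].

Lemma mdivisorsP a m : reflect (mdivides a m) (a \in mdivisors m).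
Proof.
rewrite in_fset_set; last exact: finite_mdivides.
by apply: (iffP idP); rewrite inE.
Qed.

Lemma divcmK a m : mdivides a m -> mmul a (divcm m a) = m.
Proof.
by move=> am; apply/eqP/cmP => i; rewrite cmM divcmE subnKC.
Qed.

Lemma mulcmK a b : divcm (mmul a b) a = b.
Proof. by apply/eqP/cmP => i; rewrite divcmE cmM addKn. Qed.

Lemma mdivides_mull a b : mdivides a (mmul a b).
Proof. by move=> i; rewrite cmM leq_addr. Qed.

Lemma mdivides_trans a b c : mdivides a b -> mdivides b c -> mdivides a c.
Proof. by move=> ab bc i; exact: leq_trans (ab i) (bc i). Qed.

Lemma mdivides_div a m : mdivides (divcm m a) m.
Proof. by move=> i; rewrite divcmE leq_subr. Qed.

Lemma mdivides_refl m : mdivides m m.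
Proof. by move=> i. Qed.

End Monomials.

Section Convolution.
Context (K : comNzRingType) (V : choiceType).
Implicit Types (f g h : {cmonom V} -> K) (a b c m n : {cmonom V}).

Definition convol f g m : K :=
  \sum_(a <- mdivisors m) f a * g (divcm m a).

Lemma convolE f g n m : mdivides m n ->
  convol f g m = \sum_(a <- mdivisors n) \sum_(b <- mdivisors n)
     (f a * g b) *+ (mmul a b == m).
Proof.
move=> mn; pose F a := \sum_(b <- mdivisors n) (f a * g b) *+ (mmul a b == m).
transitivity (\sum_(a <- mdivisors m) F a).
  rewrite /convol !big_seq; apply: eq_bigr => a /mdivisorsP am.
  rewrite /F (big_fsetD1 (divcm m a)) /=; last first.
    by apply/mdivisorsP/(mdivides_trans _ mn)/mdivides_div.
  rewrite divcmK // eqxx mulr1n big_seq big1 ?addr0 // => b.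
  rewrite in_fsetD1 => /andP[bm _]; case: eqVneq => //= abm.
  by rewrite -abm mulcmK eqxx in bm.
apply: big_fset_incl => [|a _ /mdivisorsP am].
  by apply/fsubsetP => a /mdivisorsP am; apply/mdivisorsP/(mdivides_trans am).
rewrite /F big1 // => b _; case: eqVneq => //= abm.
by case: am; rewrite -abm; exact: mdivides_mull.
Qed.

Lemma convolC f g : convol f g = convol g f.
Proof.
apply/funext => m; rewrite !(convolE _ _ (@mdivides_refl _ m)) exchange_big /=.
by apply: eq_bigr => a _; apply: eq_bigr => b _; rewrite mulrC mulmC.
Qed.

Lemma convolDl f g h : convol (f \+ g) h = convol f h \+ convol g h.
Proof.
apply/funext => m; rewrite /convol /= -big_split /=.
by apply: eq_bigr => a _; rewrite mulrDl.
Qed.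

Definition convol1 m : K := (m == mone)%:R.

Lemma convol1l f : convol convol1 f = f.
Proof.
apply/funext => m; rewrite /convol (big_fsetD1 mone) /=; last first.
  by apply/mdivisorsP => i; rewrite cm1.
rewrite /convol1 eqxx mul1r big_seq big1 ?addr0.
  by congr f; apply/eqP/cmP => i; rewrite divcmE cm1 subn0.
by move=> a; rewrite in_fsetD1 => /andP[/negPf am _]; rewrite am mulr0n mul0r.
Qed.

Lemma convolAl f g h m : convol (convol f g) h m =
  \sum_(a <- mdivisors m) \sum_(b <- mdivisors m) \sum_(c <- mdivisors m)
    (f a * g b * h c) *+ (mmul (mmul a b) c == m).
Proof.
rewrite (convolE _ _ (@mdivides_refl _ m)).
transitivity (\sum_(x <- mdivisors m) \sum_(c <- mdivisors m)
  \sum_(a <- mdivisors m) \sum_(b <- mdivisors m)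
    ((f a * g b * h c) *+ (mmul a b == x)) *+ (mmul x c == m)).
  rewrite !big_seq; apply: eq_bigr => x /mdivisorsP xm; apply: eq_bigr => c _.
  rewrite (convolE _ _ xm) mulr_suml -sumrMnl; apply: eq_bigr => a _.
  rewrite mulr_suml -sumrMnl; apply: eq_bigr => b _.
  by rewrite mulrnAl.
under eq_bigr do rewrite exchange_big /=.
rewrite exchange_big /=; apply: eq_bigr => a _.
under eq_bigr do rewrite exchange_big /=.
rewrite exchange_big /=; apply: eq_bigr => b _.
rewrite exchange_big /=; apply: eq_bigr => c _.
case: (eqVneq (mmul (mmul a b) c) m) => [abc|abc].
  rewrite (big_fsetD1 (mmul a b)) /=; last first.
    by apply/mdivisorsP; rewrite -abc; exact: mdivides_mull.
  rewrite eqxx abc eqxx !mulr1n big_seq big1 ?addr0 // => x.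
  by rewrite in_fsetD1 => /andP[xab _]; rewrite eq_sym (negPf xab) mul0rn.
rewrite big1 // => x _; case: eqVneq => [<-|]; last by rewrite mul0rn.
by rewrite (negPf abc).
Qed.

Lemma convolA f g h : convol f (convol g h) = convol (convol f g) h.
Proof.
apply/funext => m; rewrite [LHS](_ : _ = convol (convol h g) f m); last first.
  by rewrite convolC [convol g h]convolC.
rewrite !convolAl exchange_big /=; under eq_bigr do rewrite exchange_big /=.
rewrite exchange_big /=; apply: eq_bigr => a _; apply: eq_bigr => b _.
apply: eq_bigr => c _; rewrite [mmul (mmul c b) a]mulmC [mmul c b]mulmC mulmA.
by rewrite mulrC [h c * g b]mulrC mulrA.
Qed.

End Convolution.

Section RestrictedSeries.
Context (RR : realType) (K : fieldType) (v : absval RR K) (V : choiceType).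
Implicit Types (f g h : {cmonom V} -> K) (m : {cmonom V}).

Definition restricted f :=
  forall e : RR, 0 < e -> finite_set [set m | e <= v (f m)].

Lemma restricted_bound f : restricted f ->
  exists2 c : RR, 0 < c & forall m, v (f m) <= c.
Proof.
move=> /(_ 1 ltr01) fin; pose A := fset_set [set m | 1 <= v (f m)].
exists (1 + \sum_(m <- A) v (f m)).
  by rewrite ltr_wpDr // sumr_ge0 // => m _; exact: av_ge0.
move=> m; have [mA|] := boolP (m \in A).
  rewrite (big_fsetD1 m) //= addrCA lerDl addr_ge0 // sumr_ge0 // => a _.
  exact: av_ge0.
rewrite in_fset_set // notin_setE /= => /negP; rewrite -ltNge => /ltW vm.
by rewrite (le_trans vm) // lerDl sumr_ge0 // => a _; exact: av_ge0.
Qed.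

Lemma restricted_convol f g : restricted f -> restricted g ->
  restricted (convol f g).
Proof.
move=> rf rg e e0.
have [c c0 fc] := restricted_bound rf; have [d d0 gd] := restricted_bound rg.
pose F := [set m | e / d <= v (f m)]; pose G := [set m | e / c <= v (g m)].
have fFG : finite_set ((fun x : _ * _ => mmul x.1 x.2) @` (F `*` G)).
  apply: finite_image; apply: finite_setX.
    by apply: rf; rewrite divr_gt0.
  by apply: rg; rewrite divr_gt0.
apply: sub_finite_set fFG => m /= em.
have [a /mdivisorsP am] := av_sum_ge e0 em; rewrite avM => eab.
exists (a, divcm m a); last by rewrite /= divcmK.
split; rewrite /F /G /= ler_pdivrMr // (le_trans eab) //.
  by rewrite ler_wpM2l // av_ge0.
by rewrite mulrC ler_wpM2l // av_ge0.
Qed.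

Lemma restrictedB f g : restricted f -> restricted g -> restricted (f \- g).
Proof.
move=> rf rg e e0.
apply: (@sub_finite_set _ _ ([set m | e <= v (f m)] `|` [set m | e <= v (g m)])).
  move=> m /= /le_trans /(_ (avB _ _ _)).
  by rewrite le_max => /orP[|]; [left|right].
by rewrite finite_setU; split; [exact: rf|exact: rg].
Qed.

Lemma restrictedC (c : K) m0 : restricted (fun m => c *+ (m == m0)).
Proof.
move=> e e0; apply: (@sub_finite_set _ _ [set m0]); last exact: finite_set1.
by move=> m /=; case: eqVneq => //= _; rewrite mulr0n av0 leNgt e0.
Qed.

(* K<V>: the completion of K[V] for the Gauss norm, realized as the ring of
   series whose coefficients tend to 0. *)
Record tate : Type := Tate { coef :> {cmonom V} -> K; coefP : restricted coef }.

HB.instance Definition _ := gen_eqMixin tate.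
HB.instance Definition _ := gen_choiceMixin tate.

Lemma tateP (x y : tate) : x = y <-> forall m, x m = y m.
Proof.
split=> [->//|]; case: x y => [f rf] [g rg] /= fg.
have {}fg : f = g by exact/funext.
by rewrite -{}fg in rg *; congr Tate; exact: Prop_irrelevance.
Qed.

(* The term c * m0 *)
Definition tate_mono (c : K) m0 : tate := Tate (restrictedC c m0).
Definition tate0 : tate := tate_mono 0 mone.
Definition tateB (x y : tate) : tate := Tate (restrictedB (coefP x) (coefP y)).
Definition tateN (x : tate) : tate := tateB tate0 x.
Definition tateD (x y : tate) : tate := tateB x (tateN y).
Definition tate1 : tate := tate_mono 1 mone.
Definition tateM (x y : tate) : tate :=
  Tate (restricted_convol (coefP x) (coefP y)).

Let tate0E m : tate0 m = 0. Proof. by rewrite /= mul0rn. Qed.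
Let tateNE x m : tateN x m = - x m. Proof. by rewrite /= mul0rn sub0r. Qed.
Let tateDE x y m : tateD x y m = x m + y m.
Proof. by rewrite /= mul0rn sub0r opprK. Qed.

Let tateDA : associative tateD.
Proof. by move=> x y z; apply/tateP => m; rewrite !tateDE addrA. Qed.
Let tateDC : commutative tateD.
Proof. by move=> x y; apply/tateP => m; rewrite !tateDE addrC. Qed.
Let tate0D : left_id tate0 tateD.
Proof. by move=> x; apply/tateP => m; rewrite tateDE tate0E add0r. Qed.
Let tateND : left_inverse tate0 tateN tateD.
Proof. by move=> x; apply/tateP => m; rewrite tateDE tateNE tate0E addNr. Qed.

HB.instance Definition _ :=
  GRing.isZmodule.Build tate tateDA tateDC tate0D tateND.

Lemma tcoefD (x y : tate) m : (x + y) m = x m + y m.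
Proof. exact: tateDE. Qed.
Lemma tcoefN (x : tate) m : (- x) m = - x m.
Proof. exact: tateNE. Qed.
Lemma tcoefB (x y : tate) m : (x - y) m = x m - y m.
Proof. by rewrite tcoefD tcoefN. Qed.
Lemma tcoef0 m : (0 : tate) m = 0.
Proof. exact: tate0E. Qed.

Let tateMA : associative tateM.
Proof. by move=> x y z; apply/tateP => m; rewrite /= convolA. Qed.
Let tateMC : commutative tateM.
Proof. by move=> x y; apply/tateP => m; rewrite /= convolC. Qed.
Let tate1M : left_id tate1 tateM.
Proof.
move=> x; apply/tateP => m /=; rewrite -[in RHS](convol1l x).
by congr convol; apply/funext => n; rewrite /convol1.
Qed.
Let tateMDl : left_distributive tateM +%R.
Proof.
move=> x y z; apply/tateP => m; rewrite tcoefD /=.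
rewrite -[RHS]/((convol x z \+ convol y z) m) -convolDl; congr convol.
by apply/funext => n; exact: tateDE.
Qed.

HB.instance Definition _ :=
  GRing.Zmodule_isComPzRing.Build tate tateMA tateMC tate1M tateMDl.

Lemma tcoefM (x y : tate) m :
  (x * y) m = \sum_(a <- mdivisors m) x a * y (divcm m a).
Proof. by []. Qed.

Lemma tcoef1 m : (1 : tate) m = (m == mone)%:R.
Proof. by []. Qed.

Definition gauss (x : tate) : RR := sup (range (fun m => v (x m))).

Lemma gauss_ub (x : tate) m : v (x m) <= gauss x.
Proof.
apply: sup_upper_bound; last by exists m.
split; first by exists (v (x m)), m.
by have [c _ xc] := restricted_bound (coefP x); exists c => _ [n _ <-].
Qed.

Lemma gauss_le (x : tate) c : (forall m, v (x m) <= c) -> gauss x <= c.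
Proof.
move=> xc; apply: ge_sup; first by exists (v (x mone)), mone.
by move=> _ [m _ <-].
Qed.

Lemma gauss_ge0 x : 0 <= gauss x.
Proof. by rewrite (le_trans (av_ge0 v (x mone))) ?gauss_ub. Qed.

Lemma gauss0 : gauss 0 = 0.
Proof.
apply/eqP; rewrite eq_le gauss_ge0 andbT gauss_le // => m.
by rewrite tcoef0 av0.
Qed.

Lemma gaussB x y : gauss (x - y) <= Num.max (gauss x) (gauss y).
Proof.
apply: gauss_le => m; rewrite tcoefB (le_trans (avB _ _ _)) //.
by rewrite ge_max !le_max !gauss_ub orbT.
Qed.

Lemma gaussM x y : gauss (x * y) <= gauss x * gauss y.
Proof.
apply: gauss_le => m; rewrite tcoefM.
have [h|h] := ltP 0 (v (\sum_(a <- mdivisors m) x a * y (divcm m a))).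
  have [a _ /le_trans->//] := av_sum_ge h (lexx _).
  by rewrite avM ler_pM ?av_ge0 ?gauss_ub.
by rewrite (le_trans h) // mulr_ge0 // gauss_ge0.
Qed.

HB.instance Definition _ := NASeminorm_isTopologicalComRing.Build RR tate
  gauss_ge0 gauss0 gaussB gaussM.

Definition tate_cst (c : K) : tate := tate_mono c mone.
Definition tate_var (i : V) : tate := tate_mono 1 (ucm i).

End RestrictedSeries.

Inductive var : Type :=
  | varT | vars | varxs of nat | varx of nat & nat | vary of nat & nat.

HB.instance Definition _ := gen_eqMixin var.
HB.instance Definition _ := gen_choiceMixin var.

Definition is_z (i : var) : bool :=
  match i with varT | vars => false | _ => true end.

Definition zdeg (m : {cmonom var}) : nat := \sum_(i <- finsupp m | is_z i) m i.

Lemma zdeg_eq0 m : zdeg m = 0%N <-> forall i, is_z i -> m i = 0%N.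
Proof.
split=> [/eqP|mz]; last by rewrite /zdeg big1 // => i /mz.
rewrite sum_nat_seq_eq0 => /allP h i iz.
have [im|/fsfun_dflt //] := boolP (i \in finsupp m).
by have /implyP/(_ iz)/eqP := h _ im.
Qed.

Lemma zdeg_div_gt0 (a m : {cmonom var}) : mdivides a m ->
  (0 < zdeg a)%N -> (0 < zdeg m)%N.
Proof.
move=> am; rewrite !lt0n; apply: contra_neq => /zdeg_eq0 mz.
by apply/zdeg_eq0 => i iz; have := am i; rewrite mz // leqn0 => /eqP.
Qed.

Section RingR.
Context (RR : realType) (K : fieldType) (v : absval RR K).
Local Notation C := (tate v var).

Definition T_ : C := tate_var v varT.
Definition s_ : C := tate_var v vars.
Definition xs_ (j : nat) : C := tate_var v (varxs j).
Definition x_ (j n : nat) : C := tate_var v (varx j n).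
Definition y_ (j n : nat) : C := tate_var v (vary j n).

(* in_KTs is K<T,s>, in_J is the ideal J and in_R is R = K<T,s> + sJ. *)
Definition in_KTs (x : C) := forall m, x m != 0 -> zdeg m = 0%N.
Definition in_J (x : C) := forall m, x m != 0 -> (0 < zdeg m)%N.

Definition in_R : {pred C} :=
  fun x => `[< exists a b, [/\ in_KTs a, in_J b & x = a + s_ * b] >].

Lemma in_RP x :
  reflect (exists a b, [/\ in_KTs a, in_J b & x = a + s_ * b]) (x \in in_R).
Proof. exact: asboolP. Qed.

Lemma in_KTs1 : in_KTs 1.
Proof.
move=> m; rewrite tcoef1; case: (eqVneq m mone) => [-> _|_]; last by rewrite eqxx.
by apply/zdeg_eq0 => i _; rewrite cm1.
Qed.

Lemma in_KTsB x y : in_KTs x -> in_KTs y -> in_KTs (x - y).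
Proof.
move=> hx hy m; rewrite tcoefB; have [xm|/hx //] := eqVneq (x m) 0.
have [ym|/hy //] := eqVneq (y m) 0.
by rewrite xm ym subr0 eqxx.
Qed.

Lemma in_JB x y : in_J x -> in_J y -> in_J (x - y).
Proof.
move=> hx hy m; rewrite tcoefB; have [xm|/hx //] := eqVneq (x m) 0.
have [ym|/hy //] := eqVneq (y m) 0.
by rewrite xm ym subr0 eqxx.
Qed.

Lemma in_KTsM x y : in_KTs x -> in_KTs y -> in_KTs (x * y).
Proof.
move=> hx hy m; rewrite tcoefM; apply: contraNeq => /eqP/zdeg_eq0 mz.
rewrite big_seq big1 // => a /mdivisorsP am.
have [xa|/hx /zdeg_eq0 az] := eqVneq (x a) 0; first by rewrite xa mul0r.
have [yb|/hy /zdeg_eq0 bz] := eqVneq (y (divcm m a)) 0.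
  by rewrite yb mulr0.
case: mz => i iz.
by have := congr1 (fun n : {cmonom var} => n i) (divcmK am); rewrite cmM az // bz.
Qed.

Lemma in_JM x y : in_J y -> in_J (x * y).
Proof.
move=> hy m; rewrite tcoefM; apply: contraNT => mz.
rewrite big_seq big1 // => a /mdivisorsP am.
have [->|/hy h] := eqVneq (y (divcm m a)) 0; first by rewrite mulr0.
by rewrite (zdeg_div_gt0 (@mdivides_div _ a m) h) in mz.
Qed.

Lemma in_J0 : in_J 0.
Proof. by move=> m; rewrite tcoef0 eqxx. Qed.

Lemma in_JD x y : in_J x -> in_J y -> in_J (x + y).
Proof.
move=> hx hy; rewrite -[y]opprK; apply: in_JB => //.
by rewrite -sub0r; apply: in_JB => //; exact: in_J0.
Qed.

Lemma in_R_subring : subring_closed in_R.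
Proof.
split.
- by apply/in_RP; exists 1, 0; split; rewrite ?mulr0 ?addr0 //;
    [exact: in_KTs1|exact: in_J0].
- move=> _ _ /in_RP[a [b [ha hb ->]]] /in_RP[c [d [hc hd ->]]].
  apply/in_RP; exists (a - c), (b - d).
  by split; [exact: in_KTsB|exact: in_JB|rewrite mulrBr opprD addrACA].
- move=> _ _ /in_RP[a [b [ha hb ->]]] /in_RP[c [d [hc hd ->]]].
  apply/in_RP; exists (a * c), (a * d + c * b + (s_ * b) * d); split.
  + exact: in_KTsM.
  + by apply: in_JD; [apply: in_JD|]; exact: in_JM.
  + rewrite mulrDl !mulrDr -!addrA; congr (_ + _).
    rewrite mulrCA; congr (_ + _); rewrite [s_ * b * (_ * _)]mulrCA.
    by congr (_ + _); rewrite -mulrA [b * c]mulrC.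
Qed.

Record ringR : Type := RingR { Rval : C; RvalP : Rval \in in_R }.

HB.instance Definition _ := [isSub for Rval].
HB.instance Definition _ := [Choice of ringR by <:].
HB.instance Definition _ :=
  GRing.SubChoice_isSubComPzRing.Build C in_R ringR in_R_subring.

Definition gaussR (x : ringR) : RR := gauss (val x).

Let gaussR0 : gaussR 0 = 0. Proof. by rewrite /gaussR raddf0 gauss0. Qed.
Let gaussRB x y : gaussR (x - y) <= Num.max (gaussR x) (gaussR y).
Proof. by rewrite /gaussR raddfB gaussB. Qed.
Let gaussRM x y : gaussR (x * y) <= gaussR x * gaussR y.
Proof. by rewrite /gaussR rmorphM gaussM. Qed.

HB.instance Definition _ := NASeminorm_isTopologicalComRing.Build RR ringR
  (fun x => gauss_ge0 (val x)) gaussR0 gaussRB gaussRM.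

End RingR.

Record perfectoid_field (RR : realType) (p : nat) (K : fieldType)
    (v : absval RR K) : Prop := PerfectoidField {
  pf_complete : forall u : nat -> K,
    (forall e : RR, 0 < e -> exists N, forall m n,
       (N <= m)%N -> (N <= n)%N -> v (u m - u n) < e) ->
    exists l, forall e : RR, 0 < e -> exists N, forall n,
       (N <= n)%N -> v (u n - l) < e;
  pf_nondiscrete : forall e : RR, 0 < e -> exists x, 1 < v x < 1 + e;
  pf_residue_char : prime p /\ v p%:R < 1;
  pf_frobenius : forall x, v x <= 1 ->
    exists y z, [/\ v y <= 1, v z <= 1 & x = y ^+ p + p%:R * z]
}.

Section TopologicalRings.
Implicit Types A B : topComRingType.

Definition tring_hom A B (f : A -> B) : Prop :=
  [/\ zmod_morphism f, monoid_morphism f & continuous f].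

Definition is_unit A (a : A) : Prop := exists b, a * b = 1.

Definition is_subring A (S : set A) : Prop :=
  [/\ S 1, forall x y, S x -> S y -> S (x - y)
    & forall x y, S x -> S y -> S (x * y)].

Definition bounded A (S : set A) : Prop :=
  forall U, nbhs (0 : A) U ->
  exists2 W, nbhs (0 : A) W & forall w x, W w -> S x -> U (w * x).

Definition power_bounded A : set A :=
  [set a | bounded (range (fun n : nat => a ^+ n))].

Definition top_nilpotent A (a : A) : Prop :=
  (fun n : nat => a ^+ n) @ \oo --> (0 : A).

Definition pseudo_uniformizer A (a : A) : Prop := is_unit a /\ top_nilpotent a.

Definition uniform_ring A : Prop := bounded (@power_bounded A).

Definition complete_ring A : Prop :=
  hausdorff_space A /\
  forall F : set_system A, ProperFilter F ->
    (forall U, nbhs (0 : A) U ->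
       exists2 P, F P & forall x y, P x -> P y -> U (x - y)) ->
    exists x : A, F --> x.

Definition nonarchimedean A : Prop :=
  forall U, nbhs (0 : A) U -> exists H : set A,
    [/\ nbhs (0 : A) H, H 0, forall x y, H x -> H y -> H (x - y) & H `<=` U].

(* The n-th power of the ideal of the subring A0 generated by fs *)
Fixpoint ideal_pow A (A0 : set A) (fs : seq A) (n : nat) : set A :=
  if n is n'.+1 then
    [set x | exists2 c : nat -> A, forall i, ideal_pow A0 fs n' (c i)
           & x = \sum_(i < size fs) fs`_i * c i]
  else A0.

Definition huber_ring A : Prop :=
  exists (A0 : set A) (fs : seq A),
    [/\ is_subring A0, open A0, forall f, f \in fs -> A0 f
      & forall U, nbhs (0 : A) U <-> exists n, ideal_pow A0 fs n `<=` U].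

Definition tate_ring A : Prop :=
  huber_ring A /\ exists u : A, pseudo_uniformizer u.

Definition perfectoid_ring (p : nat) A : Prop :=
  [/\ tate_ring A, complete_ring A, uniform_ring A
    & exists w : A,
      [/\ pseudo_uniformizer w,
          exists2 c, power_bounded c & p%:R = w ^+ p * c,
          forall x y, power_bounded x -> power_bounded y ->
            (exists2 c, power_bounded c & x ^+ p - y ^+ p = w ^+ p * c) ->
            exists2 c, power_bounded c & x - y = w * c
        & forall y, power_bounded y -> exists x c,
            [/\ power_bounded x, power_bounded c & y = x ^+ p + w ^+ p * c]]].

Definition sousperfectoid (p : nat) A : Prop :=
  [/\ tate_ring A, complete_ring A
    & exists (B : topComRingType) (i : A -> B) (r : B -> A),
      [/\ perfectoid_ring p B, tring_hom i, injective i,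
          [/\ zmod_morphism r, continuous r & forall a b, r (i a * b) = a * r b]
        & cancel i r]].

Definition integrally_closed A (S : set A) : Prop :=
  forall (a : A) (n : nat) (c : nat -> A), (forall i, S (c i)) ->
    a ^+ n + \sum_(i < n) c i * a ^+ i = 0 -> S a.

Definition huber_pair A (Ap : set A) : Prop :=
  [/\ huber_ring A, is_subring Ap, open Ap, Ap `<=` @power_bounded A
    & integrally_closed Ap].

Definition open_ideal A (fs : seq A) : Prop := open (ideal_pow setT fs 1).

Definition inverts_rational A (fs : seq A) (g : A) B (phi : A -> B) : Prop :=
  exists2 h, phi g * h = 1 & forall f, f \in fs -> power_bounded (phi f * h).

(* phi : A -> B is the rational localization A -> A<fs/g>, by its universal
   property among complete non-archimedean rings (Huber) *)
Definition rational_localization A (fs : seq A) (g : A) B (phi : A -> B) : Prop :=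
  [/\ complete_ring B, nonarchimedean B, tring_hom phi,
      inverts_rational fs g phi
    & forall (C : topComRingType) (psi : A -> C),
        complete_ring C -> nonarchimedean C -> tring_hom psi ->
        inverts_rational fs g psi ->
        exists! chi : B -> C, tring_hom chi /\ chi \o phi = psi].

End TopologicalRings.

(* Totally ordered commutative groups with a zero adjoined *)
Record ogroup0 := OGroup0 {
  og :> Type;
  og0 : og;
  og1 : og;
  og_mul : og -> og -> og;
  og_le : og -> og -> Prop;
  og_mulA : forall x y z, og_mul x (og_mul y z) = og_mul (og_mul x y) z;
  og_mulC : forall x y, og_mul x y = og_mul y x;
  og_mul1 : forall x, og_mul og1 x = x;
  og_mul0 : forall x, og_mul og0 x = og0;
  og_10 : og1 <> og0;
  og_inv : forall x, x <> og0 -> exists y, og_mul x y = og1;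
  og_le_anti : forall x y, og_le x y -> og_le y x -> x = y;
  og_le_trans : forall x y z, og_le x y -> og_le y z -> og_le x z;
  og_le_total : forall x y, og_le x y \/ og_le y x;
  og_le0 : forall x, og_le og0 x;
  og_le_mul : forall x y z, og_le x y -> og_le (og_mul z x) (og_mul z y)
}.
Arguments og0 {_}.
Arguments og1 {_}.

Definition is_valuation (A : comPzRingType) (Gam : ogroup0) (v : A -> Gam) : Prop :=
  [/\ v 0 = og0, v 1 = og1, forall a b, v (a * b) = og_mul (v a) (v b)
    & forall a b, og_le (v (a + b)) (v a) \/ og_le (v (a + b)) (v b)].

(* An equivalence class of valuations v is recorded as the relation
   v a <= v b.  Such a class is continuous when {a | v a < gamma} is open for
   every gamma = v b / v c in the value group. *)
Definition continuous_class (A : topComRingType) (x : A -> A -> Prop) : Prop :=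
  forall b c, ~ x b 0 -> ~ x c 0 -> open [set a | ~ x b (a * c)].

Section Spa.
Context (A : topComRingType) (Ap : set A).

Definition spa_point (x : A -> A -> Prop) : Prop :=
  continuous_class x /\
  exists (Gam : ogroup0) (v : A -> Gam),
    [/\ is_valuation v, forall a, Ap a -> og_le (v a) og1
      & forall a b, x a b <-> og_le (v a) (v b)].

Record spa : Type := SpaPoint {
  spa_le :> A -> A -> Prop;
  spa_leP : spa_point spa_le
}.

Definition rational_set (fs : seq A) (g : A) : set spa :=
  [set x | (forall f, f \in fs -> x f g) /\ ~ x g 0].

HB.instance Definition _ := gen_eqMixin spa.
HB.instance Definition _ := gen_choiceMixin spa.
HB.instance Definition _ := isSubBaseTopological.Build spa
  [set U | exists f g, U = rational_set [:: f] g] (@id (set spa)).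

Definition rational_subset (U : set spa) : Prop :=
  exists fs g, open_ideal fs /\ U = rational_set fs g.

End Spa.

(* Only the values on open sets U, on inclusions V `<=` U of open sets, and on
   points x of open sets U are meaningful. *)
Record presheaf (X : topologicalType) := Presheaf {
  sec :> set X -> topComRingType;
  res : forall U V : set X, sec U -> sec V
}.
Arguments res {X} _ U V _.

Record vstructure (X : topologicalType) := VStructure {
  vsec :> presheaf X;
  vle : forall (x : X) (U : set X), vsec U -> vsec U -> Prop
}.
Arguments vle {X} _ x U _ _.

Definition is_presheaf (X : topologicalType) (O : presheaf X) : Prop :=
  [/\ forall U V, open U -> open V -> V `<=` U -> tring_hom (res O U V),
      forall U, open U -> forall s, res O U U s = s
    & forall U V W, open U -> open V -> open W -> V `<=` U -> W `<=` V ->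
        forall s, res O V W (res O U V s) = res O U W s].

(* For continuous f i: the topology of A is the initial one *)
Definition initial_for (A : topologicalType) (I : Type) (B : I -> topologicalType)
    (f : forall i, A -> B i) : Prop :=
  forall F : set_system A, ProperFilter F -> forall a,
    (forall i, f i @ F --> f i a) -> F --> a.

Definition is_sheaf (X : topologicalType) (O : presheaf X) : Prop :=
  is_presheaf O /\
  forall (I : Type) (U : I -> set X), (forall i, open (U i)) ->
    let W := \bigcup_i U i in
    (forall s : (forall i, O (U i)),
       (forall i j, res O (U i) (U i `&` U j) (s i) =
                    res O (U j) (U i `&` U j) (s j)) ->
       exists! t : O W, forall i, res O W (U i) t = s i) /\
    initial_for (fun i => res O W (U i)).

Section Stalks.
Context (X : topologicalType) (O : vstructure X) (x : X).

Definition germ_unit (U : set X) (s : O U) : Prop :=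
  exists V, [/\ open V, V x, V `<=` U & is_unit (res O U V s)].

Definition local_stalk : Prop :=
  forall U, open U -> U x ->
    ~ germ_unit (0 : O U) /\
    forall s t : O U, germ_unit (s + t) -> germ_unit s \/ germ_unit t.

(* vle O x is a valuation class on the stalk at x whose support is the maximal
   ideal, i.e. a valuation class on the residue field at x *)
Definition residue_valuation : Prop :=
  exists (Gam : ogroup0) (v : forall U, O U -> Gam),
    [/\ forall U, open U -> U x -> is_valuation (v U),
        forall U V, open U -> open V -> V x -> V `<=` U ->
          forall s, v V (res O U V s) = v U s,
        forall U, open U -> U x -> forall s, v U s = og0 <-> ~ germ_unit s
      & forall U, open U -> U x -> forall s t,
          vle O x U s t <-> og_le (v U s) (v U t)].

End Stalks.

Definition v_ringed (X : topologicalType) (O : vstructure X) : Prop :=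
  [/\ is_sheaf O, forall U, open U -> complete_ring (O U),
      forall x, local_stalk O x & forall x, residue_valuation O x].

Record vmor (X Y : topologicalType) (S : vstructure X) (O : vstructure Y) := VMor {
  vmap :> X -> Y;
  vpull : forall V : set Y, O V -> S (vmap @^-1` V)
}.
Arguments vpull {X Y S O} _ V _.

Section Morphisms.
Context (X Y : topologicalType) (S : vstructure X) (O : vstructure Y).
Implicit Types m : vmor S O.

Definition is_vmor m : Prop :=
  [/\ continuous m, forall V, open V -> tring_hom (vpull m V),
      forall V W, open V -> open W -> W `<=` V -> forall s,
        res S (m @^-1` V) (m @^-1` W) (vpull m V s) = vpull m W (res O V W s)
    & forall x V, open V -> V (m x) -> forall s t,
        vle S x (m @^-1` V) (vpull m V s) (vpull m V t) <-> vle O (m x) V s t].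

Definition open_immersion m : Prop :=
  [/\ is_vmor m, injective m, forall U, open U -> open (m @` U)
    & forall V, open V -> V `<=` range m ->
        exists2 k, continuous k & cancel (vpull m V) k /\ cancel k (vpull m V)].

End Morphisms.

Section StructurePresheaf.
Context (A : topComRingType) (Ap : set A).

Definition structure_presheaf (O : presheaf (spa Ap)) (rho : A -> O setT) : Prop :=
  [/\ is_presheaf O, tring_hom rho,
      forall fs g, open_ideal fs ->
        rational_localization fs g
          (fun a => res O setT (rational_set fs g) (rho a))
    & forall W, open W ->
        let I := {U : set (spa Ap) | rational_subset U /\ U `<=` W} in
        (forall s : (forall i : I, O (sval i)),
           (forall i j : I, sval j `<=` sval i ->
              res O (sval i) (sval j) (s i) = s j) ->
           exists! t : O W, forall i : I, res O W (sval i) t = s i) /\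
        initial_for (fun i : I => res O W (sval i))].

Definition sheafy : Prop :=
  huber_pair Ap /\
  exists (O : presheaf (spa Ap)) (rho : A -> O setT),
    structure_presheaf rho /\ is_sheaf O.

Definition stably_uniform : Prop :=
  huber_pair Ap /\
  exists (O : presheaf (spa Ap)) (rho : A -> O setT),
    structure_presheaf rho /\
    forall U, rational_subset U -> uniform_ring (O U).

(* Spa(A, A+) as a v-ringed space, for (A, A+) sheafy: the valuation at x is the
   continuous extension of x to the sections around x *)
Definition spa_structure (O : vstructure (spa Ap)) (rho : A -> O setT) : Prop :=
  [/\ huber_pair Ap, structure_presheaf rho, v_ringed O,
      forall (x : spa Ap) a b, vle O x setT (rho a) (rho b) <-> x a b
    & forall (x : spa Ap) U, open U -> U x -> continuous_class (vle O x U)].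

End StructurePresheaf.

Definition adic_space (X : topologicalType) (O : vstructure X) : Prop :=
  v_ringed O /\
  forall y : X, exists (A : topComRingType) (Ap : set A)
      (S : vstructure (spa Ap)) (rho : A -> S setT) (m : vmor S O),
    [/\ spa_structure rho, open_immersion m & range m y].

Section Quotient.
Context (G : finGroupType) (X : topologicalType) (O : vstructure X).

Definition is_vaction (act : G -> vmor O O) : Prop :=
  [/\ forall g, is_vmor (act g),
      forall x, act 1%g x = x,
      forall g h x, act (g * h)%g x = act g (act h x),
      forall V, open V -> forall s,
        res O (act 1%g @^-1` V) V (vpull (act 1%g) V s) = s
    & forall g h V, open V -> forall s,
        res O (act h @^-1` (act g @^-1` V)) (act (g * h)%g @^-1` V)
          (vpull (act h) (act g @^-1` V) (vpull (act g) V s)) =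
        vpull (act (g * h)%g) V s].

(* As act g @^-1` W = W for W := q @^-1` V, the last condition says that the
   image of O_Y(V) is the subring of G-invariants of O(W). *)
Definition is_quotient (act : G -> vmor O O) (Y : topologicalType)
    (Q : vstructure Y) (q : vmor O Q) : Prop :=
  [/\ v_ringed Q, is_vmor q,
      [/\ range q = setT, forall x y, q x = q y <-> exists g, act g x = y
        & forall V, open V <-> open (q @^-1` V)],
      forall V, open V -> injective (vpull q V) /\
        initial_for (fun _ : unit => vpull q V)
    & forall V, open V -> forall s : O (q @^-1` V),
        range (vpull q V) s <->
        forall g, res O (act g @^-1` (q @^-1` V)) (q @^-1` V)
                    (vpull (act g) (q @^-1` V) s) = s].

End Quotient.

(* g acts on Spa(A, A+) through sg g^-1, so that a left action on A gives a left
   action on the space *)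
Definition induced_action (A : topComRingType) (Ap : set A) (G : finGroupType)
    (sg : G -> A -> A) (O : vstructure (spa Ap)) (rho : A -> O setT)
    (act : G -> vmor O O) : Prop :=
  forall g,
    (forall (x : spa Ap) a b,
       act g x a b <-> x (sg g^-1%g a) (sg g^-1%g b)) /\
    forall a, vpull (act g) setT (rho a) =
              res O setT (act g @^-1` setT) (rho (sg g^-1%g a)).

Section Action.
Context (RR : realType) (K : fieldType) (v : absval RR K) (pi : K).
Context (G : finGroupType) (sigma : G).
Local Notation C := (tate v var).
Local Notation T := (T_ v).
Local Notation s := (s_ v).
Local Notation xs := (xs_ v).
Local Notation x := (x_ v).
Local Notation y := (y_ v).

Definition is_Cp_action (rho : G -> C -> C) : Prop :=
  [/\ forall g, tring_hom (rho g),
      forall f, rho 1%g f = f,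
      forall g h f, rho (g * h)%g f = rho g (rho h f),
      forall g, [/\ forall c, rho g (tate_cst v var c) = tate_cst v var c,
                    rho g T = T & rho g s = s]
    & forall j n, [/\ rho sigma (xs j) = xs j - tate_cst v var (pi ^+ j) * y j 0%N,
          rho sigma (x j n) =
            x j n + tate_cst v var (pi ^+ j) * y j n - T * y j n.+1
        & rho sigma (y j n) = y j n]].

End Action.

(* Main.v *)
(* The ring R has a bounded Frobenius splitting psi (take the monomials that are
   p-th powers and extract p-th roots of their coefficients).  Hence
   c |-> lim psi^n (c n) retracts the completed perfection onto R, and the
   extension of psi to fractions shows that the rational localizations are
   uniform: an element bounded by 1 at all points has bounded powers (every
   spectral seminorm is attained by a point, by Zorn), so after applying psi often
   enough it lies in a fixed multiple of the unit ball.  Uniformity splits Laurent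
   cocycles, which gives the sheaf property.  Sections over an open set are
   realised as families of Cauchy sequences of fractions, indexed by the points,
   that are uniformly approximable by fractions on rational subsets; the quotient
   is the same construction with invariant families.

   The quotient is not adic at the image of the point T = s = 0.  Let an affinoid
   chart contain the image of |T|, |s| <= |pi|^k.  After rescaling T and s by pi^k,
   the coefficients h_* and h_n of an invariant function that are linear in x_{j,*}
   and x_{j,n} satisfy h_0 = h_* and pi^j h_(n+1) = pi^k T h_n, so h_* = 0 if j > k
   because the h_n are bounded.  On the other hand
   s x_{j,*} + sum_n (T / pi^j)^n s x_{j,n} is an invariant function on
   |T| <= |pi|^(j+1) with h_* = s.  Thus the homomorphism to the dual numbers that
   records h_* and the one that records 0 agree on the functions of the chart but
   not on those of a small rational subset of it, against the universal property of
   rational localizations. *)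
Require Import Defs.
From HB Require Import structures.
From mathcomp Require Import all_boot all_order all_algebra all_fingroup finmap.
From mathcomp Require Import cyclic.
From mathcomp Require Import all_classical reals topology tvs.
From mathcomp Require Import monalg ring lra zify.

Set SsrOldRewriteGoalsOrder.
Set Implicit Arguments.
Unset Strict Implicit.
Unset Printing Implicit Defensive.

Import Order.TTheory GRing.Theory Num.Theory.

Local Open Scope classical_set_scope.
Local Open Scope ring_scope.

(** The factor s controls the geometry at T = s = 0. An element of R without constant term is T f +
    s g with g in the big Tate algebra; s g need not be a multiple of s in R, but its square is s
    times the element s g^2 of R, so it is small wherever T and s are. Hence the group-stable sets
    |T|, |s| <= |pi|^k form a neighbourhood basis of that point. Infinitely many j are needed: a
    chart containing such a set annihilates the coefficient of x_{j,*} only for j > k, so j is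
    chosen after the chart, as k + 1.

    Uniformity is the analytic core. A bound by 1 at all points gives only that pi^(c + n) h^n is
    integral, with c depending on h. Extracting a p^m-th root with p^m > c turns the exponent c +
    p^m into a constant, so the loss becomes independent of h.

    Section rings and the perfectoid cover are both separated quotients of rings of sequences, so
    equality, continuity and completeness are checked on representatives. A boolean flag selects all
    sections or the invariant ones, and the proofs of the sheaf property, of completeness and of
    local stalks are shared by the spectrum and its quotient. *)

(** * Separated quotients of filtered rings of sequences *)

(** The ambient ring [fE] contains arbitrary sequences, [fS] the admissible ones, and each index [j]
    carries its own chain of additive levels. Continuity of multiplication, [flev_SM], is asked only
    for admissible factors because general sequences are unbounded. *)
Record filt_ring := FiltRing {
  fE : comPzRingType;
  fS : set fE;
  fJ : Type;
  flev : fJ -> nat -> set fE;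
  fS_1 : fS 1;
  fS_B : forall x y, fS x -> fS y -> fS (x - y);
  fS_M : forall x y, fS x -> fS y -> fS (x * y);
  flev_0 : forall j n, flev j n 0;
  flev_B : forall j n x y, flev j n x -> flev j n y -> flev j n (x - y);
  flev_W : forall j n x, flev j n.+1 x -> flev j n x;
  flev_M : forall j n x y, flev j n x -> flev j n y -> flev j n (x * y);
  flev_SM : forall j n x, fS x ->
    exists m, forall y, fS y -> flev j m y -> flev j n (x * y) }.

Section FiltQuotient.
Variable D : filt_ring.
Implicit Types x y z : fE D.

Definition fnull : set (fE D) := [set x | forall j n, flev (f := D) j n x].

(** The choice is made from a set that depends only on the null class of [x], so equivalent elements
    get the same representative. Storing classes by this representative makes equality of classes
    plain equality. *)
Definition fcanon x : fE D :=
  xget 0 [set y | fS (f := D) y /\ fnull (x - y)].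

Record filtq : Type := FiltQ { frep : fE D; frepP : fS frep /\ fcanon frep = frep }.

HB.instance Definition _ := gen_eqMixin filtq.
HB.instance Definition _ := gen_choiceMixin filtq.

Lemma fS_0 : fS (0 : fE D).
Proof. by rewrite -(subrr 1); apply: fS_B; exact: fS_1. Qed.

Lemma fS_N x : fS x -> fS (- x).
Proof. by move=> xS; rewrite -sub0r; apply: fS_B => //; exact: fS_0. Qed.

Lemma fS_D x y : fS x -> fS y -> fS (x + y).
Proof. by move=> xS yS; rewrite -[y]opprK; apply: fS_B => //; exact: fS_N. Qed.

Lemma flev_N j n x : flev (f := D) j n x -> flev j n (- x).
Proof. by move=> h; rewrite -sub0r; apply: flev_B => //; exact: flev_0. Qed.

Lemma flev_D j n x y : flev (f := D) j n x -> flev j n y -> flev j n (x + y).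
Proof. by move=> hx hy; rewrite -[y]opprK; apply: flev_B => //; exact: flev_N. Qed.

Lemma flev_le j m n x : (m <= n)%N -> flev (f := D) j n x -> flev j m x.
Proof.
move=> /subnK <-; elim: (n - m)%N => [//|k IH]; rewrite addSn => /flev_W.
exact: IH.
Qed.

Lemma fnull0 : fnull 0. Proof. by move=> j n; exact: flev_0. Qed.

Lemma fnullB x y : fnull x -> fnull y -> fnull (x - y).
Proof. by move=> hx hy j n; apply: flev_B. Qed.

Lemma fnullN x : fnull x -> fnull (- x).
Proof. by move=> hx j n; apply: flev_N. Qed.

Lemma fnullD x y : fnull x -> fnull y -> fnull (x + y).
Proof. by move=> hx hy j n; apply: flev_D. Qed.

Lemma fnullM x y : fS x -> fS y -> fnull y -> fnull (x * y).
Proof.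
by move=> xS yS hy j n; have [m] := flev_SM j n xS; apply => //; exact: hy.
Qed.

Lemma fcanonP x : fS x -> fS (fcanon x) /\ fnull (x - fcanon x).
Proof.
move=> xS; rewrite /fcanon; case: xgetP => [y _ //|/(_ x) []].
by split=> //; rewrite subrr; exact: fnull0.
Qed.

Lemma fcanon_eq x y : fnull (x - y) -> fcanon x = fcanon y.
Proof.
move=> xy; rewrite /fcanon; congr xget; apply/seteqP; split=> z [zS hz].
  by split=> //; rewrite (_ : y - z = (x - z) - (x - y)); [exact: fnullB|ring].
by split=> //; rewrite (_ : x - z = (y - z) + (x - y)); [exact: fnullD|ring].
Qed.

(** Inadmissible elements are sent to the class of 0, which makes [fq] total on the ambient ring. *)
Lemma fq_subproof x :
  let y := if `[< fS x >] then fcanon x else fcanon 0 in fS y /\ fcanon y = y.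
Proof.
have H z : fS z -> fS (fcanon z) /\ fcanon (fcanon z) = fcanon z.
  move=> zS; have [h1 h2] := fcanonP zS; split=> //; apply: fcanon_eq.
  by rewrite -opprB; exact: fnullN.
by case: asboolP => [xS|_] /=; apply: H => //; exact: fS_0.
Qed.

Definition fq x : filtq := FiltQ (fq_subproof x).

Lemma frepS (s : filtq) : fS (frep s). Proof. by case: (frepP s). Qed.

Lemma fqP x : fS x -> fnull (frep (fq x) - x).
Proof.
move=> xS /=; case: asboolP => // _; rewrite -opprB.
by apply: fnullN; case: (fcanonP xS).
Qed.

Lemma fq_eqP (s t : filtq) : s = t <-> fnull (frep s - frep t).
Proof.
split=> [->|]; first by rewrite subrr; exact: fnull0.
case: s t => [a [aS ac]] [b [bS bc]] /= /fcanon_eq ab.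
have {}ab : a = b by rewrite -ac ab bc.
by rewrite -{}ab in bS bc *; congr FiltQ; exact: Prop_irrelevance.
Qed.

Lemma fqK (s : filtq) : fq (frep s) = s.
Proof. by apply/fq_eqP/fqP; exact: frepS. Qed.

Lemma fq_eq x y : fS x -> fS y -> fq x = fq y <-> fnull (x - y).
Proof.
move=> xS yS; rewrite fq_eqP.
rewrite [X in fnull X <-> _](_ : _ =
   (x - y) + ((frep (fq x) - x) - (frep (fq y) - y))); last by ring.
have h : fnull ((frep (fq x) - x) - (frep (fq y) - y)).
  by apply: fnullB; apply: fqP.
split=> [h'|h']; last exact: fnullD.
by have := fnullB h' h; rewrite addrK.
Qed.

Definition fq_add (s t : filtq) := fq (frep s + frep t).
Definition fq_opp (s : filtq) := fq (- frep s).
Definition fq_mul (s t : filtq) := fq (frep s * frep t).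

Lemma fq_addE x y : fS x -> fS y -> fq_add (fq x) (fq y) = fq (x + y).
Proof.
move=> xS yS; apply/fq_eq; try exact: fS_D; try by apply: fS_D; exact: frepS.
rewrite opprD addrACA; apply: fnullD; exact: fqP.
Qed.

Lemma fq_oppE x : fS x -> fq_opp (fq x) = fq (- x).
Proof.
move=> xS; apply/fq_eq; try by apply: fS_N => //; exact: frepS.
by rewrite -opprD; apply: fnullN; exact: fqP.
Qed.

Lemma fq_mulE x y : fS x -> fS y -> fq_mul (fq x) (fq y) = fq (x * y).
Proof.
move=> xS yS; apply/fq_eq; try by apply: fS_M => //; exact: frepS.
have -> : frep (fq x) * frep (fq y) - x * y =
   y * (frep (fq x) - x) + frep (fq x) * (frep (fq y) - y) by ring.
apply: fnullD; apply: fnullM => //; try exact: fqP; try exact: frepS;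
  by apply: fS_B => //; exact: frepS.
Qed.

Lemma fq_ind (P : filtq -> Prop) : (forall x, fS x -> P (fq x)) -> forall s, P s.
Proof. by move=> h s; rewrite -(fqK s); apply: h; exact: frepS. Qed.

Let addA : associative fq_add.
Proof.
elim/fq_ind => x xS; elim/fq_ind => y yS; elim/fq_ind => z zS.
by rewrite !fq_addE ?addrA //; exact: fS_D.
Qed.
Let addC : commutative fq_add.
Proof. by move=> s t; rewrite /fq_add addrC. Qed.
Let add0 : left_id (fq 0) fq_add.
Proof. by elim/fq_ind => x xS; rewrite fq_addE ?add0r //; exact: fS_0. Qed.
Let addN : left_inverse (fq 0) fq_opp fq_add.
Proof.
by elim/fq_ind => x xS; rewrite fq_oppE // fq_addE ?addNr //; exact: fS_N.
Qed.
HB.instance Definition _ := GRing.isZmodule.Build filtq addA addC add0 addN.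

Let mulA : associative fq_mul.
Proof.
elim/fq_ind => x xS; elim/fq_ind => y yS; elim/fq_ind => z zS.
by rewrite !fq_mulE ?mulrA //; exact: fS_M.
Qed.
Let mulC : commutative fq_mul.
Proof. by move=> s t; rewrite /fq_mul mulrC. Qed.
Let mul1 : left_id (fq 1) fq_mul.
Proof. by elim/fq_ind => x xS; rewrite fq_mulE ?mul1r //; exact: fS_1. Qed.
Let mulDl : left_distributive fq_mul +%R.
Proof.
elim/fq_ind => x xS; elim/fq_ind => y yS; elim/fq_ind => z zS.
rewrite -![_ + _]/(fq_add _ _) !(fq_addE, fq_mulE) ?mulrDl //;
  by [exact: fS_D|exact: fS_M].
Qed.
HB.instance Definition _ :=
  GRing.Zmodule_isComPzRing.Build filtq mulA mulC mul1 mulDl.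

Lemma fq0 : fq 0 = 0. Proof. by []. Qed.
Lemma fq1 : fq 1 = 1. Proof. by []. Qed.
Lemma fqD x y : fS x -> fS y -> fq (x + y) = fq x + fq y.
Proof. by move=> xS yS; rewrite -fq_addE. Qed.
Lemma fqN x : fS x -> fq (- x) = - fq x.
Proof. by move=> xS; rewrite -fq_oppE. Qed.
Lemma fqB x y : fS x -> fS y -> fq (x - y) = fq x - fq y.
Proof. by move=> xS yS; rewrite fqD ?fqN //; exact: fS_N. Qed.
Lemma fqM x y : fS x -> fS y -> fq (x * y) = fq x * fq y.
Proof. by move=> xS yS; rewrite -fq_mulE. Qed.

Lemma frepB (s t : filtq) : fnull (frep (s - t) - (frep s - frep t)).
Proof.
rewrite -{1}(fqK s) -{1}(fqK t) -fqB; try exact: frepS.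
by apply: fqP; apply: fS_B; exact: frepS.
Qed.

Lemma frepM (s t : filtq) : fnull (frep (s * t) - frep s * frep t).
Proof. by apply: fqP; apply: fS_M; exact: frepS. Qed.

Lemma flev_eq j n x y : fnull (x - y) -> flev (f := D) j n x -> flev j n y.
Proof. by move=> xy xj; rewrite -(subKr x y); apply: flev_B => //; exact: xy. Qed.

Definition qlev j n : set filtq := [set s | flev (f := D) j n (frep s)].

Lemma qlev_fq j n x : fS x -> qlev j n (fq x) <-> flev j n x.
Proof.
move=> xS; split; apply: flev_eq; first exact: fqP.
by rewrite -opprB; apply: fnullN; exact: fqP.
Qed.

Lemma qlev0 j n : qlev j n 0.
Proof. by rewrite -fq0; apply/(qlev_fq _ _ fS_0); exact: flev_0. Qed.
Lemma qlevB j n s t : qlev j n s -> qlev j n t -> qlev j n (s - t).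
Proof.
elim/fq_ind: s => x xS; elim/fq_ind: t => y yS; rewrite -fqB // !qlev_fq //.
  exact: flev_B.
exact: fS_B.
Qed.
Lemma qlevN j n s : qlev j n s -> qlev j n (- s).
Proof. by move=> h; rewrite -sub0r; apply: qlevB => //; exact: qlev0. Qed.
Lemma qlevD j n s t : qlev j n s -> qlev j n t -> qlev j n (s + t).
Proof. by move=> hs ht; rewrite -[t]opprK; apply: qlevB => //; exact: qlevN. Qed.
Lemma qlevM j n s t : qlev j n s -> qlev j n t -> qlev j n (s * t).
Proof.
elim/fq_ind: s => x xS; elim/fq_ind: t => y yS; rewrite -fqM // !qlev_fq //.
  exact: flev_M.
exact: fS_M.
Qed.
Lemma qlev_le j m n s : (m <= n)%N -> qlev j n s -> qlev j m s.
Proof. exact: flev_le. Qed.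
Lemma qlev_SM j n s : exists m, forall t, qlev j m t -> qlev j n (s * t).
Proof.
elim/fq_ind: s => x xS; have [m hm] := flev_SM j n xS; exists m.
elim/fq_ind=> y yS; rewrite -fqM // !qlev_fq //; first exact: hm.
exact: fS_M.
Qed.
Lemma qlev_sep s : (forall j n, qlev j n s) -> s = 0.
Proof.
move=> h; apply/fq_eqP; apply: fnullB; first exact: h.
by rewrite -[frep _]subr0; apply: fqP; exact: fS_0.
Qed.

(** Finitely many indices at one common level form a basis. Membership is [List.In] since the index
    type has no decidable equality. *)
Definition fq_nbhs (s : filtq) : set_system filtq := [set B |
  exists (l : seq (fJ D)) (n : nat),
    forall t, (forall j, List.In j l -> qlev j n (t - s)) -> B t].

HB.instance Definition _ := hasNbhs.Build filtq fq_nbhs.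

Let nb_filter s : ProperFilter (fq_nbhs s).
Proof.
apply: Build_ProperFilter_ex.
  move=> B [l [n Bl]]; exists s; apply: Bl => j _; rewrite subrr; exact: qlev0.
split.
- by exists nil, 0%N.
- move=> P Q [l [n Pl]] [l' [n' Ql]]; exists (l ++ l'), (maxn n n') => t h.
  split; [apply: Pl|apply: Ql] => j jl; apply: qlev_le (h j _);
    rewrite ?leq_maxl ?leq_maxr //; apply/List.in_app_iff; by [left|right].
- by move=> P Q PQ [l [n Pl]]; exists l, n => t /Pl /PQ.
Qed.

Let nb_singleton s B : fq_nbhs s B -> B s.
Proof. by move=> [l [n]]; apply => j _; rewrite subrr; exact: qlev0. Qed.

Let nb_nbhs s B : fq_nbhs s B -> fq_nbhs s (fq_nbhs^~ B).
Proof.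
move=> [l [n Bl]]; exists l, n => t ts; exists l, n => u ut; apply: Bl => j jl.
have -> : u - s = (u - t) + (t - s) by ring.
by apply: qlevD; [exact: ut|exact: ts].
Qed.

HB.instance Definition _ :=
  Nbhs_isNbhsTopological.Build filtq nb_filter nb_singleton nb_nbhs.

Let sub_cont : continuous (fun x : filtq * filtq => x.1 - x.2).
Proof.
move=> [s t] B [l [n Bl]] /=.
pose U u := [set a | forall j, List.In j l -> qlev j n (a - u)].
exists (U s, U t); first by split; exists l, n.
move=> [a b] [/= as_ bt]; apply: Bl => j jl.
have -> : a - b - (s - t) = (a - s) - (b - t) by ring.
by apply: qlevB; [exact: as_|exact: bt].
Qed.

HB.instance Definition _ :=
  PreTopologicalNmodule_isTopologicalZmodule.Build filtq sub_cont.

Lemma qlev_SMs (l : seq (fJ D)) n s : exists m, forall j, List.In j l ->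
  forall t, qlev j m t -> qlev j n (s * t).
Proof.
elim: l => [|j l [m hm]]; first by exists 0%N.
have [m' hm'] := qlev_SM j n s; exists (maxn m m') => i /= [<-|il] t ht.
  by apply: hm'; apply: qlev_le ht; exact: leq_maxr.
by apply: hm il _ _; apply: qlev_le ht; exact: leq_maxl.
Qed.

Let mul_cont : continuous (fun x : filtq * filtq => x.1 * x.2).
Proof.
move=> [s t] B [l [n Bl]] /=.
have [m hm] := qlev_SMs l n s; have [m' hm'] := qlev_SMs l n t.
pose k := maxn n (maxn m m').
pose U u := [set a | forall j, List.In j l -> qlev j k (a - u)].
exists (U s, U t); first by split; exists l, k.
move=> [a b] [/= as_ bt]; apply: Bl => j jl.
have -> : a * b - s * t = (a - s) * (b - t) + s * (b - t) + t * (a - s) by ring.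
have ha := as_ j jl; have hb := bt j jl.
apply: qlevD; first apply: qlevD.
- by apply: qlevM; apply: qlev_le; [|exact: ha| |exact: hb]; exact: leq_maxl.
- by apply: hm => //; apply: qlev_le hb; rewrite /k !leq_max leqnn !orbT.
- by apply: hm' => //; apply: qlev_le ha; rewrite /k !leq_max leqnn !orbT.
Qed.

HB.instance Definition _ :=
  TopologicalZmodule_isTopologicalComRing.Build filtq mul_cont.

Lemma fq_nbhs_lev j n s : nbhs s [set t | qlev j n (t - s)].
Proof. by exists [:: j], n => t; apply; left. Qed.

Lemma fq_nbhs0_lev j n : nbhs (0 : filtq) (qlev j n).
Proof. by exists [:: j], n => t /(_ j (or_introl erefl)); rewrite subr0. Qed.

Lemma fq_hausdorff : hausdorff_space filtq.
Proof.
move=> s t st; apply/eqP; rewrite -subr_eq0; apply/eqP/qlev_sep => j n.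
have [u [/= us ut]] := st _ _ (fq_nbhs_lev j n s) (fq_nbhs_lev j n t).
rewrite (_ : s - t = (u - t) - (u - s)); last by ring.
exact: qlevB.
Qed.

Lemma fq_nonarchimedean : nonarchimedean filtq.
Proof.
move=> U [l [n Ul]]; exists [set t | forall j, List.In j l -> qlev j n t]; split.
- by exists l, n => t ht j jl; rewrite -[t]subr0; apply: ht.
- by move=> j _; exact: qlev0.
- by move=> s t hs ht j jl; apply: qlevB; [exact: hs|exact: ht].
- by move=> t ht; apply: Ul => j jl; rewrite subr0; exact: ht.
Qed.

(** Both the Cauchy condition and convergence may be tested on one level at a time, because a basic
    neighbourhood involves only finitely many of them. *)
Lemma fq_complete :
  (forall F : set_system filtq, ProperFilter F ->
    (forall j n, exists2 P, F P & forall s t, P s -> P t -> qlev j n (s - t)) ->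
    exists t, forall j n, F [set s | qlev j n (s - t)]) ->
  complete_ring filtq.
Proof.
move=> H; split=> [|F PF FC]; first exact: fq_hausdorff.
have [t Ft] : exists t, forall j n, F [set s | qlev j n (s - t)].
  by apply: H => // j n; apply: FC; exact: fq_nbhs0_lev.
exists t => B [l [n Bl]]; apply: filterS Bl _.
elim: l => [|j l IH]; first by apply: filterS filterT.
apply: filterS (filterI (Ft j n) IH) => s [/= h1 h2] i [<-//|]; exact: h2.
Qed.

End FiltQuotient.

(** * Multiplicative seminorms below a seminorm *)

Section SquareNorms.
Context (RR : realType) (B : comPzRingType).
Implicit Types (f g h : B -> RR) (x y c : B).

(** Power-multiplicative seminorms: squares suffice, as shown by [sq_exp]. The value at 1 is left
    free, so the zero function qualifies; it is fixed only for the multiplicative seminorms produced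
    at the end. *)
Record sqnorm f : Prop := SqNorm {
  sq_ge0 : forall x, 0 <= f x;
  sq_B : forall x y, f (x - y) <= Num.max (f x) (f y);
  sq_M : forall x y, f (x * y) <= f x * f y;
  sq_2 : forall x, f (x * x) = f x * f x }.

Lemma le_max_lim (z i j : RR) :
  (forall a b, i < a -> j < b -> z <= Num.max a b) -> z <= Num.max i j.
Proof.
move=> H; apply/ler_addgt0Pr => e e0.
apply: (le_trans (H (i + e) (j + e) _ _)); rewrite ?ltrDl //.
by rewrite ge_max !lerD2r !le_max !lexx orbT.
Qed.

Lemma le_mul_lim (z i j : RR) : 0 <= i -> 0 <= j ->
  (forall a b, i < a -> j < b -> z <= a * b) -> z <= i * j.
Proof.
move=> i0 j0 H; apply/ler_addgt0Pr => e e0.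
pose s := i + j + 1; have s0 : 0 < s by rewrite /s; lra.
(* As d <= 1, the product (i + d)(j + d) exceeds i j by at most d (i + j + 1). *)
pose d := Num.min 1 (e / s).
have d0 : 0 < d by rewrite /d lt_min ltr01 divr_gt0.
have d1 : d <= 1 by rewrite /d ge_min lexx.
have ds : d * s <= e by rewrite -ler_pdivlMr // /d ge_min lexx orbT.
apply: (le_trans (H (i + d) (j + d) _ _)); rewrite ?ltrDl //.
apply: (@le_trans _ _ (i * j + d * (i + j + d))).
  by rewrite le_eqVlt; apply/orP; left; apply/eqP; ring.
rewrite lerD2l; apply: le_trans ds; rewrite ler_wpM2l ?(ltW d0) //.
by rewrite /s lerD2l.
Qed.

Section InfNorm.
Context (I : Type) (i0 : I) (F : I -> B -> RR).
Hypothesis F_ge0 : forall i x, 0 <= F i x.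
Hypothesis F_B : forall i j x y, exists k, F k (x - y) <= Num.max (F i x) (F j y).
Hypothesis F_M : forall i j x y, exists k, F k (x * y) <= F i x * F j y.
Hypothesis F_2 : forall i x, exists k, F k x * F k x <= F i (x * x).

(** The hypotheses hold only after passing to another index [k]. This form covers both uses: a chain
    of seminorms, where two members have a common lower one, and the decreasing sequence that
    defines [locnorm]. *)
Definition inff x : RR := inf (range (F ^~ x)).

Let has_inff x : has_inf (range (F ^~ x)).
Proof. by split; [exists (F i0 x), i0|exists 0 => _ [i _ <-]]. Qed.

Lemma inff_le i x : inff x <= F i x.
Proof. by apply: ge_inf; [case: (has_inff x)|exists i]. Qed.

Lemma inff_ge x r : (forall i, r <= F i x) -> r <= inff x.
Proof. by move=> H; apply: lb_le_inf; [exists (F i0 x), i0|move=> _ [i _ <-]]. Qed.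

Lemma inff_lt x a : inff x < a -> exists i, F i x < a.
Proof. by move=> /(inf_lt (proj1 (has_inff x))) [_ [i _ <-]]; exists i. Qed.

Lemma inff_sqnorm : sqnorm inff.
Proof.
have g0 x : 0 <= inff x by apply: inff_ge.
have mM x y : inff (x * y) <= inff x * inff y.
  apply: le_mul_lim => // a b /inff_lt[i ia] /inff_lt[j jb].
  have [k hk] := F_M i j x y; apply: (le_trans (inff_le k _)).
  by apply: (le_trans hk); rewrite ler_pM ?F_ge0 ?ltW.
split=> // [x y|x].
- apply: le_max_lim => a b /inff_lt[i ia] /inff_lt[j jb].
  have [k hk] := F_B i j x y; apply: (le_trans (inff_le k _)).
  by apply: (le_trans hk); rewrite ge_max !le_max (ltW ia) (ltW jb) orbT.
- apply/le_anti; rewrite mM /=; apply: inff_ge => i.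
  have [k hk] := F_2 i x; apply: le_trans hk.
  by rewrite ler_pM ?inff_le.
Qed.

End InfNorm.

(** Submultiplicativity bounds every power from above. Equality holds for exponents 2^k, and with
    2^k larger than the given exponent the complementary power can be cancelled. *)
Lemma sq_exp f x n : sqnorm f -> f (x ^+ n.+1) = f x ^+ n.+1.
Proof.
move=> hf; have p2 k : f (x ^+ (2 ^ k)) = f x ^+ (2 ^ k).
  elim: k => [|k IH]; first by rewrite !expr1.
  by rewrite expnS mul2n -addnn !exprD (sq_2 hf) IH.
have ub m : f (x ^+ m.+1) <= f x ^+ m.+1.
  elim: m => [|m IH]; first by rewrite !expr1.
  by rewrite exprS (le_trans (sq_M hf _ _)) // [f x ^+ _]exprS ler_wpM2l // (sq_ge0 hf).
apply/le_anti; rewrite ub /=.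
have [fx|fx] := eqVneq (f x) 0; first by rewrite fx exprS mul0r (sq_ge0 hf).
have fx0 : 0 < f x by rewrite lt_neqAle eq_sym fx (sq_ge0 hf).
have /ltnW nk : (n.+1 < 2 ^ n.+1)%N by rewrite ltn_expl.
have := p2 n.+1; rewrite -{1 2}(subnK nk) !exprD => e.
case e' : (2 ^ n.+1 - n.+1)%N => [|m]; first by move: e; rewrite e' !expr0 !mul1r => ->.
rewrite e' in e; rewrite -(ler_pM2l (exprn_gt0 m.+1 fx0)) -e.
by rewrite (le_trans (sq_M hf _ _)) // ler_wpM2r ?(sq_ge0 hf).
Qed.

(** The quotients decrease with [n], so this is their limit: the classical smoothing that makes [c]
    multiplicative while keeping its value. *)
Definition locnorm f c x := inff (fun n : nat => fun x => f (x * c ^+ n) / f c ^+ n) x.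

Section LocNorm.
Context (f : B -> RR) (c : B) (hf : sqnorm f) (fc0 : 0 < f c).
Let F (n : nat) (x : B) := f (x * c ^+ n) / f c ^+ n.
Let fn0 n : 0 < f c ^+ n. Proof. exact: exprn_gt0. Qed.

Let F_ge0 i x : 0 <= F i x.
Proof. by rewrite /F mulr_ge0 ?(sq_ge0 hf) // invr_ge0 ltW. Qed.

Let F_dec m n x : (m <= n)%N -> F n x <= F m x.
Proof.
move=> /subnK <-; elim: (n - m)%N => [//|k IH]; rewrite addSn.
apply: le_trans IH; rewrite /F ler_pdivrMr // exprSr mulrA.
rewrite [in X in _ <= X]exprS mulrACA mulVf ?gt_eqF // mulr1 mulrC.
by rewrite mulrC (le_trans (sq_M hf _ _)).
Qed.

Let F_B i j x y : exists k, F k (x - y) <= Num.max (F i x) (F j y).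
Proof.
exists (maxn i j); apply: (@le_trans _ _ (Num.max (F (maxn i j) x) (F (maxn i j) y))).
  by rewrite /F le_max !ler_pM2r ?invr_gt0 // -le_max mulrBl (sq_B hf).
by rewrite ge_max !le_max !F_dec ?leq_maxl ?leq_maxr ?orbT.
Qed.

Let F_M i j x y : exists k, F k (x * y) <= F i x * F j y.
Proof.
exists (i + j)%N; rewrite /F mulrACA -invfM -exprD ler_pM2r ?invr_gt0 //.
have -> : x * y * c ^+ (i + j) = (x * c ^+ i) * (y * c ^+ j) by rewrite exprD mulrACA.
exact: sq_M.
Qed.

Let F_2 i x : exists k, F k x * F k x <= F i (x * x).
Proof.
exists i; apply: (@le_trans _ _ (F (i + i)%N (x * x))); last first.
  by apply: F_dec; exact: leq_addr.
rewrite /F mulrACA -invfM -exprD -(sq_2 hf).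
by have -> : x * x * c ^+ (i + i) = (x * c ^+ i) * (x * c ^+ i) by rewrite exprD mulrACA.
Qed.

Lemma locnorm_sq : sqnorm (locnorm f c).
Proof. exact: (inff_sqnorm 0%N F_ge0 F_B F_M F_2). Qed.

Lemma locnorm_le x : locnorm f c x <= f x.
Proof.
have <- : F 0%N x = f x by rewrite /F !expr0 mulr1 divr1.
exact: (inff_le 0%N F_ge0).
Qed.

Lemma locnorm_mul x : locnorm f c (c * x) = f c * locnorm f c x.
Proof.
have e n : F n (c * x) = f c * F n.+1 x.
  rewrite /F (_ : c * x * c ^+ n = x * c ^+ n.+1); last first.
    by rewrite exprS mulrCA mulrA.
  rewrite [f c ^+ n.+1]exprS; field.
  by rewrite !gt_eqF.
apply/le_anti/andP; split.
  rewrite -ler_pdivrMl //; apply: (inff_ge 0%N) => n.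
  rewrite ler_pdivrMl //; apply: (@le_trans _ _ (F n (c * x))).
    exact: (inff_le 0%N F_ge0).
  by rewrite e ler_pM2l // F_dec.
apply: (inff_ge 0%N) => n; rewrite -/(F n (c * x)) e ler_pM2l //.
exact: (inff_le 0%N F_ge0).
Qed.

Lemma locnorm_c : locnorm f c c = f c.
Proof.
apply/le_anti; rewrite locnorm_le; apply: (inff_ge 0%N) => n.
by rewrite -exprS sq_exp // exprS mulfK ?gt_eqF.
Qed.

(** Smoothing at [c] keeps multiplicativity and the value at an element [h] that already had it, so
    the normalisation at [h] survives the minimality argument. *)
Lemma locnorm_hmul (h : B) : (forall x, f (h * x) = f h * f x) ->
  locnorm f c h = f h /\ forall x, locnorm f c (h * x) = f h * locnorm f c x.
Proof.
move=> fh.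
have m x : locnorm f c (h * x) = f h * locnorm f c x.
  have e n : F n (h * x) = f h * F n x by rewrite /F -mulrA fh mulrA.
  have [h0|h0] := eqVneq (f h) 0.
    apply/le_anti; rewrite h0 mul0r (sq_ge0 locnorm_sq) andbT.
    by apply: (le_trans (locnorm_le _)); rewrite fh h0 mul0r.
  have {}h0 : 0 < f h by rewrite lt_neqAle eq_sym h0 (sq_ge0 hf).
  apply/le_anti/andP; split.
    rewrite -ler_pdivrMl //; apply: (inff_ge 0%N) => n.
    rewrite ler_pdivrMl // -/(F n x) -e.
    exact: (inff_le 0%N F_ge0).
  apply: (inff_ge 0%N) => n; rewrite -/(F n _) e ler_pM2l //.
  exact: (inff_le 0%N F_ge0).
split=> //; apply/le_anti; rewrite locnorm_le; apply: (inff_ge 0%N) => n.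
rewrite fh -mulrA ler_peMr ?(sq_ge0 hf) //.
case: n => [|n]; last by rewrite sq_exp // mulfV ?gt_eqF.
rewrite !expr0 divr1; have := sq_M hf 1 c; rewrite mul1r.
by rewrite -{1}[f c]mul1r ler_pM2r.
Qed.

End LocNorm.

Record mulnorm f : Prop := MulNorm {
  mn_ge0 : forall x, 0 <= f x;
  mn_1 : f 1 = 1;
  mn_B : forall x y, f (x - y) <= Num.max (f x) (f y);
  mn_M : forall x y, f (x * y) = f x * f y }.

(* A minimal element among the square norms below [f] that are multiplicative at
   [h] with value [f h] is multiplicative: otherwise [locnorm] makes it smaller. *)
Lemma exists_mulnorm f (h : B) : sqnorm f -> 0 < f h ->
  exists g, [/\ mulnorm g, forall x, g x <= f x & g h = f h].
Proof.
move=> hf fh.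
pose P g := [/\ sqnorm g, forall x, g x <= f x, g h = f h
                & forall x, g (h * x) = f h * g x].
pose T := {g | P g}.
have P0 : P (locnorm f h).
  split; [exact: locnorm_sq|exact: locnorm_le|exact: locnorm_c|exact: locnorm_mul].
(* The order is reversed: a maximal element for [R] is a minimal seminorm. *)
pose R (a b : T) := `[< forall x, sval b x <= sval a x >].
have [[g [sg gf gh gm]] gmin] : exists t : T, forall s, R t s -> s = t.
  apply: Zorn.
  - by move=> t; apply/asboolP.
  - move=> a b c /asboolP ab /asboolP bc; apply/asboolP => x.
    exact: le_trans (bc x) (ab x).
  - move=> [a Pa] [b Pb] /asboolP /= ab /asboolP /= ba.
    have eab : a = b by apply/funext => x; apply/le_anti; rewrite ab ba.
    by rewrite -{}eab in Pb ab ba *; congr exist; exact: Prop_irrelevance.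
  (* A nonempty chain is bounded by its infimum, the empty one by the initial seminorm [P0]. *)
  - move=> A Atot; have [[a0 Aa0]|A0] := pselect (exists a, A a); last first.
      by exists (exist _ _ P0) => s As; case: A0; exists s.
    pose I := {a | A a}; pose i0 : I := exist _ a0 Aa0.
    pose F (i : I) := sval (sval i).
    have dir (i j : I) : exists k : I, forall x, F k x <= F i x /\ F k x <= F j x.
      have [/asboolP ij|/asboolP ij] := Atot _ _ (svalP i) (svalP j).
        by exists j => x; split=> //; exact: ij.
      by exists i => x; split=> //; exact: ij.
    have sF i : P (F i) by exact: svalP (sval i).
    have F0 i x : 0 <= F i x by case: (sF i) => s _ _ _; exact: (sq_ge0 s).
    have sI : sqnorm (inff F).
      apply: (inff_sqnorm i0) => //.
      - move=> i j x y; have [k hk] := dir i j; exists k.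
        case: (sF k) => s _ _ _; apply: (le_trans (sq_B s _ _)).
        by rewrite ge_max !le_max; case: (hk x) => -> _; case: (hk y) => _ ->; rewrite orbT.
      - move=> i j x y; have [k hk] := dir i j; exists k.
        case: (sF k) => s _ _ _; apply: (le_trans (sq_M s _ _)).
        by rewrite ler_pM //; [case: (hk x)|case: (hk y)].
      - by move=> i x; exists i; case: (sF i) => s _ _ _; rewrite (sq_2 s).
    have PI : P (inff F).
      split=> //.
      - move=> x; apply: (le_trans (inff_le i0 F0 i0 x)).
        by case: (sF i0).
      - apply/le_anti/andP; split.
          by apply: (le_trans (inff_le i0 F0 i0 h)); case: (sF i0) => _ _ -> _.
        by apply: (inff_ge i0) => i; case: (sF i) => _ _ -> _.
      - move=> x; apply/le_anti/andP; split.
          rewrite -ler_pdivrMl //; apply: (inff_ge i0) => i.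
          rewrite ler_pdivrMl //; case: (sF i) => _ _ _ <-; exact: (inff_le i0).
        apply: (inff_ge i0) => i; case: (sF i) => _ _ _ ->.
        by rewrite ler_pM2l //; exact: (inff_le i0).
    exists (exist _ _ PI) => s As; apply/asboolP => x /=.
    exact: (inff_le i0 F0 (exist _ s As)).
exists g; split=> //; split; [exact: sq_ge0 sg| |exact: sq_B sg|].
  have := gm 1; rewrite mulr1 gh => e.
  by apply: (mulfI (lt0r_neq0 fh)); rewrite -e mulr1.
move=> c x; have [c0|c0] := eqVneq (g c) 0.
  by apply/le_anti; rewrite (sq_M sg) c0 mul0r (sq_ge0 sg).
have {}c0 : 0 < g c by rewrite lt_neqAle eq_sym c0 (sq_ge0 sg).
have gm' y : g (h * y) = g h * g y by rewrite gh.
have [l1 l2] := locnorm_hmul sg c0 gm'.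
(* The smoothing at [c] lies below [g] and in the same family; minimality makes it equal to [g], and
   [locnorm_mul] then says that [c] is multiplicative for [g]. *)
have PL : P (locnorm g c).
  split; [exact: locnorm_sq|move=> y|by rewrite l1|by move=> y; rewrite l2 gh].
  exact: le_trans (locnorm_le sg c0 y) (gf y).
have /(congr1 sval)/= e : exist _ _ PL = exist _ _ (And4 sg gf gh gm) :> T.
  by apply: gmin; apply/asboolP => y /=; exact: locnorm_le.
by rewrite -e locnorm_mul // e.
Qed.

Section Spectral.
Context (f : B -> RR).
Hypothesis f_ge0 : forall x, 0 <= f x.
Hypothesis f_0 : f 0 = 0.
Hypothesis f_B : forall x y, f (x - y) <= Num.max (f x) (f y).
Hypothesis f_M : forall x y, f (x * y) <= f x * f y.

(** The free constant [C] makes the infimum the spectral radius without n-th roots. *)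
Definition spec_ub x : set RR :=
  [set r | 0 < r /\ exists C, forall n, f (x ^+ n) <= C * r ^+ n].
Definition specnorm x : RR := inf (spec_ub x).

Let fN x : f (- x) <= f x.
Proof. by rewrite -sub0r (le_trans (f_B _ _)) // f_0 ge_max f_ge0 lexx. Qed.

Let ub_ge0 r x C : 0 < r -> (forall n, f (x ^+ n) <= C * r ^+ n) -> 0 <= C.
Proof. by move=> r0 /(_ 0%N); rewrite !expr0 mulr1; exact: le_trans (f_ge0 _). Qed.

Let spec_ub_f x r : f x <= r -> 0 < r -> spec_ub x r.
Proof.
move=> xr r0; split=> //; exists (f 1); elim=> [|n IH].
  by rewrite !expr0 mulr1.
rewrite !exprSr (le_trans (f_M _ _)) // mulrA ler_pM //.
Qed.

Let has_spec x : has_inf (spec_ub x).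
Proof.
split; last by exists 0 => r [/ltW].
exists (f x + 1); apply: spec_ub_f; first by rewrite lerDl.
by rewrite ltr_wpDl.
Qed.

Lemma specnorm_lt x a : specnorm x < a -> spec_ub x a.
Proof.
move=> /(inf_lt (proj1 (has_spec x))) [r [r0 [C hC]] ra]; split; first exact: lt_trans ra.
exists C => n; apply: (le_trans (hC n)); rewrite ler_wpM2l //.
  exact: ub_ge0 hC.
by rewrite lerXn2r // ?nnegrE ?ltW // (lt_trans r0).
Qed.

Let spec_le x a : spec_ub x a -> specnorm x <= a.
Proof. by move=> h; apply: ge_inf => //; case: (has_spec x). Qed.

Let spec_ge0 x : 0 <= specnorm x.
Proof. by apply: lb_le_inf; [case: (has_spec x)|move=> r [/ltW]]. Qed.

Let f_sum (I : Type) (r : seq I) (F : I -> B) (C : RR) : 0 <= C ->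
  (forall i, f (F i) <= C) -> f (\sum_(i <- r) F i) <= C.
Proof.
move=> C0 FC; elim/big_rec: _ => [|i x _ IH]; first by rewrite f_0.
rewrite -[x]opprK (le_trans (f_B _ _)) // ge_max FC /=.
exact: le_trans (fN _) _.
Qed.

Let f_muln x n : f (x *+ n) <= f x.
Proof.
elim: n => [|n IH]; first by rewrite mulr0n f_0.
rewrite mulrS -[x *+ n]opprK (le_trans (f_B _ _)) // ge_max lexx /=.
exact: le_trans (fN _) _.
Qed.

Let spec_D x y : specnorm (x + y) <= Num.max (specnorm x) (specnorm y).
Proof.
apply: le_max_lim => a b /specnorm_lt[a0 [C hC]] /specnorm_lt[b0 [D hD]].
set r := Num.max a b.
have r0 : 0 < r by rewrite lt_max a0.
have C0 := ub_ge0 a0 hC; have D0 := ub_ge0 b0 hD.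
(* Integer multiples do not increase a nonarchimedean seminorm, so each binomial term is bounded by
   C a^(n-i) D b^i. *)
apply: spec_le; split=> //; exists (C * D) => n; rewrite exprDn.
apply: f_sum => [|i].
  by rewrite !mulr_ge0 // exprn_ge0 // ltW.
apply: (le_trans (f_muln _ _)); apply: (le_trans (f_M _ _)).
have -> : C * D * r ^+ n = (C * r ^+ (n - i)) * (D * r ^+ i).
  by rewrite mulrACA -exprD subnK // -ltnS.
apply: ler_pM => //.
  apply: (le_trans (hC _)); rewrite ler_wpM2l // lerXn2r ?nnegrE ?(ltW a0) ?(ltW r0) //.
  by rewrite le_max lexx.
apply: (le_trans (hD _)); rewrite ler_wpM2l // lerXn2r ?nnegrE ?(ltW b0) ?(ltW r0) //.
by rewrite le_max lexx orbT.
Qed.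

Let spec_N x : specnorm (- x) <= specnorm x.
Proof.
apply/ler_addgt0Pr => e e0.
have [r0 [C hC]] : spec_ub x (specnorm x + e) by apply: specnorm_lt; rewrite ltrDl.
apply: spec_le; split=> //; exists C => n; rewrite exprNn.
rewrite -signr_odd; case: (odd n); rewrite ?expr0 ?expr1 ?mul1r ?mulN1r //.
exact: le_trans (fN _) _.
Qed.

Lemma specnorm_le x : specnorm x <= f x.
Proof.
apply/ler_addgt0Pr => e e0; apply: spec_le; apply: spec_ub_f; first by rewrite lerDl ltW.
by rewrite ltr_wpDl.
Qed.

Lemma specnorm_sq : sqnorm specnorm.
Proof.
have M x y : specnorm (x * y) <= specnorm x * specnorm y.
  apply: le_mul_lim => // a b /specnorm_lt[a0 [C hC]] /specnorm_lt[b0 [D hD]].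
  apply: spec_le; split; first exact: mulr_gt0.
  exists (C * D) => n; rewrite !exprMn mulrACA (le_trans (f_M _ _)) //.
  by rewrite ler_pM.
split=> // [x y|x].
  apply: (le_trans (spec_D _ _)); rewrite ge_max !le_max lexx /=.
  by rewrite spec_N orbT.
apply/le_anti; rewrite M /=; apply/ler_addgt0Pr => e e0.
set s := _ + e; have s0 : 0 < s by rewrite /s ltr_wpDl.
have [_ [C hC]] : spec_ub (x * x) s by apply: specnorm_lt; rewrite ltrDl.
have C0 := ub_ge0 s0 hC.
pose r := Num.sqrt s; have r0 : 0 < r by rewrite sqrtr_gt0.
have rr : s = r ^+ 2 by rewrite sqr_sqrtr ?ltW.
suff xr : specnorm x <= r by rewrite rr expr2 ler_pM.
apply: spec_le; split=> //.
(* The bound for x^2 controls even powers; an odd power costs one more factor f x / r. *)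
exists (C * Num.max 1 (f x / r)) => n.
have e2 : x ^+ n = (x * x) ^+ n./2 * x ^+ (odd n).
  by rewrite -expr2 -exprM -exprD mul2n addnC odd_double_half.
have e3 : r ^+ n = s ^+ n./2 * r ^+ (odd n).
  by rewrite rr -exprM -exprD mul2n addnC odd_double_half.
rewrite e2 e3 mulrACA; case: (odd n); last first.
  rewrite !expr0 !mulr1 (le_trans (hC _)) //.
  rewrite ler_peMr ?le_max ?lexx // mulr_ge0 // exprn_ge0 //; exact: ltW.
rewrite !expr1 (le_trans (f_M _ _)) // ler_pM //.
by rewrite -ler_pdivrMr // le_max lexx orbT.
Qed.

(** If the spectral seminorm of [h] were at least r > 1, [exists_mulnorm] would give a
    multiplicative seminorm below [f] with that same value at [h]. *)
Lemma spectral_bound (h : B) : (forall g, mulnorm g -> (forall x, g x <= f x) -> g h <= 1) ->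
  forall r, 1 < r -> exists C, forall n, f (h ^+ n) <= C * r ^+ n.
Proof.
move=> H r r1; suff /specnorm_lt[] : specnorm h < r by [].
rewrite ltNge; apply/negP => rh.
have h1 := lt_le_trans r1 rh.
have [g [gm gf gh]] := exists_mulnorm specnorm_sq (lt_trans ltr01 h1).
have := H g gm (fun x => le_trans (gf x) (specnorm_le x)).
by rewrite gh leNgt h1.
Qed.

End Spectral.
End SquareNorms.

(** * Value groups of valuation relations *)

(** Points of the spectrum are stored as relations v a <= v b; these are the axioms of such a
    relation. The subring [S] is there for the local ring of a point inside the fraction field. *)
Record vrel (E : comPzRingType) (S : set E) (x : E -> E -> Prop) : Prop := VRel {
  vr_S1 : S 1;
  vr_SB : forall a b, S a -> S b -> S (a - b);
  vr_SM : forall a b, S a -> S b -> S (a * b);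
  vr_tot : forall a b, S a -> S b -> x a b \/ x b a;
  vr_trans : forall b a c, S a -> S b -> S c -> x a b -> x b c -> x a c;
  vr_10 : ~ x 1 0;
  vr_0 : forall a, S a -> x 0 a;
  vr_mul : forall c a b, S a -> S b -> S c -> x a b -> x (a * c) (b * c);
  vr_can : forall c a b, S a -> S b -> S c -> ~ x c 0 -> x (a * c) (b * c) -> x a b;
  vr_add : forall a b, S a -> S b -> x (a + b) a \/ x (a + b) b }.

Section FromRel.
Context (E : comPzRingType) (S : set E) (x : E -> E -> Prop) (H : vrel S x).
Implicit Types (a b c d : E) (p q r : E * E).

Let S1 := vr_S1 H.
Let SM := vr_SM H.
Let S0 : S 0. Proof. by rewrite -(subrr 1); exact: (vr_SB H). Qed.

Lemma vr_tr a b c : x a b -> x b c -> S a -> S b -> S c -> x a c.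
Proof. by move=> ab bc Sa Sb Sc; exact: (vr_trans H Sa Sb Sc ab bc). Qed.

Lemma vr_cancel a b c : x (a * c) (b * c) -> ~ x c 0 -> S a -> S b -> S c -> x a b.
Proof. by move=> ab c0 Sa Sb Sc; exact: (vr_can H Sa Sb Sc c0 ab). Qed.

Lemma vr_S0 : S 0. Proof. exact: S0. Qed.
Lemma vr_SN a : S a -> S (- a).
Proof. by move=> Sa; rewrite -sub0r; exact: (vr_SB H). Qed.
Lemma vr_SD a b : S a -> S b -> S (a + b).
Proof. by move=> Sa Sb; rewrite -[b]opprK; apply: (vr_SB H) => //; exact: vr_SN. Qed.
Lemma vr_SX a n : S a -> S (a ^+ n).
Proof. by move=> Sa; elim: n => [|n IH]; rewrite ?expr0 // exprS; exact: SM. Qed.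

Lemma vr_refl a : S a -> x a a.
Proof. by move=> Sa; case: (vr_tot H Sa Sa). Qed.

Lemma vr_nle a b : S a -> S b -> ~ x a b -> x b a.
Proof. by move=> Sa Sb; case: (vr_tot H Sa Sb). Qed.

Lemma vr_mull c a b : S a -> S b -> S c -> x a b -> x (c * a) (c * b).
Proof. by move=> *; rewrite ![c * _]mulrC; exact: (vr_mul H). Qed.

Lemma vr_mul2 a b c d : S a -> S b -> S c -> S d ->
  x a b -> x c d -> x (a * c) (b * d).
Proof.
move=> Sa Sb Sc Sd ab cd; apply: (@vr_tr _ (b * c)); try exact: SM.
  exact: (vr_mul H).
exact: vr_mull.
Qed.

Lemma vr_exp a b n : S a -> S b -> x a b -> x (a ^+ n) (b ^+ n).
Proof.
move=> Sa Sb ab; elim: n => [|n IH]; first by rewrite !expr0; exact: vr_refl.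
by rewrite !exprS; apply: vr_mul2 => //; exact: vr_SX.
Qed.

Lemma vr_D a b c : S a -> S b -> S c -> x a c -> x b c -> x (a + b) c.
Proof.
move=> Sa Sb Sc ac bc; have Sab := vr_SD Sa Sb.
by case: (vr_add H Sa Sb) => h; apply: (vr_tr h).
Qed.

Lemma vr_N a : S a -> x (- a) a.
Proof.
move=> Sa; have SN1 := vr_SN S1.
suff N1 : x (- 1) 1 by rewrite -mulN1r -[a in x _ a]mul1r; exact: (vr_mul H).
have [//|h] := vr_tot H SN1 S1.
have := vr_mul H S1 SN1 SN1 h; rewrite mul1r mulrNN mulr1 => h1.
exact: h1.
Qed.

Lemma vr_B a b c : S a -> S b -> S c -> x a c -> x b c -> x (a - b) c.
Proof.
move=> Sa Sb Sc ac bc; apply: vr_D => //; first exact: vr_SN.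
by apply: (vr_tr (vr_N Sb) bc) => //; exact: vr_SN.
Qed.

Lemma vr_nz a b : S a -> S b -> ~ x a 0 -> ~ x b 0 -> ~ x (a * b) 0.
Proof.
move=> Sa Sb a0 b0 ab; apply: a0; apply: (@vr_cancel _ _ b) => //; first by rewrite mul0r.
Qed.

Lemma vr_nzX a n : S a -> ~ x a 0 -> ~ x (a ^+ n) 0.
Proof.
move=> Sa a0; elim: n => [|n IH]; first by rewrite expr0; exact: (vr_10 H).
by rewrite exprS; apply: vr_nz => //; exact: vr_SX.
Qed.

Lemma vr_nz_le a b : S a -> S b -> ~ x a 0 -> x a b -> ~ x b 0.
Proof. by move=> Sa Sb a0 ab b0; apply: a0; apply: (vr_tr ab b0) => //; exact: S0. Qed.

(** A pair (a, b) stands for the value of a / b, with b of nonzero value. The value group with zero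
    consists of the classes of such pairs, stored by canonical representatives. *)
Definition vg_ok p := [/\ S p.1, S p.2 & ~ x p.2 0].
Definition vg_rel p q := x (p.1 * q.2) (q.1 * p.2).

Let relT q p r : vg_ok p -> vg_ok q -> vg_ok r -> vg_rel p q -> vg_rel q r -> vg_rel p r.
Proof.
case: p q r => [a b] [c d] [e f] [/= Sa Sb b0] [/= Sc Sd d0] [/= Se Sf f0].
rewrite /vg_rel /= => h1 h2; apply: (@vr_cancel _ _ d) => //; try exact: SM.
apply: (@vr_tr _ (c * b * f)); try by do !apply: SM.
  by rewrite mulrAC; apply: (vr_mul H) => //; exact: SM.
by rewrite mulrAC [e * b * d]mulrAC; apply: (vr_mul H) => //; exact: SM.
Qed.

Let relR p : vg_ok p -> vg_rel p p.
Proof. by move=> [? ? _]; apply: vr_refl; exact: SM. Qed.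

Definition vg_can p := xget (0, 1) [set q | vg_ok q /\ (vg_rel p q /\ vg_rel q p)].

Let canP p : vg_ok p -> vg_ok (vg_can p) /\ (vg_rel p (vg_can p) /\ vg_rel (vg_can p) p).
Proof.
move=> okp; rewrite /vg_can; case: xgetP => [y _ //|/(_ p) []].
by split=> //; split; exact: relR.
Qed.

Let can_eq p q : vg_ok p -> vg_ok q -> vg_rel p q -> vg_rel q p -> vg_can p = vg_can q.
Proof.
move=> okp okq pq qp; rewrite /vg_can; congr xget; apply/seteqP; split=> r [okr [h1 h2]].
  by split=> //; split; [exact: (relT (q := p))|exact: (relT (q := p))].
by split=> //; split; [exact: (relT (q := q))|exact: (relT (q := q))].
Qed.

Record vgrp := VGrp { vg_rep : E * E; vg_repP : vg_ok vg_rep /\ vg_can vg_rep = vg_rep }.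

Let ok01 : vg_ok (0, 1). Proof. by split=> //=; exact: (vr_10 H). Qed.

Lemma vg_subproof p :
  let q := if `[< vg_ok p >] then vg_can p else vg_can (0, 1) in
  vg_ok q /\ vg_can q = q.
Proof.
have h r : vg_ok r -> vg_ok (vg_can r) /\ vg_can (vg_can r) = vg_can r.
  by move=> okr; have [h1 [h2 h3]] := canP okr; split=> //; exact: can_eq.
by case: asboolP => [hp|_]; apply: h.
Qed.

Definition vg_cls p : vgrp := VGrp (vg_subproof p).

Let repok (g : vgrp) : vg_ok (vg_rep g). Proof. by case: (vg_repP g). Qed.

Let vg_eq (g h : vgrp) : vg_rel (vg_rep g) (vg_rep h) -> vg_rel (vg_rep h) (vg_rep g) -> g = h.
Proof.
case: g h => [p [okp cp]] [q [okq cq]] /= h1 h2.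
have {}cpq : p = q by rewrite -cp -cq; exact: can_eq.
by rewrite -{}cpq in okq cq h1 h2 *; congr VGrp; exact: Prop_irrelevance.
Qed.

Let clsP p : vg_ok p -> vg_rel p (vg_rep (vg_cls p)) /\ vg_rel (vg_rep (vg_cls p)) p.
Proof. by move=> okp /=; case: asboolP => // _; case: (canP okp). Qed.

Let cls_eq p q : vg_ok p -> vg_ok q -> vg_rel p q -> vg_rel q p -> vg_cls p = vg_cls q.
Proof.
move=> okp okq pq qp; have [h1 h2] := clsP okp; have [h3 h4] := clsP okq.
by apply: vg_eq; [apply: (relT (q := p)) => //; apply: (relT (q := q))|
  apply: (relT (q := q)) => //; apply: (relT (q := p))].
Qed.

Let clsK g : vg_cls (vg_rep g) = g.
Proof. by have [h1 h2] := clsP (repok g); apply: vg_eq. Qed.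

Let vg_ind (P : vgrp -> Prop) : (forall p, vg_ok p -> P (vg_cls p)) -> forall g, P g.
Proof. by move=> h g; rewrite -(clsK g); exact: h. Qed.

Let mulp p q := (p.1 * q.1, p.2 * q.2).
Let mulp_ok p q : vg_ok p -> vg_ok q -> vg_ok (mulp p q).
Proof. by move=> [? ? ?] [? ? ?]; split; try exact: SM; exact: vr_nz. Qed.

Let mulp_rel p q r : vg_ok p -> vg_ok q -> vg_ok r -> vg_rel p q ->
  vg_rel (mulp r p) (mulp r q).
Proof.
case: p q r => [a b] [c d] [e f] [/= Sa Sb _] [/= Sc Sd _] [/= Se Sf _].
rewrite /vg_rel /= => h; rewrite mulrACA [e * c * _]mulrACA.
by apply: vr_mull => //; exact: SM.
Qed.

Definition vg_mul g h := vg_cls (mulp (vg_rep g) (vg_rep h)).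
Definition vg_le g h := vg_rel (vg_rep g) (vg_rep h).

Let leE p q : vg_ok p -> vg_ok q -> vg_le (vg_cls p) (vg_cls q) <-> vg_rel p q.
Proof.
move=> okp okq; have [h1 h2] := clsP okp; have [h3 h4] := clsP okq.
have rp := repok (vg_cls p); have rq := repok (vg_cls q).
split=> h.
  by apply: (relT (q := vg_rep (vg_cls p))) => //; apply: (relT (q := vg_rep (vg_cls q))).
by apply: (relT (q := p)) => //; apply: (relT (q := q)).
Qed.

Let mulpC p q : mulp p q = mulp q p.
Proof. by rewrite /mulp mulrC [p.2 * _]mulrC. Qed.

Let mulE p q : vg_ok p -> vg_ok q -> vg_mul (vg_cls p) (vg_cls q) = vg_cls (mulp p q).
Proof.
move=> okp okq; have [h1 h2] := clsP okp; have [h3 h4] := clsP okq.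
have rp := repok (vg_cls p); have rq := repok (vg_cls q).
apply: cls_eq; try exact: mulp_ok.
  apply: (relT (q := mulp (vg_rep (vg_cls p)) q)); try exact: mulp_ok.
    exact: mulp_rel.
  by rewrite ![mulp _ q]mulpC; exact: mulp_rel.
apply: (relT (q := mulp (vg_rep (vg_cls p)) q)); try exact: mulp_ok.
  by rewrite ![mulp _ q]mulpC; exact: mulp_rel.
exact: mulp_rel.
Qed.

Let ok11 : vg_ok (1, 1). Proof. by split=> //=; exact: (vr_10 H). Qed.

Let gmulA g h k : vg_mul g (vg_mul h k) = vg_mul (vg_mul g h) k.
Proof.
elim/vg_ind: g => p ?; elim/vg_ind: h => q ?; elim/vg_ind: k => r ?.
by rewrite !mulE /mulp /= ?mulrA //; exact: mulp_ok.
Qed.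
Let gmulC g h : vg_mul g h = vg_mul h g.
Proof. by rewrite /vg_mul mulpC. Qed.
Let gmul1 g : vg_mul (vg_cls (1, 1)) g = g.
Proof. by elim/vg_ind: g => p ?; rewrite mulE // /mulp /= !mul1r -surjective_pairing. Qed.
Let gmul0 g : vg_mul (vg_cls (0, 1)) g = vg_cls (0, 1).
Proof.
rewrite gmulC; elim/vg_ind: g => p okp; rewrite mulE //; apply: cls_eq => //.
- exact: mulp_ok.
- by rewrite /vg_rel /mulp /= mulr0 !mul0r; exact: vr_refl.
- by rewrite /vg_rel /mulp /= mulr0 !mul0r; exact: vr_refl.
Qed.
Let g10 : vg_cls (1, 1) <> vg_cls (0, 1).
Proof.
move=> e; have : vg_le (vg_cls (1, 1)) (vg_cls (0, 1)).
  by rewrite e; apply/leE => //; exact: relR.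
by move=> /leE; rewrite /vg_rel /= mul1r mul0r => h; apply: (vr_10 H); exact: h.
Qed.
Let ginv g : g <> vg_cls (0, 1) -> exists h, vg_mul g h = vg_cls (1, 1).
Proof.
elim/vg_ind: g => -[a b] okp g0; have [/= Sa Sb b0] := okp.
have a0 : ~ x a 0.
  move=> a0; apply: g0; apply: cls_eq => //; rewrite /vg_rel /= mulr1 mul0r //.
  exact: (vr_0 H).
have okq : vg_ok (b, a) by [].
exists (vg_cls (b, a)); rewrite mulE //; apply: cls_eq => //; first exact: mulp_ok.
  by rewrite /vg_rel /= mulr1 mul1r mulrC; apply: vr_refl; exact: SM.
by rewrite /vg_rel /= mulr1 mul1r mulrC; apply: vr_refl; exact: SM.
Qed.
Let gle_anti g h : vg_le g h -> vg_le h g -> g = h.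
Proof. exact: vg_eq. Qed.
Let gle_trans g h k : vg_le g h -> vg_le h k -> vg_le g k.
Proof. by move=> gh hk; apply: (relT (q := vg_rep h)). Qed.
Let gle_tot g h : vg_le g h \/ vg_le h g.
Proof. by have [? ? ?] := repok g; have [? ? ?] := repok h; apply: (vr_tot H); exact: SM. Qed.
Let gle0 g : vg_le (vg_cls (0, 1)) g.
Proof.
elim/vg_ind: g => p okp; apply/leE => //; rewrite /vg_rel /= mul0r.
by case: okp => *; apply: (vr_0 H); exact: SM.
Qed.
Let gle_mul g h k : vg_le g h -> vg_le (vg_mul k g) (vg_mul k h).
Proof.
elim/vg_ind: g => p okp; elim/vg_ind: h => q okq; elim/vg_ind: k => r okr.
by rewrite !mulE // !leE //; try exact: mulp_ok; exact: mulp_rel.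
Qed.

Definition vg_ogroup : ogroup0 :=
  @OGroup0 vgrp (vg_cls (0, 1)) (vg_cls (1, 1)) vg_mul vg_le gmulA gmulC gmul1 gmul0 g10 ginv gle_anti gle_trans gle_tot gle0 gle_mul.

(** Turns a relation back into the actual valuation that [spa_point] and [residue_valuation]
    require; the value of [a] is the class of a / 1. *)
Lemma vrel_valuation : exists (Gam : ogroup0) (v : E -> Gam),
  [/\ v 0 = og0, v 1 = og1,
      forall a b, S a -> S b -> v (a * b) = og_mul (v a) (v b),
      forall a b, S a -> S b -> og_le (v (a + b)) (v a) \/ og_le (v (a + b)) (v b)
    & forall a b, S a -> S b -> x a b <-> og_le (v a) (v b)].
Proof.
have ok a : S a -> vg_ok (a, 1) by move=> Sa; split=> //=; exact: (vr_10 H).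
have leq a b : S a -> S b -> x a b <-> vg_le (vg_cls (a, 1)) (vg_cls (b, 1)).
  by move=> Sa Sb; rewrite leE; [rewrite /vg_rel /= !mulr1|exact: ok|exact: ok].
exists vg_ogroup, (fun a => vg_cls (a, 1)); split=> //=.
- by move=> a b Sa Sb; rewrite mulE /mulp /= ?mulr1 //; exact: ok.
- by move=> a b Sa Sb; rewrite -!leq //; try exact: vr_SD; exact: (vr_add H).
Qed.

End FromRel.

(** * Points of the adic spectrum *)

Section TopRing.
Context (B : topComRingType).
Implicit Types (a b : B) (U : set B).

Lemma nbhs_add a b U : nbhs (a + b) U -> exists P Q : set B,
  [/\ nbhs a P, nbhs b Q & forall x y, P x -> Q y -> U (x + y)].
Proof.
move=> /(@add_continuous B (a, b)) [[P Q] [/= hP hQ] h].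
by exists P, Q; split=> // x y Px Qy; exact: (h (x, y)).
Qed.

Lemma nbhs_mul a b U : nbhs (a * b) U -> exists P Q : set B,
  [/\ nbhs a P, nbhs b Q & forall x y, P x -> Q y -> U (x * y)].
Proof.
move=> /(@mulr_continuous B (a, b)) [[P Q] [/= hP hQ] h].
by exists P, Q; split=> // x y Px Qy; exact: (h (x, y)).
Qed.

Lemma nbhs_opp a U : nbhs (- a) U -> nbhs a [set x | U (- x)].
Proof. exact: (@opp_continuous B a). Qed.

Lemma nbhs_shift a U : nbhs a U <-> nbhs 0 [set z | U (z + a)].
Proof.
split=> h.
  rewrite -[a]add0r in h; have [P [Q [hP hQ hPQ]]] := nbhs_add h.
  by apply: filterS hP => z Pz; apply: hPQ => //; exact: nbhs_singleton hQ.
rewrite -(subrr a) in h; have [P [Q [hP hQ hPQ]]] := nbhs_add h.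
apply: filterS hP => z Pz; rewrite -(subrK a z); apply: hPQ => //.
exact: nbhs_singleton hQ.
Qed.

Lemma nbhs0_mul a U : nbhs (0 : B) U -> nbhs (0 : B) [set z | U (a * z)].
Proof.
rewrite -{1}(mulr0 a) => h; have [P [Q [hP hQ hPQ]]] := nbhs_mul h.
by apply: filterS hQ => z Qz; apply: hPQ => //; exact: nbhs_singleton hP.
Qed.

Lemma nbhs0_add U : nbhs (0 : B) U -> exists2 P, nbhs (0 : B) P &
  forall x y, P x -> P y -> U (x + y).
Proof.
rewrite -{1}(addr0 (0 : B)) => /nbhs_add[P [Q [hP hQ hPQ]]].
by exists (P `&` Q); [exact: filterI|move=> x y [Px _] [_ Qy]; exact: hPQ].
Qed.

Lemma nbhs0_sub U : nbhs (0 : B) U -> exists2 P, nbhs (0 : B) P &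
  forall x y, P x -> P y -> U (x - y).
Proof.
move=> /nbhs0_add[P hP hU].
exists (P `&` [set z | P (- z)]).
  by apply: filterI => //; apply: nbhs_opp; rewrite oppr0.
by move=> x y [Px _] [_ Py]; exact: hU.
Qed.

Lemma hausdorff_sep : hausdorff_space B ->
  forall a, (forall U, nbhs (0 : B) U -> U a) -> a = 0.
Proof.
move=> hB a h; apply: hB => U V hU hV; exists 0; split; last first.
  exact: nbhs_singleton.
have {}hU : nbhs (0 : B) [set z | U (- z + a)].
  move/nbhs_shift: hU => hU.
  have : nbhs (- 0 : B) [set z | U (z + a)] by rewrite oppr0.
  by move=> /nbhs_opp.
by have := h _ hU; rewrite /= addNr.
Qed.

End TopRing.

Lemma zmod_continuous (B C : topComRingType) (f : B -> C) : zmod_morphism f ->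
  (forall U, nbhs (0 : C) U -> nbhs (0 : B) (f @^-1` U)) -> continuous f.
Proof.
move=> fB h a V; rewrite nbhs_shift => /h hU.
apply/nbhs_shift; apply: filterS hU => z /=.
have f0 : f 0 = 0 by rewrite -(subrr 0) fB subrr.
have fN y : f (- y) = - f y by rewrite -[- y]sub0r fB f0 sub0r.
have -> // : f (z + a) = f z + f a.
by rewrite -{1}[a]opprK fB fN opprK.
Qed.

Lemma spa_point_vrel (A : topComRingType) (Ap : set A) (x : spa Ap) : vrel setT x.
Proof.
case: x => x [cx [Gam [v [[v0 v1 vM vA] vp vx]]]] /=.
have le_mul (u a b : Gam) : og_le a b -> og_le (og_mul a u) (og_mul b u).
  by rewrite ![og_mul _ u]og_mulC; exact: og_le_mul.
split=> //.
- by move=> a b _ _; rewrite !vx; exact: og_le_total.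
- by move=> b a c _ _ _; rewrite !vx; exact: og_le_trans.
- rewrite vx v0 v1 => h; apply: (@og_10 Gam); apply: og_le_anti => //.
  exact: og_le0.
- by move=> a _; rewrite vx v0; exact: og_le0.
- by move=> c a b _ _ _; rewrite !vx !vM; exact: le_mul.
- move=> c a b _ _ _; rewrite !vx !vM v0 => c0 h.
  have [u cu] : exists u, og_mul (v c) u = og1.
    by apply: og_inv => c0'; apply: c0; rewrite c0'; exact: og_le0.
  by have := le_mul u _ _ h; rewrite -!og_mulA cu ![og_mul _ og1]og_mulC !og_mul1.
- by move=> a b _ _; rewrite !vx; exact: vA.
Qed.

(* A complete Tate ring [kA] of characteristic p whose unit ball is the ring of
   power-bounded elements, with fraction field [kF], a bounded Frobenius
   splitting [kpsi], and a finite group of isometries. *)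
Record fsplit := FSplit {
  kRR : realType;
  kA : topComRingType;
  kF : fieldType;
  ki : {rmorphism kA -> kF};
  ki_inj : injective ki;
  ki_frac : forall h, exists a b, b != 0 /\ h = ki a / ki b;
  kpi : kA;
  kpi' : kA;
  kpi_pb : power_bounded kpi;
  kpiV : kpi * kpi' = 1;
  knbhs : forall U : set kA, nbhs (0 : kA) U <->
    exists n, forall a, power_bounded a -> U (kpi ^+ n * a);
  kabs : forall a : kA, exists n, power_bounded (kpi ^+ n * a);
  kpb : is_subring (@power_bounded kA);
  kcomplete : complete_ring kA;
  kp : nat;
  kp_prime : prime kp;
  kchar : kp \in [pchar kF];
  kpsi : kA -> kA;
  kpsi_add : forall x y, kpsi (x + y) = kpsi x + kpsi y;
  kpsi_lin : forall x y, kpsi (x ^+ kp * y) = x * kpsi y;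
  kpsi1 : kpsi 1 = 1;
  kpsi_pb : forall x, power_bounded x -> power_bounded (kpsi x);
  kG : finGroupType;
  kact : kG -> kA -> kA;
  kact_hom : forall g, zmod_morphism (kact g) /\ monoid_morphism (kact g);
  kact1 : forall x, kact 1%g x = x;
  kactM : forall g h x, kact (g * h)%g x = kact g (kact h x);
  kact_pb : forall g x, power_bounded x -> power_bounded (kact g x);
  kact_pi : forall g, kact g kpi = kpi }.

Section SpaBasics.
Variable K : fsplit.
Local Notation A := (kA K).
Local Notation F := (kF K).
Local Notation i := (@ki K).
Local Notation pi := (@kpi K).
Local Notation pi' := (@kpi' K).
Local Notation pb := (@power_bounded A).
Local Notation X := (spa pb).
Implicit Types (a b c d : A) (x : X) (h k : F).

Lemma pb1 : pb 1. Proof. by case: (kpb K). Qed.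
Lemma pbB a b : pb a -> pb b -> pb (a - b).
Proof. by case: (kpb K) => _ H _; exact: H. Qed.
Lemma pbM a b : pb a -> pb b -> pb (a * b).
Proof. by case: (kpb K) => _ _; exact. Qed.
Lemma pb0 : pb 0. Proof. by rewrite -(subrr 1); apply: pbB; exact: pb1. Qed.
Lemma pbN a : pb a -> pb (- a).
Proof. by move=> h; rewrite -sub0r; apply: pbB => //; exact: pb0. Qed.
Lemma pbD a b : pb a -> pb b -> pb (a + b).
Proof. by move=> ha hb; rewrite -[b]opprK; apply: pbB => //; exact: pbN. Qed.
Lemma pbX a n : pb a -> pb (a ^+ n).
Proof. by move=> ha; elim: n => [|n IH]; rewrite ?expr0 ?exprS; [exact: pb1|exact: pbM]. Qed.

Lemma nbhs0_pb : nbhs (0 : A) pb.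
Proof. by apply/knbhs; exists 0%N => b; rewrite expr0 mul1r. Qed.

Lemma open_pb : open pb.
Proof.
rewrite openE => a ha; apply/nbhs_shift.
by apply: filterS nbhs0_pb => z hz; exact: pbD.
Qed.

Lemma pi_neq0 : pi != 0.
Proof.
apply/eqP => h; have := kpiV K; rewrite h mul0r => /(congr1 i).
by rewrite rmorph0 rmorph1 => /esym/eqP; rewrite oner_eq0.
Qed.

Lemma i_neq0 a : (i a != 0) = (a != 0).
Proof.
by congr negb; apply/eqP/eqP => [h|->]; [apply: (@ki_inj K); rewrite rmorph0|rewrite rmorph0].
Qed.

Lemma mul_neq0 a b : a != 0 -> b != 0 -> a * b != 0.
Proof. by rewrite -!i_neq0 rmorphM mulf_eq0 => /negPf -> /negPf ->. Qed.

Lemma exp_neq0 a n : a != 0 -> a ^+ n != 0.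
Proof. by rewrite -!i_neq0 rmorphXn => h; rewrite expf_neq0. Qed.

Lemma one_neq0 : (1 : A) != 0. Proof. by rewrite -i_neq0 rmorph1 oner_eq0. Qed.

Local Notation w := (i pi).
Lemma w_neq0 : w != 0. Proof. by rewrite i_neq0 pi_neq0. Qed.
Lemma wX_neq0 n : w ^+ n != 0. Proof. by rewrite expf_neq0 // w_neq0. Qed.
Lemma wV : i pi' = w^-1.
Proof.
by apply: (mulfI w_neq0); rewrite -rmorphM kpiV rmorph1 mulfV // w_neq0.
Qed.

Lemma nbhs_piX n : nbhs (0 : A) [set b | exists2 a, pb a & b = pi ^+ n * a].
Proof. by apply/knbhs; exists n => a ha; exists a. Qed.

Lemma spa_vrel x : vrel setT x. Proof. exact: spa_point_vrel. Qed.

Lemma spa_pb x a : pb a -> x a 1.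
Proof.
case: x => x [cx [Gam [v [[v0 v1 vM vA] vp vx]]]] /= /vp.
by rewrite vx v1.
Qed.

Lemma xrefl x a : x a a. Proof. exact: (vr_refl (spa_vrel x)). Qed.
Lemma xtr x b a c : x a b -> x b c -> x a c.
Proof. by move=> h1 h2; exact: (vr_tr (spa_vrel x) h1 h2). Qed.
Lemma xnle x a b : ~ x a b -> x b a. Proof. exact: (vr_nle (spa_vrel x)). Qed.
Lemma x00 x a : x 0 a. Proof. exact: (vr_0 (spa_vrel x)). Qed.
Lemma x10 x : ~ x 1 0. Proof. exact: (vr_10 (spa_vrel x)). Qed.
Lemma xmul x c a b : x a b -> x (a * c) (b * c).
Proof. exact: (vr_mul (spa_vrel x)). Qed.
Lemma xmull x c a b : x a b -> x (c * a) (c * b).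
Proof. exact: (vr_mull (spa_vrel x)). Qed.
Lemma xmul2 x a b c d : x a b -> x c d -> x (a * c) (b * d).
Proof. exact: (vr_mul2 (spa_vrel x)). Qed.
Lemma xcan x c a b : ~ x c 0 -> x (a * c) (b * c) -> x a b.
Proof. by move=> h1 h2; exact: (vr_cancel (spa_vrel x) h2 h1). Qed.
Lemma xexp x a b n : x a b -> x (a ^+ n) (b ^+ n).
Proof. exact: (vr_exp (spa_vrel x)). Qed.
Lemma xD x a b c : x a c -> x b c -> x (a + b) c.
Proof. exact: (vr_D (spa_vrel x)). Qed.
Lemma xB x a b c : x a c -> x b c -> x (a - b) c.
Proof. exact: (vr_B (spa_vrel x)). Qed.
Lemma xN x a : x (- a) a. Proof. exact: (vr_N (spa_vrel x)). Qed.
Lemma xnz x a b : ~ x a 0 -> ~ x b 0 -> ~ x (a * b) 0.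
Proof. exact: (vr_nz (spa_vrel x)). Qed.
Lemma xnzX x a n : ~ x a 0 -> ~ x (a ^+ n) 0.
Proof. exact: (vr_nzX (spa_vrel x)). Qed.
Lemma xnz_le x a b : ~ x a 0 -> x a b -> ~ x b 0.
Proof. exact: (vr_nz_le (spa_vrel x)). Qed.
Lemma xneq0 x a : ~ x a 0 -> a != 0.
Proof. by move=> h; apply/eqP => a0; apply: h; rewrite a0; exact: xrefl. Qed.
Lemma xnzl x a b : ~ x (a * b) 0 -> ~ x a 0.
Proof. by move=> h h'; apply: h; rewrite -(mul0r b); exact: xmul. Qed.
Lemma xnzr x a b : ~ x (a * b) 0 -> ~ x b 0.
Proof. by rewrite mulrC; exact: xnzl. Qed.
Lemma xpi0 x : ~ x pi 0.
Proof. by move=> /(xmul pi'); rewrite mul0r kpiV; exact: x10. Qed.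
Lemma xpiX0 x n : ~ x (pi ^+ n) 0. Proof. by apply: xnzX; exact: xpi0. Qed.

(** The set |a| < |b| is open and contains 0, hence contains some power of pi. *)
Lemma spa_bounded_below x b : ~ x b 0 -> exists n, x (pi ^+ n) b.
Proof.
move=> b0; have /(_ b 1 b0 (@x10 x)) : continuous_class x by case: x {b0} => ? [].
move=> op; have /knbhs[n /(_ 1 pb1) /= h] : nbhs (0 : A) [set a | ~ x b (a * 1)].
  by apply: open_nbhs_nbhs; split=> //=; rewrite mul0r.
by exists n; apply: xnle; rewrite !mulr1 in h.
Qed.

(** If |pi| >= 1 then all powers have value at least 1, but the open set |a| < 1 contains one of
    them. *)
Lemma xpi_lt1 x : ~ x 1 pi.
Proof.
have /(_ 1 1 (@x10 x) (@x10 x)) : continuous_class x by case: x => ? [].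
move=> op; have /knbhs[n /(_ 1 pb1) /=] : nbhs (0 : A) [set a | ~ x 1 (a * 1)].
  by apply: open_nbhs_nbhs; split=> //=; rewrite mul0r; exact: x10.
by rewrite !mulr1 => h h'; apply: h; rewrite -(expr1n _ n); exact: xexp.
Qed.

Lemma xpi_le x m n : (m <= n)%N -> x (pi ^+ n) (pi ^+ m).
Proof.
move=> /subnK <-; rewrite exprD -[X in _ _ X]mul1r; apply: xmul.
by apply: spa_pb; apply: pbX; exact: kpi_pb.
Qed.

Lemma xpi_lt x n : ~ x (pi ^+ n) (pi ^+ n.+1).
Proof.
rewrite exprS -{1}[pi ^+ n]mul1r => h; apply: (@xpi_lt1 x).
by apply: (@xcan _ (pi ^+ n)) h; exact: xpiX0.
Qed.

Lemma xpi_ltn x m n : x (pi ^+ m) (pi ^+ n) -> (n <= m)%N.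
Proof.
move=> h; rewrite leqNgt; apply/negP => mn; apply: (@xpi_lt x m).
exact: xtr h (xpi_le x mn).
Qed.

Lemma spa_bounded a : exists n, forall x, x (pi ^+ n * a) 1.
Proof. by have [n hn] := kabs a; exists n => x; exact: spa_pb. Qed.

Lemma spa_eqP (x y : X) : (forall a b, x a b <-> y a b) -> x = y.
Proof.
case: x y => [x hx] [y hy] /= h.
have {}h : x = y by apply/funext => a; apply/funext => b; apply/propext.
by rewrite -{}h in hy *; congr SpaPoint; exact: Prop_irrelevance.
Qed.

(** Over a Tate ring, continuity of a valuation amounts to |pi| < 1 together with every nonzero
    value being bounded below by a power of pi. Points coming from seminorms, ultrafilters, the
    group and the origin are all built through this criterion. *)
Lemma spa_of_vrel (R : A -> A -> Prop) : vrel setT R ->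
  (forall a, pb a -> R a 1) -> ~ R 1 pi ->
  (forall b, ~ R b 0 -> exists n, R (pi ^+ n) b) -> exists x : X, x = R :> (A -> A -> Prop).
Proof.
move=> vR Rpb R1 Rb; suff h : spa_point pb R by exists (SpaPoint h).
split; last first.
  have [Gam [v [v0 v1 vM vA vR']]] := vrel_valuation vR.
  exists Gam, v; split=> //; first by split=> // a b; [exact: vM|exact: vA].
    by move=> a /Rpb; rewrite vR' // v1.
  by move=> a b; exact: vR'.
move=> b c b0 c0; rewrite openE => a /= ha; apply/nbhs_shift.
have [n hn] := Rb b b0; have [m hm] := kabs c.
(* The perturbation pi^(n+m+1) e, multiplied by c, has value below that of b, since e and pi^m c are
   integral and |pi|^n <= |b|. It therefore cannot affect whether |a c| < |b|. *)
apply: filterS (nbhs_piX (n + m).+1) => _ [e he ->] /= h; apply: ha.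
have le1 : R (e * (pi ^+ m * c)) 1 by apply: Rpb; exact: pbM.
have piX (q : nat) : ~ R (pi ^+ q) 0.
  apply: (vr_nzX vR) => // h0; apply: (vr_10 vR); rewrite -(kpiV K) -(mul0r pi').
  exact: (vr_mul vR).
have lt : R (pi ^+ (n + m).+1 * e * c) (pi ^+ n.+1).
  rewrite -addSn exprD; have -> : pi ^+ n.+1 * pi ^+ m * e * c = pi ^+ n.+1 * (e * (pi ^+ m * c)) by ring.
  by rewrite -[X in R _ X]mulr1; apply: (vr_mull vR).
have nlt : ~ R b (pi ^+ (n + m).+1 * e * c).
  move=> h1; apply: R1; apply: (@vr_cancel _ _ _ vR _ _ (pi ^+ n)) => //.
  by rewrite mul1r -exprS; apply: (vr_tr vR hn) => //; exact: (vr_tr vR h1 lt).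
rewrite mulrDl in h.
have h2 := vr_nle vR I I nlt.
have [//|h3] := vr_tot vR (I : setT b) (I : setT (a * c)).
have := vr_add vR (I : setT (pi ^+ (n + m).+1 * e * c)) (I : setT (a * c)).
case=> h4; last by exact: (vr_tr vR h h4).
by case: nlt; exact: (vr_tr vR h h4).
Qed.

(* The valuation of a point extended to the local ring of its support in [F] *)
Definition ext x h k := exists a b d,
  [/\ ~ x d 0, h = i a / i d, k = i b / i d & x a b].
Definition FX x : set F := [set h | exists a d, ~ x d 0 /\ h = i a / i d].

Lemma extE x a b d e : ~ x d 0 -> ~ x e 0 ->
  ext x (i a / i d) (i b / i e) <-> x (a * e) (b * d).
Proof.
move=> d0 e0; have d0' := xneq0 d0; have e0' := xneq0 e0.
split=> [[a' [b' [d' [d'0 h1 h2 h3]]]]|h]; last first.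
  exists (a * e), (b * d), (d * e); split=> //; first exact: xnz.
    by rewrite !rmorphM; field; rewrite !i_neq0 d0' e0'.
  by rewrite !rmorphM; field; rewrite !i_neq0 d0' e0'.
have d'0' := xneq0 d'0.
have e1 : a * d' = a' * d.
  apply: (@ki_inj K); rewrite !rmorphM; move/eqP: h1.
  by rewrite eqr_div ?i_neq0 // => /eqP.
have e2 : b * d' = b' * e.
  apply: (@ki_inj K); rewrite !rmorphM; move/eqP: h2.
  by rewrite eqr_div ?i_neq0 // => /eqP.
apply: (@xcan _ d') => //.
have -> : a * e * d' = a' * (d * e) by rewrite mulrAC e1 mulrA.
have -> : b * d * d' = b' * (d * e) by rewrite mulrAC e2; ring.
exact: xmul.
Qed.

Lemma FX_i x a : FX x (i a).
Proof. by exists a, 1; split; [exact: x10|rewrite rmorph1 divr1]. Qed.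

Lemma ext_i x a b : ext x (i a) (i b) <-> x a b.
Proof.
have := @extE x a b 1 1 (@x10 x) (@x10 x).
by rewrite !rmorph1 !divr1 !mulr1.
Qed.

Lemma ext_FX x h k : ext x h k -> FX x h /\ FX x k.
Proof. by move=> [a [b [d [d0 -> -> _]]]]; split; [exists a, d|exists b, d]. Qed.

Lemma extD x a b d : ~ x d 0 -> ext x (i a / i d) (i b / i d) <-> x a b.
Proof.
by move=> d0; rewrite extE //; split=> [|h]; [exact: xcan|exact: xmul].
Qed.

Lemma FX3 x h k l : FX x h -> FX x k -> FX x l -> exists a b c d,
  [/\ ~ x d 0, h = i a / i d, k = i b / i d & l = i c / i d].
Proof.
move=> [a [d [d0 ->]]] [b [e [e0 ->]]] [c [f [f0 ->]]].
have d0' := xneq0 d0; have e0' := xneq0 e0; have f0' := xneq0 f0.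
exists (a * e * f), (b * d * f), (c * d * e), (d * e * f).
split; first by apply: xnz => //; exact: xnz.
all: by rewrite !rmorphM; field; rewrite !i_neq0 ?d0' ?e0' ?f0'.
Qed.

(** Any three elements of the local ring share a denominator by [FX3], so each axiom reduces to the
    one for numerators. *)
Lemma ext_vrel x : vrel (FX x) (ext x).
Proof.
have F1 : FX x 1 by rewrite -(rmorph1 i); exact: FX_i.
have H := spa_vrel x.
split=> //.
- move=> h k hh kk; have [a [b [_ [d [d0 -> -> _]]]]] := FX3 hh kk kk.
  by rewrite -mulrBl -rmorphB; exists (a - b), d.
- move=> h k hh kk; have [a [b [_ [d [d0 -> -> _]]]]] := FX3 hh kk kk.
  by rewrite mulf_div -!rmorphM; exists (a * b), (d * d); split=> //; exact: xnz.
- move=> h k hh kk; have [a [b [_ [d [d0 -> -> _]]]]] := FX3 hh kk kk.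
  by rewrite !extD //; exact: (vr_tot H).
- move=> h k l hh kk ll; have [a [b [c [d [d0 -> -> ->]]]]] := FX3 hh kk ll.
  by rewrite !extD //; exact: xtr.
- by rewrite -(rmorph1 i) -(rmorph0 i) ext_i; exact: x10.
- move=> h hh; have [a [_ [_ [d [d0 -> _ _]]]]] := FX3 hh hh hh.
  by rewrite -(mul0r (i d)^-1) -(rmorph0 i) extD //; exact: x00.
- move=> h k l kk ll hh; have [a [b [c [d [d0 -> -> ->]]]]] := FX3 hh kk ll.
  rewrite !mulf_div -!rmorphM !extD //; [|exact: xnz|exact: x10..].
  exact: xmul.
- move=> h k l kk ll hh; have [a [b [c [d [d0 -> -> ->]]]]] := FX3 hh kk ll.
  rewrite -{1}(mul0r (i d)^-1) -{1}(rmorph0 i) !mulf_div -!rmorphM !extD //; last exact: xnz.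
  exact: xcan.
- move=> h k hh kk; have [a [b [_ [d [d0 -> -> _]]]]] := FX3 hh kk kk.
  by rewrite -mulrDl -rmorphD !extD //; exact: (vr_add H).
Qed.

Lemma F1 x : FX x 1. Proof. exact: (vr_S1 (ext_vrel x)). Qed.
Lemma F0 x : FX x 0. Proof. exact: (vr_S0 (ext_vrel x)). Qed.
Lemma FXB x h k : FX x h -> FX x k -> FX x (h - k).
Proof. exact: (vr_SB (ext_vrel x)). Qed.
Lemma FXD x h k : FX x h -> FX x k -> FX x (h + k).
Proof. exact: (vr_SD (ext_vrel x)). Qed.
Lemma FXM x h k : FX x h -> FX x k -> FX x (h * k).
Proof. exact: (vr_SM (ext_vrel x)). Qed.
Lemma FXV x h : FX x h -> ~ ext x h 0 -> FX x h^-1 /\ ~ ext x h^-1 0.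
Proof.
move=> hh h0; have h0' : h != 0.
  by apply/eqP => e; apply: h0; rewrite e; exact: (vr_refl (ext_vrel x) (F0 x)).
move: hh h0 h0' => [a [d [d0 ->]]] h0 h0'; rewrite invf_div.
have a0 : ~ x a 0.
  move=> a0; apply: h0; rewrite -(mul0r (i d)^-1) -(rmorph0 i).
  by apply/extD.
split; first by exists d, a.
by rewrite -(mul0r (i a)^-1) -(rmorph0 i) extD.
Qed.

Lemma extR x h : FX x h -> ext x h h. Proof. exact: (vr_refl (ext_vrel x)). Qed.
Lemma ext_tr x k h l : ext x h k -> ext x k l -> ext x h l.
Proof.
move=> h1 h2; have [hh kk] := ext_FX h1; have [_ ll] := ext_FX h2.
exact: (vr_tr (ext_vrel x) h1 h2).
Qed.
Lemma ext_nle x h k : FX x h -> FX x k -> ~ ext x h k -> ext x k h.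
Proof. exact: (vr_nle (ext_vrel x)). Qed.
Lemma ext_mul x h k l m : ext x h k -> ext x l m -> ext x (h * l) (k * m).
Proof.
move=> h1 h2; have [hh kk] := ext_FX h1; have [ll mm] := ext_FX h2.
exact: (vr_mul2 (ext_vrel x)).
Qed.
Lemma ext_can x l h k : FX x h -> FX x k -> FX x l -> ~ ext x l 0 ->
  ext x (h * l) (k * l) -> ext x h k.
Proof. by move=> *; exact: (vr_can (ext_vrel x) (c := l)). Qed.
Lemma ext_B x h k l : ext x h l -> ext x k l -> ext x (h - k) l.
Proof.
move=> h1 h2; have [hh ll] := ext_FX h1; have [kk _] := ext_FX h2.
exact: (vr_B (ext_vrel x)).
Qed.
Lemma ext_0 x h : FX x h -> ext x 0 h. Proof. exact: (vr_0 (ext_vrel x)). Qed.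
Lemma ext_N x h k : ext x h k -> ext x (- h) k.
Proof.
move=> hk; have [_ kk] := ext_FX hk; rewrite -sub0r; apply: ext_B => //.
exact: ext_0.
Qed.
Lemma ext_D x h k l : ext x h l -> ext x k l -> ext x (h + k) l.
Proof. by move=> h1 h2; rewrite -[k]opprK; apply: ext_B => //; exact: ext_N. Qed.
Lemma ext_exp x h k n : ext x h k -> ext x (h ^+ n) (k ^+ n).
Proof. by move=> h1; have [? ?] := ext_FX h1; exact: (vr_exp (ext_vrel x)). Qed.

(* [lvl x n h] : |h(x)| <= |pi(x)|^n *)
Definition lvl x n h := ext x h (w ^+ n).

Lemma FXw x n : FX x (w ^+ n). Proof. by rewrite -rmorphXn; exact: FX_i. Qed.
Lemma lvl_FX x n h : lvl x n h -> FX x h. Proof. by case/ext_FX. Qed.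
Lemma lvl_w x m n : lvl x m (w ^+ n) <-> (m <= n)%N.
Proof.
rewrite /lvl -!rmorphXn ext_i; split; last exact: xpi_le.
exact: xpi_ltn.
Qed.
Lemma lvl_le x m n h : (m <= n)%N -> lvl x n h -> lvl x m h.
Proof. by move=> mn hn; apply: ext_tr hn _; apply/lvl_w. Qed.
Lemma lvl_0 x n : lvl x n 0. Proof. by apply: ext_0; exact: FXw. Qed.
Lemma lvl_B x n h k : lvl x n h -> lvl x n k -> lvl x n (h - k).
Proof. exact: ext_B. Qed.
Lemma lvl_D x n h k : lvl x n h -> lvl x n k -> lvl x n (h + k).
Proof. exact: ext_D. Qed.
Lemma lvl_N x n h : lvl x n h -> lvl x n (- h).
Proof. exact: ext_N. Qed.
Lemma lvl_M x m n h k : lvl x m h -> lvl x n k -> lvl x (m + n) (h * k).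
Proof. by move=> h1 h2; rewrite /lvl exprD; exact: ext_mul. Qed.
Lemma lvl_i x n a : lvl x n (i a) <-> x a (pi ^+ n).
Proof. by rewrite /lvl -rmorphXn ext_i. Qed.
Lemma lvl_pb x a : pb a -> lvl x 0 (i a).
Proof. by move=> h; rewrite lvl_i expr0; exact: spa_pb. Qed.
Lemma lvlw x n : ~ ext x (w ^+ n) 0.
Proof. by rewrite -rmorphXn -(rmorph0 i) ext_i; exact: xpiX0. Qed.

Lemma lvl_wM x m n h : lvl x (m + n) (w ^+ m * h) <-> lvl x n h.
Proof.
rewrite /lvl exprD; split=> [H|H]; last first.
  by apply: ext_mul => //; apply: extR; exact: FXw.
have wF := FXw x m.
have [HF _] := ext_FX H.
have hF : FX x h.
  have [wV' _] := FXV wF (@lvlw x m).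
  by rewrite -(mulKf (wX_neq0 m) h); exact: FXM.
apply: (@ext_can _ (w ^+ m)) => //; [exact: FXw|exact: lvlw|].
by rewrite ![_ * w ^+ m]mulrC.
Qed.

Lemma FX_bounded x h : FX x h -> exists n, lvl x 0 (w ^+ n * h).
Proof.
move=> [a [d [d0 ->]]]; have [n hn] := kabs a; have [m hm] := spa_bounded_below d0.
exists (n + m)%N; rewrite /lvl expr0 mulrA -rmorphXn -rmorphM -[1]divr1 -(rmorph1 i).
apply/extE => //; first exact: x10.
rewrite mulr1 mul1r exprD -mulrA [_ * a]mulrC mulrA -[d]mul1r.
by apply: xmul2 => //; exact: spa_pb.
Qed.

Lemma ext_below x h : FX x h -> ~ ext x h 0 -> exists n, ext x (w ^+ n) h.
Proof.
move=> hh h0; have [hV hV0] := FXV hh h0; have [n hn] := FX_bounded hV.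
have h0' : h != 0 by apply/eqP => e; apply: h0; rewrite e; exact: extR (F0 x).
exists n; apply: (@ext_can _ h^-1) => //; first exact: FXw.
by rewrite mulfV // -(expr0 w).
Qed.

Lemma lvl_sep x h : FX x h -> (forall n, lvl x n h) -> ext x h 0.
Proof.
move=> hh H; apply: contrapT => h0; have [n hn] := ext_below hh h0.
by have := ext_tr hn (H n.+1); rewrite -/(lvl _ _ _) lvl_w ltnn.
Qed.

End SpaBasics.

(** * Uniformity of rational localizations *)

Section Span.
Variable K : fsplit.
Local Notation A := (kA K).
Local Notation F := (kF K).
Local Notation i := (@ki K).
Local Notation pi := (@kpi K).
Local Notation pb := (@power_bounded A).
Local Notation X := (spa pb).
Local Notation w := (i pi).
Local Notation p := (@kp K).
Local Notation psi := (@kpsi K).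
Implicit Types (a b c d : A) (x : X) (h k y z u : F) (us : seq F).

Let p_gt1 : (1 < p)%N. Proof. exact: prime_gt1 (kp_prime K). Qed.
Let p_gt0 : (0 < p)%N. Proof. exact: prime_gt0 (kp_prime K). Qed.

Lemma frac_of h : {ab : A * A | ab.2 != 0 /\ h = i ab.1 / i ab.2}.
Proof.
apply: cid; have [a [b [b0 e]]] := ki_frac h; by exists (a, b).
Qed.

(* The splitting is extended to fractions by a / b = (a b^(p-1)) / b^p. *)
Definition cartier h : F :=
  let ab := sval (frac_of h) in i (psi (ab.1 * ab.2 ^+ p.-1)) / i ab.2.

Let pS d : d ^+ p = d * d ^+ p.-1.
Proof. by rewrite -exprS prednK. Qed.

(** Independence of the chosen fraction: p-linearity allows cross-multiplication by the denominators
    once these appear as p-th powers under [psi]. *)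
Lemma cartierE a b : b != 0 -> cartier (i a / i b) = i (psi (a * b ^+ p.-1)) / i b.
Proof.
move=> b0; rewrite /cartier; case: frac_of => -[c d] /= [d0 /eqP].
rewrite eqr_div ?i_neq0 // -!rmorphM => /eqP/(@ki_inj K) e.
apply/eqP; rewrite eqr_div ?i_neq0 // -!rmorphM; apply/eqP; congr (i _).
rewrite ![psi _ * _]mulrC -!kpsi_lin; congr psi.
by rewrite !pS; transitivity (c * b * (d ^+ p.-1 * b ^+ p.-1)); [ring|rewrite -e; ring].
Qed.

Lemma cartier_i a : cartier (i a) = i (psi a).
Proof.
have := @cartierE a 1 (one_neq0 K).
by rewrite expr1n mulr1 rmorph1 !divr1.
Qed.

Lemma cartierD h k : cartier (h + k) = cartier h + cartier k.
Proof.
have [a [b [b0 ->]]] := ki_frac h; have [c [d [d0 ->]]] := ki_frac k.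
have e0 := mul_neq0 b0 d0.
have e1 : i a / i b = i (a * d) / i (b * d) by rewrite !rmorphM; field; rewrite !i_neq0 b0 d0.
have e2 : i c / i d = i (c * b) / i (b * d) by rewrite !rmorphM; field; rewrite !i_neq0 b0 d0.
by rewrite e1 e2 -mulrDl -rmorphD !cartierE // mulrDl kpsi_add rmorphD mulrDl.
Qed.

Lemma cartier_lin h k : cartier (h ^+ p * k) = h * cartier k.
Proof.
have [a [b [b0 ->]]] := ki_frac h; have [c [d [d0 ->]]] := ki_frac k.
rewrite expr_div_n mulf_div -!rmorphXn -!rmorphM !cartierE ?mul_neq0 ?exp_neq0 //.
have -> : a ^+ p * c * (b ^+ p * d) ^+ p.-1 =
          (a * b ^+ p.-1) ^+ p * (c * d ^+ p.-1).
  by rewrite !exprMn -!exprM [(p * p.-1)%N]mulnC; ring.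
rewrite kpsi_lin pS !rmorphM; field.
by rewrite !i_neq0 ?b0 ?d0 ?exp_neq0.
Qed.

Lemma cartierK h : cartier (h ^+ p) = h.
Proof.
by rewrite -[h ^+ p]mulr1 cartier_lin -(rmorph1 i) cartier_i kpsi1 rmorph1 mulr1.
Qed.

(** Polynomials in the fractions [us] with integral coefficients. This is the unit ball of the
    uncompleted localization [spanK us], in which pi is inverted. *)
Inductive span us : F -> Prop :=
| span_pb a : pb a -> span us (i a)
| span_add y z : span us y -> span us z -> span us (y + z)
| span_mul u y : u \in us -> span us y -> span us (u * y).

Lemma span_i us a y : pb a -> span us y -> span us (i a * y).
Proof.
move=> ha; elim=> [b hb|z1 z2 _ h1 _ h2|u z uus _ h].
- by rewrite -rmorphM; apply: span_pb; exact: pbM.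
- by rewrite mulrDr; exact: span_add.
- by rewrite mulrCA; exact: span_mul.
Qed.

Lemma span_M us y z : span us y -> span us z -> span us (y * z).
Proof.
elim=> [a ha hz|z1 z2 _ h1 _ h2 hz|u z' uus _ h hz].
- exact: span_i.
- by rewrite mulrDl; apply: span_add; [exact: h1|exact: h2].
- by rewrite -mulrA; apply: span_mul => //; exact: h.
Qed.

Lemma span_1 us : span us 1.
Proof. by rewrite -(rmorph1 i); apply: span_pb; exact: pb1. Qed.
Lemma span_0 us : span us 0.
Proof. by rewrite -(rmorph0 i); apply: span_pb; exact: pb0. Qed.
Lemma span_N us y : span us y -> span us (- y).
Proof.
move=> hy; rewrite -mulN1r -(rmorph1 i) -rmorphN; apply: span_i => //.
by apply: pbN; exact: pb1.
Qed.
Lemma span_B us y z : span us y -> span us z -> span us (y - z).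
Proof. by move=> hy hz; apply: span_add => //; exact: span_N. Qed.
Lemma span_X us y n : span us y -> span us (y ^+ n).
Proof. by move=> h; elim: n => [|n IH]; rewrite ?expr0 ?exprS; [exact: span_1|exact: span_M]. Qed.
Lemma span_u us u : u \in us -> span us u.
Proof. by move=> h; rewrite -[u]mulr1; apply: span_mul => //; exact: span_1. Qed.
Lemma span_w us n : span us (w ^+ n).
Proof. by rewrite -rmorphXn; apply: span_pb; apply: pbX; exact: kpi_pb. Qed.
Lemma span_wM us n y : span us y -> span us (w ^+ n * y).
Proof. by move=> h; apply: span_M => //; exact: span_w. Qed.
Lemma span_wle us m n y : (m <= n)%N -> span us (w ^+ m * y) -> span us (w ^+ n * y).
Proof. by move=> /subnK <- h; rewrite exprD -mulrA; exact: span_wM. Qed.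
Lemma span_incl us vs y : {subset us <= vs} -> span us y -> span vs y.
Proof.
move=> uv; elim=> [a ha|z1 z2 _ h1 _ h2|u z uus _ h].
- exact: span_pb.
- exact: span_add.
- by apply: span_mul => //; exact: uv.
Qed.

Definition spanK us h := exists n, span us (w ^+ n * h).

Lemma spanK_span us h : span us h -> spanK us h.
Proof. by exists 0%N; rewrite expr0 mul1r. Qed.
Lemma spanK_1 us : spanK us 1. Proof. by apply: spanK_span; exact: span_1. Qed.
Lemma spanK_0 us : spanK us 0. Proof. by apply: spanK_span; exact: span_0. Qed.
Lemma spanK_B us h k : spanK us h -> spanK us k -> spanK us (h - k).
Proof.
move=> [m hm] [n hn]; exists (m + n)%N; rewrite mulrBr; apply: span_B.
  by apply: span_wle hm; exact: leq_addr.
by apply: span_wle hn; exact: leq_addl.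
Qed.
Lemma spanK_D us h k : spanK us h -> spanK us k -> spanK us (h + k).
Proof.
move=> hh kk; rewrite -[k]opprK; apply: spanK_B => //.
by rewrite -sub0r; apply: spanK_B => //; exact: spanK_0.
Qed.
Lemma spanK_M us h k : spanK us h -> spanK us k -> spanK us (h * k).
Proof. by move=> [m hm] [n hn]; exists (m + n)%N; rewrite exprD mulrACA; exact: span_M. Qed.
Lemma spanK_i us a : spanK us (i a).
Proof.
have [n hn] := kabs a; exists n; rewrite -rmorphXn -rmorphM; exact: span_pb.
Qed.
Lemma spanK_w us n : spanK us (w ^+ n)^-1.
Proof. by exists n; rewrite mulfV ?wX_neq0 //; exact: span_1. Qed.
Lemma spanK_incl us vs h : {subset us <= vs} -> spanK us h -> spanK vs h.
Proof. by move=> uv [n hn]; exists n; exact: span_incl hn. Qed.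

(** Data of a rational localization with denominator [d]. That 1 / d is a polynomial in [us]
    replaces the openness of the ideal of numerators; this form is stable under intersections and
    Laurent refinements. *)
Definition adata us d :=
  [/\ d != 0, forall u, u \in us -> exists a, u = i a / i d & spanK us (i d)^-1].

Definition uset us : set X := [set x | forall u, u \in us -> ext x u 1].

Lemma span_ext us h x : uset us x -> span us h -> ext x h 1.
Proof.
move=> xU; elim=> [a ha|z1 z2 _ h1 _ h2|u z uus _ hz].
- by have := lvl_pb x ha; rewrite /lvl expr0.
- exact: ext_D.
- by rewrite -(mul1r 1); apply: ext_mul => //; exact: xU.
Qed.

Lemma span_lvl us n h x : uset us x -> span us h -> lvl x n (w ^+ n * h).
Proof.
by move=> xU hh; rewrite -[X in lvl _ X]addn0 lvl_wM /lvl expr0; exact: span_ext hh.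
Qed.

Lemma spanK_FX us h x : uset us x -> spanK us h -> FX x h.
Proof.
move=> xU [n hn]; have [hF _] := ext_FX (span_ext xU hn).
rewrite -(mulKf (wX_neq0 K n) h); apply: FXM => //.
by have [] := FXV (FXw x n) (@lvlw K x n).
Qed.

(** Where all of [us] are integral, 1 / d is a polynomial in them and so has a finite value; hence
    [d] is not in the support of the point. *)
Lemma uset_den us d x : adata us d -> uset us x -> ~ x d 0.
Proof.
move=> [d0 _ hd] xU d0'; have [a [b [b0 e]]] := spanK_FX xU hd.
have : b = a * d.
  apply: (@ki_inj K); rewrite rmorphM; apply: (@mulIf _ (i d)^-1).
    by rewrite invr_eq0 i_neq0.
  by rewrite mulfK ?i_neq0 // e mulrCA mulfV ?mulr1 // i_neq0 (xneq0 b0).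
move=> e'; apply: b0; rewrite e' -(mulr0 a); exact: xmull.
Qed.

(* A monomial can be divided by p-th powers until all its exponents are less
   than p, and there are finitely many such monomials. *)
Lemma cartier_span us d : adata us d ->
  exists M, forall h, span us h -> span us (w ^+ M * cartier h).
Proof.
move=> [d0 hus [N hN]]; pose n := size us.
have [f hf] : exists f : nat -> A, forall j, (j < n)%N -> us`_j = i (f j) / i d.
  have /choice[f hf] : forall j, exists a, (j < n)%N -> us`_j = i a / i d.
    move=> j; have [jn|jn] := ltnP j n; last by exists 0.
    by have [a e] := hus us`_j (mem_nth 0 jn); exists a.
  by exists f.
(* The exponent [c0] makes all numerators and the denominator integral, while [N] makes 1 / d
   integral. Each of the n generators will cost both, whence [M]. *)
have [c0 [hc0 hcd]] : exists c0 : nat, (forall j, (j < n)%N -> pb (pi ^+ c0 * f j)) /\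
    pb (pi ^+ c0 * d).
  have [e he] := kabs d.
  have [m hm] : exists m, forall j, (j < n)%N -> pb (pi ^+ m * f j).
    elim: (n) => [|k [m hm]]; first by exists 0%N.
    have [q hq] := kabs (f k); exists (m + q)%N => j; rewrite ltnS leq_eqVlt.
    rewrite exprD => /orP[/eqP->|/hm h].
      by rewrite -mulrA; apply: pbM => //; apply: pbX; exact: kpi_pb.
    by rewrite [_ ^+ m * _]mulrC -mulrA; apply: pbM => //; apply: pbX; exact: kpi_pb.
  exists (m + e)%N; rewrite exprD; split=> [j /hm h|].
    by rewrite [_ ^+ m * _]mulrC -mulrA; apply: pbM => //; apply: pbX; exact: kpi_pb.
  by rewrite -mulrA; apply: pbM => //; apply: pbX; exact: kpi_pb.
pose M := ((N + c0) * n)%N; exists M.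
pose mon (r : nat -> nat) := \prod_(j < n) us`_j ^+ r j.
(* A reduced monomial [mon r], with exponents below p, is carried along because the induction peels
   generators off [h] one at a time. *)
suff H h : span us h -> forall r, (forall j, (r j < p)%N) ->
    span us (w ^+ M * cartier (mon r * h)).
  move=> h hh; have := H h hh (fun=> 0%N) (fun=> p_gt0).
  by rewrite /mon big1 ?mul1r // => j _; rewrite expr0.
elim=> {h} [a ha r rp|y z _ IHy _ IHz r rp|u z uus _ IH r rp].
(* [mon r] is g over the p-th power of d^n: the exponents p - r_j supply the missing factors d. *)
- pose g := \prod_(j < n) (f j ^+ r j * d ^+ (p - r j)).
  have gE : mon r * (i d ^+ n) ^+ p = i g.
    rewrite /mon /g rmorph_prod -exprM mulnC exprM -[X in _ ^+ X]card_ord.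
    rewrite -prodr_const -big_split /=; apply: eq_bigr => j _.
    rewrite hf // rmorphM !rmorphXn expr_div_n mulrAC -mulrA; congr (_ * _).
    apply: (@mulIf _ (i d ^+ r j)); first by rewrite expf_neq0 // i_neq0.
    rewrite mulfVK ?expf_neq0 ?i_neq0 // -exprD subnK //; exact: ltnW.
  have hg : pb (pi ^+ (c0 * n) ^+ p * g).
    rewrite -exprM mulnAC exprM -[X in _ ^+ X]card_ord -prodr_const -big_split /=.
    elim/big_ind: _ => [|y z|j _]; [exact: pb1|exact: pbM|].
    have -> : pi ^+ (c0 * p) * (f j ^+ r j * d ^+ (p - r j)) =
       (pi ^+ c0 * f j) ^+ r j * (pi ^+ c0 * d) ^+ (p - r j).
      rewrite !exprMn -!exprM mulrACA -exprD -mulnDr subnKC //; exact: ltnW.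
    by apply: pbM; apply: pbX => //; exact: hc0.
  have dn0 : i d ^+ n != 0 by rewrite expf_neq0 // i_neq0.
  have wn0 : w ^+ (c0 * n) != 0 by exact: wX_neq0.
  have -> : mon r * i a = ((i d ^+ n)^-1 * (w ^+ (c0 * n))^-1) ^+ p *
      i (pi ^+ (c0 * n) ^+ p * g * a).
    have e1 : ((i d ^+ n)^-1 * (w ^+ (c0 * n))^-1) ^+ p *
        ((w ^+ (c0 * n)) ^+ p * (i d ^+ n) ^+ p) = 1.
      rewrite -!exprMn; have -> : (i d ^+ n)^-1 / w ^+ (c0 * n) *
         (w ^+ (c0 * n) * i d ^+ n) = 1 by field; rewrite dn0 wn0.
      by rewrite expr1n.
    rewrite !rmorphM -gE !rmorphXn.
    by rewrite -[LHS]mul1r -e1; ring.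
  rewrite cartier_lin cartier_i.
  have -> : w ^+ M * ((i d ^+ n)^-1 / w ^+ (c0 * n) *
     i (psi (pi ^+ (c0 * n) ^+ p * g * a))) =
     (w ^+ N * (i d)^-1) ^+ n * i (psi (pi ^+ (c0 * n) ^+ p * g * a)).
    have -> : (w ^+ N * (i d)^-1) ^+ n = w ^+ (N * n) * (i d ^+ n)^-1.
      by rewrite exprMn -exprM exprVn.
    rewrite /M mulnDl exprD.
    set D := i d ^+ n; set W := w ^+ (c0 * n); set P := i (psi _).
    by rewrite -[D^-1 / W * P]mulrA mulrACA mulVKf.
  apply: span_M; first exact: span_X.
  by apply: span_pb; apply: kpsi_pb; exact: pbM.
- by rewrite mulrDr cartierD mulrDr; apply: span_add; [exact: IHy|exact: IHz].
- have [j jn uE] : exists2 j, (j < n)%N & u = us`_j.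
    by exists (index u us); rewrite ?index_mem // nth_index.
  (* An exponent that reaches p is reset to 0; the p-th power leaves [cartier] as a single integral
     factor. *)
  pose r' (k : nat) := if k == j then (if (r j).+1 == p then 0%N else (r j).+1) else r k.
  have r'p (k : nat) : (r' k < p)%N.
    rewrite /r'; case: eqP => // _; case: eqP => // /eqP h.
    by rewrite ltn_neqAle h rp.
  pose jj := Ordinal jn.
  have monE q : mon q = us`_j ^+ q j * \prod_(k < n | k != jj) us`_k ^+ q k.
    by rewrite /mon (bigD1 jj).
  have e : \prod_(k < n | k != jj) us`_k ^+ r' k = \prod_(k < n | k != jj) us`_k ^+ r k.
    by apply: eq_bigr => k; rewrite /r' -(inj_eq val_inj) /= => /negPf ->.
  have hr' := IH _ r'p; rewrite monE e in hr'.
  rewrite monE uE; rewrite /r' eqxx in hr'; case: eqP hr' => [rj|_] hr'.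
    rewrite expr0 mul1r in hr'.
    have -> : us`_j ^+ r j * \prod_(k < n | k != jj) us`_k ^+ r k * (us`_j * z) =
      us`_j ^+ p * (\prod_(k < n | k != jj) us`_k ^+ r k * z) by rewrite -rj exprS; ring.
    by rewrite cartier_lin mulrCA; apply: span_mul => //; rewrite -uE.
  rewrite exprS in hr'.
  by have -> : us`_j ^+ r j * \prod_(k < n | k != jj) us`_k ^+ r k * (us`_j * z) =
      us`_j * us`_j ^+ r j * \prod_(k < n | k != jj) us`_k ^+ r k * z by ring.
Qed.

(** One root extraction loses M + 1. Iterating loses (M + 1)(1 + 1/p + 1/p^2 + ...), which is at
    most 2 (M + 1) as p >= 2, so the loss does not depend on k. *)
Lemma span_frob us d : adata us d -> exists M, forall h m (k : nat),
  span us (w ^+ m * h ^+ (p ^ k)) -> span us (w ^+ (M + m %/ p ^ k) * h).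
Proof.
move=> /cartier_span[M hM]; exists (M.+1 * 2)%N.
have step m h : span us (w ^+ m * h ^+ p) -> span us (w ^+ (M.+1 + m %/ p) * h).
  move=> hh; pose q := (m %/ p).+1.
  have mq : (m <= q * p)%N by rewrite ltnW // /q ltn_ceil.
  have := hM _ (span_wle mq hh).
  rewrite exprM -exprMn cartierK mulrA -exprD.
  by rewrite /q addnS addSn.
suff H (k : nat) : forall h m, span us (w ^+ m * h ^+ (p ^ k)) ->
    span us (w ^+ (M.+1 * 2 + m %/ p ^ k) * h) by move=> h m k; exact: H.
elim: k => [|k IH] h m.
  by rewrite expn0 divn1 expr1; apply: span_wle; exact: leq_addl.
rewrite expnS exprM => /IH /step; apply: span_wle.
rewrite [(p * p ^ k)%N]mulnC divnMA.
set t := (m %/ p ^ k)%N.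
have : (M.+1 * 2 + t <= M.+1 * p + t)%N by rewrite leq_add2r leq_mul2l p_gt1 orbT.
move=> /(leq_div2r p); rewrite [in X in (_ <= X)%N]divnMDl // => h1.
by move: h1; set e := (_ %/ p)%N; set e' := (_ %/ p)%N; lia.
Qed.

End Span.

Section SpanRing.
Context (K : fsplit) (us : seq (kF K)).

Definition span_pred : {pred kF K} := fun h => `[< spanK us h >].

Lemma span_predP h : reflect (spanK us h) (h \in span_pred).
Proof. exact: asboolP. Qed.

Lemma span_subring : subring_closed span_pred.
Proof.
split=> [|x y /span_predP hx /span_predP hy|x y /span_predP hx /span_predP hy].
- by apply/span_predP; exact: spanK_1.
- by apply/span_predP; exact: spanK_B.
- by apply/span_predP; exact: spanK_M.
Qed.

(** The localization as a ring of its own, so that the spectral theory applies to seminorms on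
    it. *)
Record span_ring : Type := SpanRing { sr_val : kF K; sr_valP : sr_val \in span_pred }.

HB.instance Definition _ := [isSub for sr_val].
HB.instance Definition _ := [Choice of span_ring by <:].
HB.instance Definition _ :=
  GRing.SubChoice_isSubComPzRing.Build (kF K) span_pred span_ring span_subring.

End SpanRing.

Section Uniformity.
Variable K : fsplit.
Local Notation RR := (kRR K).
Local Notation A := (kA K).
Local Notation F := (kF K).
Local Notation i := (@ki K).
Local Notation pi := (@kpi K).
Local Notation pb := (@power_bounded A).
Local Notation X := (spa pb).
Local Notation w := (i pi).
Local Notation p := (@kp K).
Implicit Types (us : seq F).

Section Gauge.
Variable us : seq F.
Local Notation B := (span_ring us).
Implicit Types y z : B.

(* The gauge seminorm of the unit ball [span us], normalized by |pi| = 1/2 *)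
Definition gauge_ub y : set RR :=
  [set r | exists m n, r = 2 ^+ m / 2 ^+ n /\ span us (w ^+ m * (sr_val y / w ^+ n))].
Definition gauge y : RR := inf (gauge_ub y).

Let two0 n : 0 < 2 ^+ n :> RR. Proof. by rewrite exprn_gt0 // ltr0n. Qed.

Let has_gauge y : has_inf (gauge_ub y).
Proof.
split; last by exists 0 => _ [m [n [-> _]]]; rewrite divr_ge0 // ltW.
have /span_predP[n hn] := sr_valP y; exists (2 ^+ n), n, 0%N.
by rewrite !expr0 !divr1.
Qed.

Let gauge_le y m n : span us (w ^+ m * (sr_val y / w ^+ n)) -> gauge y <= 2 ^+ m / 2 ^+ n.
Proof. by move=> h; apply: ge_inf; [case: (has_gauge y)|exists m, n]. Qed.

Lemma gauge_lt y e : gauge y < e -> exists m n,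
  2 ^+ m / 2 ^+ n < e /\ span us (w ^+ m * (sr_val y / w ^+ n)).
Proof.
by move=> /(inf_lt (proj1 (has_gauge y))) [_ [m [n [-> h]]] me]; exists m, n.
Qed.

Let gauge_ge0 y : 0 <= gauge y.
Proof.
apply: lb_le_inf; first by case: (has_gauge y).
by move=> _ [m [n [-> _]]]; rewrite divr_ge0 // ltW.
Qed.

Let small (e : RR) : 0 < e -> exists n, 1 / 2 ^+ n < e.
Proof.
move=> e0; exists (Num.bound (e^-1)).
rewrite div1r -[X in _ < X]invrK ltf_pV2 ?posrE ?invr_gt0 //.
apply: (lt_le_trans (archi_boundP _)); first by rewrite invr_ge0 ltW.
by rewrite -natrX ler_nat; apply/ltnW/ltn_expl.
Qed.

Let gauge_0 : gauge 0 = 0.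
Proof.
apply/le_anti; rewrite gauge_ge0 andbT; apply/ler_addgt0Pr => e /small[n hn].
rewrite add0r; apply: le_trans (ltW hn); rewrite -(expr0 2); apply: gauge_le.
by rewrite mul0r mulr0; exact: span_0.
Qed.

Let gauge_B y z : gauge (y - z) <= Num.max (gauge y) (gauge z).
Proof.
apply: le_max_lim => a b /gauge_lt[m [n [mn hy]]] /gauge_lt[m' [n' [mn' hz]]].
have [hle|hle] := leqP (m + n') (m' + n).
  rewrite le_max; apply/orP; right; apply: le_trans (ltW mn'); apply: gauge_le.
  rewrite /= mulrBl mulrBr; apply: span_B => //.
  have -> : w ^+ m' * (sr_val y / w ^+ n') =
     w ^+ (m' + n - (m + n')) * (w ^+ m * (sr_val y / w ^+ n)).
    have e : w ^+ m' * w ^+ n = w ^+ (m' + n - (m + n')) * (w ^+ m * w ^+ n').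
      by rewrite -!exprD subnK.
    have w1 := wX_neq0 K n; have w2 := wX_neq0 K n'.
    apply: (mulIf w1); rewrite [LHS](_ : _ = w ^+ m' * w ^+ n * (sr_val y / w ^+ n')); last by ring.
    by rewrite e; field; rewrite w1 w2.
  exact: span_wM.
rewrite le_max; apply/orP; left; apply: le_trans (ltW mn); apply: gauge_le.
rewrite /= mulrBl mulrBr; apply: span_B => //.
have -> : w ^+ m * (sr_val z / w ^+ n) =
   w ^+ (m + n' - (m' + n)) * (w ^+ m' * (sr_val z / w ^+ n')).
  have e : w ^+ m * w ^+ n' = w ^+ (m + n' - (m' + n)) * (w ^+ m' * w ^+ n).
    by rewrite -!exprD subnK // ltnW.
  have w1 := wX_neq0 K n; have w2 := wX_neq0 K n'.
  apply: (mulIf w2); rewrite [LHS](_ : _ = w ^+ m * w ^+ n' * (sr_val z / w ^+ n)); last by ring.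
  by rewrite e; field; rewrite w1 w2.
exact: span_wM.
Qed.

Let gauge_M y z : gauge (y * z) <= gauge y * gauge z.
Proof.
apply: le_mul_lim => // a b /gauge_lt[m [n [mn hy]]] /gauge_lt[m' [n' [mn' hz]]].
apply: (@le_trans _ _ ((2 ^+ m / 2 ^+ n) * (2 ^+ m' / 2 ^+ n'))); last first.
  by apply: ler_pM; [rewrite divr_ge0 // ltW|rewrite divr_ge0 // ltW|exact: ltW|exact: ltW].
rewrite mulf_div -!exprD; apply: gauge_le.
have -> : w ^+ (m + m') * (sr_val (y * z) / w ^+ (n + n')) =
    (w ^+ m * (sr_val y / w ^+ n)) * (w ^+ m' * (sr_val z / w ^+ n')).
  by rewrite /= !exprD; field; rewrite !wX_neq0.
exact: span_M.
Qed.

(** With |pi| = 1/2, growth of rate 2 is one factor 1 / pi per power. Radius 2 suffices because the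
    later root extraction absorbs linear growth of the exponent. *)
Lemma gauge_bound (h : B) :
  (forall g : B -> RR, mulnorm g -> (forall y, g y <= gauge y) -> g h <= 1) ->
  exists c, forall n, span us (w ^+ (c + n) * sr_val h ^+ n).
Proof.
move=> /(spectral_bound gauge_ge0 gauge_0 gauge_B gauge_M) H.
have [//|C hC] := H 2; first by rewrite ltr1n.
pose c := Num.bound `|C|.
exists c => n; have hc : C < 2 ^+ c.
  apply: le_lt_trans (ler_norm _) _; apply: (lt_le_trans (archi_boundP (normr_ge0 _))).
  by rewrite -natrX ler_nat; apply/ltnW/ltn_expl.
have : gauge (h ^+ n) < 2 ^+ (c + n).
  by apply: (le_lt_trans (hC n)); rewrite exprD ltr_pM2r.
move=> /gauge_lt[m [k [mk hh]]].
have {}mk : (m < c + n + k)%N.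
  rewrite -(@ltr_nat RR) in mk *; rewrite ltr_pdivrMr // -exprD in mk.
  by rewrite ltr_nat; move: mk; rewrite ltr_eXn2l // ltr1n.
have -> : w ^+ (c + n) * sr_val h ^+ n =
    w ^+ (c + n + k - m) * (w ^+ m * (sr_val (h ^+ n) / w ^+ k)).
  rewrite mulrA -exprD subnK; last exact: ltnW.
  have -> : sr_val (h ^+ n) = sr_val h ^+ n by elim: (n) => [|q IH] //; rewrite !exprS /= IH.
  by rewrite [w ^+ (c + n + k)]exprD -mulrA; congr (_ * _); rewrite mulrC divfK ?wX_neq0.
exact: span_wM.
Qed.

Let Bi a : i a \in span_pred us. Proof. by apply/span_predP; exact: spanK_i. Qed.
Let bi a : B := SpanRing (Bi a).

(** Being below the gauge forces values at most 1 on integral elements and on [us], and at most 1/2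
    at pi: the conditions for a point of the rational set. The denominator cannot have value 0, as
    its inverse lies in the ring. *)
Lemma mulnorm_point d (g : B -> RR) : adata us d -> mulnorm g -> (forall y, g y <= gauge y) ->
  exists2 x : X, uset us x & forall a b, x a b <-> g (bi a) <= g (bi b).
Proof.
move=> [d0 hus hd] gm gg.
have g0 : g 0 = 0.
  by apply/le_anti; rewrite (mn_ge0 gm) andbT -gauge_0.
have Ev y z : sr_val y = sr_val z -> y = z by exact: val_inj.
have gN y : g (- y) <= g y.
  by rewrite -sub0r (le_trans (mn_B gm _ _)) // g0 ge_max lexx (mn_ge0 gm).
have gD y z : g (y + z) <= Num.max (g y) (g z).
  rewrite -[z]opprK (le_trans (mn_B gm _ _)) // ge_max !le_max lexx /= opprK.
  by rewrite gN orbT.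
have biM a b : bi (a * b) = bi a * bi b by apply: Ev; rewrite /= rmorphM.
have bi1 : bi 1 = 1 by apply: Ev; rewrite /= rmorph1.
have bi0 : bi 0 = 0 by apply: Ev; rewrite /= rmorph0.
have biD a b : bi (a + b) = bi a + bi b by apply: Ev; rewrite /= rmorphD.
have le1 y : span us (sr_val y) -> g y <= 1.
  move=> hy; apply: (le_trans (gg y)); have := @gauge_le y 0 0.
  by rewrite !expr0 mul1r !divr1 => /(_ hy).
have biX a n : bi (a ^+ n) = bi a ^+ n.
  by elim: n => [|n IH]; rewrite ?expr0 // !exprS biM IH.
have gX y n : g (y ^+ n) = g y ^+ n.
  by elim: n => [|n IH]; rewrite ?expr0 ?(mn_1 gm) // !exprS (mn_M gm) IH.
have gpi : g (bi pi) <= 1 / 2.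
  apply: (le_trans (gg _)); have := @gauge_le (bi pi) 0 1.
  by rewrite expr0 expr1 mul1r => -> //=; rewrite divff ?w_neq0 //; exact: span_1.
pose R a b := g (bi a) <= g (bi b).
have [|||| x xE] := @spa_of_vrel K R.
- split=> //; rewrite /R.
  + by move=> a b _ _; case/orP: (le_total (g (bi a)) (g (bi b))); [left|right].
  + by move=> a b c _ _ _; exact: le_trans.
  + by rewrite bi0 bi1 g0 (mn_1 gm) ler10.
  + by move=> a _; rewrite bi0 g0 (mn_ge0 gm).
  + by move=> c a b _ _ _ h; rewrite !biM !(mn_M gm) ler_wpM2r // (mn_ge0 gm).
  + move=> c a b _ _ _; rewrite bi0 g0 => /negP; rewrite -ltNge => c0.
    by rewrite !biM !(mn_M gm) ler_pM2r.
  + move=> a b _ _; rewrite biD; have := gD (bi a) (bi b); rewrite le_max.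
    by case/orP; [left|right].
- by move=> a ha; rewrite /R bi1 (mn_1 gm); apply: le1; exact: span_pb.
- rewrite /R bi1 (mn_1 gm) => /le_trans /(_ gpi); lra.
- move=> b; rewrite /R bi0 g0 => /negP; rewrite -ltNge => b0.
  have [n hn] := small b0; exists n; rewrite /R biX gX; apply: le_trans (ltW hn).
  rewrite -[X in _ <= X / _](expr1n RR n) -expr_div_n lerXn2r ?nnegrE ?(mn_ge0 gm) //.
  by rewrite divr_ge0 // ler0n.
have xR a b : x a b <-> g (bi a) <= g (bi b) by rewrite xE.
exists x => // u uus.
have [a ea] := hus u uus.
have hD : (i d)^-1 \in span_pred us by apply/span_predP.
have gd0 : g (bi d) != 0.
  apply/eqP => gd; have : g (bi d * SpanRing hD) = g 1.
    by congr g; apply: Ev; rewrite /= mulfV // i_neq0.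
  by rewrite (mn_M gm) gd mul0r (mn_1 gm) => /esym/eqP; rewrite oner_eq0.
have xd : ~ x d 0.
  rewrite xR bi0 g0 => h; move/eqP: gd0; apply; apply/le_anti.
  by rewrite h (mn_ge0 gm).
rewrite ea -[X in ext _ _ X]divr1 -(rmorph1 i); apply/extE => //; first exact: x10.
rewrite mulr1 mul1r xR.
have hu : u \in span_pred us by apply/span_predP; apply: spanK_span; exact: span_u.
have -> : bi a = SpanRing hu * bi d by apply: Ev; rewrite /= ea divfK // i_neq0.
by rewrite (mn_M gm) ler_piMl ?(mn_ge0 gm) // le1 //; exact: span_u.
Qed.

(** The spectral bound makes pi^(c + n) h^n integral for all n, with c depending on h. For n = p^k >
    c the p^k-th root has exponent M + 1, where M comes from the data alone. *)
Theorem span_uniform d : adata us d -> exists N, forall h, spanK us h ->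
  (forall x, uset us x -> ext x h 1) -> span us (w ^+ N * h).
Proof.
move=> ad; have [M hM] := span_frob ad.
exists (M + 2)%N => h hh H.
have hP : h \in span_pred us by apply/span_predP.
have [|c hc] := @gauge_bound (SpanRing hP).
  move=> g gm gg; have [x xU xE] := mulnorm_point ad gm gg.
  have [a [b [e [e0 ea eb hab]]]] := H x xU.
  have ge0 : 0 < g (bi e).
    rewrite lt_neqAle (mn_ge0 gm) andbT eq_sym; apply/eqP => e'.
    by apply: e0; rewrite xE e' (mn_ge0 gm).
  have eb' : i b = i e.
    apply: (@mulIf _ (i e)^-1); first by rewrite invr_eq0 i_neq0 (xneq0 e0).
    by rewrite -eb mulfV // i_neq0 (xneq0 e0).
  have -> : g (SpanRing hP) = g (bi a) / g (bi e).
    apply: (mulIf (lt0r_neq0 ge0)); rewrite mulfVK ?lt0r_neq0 // -(mn_M gm).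
    by congr g; apply: val_inj; rewrite /= ea divfK // i_neq0 (xneq0 e0).
  rewrite ler_pdivrMr // mul1r -xE -(@ki_inj K _ _ eb') //.
pose k := c.+1.
have pk : (c < p ^ k)%N.
  apply: (@leq_trans (p ^ c)); first by rewrite ltn_expl // prime_gt1 // kp_prime.
  by rewrite leq_pexp2l // prime_gt0 // kp_prime.
have pk0 : (0 < p ^ k)%N by rewrite (leq_ltn_trans _ pk).
have := hM h _ k (hc (p ^ k)%N); apply: span_wle; rewrite leq_add2l.
by rewrite -ltnS ltn_divLR //; lia.
Qed.

End Gauge.
End Uniformity.

Lemma mem_cat1 (T : eqType) (s : seq T) v : v \in s ++ [:: v].
Proof. by rewrite mem_cat mem_seq1 eqxx orbT. Qed.

(** * Rational sets *)

Section Rational.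
Variable K : fsplit.
Local Notation A := (kA K).
Local Notation F := (kF K).
Local Notation i := (@ki K).
Local Notation pi := (@kpi K).
Local Notation pb := (@power_bounded A).
Local Notation X := (spa pb).
Local Notation w := (i pi).
Implicit Types (a b c d e f : A) (x : X) (h : F) (us vs : seq F) (U V W : set X) (m n : nat).

Definition rat U := exists us d, adata us d /\ U = uset us.

Lemma span_frac us d h : adata us d -> span us h ->
  exists a m, h = i a / i d ^+ m.
Proof.
move=> [d0 hus _]; have dm m : i d ^+ m != 0 by rewrite expf_neq0 // i_neq0.
elim=> [a _|y z _ [a [m ->]] _ [b [n ->]]|u y uus _ [a [m ->]]].
- by exists a, 0%N; rewrite expr0 divr1.
- exists (a * d ^+ n + b * d ^+ m), (m + n)%N.
  by rewrite rmorphD !rmorphM !rmorphXn exprD; field; rewrite !dm.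
- have [b ->] := hus u uus; exists (b * a), m.+1.
  by rewrite mulf_div -exprS rmorphM.
Qed.

(** A denominator bounded below on all of [U], rather than merely nonvanishing at each point, keeps
    the fraction bounded on [U]. *)
Definition FU U h := exists a b n,
  [/\ b != 0, h = i a / i b & forall x, U x -> x (pi ^+ n) b].

Lemma FU_sub U V h : V `<=` U -> FU U h -> FU V h.
Proof. by move=> VU [a [b [n [b0 e hb]]]]; exists a, b, n; split=> // x /VU /hb. Qed.

Lemma bb_neq0 x b n : x (pi ^+ n) b -> ~ x b 0.
Proof. by apply: xnz_le; exact: xpiX0. Qed.

Lemma FU_FX U h x : U x -> FU U h -> FX x h.
Proof.
move=> Ux [a [b [n [b0 -> hb]]]]; exists a, b; split=> //.
exact: bb_neq0 (hb x Ux).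
Qed.

Lemma bb_mul U b c m n : (forall x, U x -> x (pi ^+ m) b) ->
  (forall x, U x -> x (pi ^+ n) c) -> forall x, U x -> x (pi ^+ (m + n)) (b * c).
Proof. by move=> hb hc x Ux; rewrite exprD; apply: xmul2; [exact: hb|exact: hc]. Qed.

Lemma FU_B U h k : FU U h -> FU U k -> FU U (h - k).
Proof.
move=> [a [b [m [b0 -> hb]]]] [c [d [n [d0 -> hd]]]].
exists (a * d - c * b), (b * d), (m + n)%N; split; [exact: mul_neq0| |exact: bb_mul].
by rewrite rmorphB !rmorphM; field; rewrite !i_neq0 b0 d0.
Qed.

Lemma FU_M U h k : FU U h -> FU U k -> FU U (h * k).
Proof.
move=> [a [b [m [b0 -> hb]]]] [c [d [n [d0 -> hd]]]].
exists (a * c), (b * d), (m + n)%N; split; [exact: mul_neq0| |exact: bb_mul].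
by rewrite !rmorphM; field; rewrite !i_neq0 b0 d0.
Qed.

Lemma FU_i U a : FU U (i a).
Proof.
exists a, 1, 0%N; split; [exact: one_neq0|by rewrite rmorph1 divr1|].
by move=> x _; exact: xrefl.
Qed.
Lemma FU_1 U : FU U 1. Proof. by rewrite -(rmorph1 i); exact: FU_i. Qed.
Lemma FU_0 U : FU U 0. Proof. by rewrite -(rmorph0 i); exact: FU_i. Qed.
Lemma FU_D U h k : FU U h -> FU U k -> FU U (h + k).
Proof.
move=> hh kk; rewrite -[k]opprK; apply: FU_B => //; rewrite -sub0r.
by apply: FU_B => //; exact: FU_0.
Qed.
Lemma FU_X U h n : FU U h -> FU U (h ^+ n).
Proof. by move=> hh; elim: n => [|n IH]; rewrite ?expr0 ?exprS; [exact: FU_1|exact: FU_M]. Qed.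

Lemma FU_div U a b n : (forall x, U x -> x (pi ^+ n) b) -> b != 0 -> FU U (i a / i b).
Proof. by move=> hb b0; exists a, b, n. Qed.

Lemma FU_wV U n : FU U (w ^+ n)^-1.
Proof.
rewrite -div1r -(rmorph1 i) -rmorphXn; apply: (@FU_div _ _ _ n).
  by move=> x _; exact: xrefl.
by rewrite exp_neq0 // pi_neq0.
Qed.

Lemma FU_bounded U h : FU U h -> exists n, forall x, U x -> lvl x 0 (w ^+ n * h).
Proof.
move=> [a [b [m [b0 -> hb]]]]; have [n hn] := spa_bounded a.
exists (m + n)%N => x Ux; have xb := hb x Ux; rewrite /lvl expr0 mulrA -rmorphXn -rmorphM.
rewrite -[1]divr1 -(rmorph1 i) extE ?mulr1 ?mul1r; [|exact: bb_neq0 xb|exact: x10].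
by rewrite exprD -mulrA -[b]mulr1; apply: xmul2.
Qed.

Lemma FU_V U h n : h != 0 -> FU U h -> (forall x, U x -> ext x (w ^+ n) h) -> FU U h^-1.
Proof.
move=> h0 [a [b [m [b0 e hb]]]] hn.
have a0 : a != 0 by apply: contraNneq h0 => a0; rewrite e a0 rmorph0 mul0r.
rewrite e invf_div; apply: (@FU_div _ _ _ (n + m)) => // x Ux.
have xb := hb x Ux; have := hn x Ux; rewrite e -[w ^+ n]divr1 -(rmorph1 i) -rmorphXn.
rewrite extE ?mulr1; [|exact: x10|exact: bb_neq0 xb].
by apply: xtr; rewrite exprD; exact: xmull.
Qed.

Lemma adata_bb us d : adata us d -> exists n, forall x, uset us x -> x (pi ^+ n) d.
Proof.
move=> ad; have [d0 _ [n hn]] := ad; exists n => x xU.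
have xd := uset_den ad xU.
have := span_ext xU hn; rewrite -rmorphXn -[1]divr1 -(rmorph1 i) extE //; last exact: x10.
by rewrite mulr1 mul1r.
Qed.

Lemma spanK_FU us d h : adata us d -> spanK us h -> FU (uset us) h.
Proof.
move=> ad [n hn]; have [N hN] := adata_bb ad; have [d0 _ _] := ad.
have -> : h = (w ^+ n)^-1 * (w ^+ n * h) by rewrite mulKf // wX_neq0.
apply: FU_M; first exact: FU_wV.
have [a [m ->]] := span_frac ad hn; rewrite -rmorphXn.
apply: (@FU_div _ _ _ (N * m)); last exact: exp_neq0.
by move=> x Ux; rewrite exprM; apply: xexp; exact: hN.
Qed.

Lemma uset_cat us vs : uset (us ++ vs) = uset us `&` uset vs.
Proof.
apply/seteqP; split=> x /= => [h|[h1 h2] u].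
  by split=> u hu; apply: h; rewrite mem_cat hu ?orbT.
by rewrite mem_cat => /orP[/h1|/h2].
Qed.

Lemma adata_cat us vs d e : adata us d -> e != 0 ->
  (forall u, u \in vs -> exists a, u = i a / i e) -> spanK (us ++ vs) (i e)^-1 ->
  adata (us ++ vs) (d * e).
Proof.
move=> [d0 hd sd] e0 he se; split; first exact: mul_neq0.
  move=> u; rewrite mem_cat => /orP[/hd [a ->]|/he [a ->]].
    by exists (a * e); rewrite !rmorphM; field; rewrite !i_neq0 d0 e0.
  by exists (a * d); rewrite !rmorphM; field; rewrite !i_neq0 d0 e0.
rewrite rmorphM invfM; apply: spanK_M => //; apply: spanK_incl sd => u hu.
by rewrite mem_cat hu.
Qed.

Lemma rat_cap U V : rat U -> rat V -> rat (U `&` V).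
Proof.
move=> [us [d [ad ->]]] [vs [e [[e0 he se] ->]]].
exists (us ++ vs), (d * e); rewrite uset_cat; split=> //.
apply: adata_cat => //; apply: spanK_incl se => u hu.
by rewrite mem_cat hu orbT.
Qed.

(** Adjoining pi^m / b imposes nothing new where |b| >= |pi|^m, yet it makes b invertible in the
    algebraic localization. *)
Lemma adata_unit us d b m : adata us d -> b != 0 ->
  (forall x, uset us x -> x (pi ^+ m) b) ->
  let vs := us ++ [:: w ^+ m / i b] in
  [/\ adata vs (d * b), uset vs = uset us & spanK vs (i b)^-1].
Proof.
move=> ad b0 hb vs.
have sb : spanK vs (i b)^-1.
  exists m; apply: span_u; exact: mem_cat1.
split=> //.
  apply: adata_cat => // u; rewrite mem_seq1 => /eqP ->.
  by exists (pi ^+ m); rewrite rmorphXn.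
rewrite /vs uset_cat; apply/seteqP; split=> x /= => [[]//|xU].
split=> // u; rewrite mem_seq1 => /eqP ->.
rewrite -[1]divr1 -(rmorph1 i) -rmorphXn extE; [|exact: bb_neq0 (hb x xU)|exact: x10].
by rewrite mulr1 mul1r; exact: hb.
Qed.

Lemma ext_div1 x f (h : A) : ~ x h 0 -> ext x (i f / i h) 1 <-> x f h.
Proof.
move=> h0; rewrite -[X in ext _ _ X]divr1 -(rmorph1 i) extE //; last exact: x10.
by rewrite mulr1 mul1r.
Qed.

Lemma rat0 : rat set0.
Proof.
have w0 := w_neq0 K; exists [:: w^-1], pi; split.
  split; first exact: pi_neq0.
    by move=> u; rewrite mem_seq1 => /eqP ->; exists 1; rewrite rmorph1 div1r.
  by apply: spanK_span; apply: span_u; rewrite mem_seq1.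
apply/seteqP; split=> x //= /(_ w^-1); rewrite mem_seq1 eqxx => /(_ isT).
rewrite -[w^-1]mul1r -{1}(rmorph1 i) ext_div1; last exact: xpi0.
exact: xpi_lt1.
Qed.

Lemma ratT : rat setT.
Proof.
exists [::], 1; split; last by apply/seteqP; split.
split=> //; first exact: one_neq0.
by rewrite rmorph1 invr1; exact: spanK_1.
Qed.

Section Half.
Context (us : seq F) (d f h : A) (m : nat).
Hypothesis ad : adata us d.
Hypothesis h0 : h != 0.
Hypothesis hb : forall x, uset us x -> x (pi ^+ m) h.
Let vs := us ++ [:: w ^+ m / i h].

Lemma half_le : adata (vs ++ [:: i f / i h]) (d * h * h) /\
  uset (vs ++ [:: i f / i h]) = uset us `&` [set x | x f h].
Proof.
have [av vE sv] := adata_unit ad h0 hb; split.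
  apply: adata_cat => //.
    by move=> u; rewrite mem_seq1 => /eqP ->; exists f.
  by apply: spanK_incl sv => u hu; rewrite mem_cat hu.
rewrite uset_cat vE; apply/seteqP; split=> x /= [xU xf]; split=> //.
  by apply/(ext_div1 f (bb_neq0 (hb xU))); apply: xf; rewrite mem_seq1.
move=> u; rewrite mem_seq1 => /eqP ->.
by apply/(ext_div1 f (bb_neq0 (hb xU))).
Qed.

Hypothesis f0 : f != 0.

(** Since 1 / f = (h / f)(1 / h), adjoining h / f makes f a legitimate denominator as well. *)
Lemma half_ge : adata (vs ++ [:: i h / i f]) (d * h * f) /\
  uset (vs ++ [:: i h / i f]) = uset us `&` [set x | x h f].
Proof.
have [av vE sv] := adata_unit ad h0 hb.
have sf : spanK (vs ++ [:: i h / i f]) (i f)^-1.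
  rewrite [X in spanK _ X](_ : _ = (i h / i f) * (i h)^-1); last first.
    by field; rewrite !i_neq0 f0 h0.
  apply: spanK_M; last by apply: spanK_incl sv => u hu; rewrite mem_cat hu.
  by apply: spanK_span; apply: span_u; exact: mem_cat1.
have afull : adata (vs ++ [:: i h / i f]) (d * h * f).
  apply: adata_cat => // u; rewrite mem_seq1 => /eqP ->; by exists h.
split=> //.
apply/seteqP; split=> x.
  move=> xV; have xf : ~ x f 0 := xnzr (uset_den afull xV).
  move: xV; rewrite uset_cat vE => -[xU xu]; split=> //=.
  by apply/(ext_div1 h xf); apply: xu; rewrite mem_seq1.
move=> [xU hf]; rewrite uset_cat vE; split=> // u; rewrite mem_seq1 => /eqP ->.
by apply/ext_div1 => //; apply: (xnz_le (bb_neq0 (hb xU))).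
Qed.

Lemma half_eq : adata (vs ++ [:: i f / i h; i h / i f]) (d * h * (h * f)) /\
  uset (vs ++ [:: i f / i h; i h / i f]) =
  uset us `&` [set x | x f h] `&` [set x | x h f].
Proof.
have [av vE sv] := adata_unit ad h0 hb; have [ag gE] := half_ge; have [al lE] := half_le.
have sub : {subset vs ++ [:: i h / i f] <= vs ++ [:: i f / i h; i h / i f]}.
  by move=> u; rewrite !mem_cat !inE => /orP[->//|->]; rewrite !orbT.
split.
  apply: adata_cat => //; first exact: mul_neq0.
    move=> u; rewrite !inE => /orP[]/eqP->; [exists (f * f)|exists (h * h)];
      by rewrite !rmorphM; field; rewrite !i_neq0 f0 h0.
  have -> : (i (h * f))^-1 = i d * (i (d * h * f))^-1.
    by have [d0 _ _] := ad; rewrite !rmorphM; field; rewrite !i_neq0 f0 h0 d0.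
  apply: spanK_M; first exact: spanK_i.
  by case: ag => _ _; exact: spanK_incl.
have -> : uset (vs ++ [:: i f / i h; i h / i f]) =
   uset (vs ++ [:: i f / i h]) `&` uset (vs ++ [:: i h / i f]).
  apply/seteqP; split=> [x xV|x [x1 x2] u].
    split=> u hu; apply: xV; last exact: sub.
    by move: hu; rewrite !mem_cat !inE => /orP[->//|->]; rewrite orbT.
  by rewrite mem_cat !inE => /or3P[hu|hu|hu]; [apply: x1|apply: x1|apply: x2];
    rewrite mem_cat !inE hu ?orbT.
rewrite gE lE; apply/seteqP; split=> x /=; first by move=> [[? ?] [_ ?]].
by move=> [[? ?] ?].
Qed.

End Half.

Lemma rat_le U f (h : A) m : rat U -> h != 0 -> (forall x, U x -> x (pi ^+ m) h) ->
  rat (U `&` [set x | x f h]).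
Proof.
move=> [us [d [ad ->]]] h0 hb; have [a1 a2] := half_le f ad h0 hb.
by rewrite -a2; eexists; eexists; split; first exact: a1.
Qed.

Lemma rat_ge U f (h : A) m : rat U -> h != 0 -> (forall x, U x -> x (pi ^+ m) h) ->
  rat (U `&` [set x | x h f]).
Proof.
move=> [us [d [ad ->]]] h0 hb; have [f0|f0] := eqVneq f 0.
  rewrite (_ : _ `&` _ = set0); first exact: rat0.
  apply/seteqP; split=> x //= [xU]; rewrite f0; exact: bb_neq0 (hb x xU).
have [a1 a2] := half_ge ad h0 hb f0.
by rewrite -a2; eexists; eexists; split; first exact: a1.
Qed.

(** Serves to write a constant as y + u z, and so to solve for the inverse of the denominator
    contained in u. *)
Lemma span_head us u h : span (us ++ [:: u]) h ->
  exists y z, [/\ span us y, span (us ++ [:: u]) z & h = y + u * z].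
Proof.
elim=> [a ha|y1 y2 _ [z1 [t1 [hz1 ht1 ->]]] _ [z2 [t2 [hz2 ht2 ->]]]|v y].
- exists (i a), 0; split; [exact: span_pb|exact: span_0|by rewrite mulr0 addr0].
- exists (z1 + z2), (t1 + t2); split; [exact: span_add|exact: span_add|].
  by rewrite mulrDr addrACA.
- rewrite mem_cat mem_seq1 => /orP[vus|/eqP->] hy [z [t [hz ht e]]].
    exists (v * z), (v * t); split; [exact: span_mul| |by rewrite e; ring].
    by apply: span_mul => //; rewrite mem_cat vus.
  exists 0, y; split; [exact: span_0|by []|by rewrite add0r].
Qed.

(** Since u and u^-1 cancel, every monomial involves only one of them. This is the additive
    splitting of a Laurent cocycle, and it preserves integrality. *)
Lemma span_two us u h : u != 0 -> span (us ++ [:: u; u^-1]) h ->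
  exists y z, [/\ span (us ++ [:: u]) y, span (us ++ [:: u^-1]) z & h = y + z].
Proof.
move=> u0; pose E h := exists y z,
  [/\ span (us ++ [:: u]) y, span (us ++ [:: u^-1]) z & h = y + z].
rewrite -/(E h).
have ED y z : E y -> E z -> E (y + z).
  move=> [y1 [z1 [h1 k1 ->]]] [y2 [z2 [h2 k2 ->]]]; exists (y1 + y2), (z1 + z2).
  by split; [exact: span_add|exact: span_add|rewrite addrACA].
have El y : span (us ++ [:: u]) y -> E y.
  by move=> hy; exists y, 0; split=> //; [exact: span_0|rewrite addr0].
have Er y : span (us ++ [:: u^-1]) y -> E y.
  by move=> hy; exists 0, y; split=> //; [exact: span_0|rewrite add0r].
have m1 v : v \in us ++ [:: v] by rewrite mem_cat mem_seq1 eqxx orbT.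
have m2 v vs : v \in us -> v \in us ++ vs by rewrite mem_cat => ->.
have Ev v y : v \in us -> E y -> E (v * y).
  move=> vus [y1 [z1 [h1 k1 ->]]]; exists (v * y1), (v * z1); rewrite mulrDr.
  by split=> //; apply: span_mul => //; exact: m2.
have Eu1 z : span (us ++ [:: u^-1]) z -> E (u * z).
  elim=> [a ha|y1 y2 _ h1 _ h2|v y].
  - by apply: El; apply: span_mul; [exact: m1|exact: span_pb].
  - by rewrite mulrDr; exact: ED.
  - rewrite mem_cat mem_seq1 => /orP[vus|/eqP->] hy IH.
      by rewrite mulrCA; exact: Ev.
    by rewrite mulVKf //; exact: Er.
have Eu2 z : span (us ++ [:: u]) z -> E (u^-1 * z).
  elim=> [a ha|y1 y2 _ h1 _ h2|v y].
  - by apply: Er; apply: span_mul; [exact: m1|exact: span_pb].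
  - by rewrite mulrDr; exact: ED.
  - rewrite mem_cat mem_seq1 => /orP[vus|/eqP->] hy IH.
      by rewrite mulrCA; exact: Ev.
    by rewrite mulKf //; exact: El.
elim=> [a ha|y1 y2 _ h1 _ h2|v y].
- by apply: El; exact: span_pb.
- exact: ED.
- rewrite mem_cat !inE => /or3P[vus|/eqP->|/eqP->] _ Ey; first exact: Ev.
    case: Ey => [y1 [z1 [h1 k1 ->]]]; rewrite mulrDr; apply: ED; last exact: Eu1.
    by apply: El; apply: span_mul.
  case: Ey => [y1 [z1 [h1 k1 ->]]]; rewrite mulrDr; apply: ED; first exact: Eu2.
  by apply: Er; apply: span_mul.
Qed.

(* A denominator [b] bounded below on [U] is invertible in the completed
   localization: the rational set |b| <= |pi^m| of [U] is empty for large [m], so by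
   uniformity 1 is an arbitrarily small polynomial in b / pi^m. *)
Lemma span_dense us d h n : adata us d -> FU (uset us) h ->
  exists2 k, spanK us k & forall x, uset us x -> lvl x n (h - k).
Proof.
move=> ad [a [b [m [b0 -> hb]]]].
pose u := i b / w ^+ m.+1; pose vs := us ++ [:: u].
have u0 : u != 0 by rewrite mulf_neq0 ?invr_eq0 ?wX_neq0 // i_neq0.
have av : adata vs (d * pi ^+ m.+1).
  apply: adata_cat => //; first by rewrite exp_neq0 // pi_neq0.
    by move=> v; rewrite mem_seq1 => /eqP ->; exists b; rewrite rmorphXn.
  by rewrite rmorphXn; exact: spanK_w.
have [N hN] := span_uniform av.
have vs0 x : uset vs x -> False.
  rewrite uset_cat => -[xU /(_ u)]; rewrite mem_seq1 eqxx => /(_ isT).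
  rewrite /u -rmorphXn ext_div1; last exact: xpiX0.
  by move=> /(xtr (hb x xU)) /xpi_ltn; rewrite ltnn.
have [M hM] := kabs a.
(* The excess of [q] over n pays m for 1 / b and M for making a integral; one factor of pi is left
   over. *)
pose q := (n + m + M.+1)%N.
(* Over an empty set every function is bounded by 1, so uniformity applies to an arbitrarily high
   power of 1 / pi. *)
have : span vs (w ^+ N * (w ^+ (N + q))^-1).
  by apply: hN => [|x /vs0//]; exact: spanK_w.
have -> : w ^+ N * (w ^+ (N + q))^-1 = (w ^+ q)^-1.
  by rewrite exprD; field; rewrite !wX_neq0.
move=> /span_head[y [z [hy hz e]]].
have su : spanK us u.
  by apply: spanK_M; [exact: spanK_i|exact: spanK_w].
have sz : spanK us z.
  elim: hz => [c hc|y1 y2 _ h1 _ h2|v y1].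
  - exact: spanK_i.
  - exact: spanK_D.
  - rewrite mem_cat mem_seq1 => /orP[vus|/eqP->] _ h1; apply: spanK_M => //.
    by apply: spanK_span; exact: span_u.
have wq0 := wX_neq0 K q; have wm0 := wX_neq0 K m.+1; have b0' : i b != 0 by rewrite i_neq0.
have uV : (i b)^-1 = w ^+ q * y / i b + w ^+ q * (w ^+ m.+1)^-1 * z.
  have e2 : 1 = w ^+ q * y + w ^+ q * u * z.
    by rewrite -mulrA -mulrDr -e mulfV.
  by rewrite -[LHS]mul1r {1}e2 /u; field; rewrite wm0.
exists (i a * (w ^+ q * (w ^+ m.+1)^-1 * z)).
  apply: spanK_M; first exact: spanK_i.
  apply: spanK_M => //; apply: spanK_M; last exact: spanK_w.
  by apply: spanK_span; exact: span_w.
move=> x xU; rewrite -mulrBr {1}uV addrK.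
have xb : ~ x b 0 := bb_neq0 (hb x xU).
have -> : i a * (w ^+ q * y / i b) = w ^+ n * ((i (pi ^+ M * a)) * (w ^+ m / i b) * (w * y)).
  by rewrite /q addnS exprS !exprD rmorphM rmorphXn; ring.
rewrite -[n in lvl _ n _]addn0 lvl_wM -(addn0 0%N); apply: lvl_M; last first.
  rewrite -[0%N](addn0 0%N); apply: lvl_M; first by rewrite -(expr1 w) -[w ^+ 1]mulr1 -(addn0 0%N); apply: lvl_M; [apply/lvl_w|rewrite /lvl expr0; apply: extR; exact: F1].
  by rewrite /lvl expr0; exact: span_ext hy.
rewrite -(addn0 0%N); apply: lvl_M; first exact: lvl_pb.
rewrite /lvl expr0 -rmorphXn ext_div1 //; exact: hb.
Qed.

(* [c] is a family of sequences in [F] indexed by the points *)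
Definition lev U n (c : X -> nat -> F) :=
  forall x, U x -> exists N, forall k, (N <= k)%N -> lvl x n (c x k).

(** At each level one fraction must serve on all of [U]: the family belongs to the completion of the
    fractions on [U] for the supremum seminorm. *)
Definition appr (c : X -> nat -> F) U :=
  forall n, exists2 h, FU U h & lev U n (fun x k => c x k - h).

Lemma lev_sub U V n (c : X -> nat -> F) : V `<=` U -> lev U n c -> lev V n c.
Proof. by move=> VU hc x /VU; exact: hc. Qed.

Lemma appr_sub U V (c : X -> nat -> F) : V `<=` U -> appr c U -> appr c V.
Proof.
by move=> VU hc n; have [h hh hl] := hc n; exists h;
  [exact: FU_sub hh|exact: lev_sub hl].
Qed.

Lemma lvl_lev U n (h k : F) (c : X -> nat -> F) : (forall x, U x -> lvl x n (h - k)) ->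
  lev U n (fun x q => c x q - h) -> lev U n (fun x q => c x q - k).
Proof.
move=> hk hc x Ux; have [N hN] := hc x Ux; exists N => q Nq.
have -> : c x q - k = (c x q - h) + (h - k) by ring.
by apply: lvl_D; [exact: hN|exact: hk].
Qed.

Lemma lev_lvl U n (h k : F) (c : X -> nat -> F) : lev U n (fun x q => c x q - h) ->
  lev U n (fun x q => c x q - k) -> forall x, U x -> lvl x n (h - k).
Proof.
move=> hh hk x Ux; have [N hN] := hh x Ux; have [M hM] := hk x Ux.
have -> : h - k = (c x (N + M)%N - k) - (c x (N + M)%N - h) by ring.
by apply: lvl_B; [apply: hM; exact: leq_addl|apply: hN; exact: leq_addr].
Qed.

(* Gluing for a Laurent cover: uniformity of the intersection lets one split the
   difference of two approximations into a part for each of the two sets. *)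
Lemma appr_laurent U f (h : A) m (c : X -> nat -> F) : rat U -> h != 0 -> (forall x, U x -> x (pi ^+ m) h) ->
  appr c (U `&` [set x | x f h]) -> appr c (U `&` [set x | x h f]) -> appr c U.
Proof.
move=> [us [d [ad ->]]] h0 hb ale age.
have [f0|f0] := eqVneq f 0.
  apply: appr_sub ale => x xU; split=> //=; rewrite f0; exact: x00.
have [al lE] := half_le f ad h0 hb; have [ag gE] := half_ge ad h0 hb f0.
have [ae eE] := half_eq ad h0 hb f0; have [av vE sv] := adata_unit ad h0 hb.
set vs := us ++ [:: w ^+ m / i h] in al lE ag gE ae eE av vE sv.
set u := i f / i h in al lE ae eE; have uV : i h / i f = u^-1 by rewrite invf_div.
rewrite uV in ag gE ae eE.
have u0 : u != 0 by rewrite mulf_neq0 ?invr_eq0 ?i_neq0.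
have [N hN] := span_uniform ae.
(* Approximating to level n + N leaves room for the loss [N] of uniformity on the overlap. *)
move=> n; have [k1 k1F k1a] := ale (n + N)%N; have [k2 k2F k2a] := age (n + N)%N.
rewrite -lE in k1F k1a; rewrite -gE in k2F k2a.
have [y1 y1s y1l] := span_dense (n + N) al k1F.
have [y2 y2s y2l] := span_dense (n + N) ag k2F.
have {k1F k1a y1l} y1a := lvl_lev y1l k1a.
have {k2F k2a y2l} y2a := lvl_lev y2l k2a.
set Ve := uset (vs ++ [:: u; u^-1]) in hN.
have sub1 : Ve `<=` uset (vs ++ [:: u]) by rewrite /Ve eE lE => x [].
have sub2 : Ve `<=` uset (vs ++ [:: u^-1]) by rewrite /Ve eE gE => x [[? _] ?].
have sKK : spanK (vs ++ [:: u; u^-1]) ((w ^+ (n + N))^-1 * (y1 - y2)).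
  apply: spanK_M; first exact: spanK_w.
  apply: spanK_B; [apply: spanK_incl y1s|apply: spanK_incl y2s] => v;
    rewrite !mem_cat !inE => /orP[] ->; rewrite ?orbT //.
have /(hN _ sKK) : forall x, Ve x -> ext x ((w ^+ (n + N))^-1 * (y1 - y2)) 1.
  move=> x xV; rewrite -(expr0 w) -/(lvl x 0 _).
  rewrite -(lvl_wM _ (n + N) 0) mulVKf ?wX_neq0 // addn0.
  exact: (lev_lvl (lev_sub sub1 y1a) (lev_sub sub2 y2a)).
have -> : w ^+ N * ((w ^+ (n + N))^-1 * (y1 - y2)) = (y1 - y2) / w ^+ n.
  by rewrite exprD; field; rewrite !wX_neq0.
move=> /(span_two u0)[e1 [e2 [he1 he2 e]]].
have sub3 : {subset vs ++ [:: u] <= vs ++ [:: u; u^-1]}.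
  by move=> v; rewrite !mem_cat !inE => /orP[->//|->]; rewrite orbT.
(* The two corrected approximations are the same fraction, which therefore serves on both halves. *)
have yE : y1 - w ^+ n * e1 = y2 + w ^+ n * e2.
  have : w ^+ n * (e1 + e2) = y1 - y2 by rewrite -e mulrC divfK ?wX_neq0.
  by move=> e3; rewrite -[y1](subrK y2) -e3; ring.
(* On the whole set u = f / h is available, because 1 / h is; this is why the expression in y1 and
   e1 is the one retained. *)
have uvs : spanK vs u by apply: spanK_M => //; exact: spanK_i.
have toV z : spanK (vs ++ [:: u]) z -> spanK vs z.
  move=> [q hq]; rewrite -(mulKf (wX_neq0 K q) z).
  apply: spanK_M; first exact: spanK_w.
  elim: hq => [b hb'|z1 z2 _ h1 _ h2|v z1]; [exact: spanK_i|exact: spanK_D|].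
  rewrite mem_cat mem_seq1 => /orP[vus|/eqP->] _ h1; apply: spanK_M => //.
  by apply: spanK_span; exact: span_u.
exists (y1 - w ^+ n * e1).
  rewrite -vE; apply: (spanK_FU av); apply: toV; apply: spanK_B => //.
  by apply: spanK_span; exact: span_wM.
have le_n x q : lvl x (n + N) q -> lvl x n q by apply: lvl_le; exact: leq_addr.
move=> x xU; have [xf|xf] : x f h \/ x h f by exact: (vr_tot (spa_vrel x)).
  have xV : uset (vs ++ [:: u]) x by rewrite lE.
  have [q hq] := y1a x xV; exists q => r /hq hr.
  have -> : c x r - (y1 - w ^+ n * e1) = (c x r - y1) + w ^+ n * e1 by ring.
  by apply: lvl_D; [exact: le_n|exact: span_lvl he1].
have xV : uset (vs ++ [:: u^-1]) x by rewrite gE.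
have [q hq] := y2a x xV; exists q => r /hq hr; rewrite yE.
have -> : c x r - (y2 + w ^+ n * e2) = (c x r - y2) - w ^+ n * e2 by ring.
by apply: lvl_B; [exact: le_n|exact: span_lvl he2].
Qed.

End Rational.

(** * Neighbourhoods in the adic spectrum *)

Section SpaTopology.
Context (A : topComRingType) (Ap : set A).

Lemma spa_nbhs (W : set (spa Ap)) x : open W -> W x -> exists l : seq (A * A),
  (forall q, q \in l -> x q.1 q.2 /\ ~ x q.2 0) /\
  forall y : spa Ap, (forall q, q \in l -> y q.1 q.2 /\ ~ y q.2 0) -> W y.
Proof.
move=> [D hD <-] [B /[dup] DB /hD [E hE EB] xB].
have /choice[fg fgE] : forall Z : set (spa Ap), exists q : A * A, Z \in E ->
    Z = rational_set [:: q.1] q.2.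
  move=> Z; have [ZE|ZE] := boolP (Z \in E); last by exists (0, 0).
  by have := hE _ ZE; rewrite inE => -[f [g e]]; exists (f, g).
have ratE (y : spa Ap) q : rational_set [:: q.1] q.2 y <-> y q.1 q.2 /\ ~ y q.2 0.
  split=> [[h1 h2]|[h1 h2]]; split=> //; first by apply: h1; rewrite mem_seq1.
  by move=> f; rewrite mem_seq1 => /eqP ->.
exists [seq fg Z | Z <- enum_fset E]; split.
  move=> q /mapP[Z ZE ->]; apply/ratE; rewrite -fgE //.
  by move: xB; rewrite -EB; apply.
move=> y hy; suff By : B y by exists B.
rewrite -EB => Z ZE; change (Z y).
by rewrite (fgE Z ZE); apply/ratE; apply: hy; apply/mapP; exists Z.
Qed.

Lemma open_rational1 (f g : A) : open (rational_set [:: f] g : set (spa Ap)).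
Proof.
exists [set rational_set [:: f] g : set (spa Ap)]; last by rewrite bigcup_set1.
move=> _ ->; exists [fset (rational_set [:: f] g : set (spa Ap))]%fset.
  by move=> Z /fset1P ->; rewrite inE; exists f, g.
by rewrite set_fset1 bigcap_set1.
Qed.

Lemma open_rational (fs : seq A) (g : A) : open (rational_set fs g : set (spa Ap)).
Proof.
(* The element 0 is added to the list so that the condition |g| <> 0 remains when [fs] is empty. *)
suff -> : rational_set fs g = \big[setI/setT]_(f <- 0 :: fs)
    (rational_set [:: f] g : set (spa Ap)).
  by apply: big_ind => [|U V|f _]; [exact: openT|exact: openI|exact: open_rational1].
have e (x : spa Ap) gs : ~ x g 0 -> (\big[setI/setT]_(f <- gs)
    (rational_set [:: f] g : set (spa Ap))) x <-> forall f, f \in gs -> x f g.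
  move=> xg; elim: gs => [|f gs IH]; first by rewrite big_nil.
  rewrite big_cons; split.
    move=> [[h1 _] /IH h2] f'; rewrite inE => /orP[/eqP->|/h2//].
    by apply: h1; rewrite mem_seq1.
  move=> h; split; last by apply/IH => f' f's; apply: h; rewrite inE f's orbT.
  split=> // f'; rewrite mem_seq1 => /eqP ->; apply: h; exact: mem_head.
have x0 (x : spa Ap) f : x 0 f.
  case: x => x [_ [Gam [v [[v0 _ _ _] _ vx]]]] /=; apply/vx; rewrite v0; exact: og_le0.
apply/seteqP; split=> x.
  move=> [h1 h2]; apply/e => // f; rewrite inE => /orP[/eqP->|/h1//]; exact: x0.
move=> h; have h2 : ~ x g 0 by move: h; rewrite big_cons => -[[]].
by split=> // f ffs; move/(e _ _ h2): h; apply; rewrite inE ffs orbT.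
Qed.

Lemma open_idealT (fs : seq A) f u : f \in fs -> f * u = 1 -> open_ideal fs.
Proof.
move=> ffs fu; rewrite /open_ideal (_ : ideal_pow _ _ _ = setT); first exact: openT.
apply/seteqP; split=> // x _; rewrite /=.
have fi : (index f fs < size fs)%N by rewrite index_mem.
exists (fun j => if j == index f fs then u * x else 0) => //.
rewrite (bigD1 (Ordinal fi)) //= eqxx nth_index // mulrA fu mul1r big1 ?addr0 //.
move=> j; rewrite -(inj_eq val_inj) /= => /negPf ->; exact: mulr0.
Qed.

End SpaTopology.

(** * Rational covers, quasi-compactness and locality of approximation *)

Section Covers.
Variable K : fsplit.
Local Notation A := (kA K).
Local Notation F := (kF K).
Local Notation i := (@ki K).
Local Notation pi := (@kpi K).
Local Notation pb := (@power_bounded A).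
Local Notation X := (spa pb).
Local Notation w := (i pi).
Implicit Types (a b c d e f g : A) (x y : X) (us vs : seq F) (U V W : set X) (m n : nat).

Lemma open_ideal_pi (fs : seq A) : open_ideal fs ->
  exists (n : nat) (c : nat -> A), pi ^+ n = \sum_(j < size fs) fs`_j * c j.
Proof.
move=> op; have : nbhs (0 : A) (ideal_pow setT fs 1).
  apply: open_nbhs_nbhs; split=> //; exists (fun=> 0) => //.
  by rewrite big1 // => j _; rewrite mulr0.
move=> /knbhs[n /(_ 1 (@pb1 K))]; rewrite mulr1 => -[c _ e].
by exists n, c.
Qed.

Lemma adata_rational (fs : seq A) g : open_ideal fs -> g != 0 ->
  adata [seq i f / i g | f <- fs] g /\
  uset [seq i f / i g | f <- fs] = rational_set fs g.
Proof.
move=> op g0; have [n [c e]] := open_ideal_pi op.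
have ad : adata [seq i f / i g | f <- fs] g.
  split=> //; first by move=> u /mapP[f _ ->]; exists f.
  rewrite [X in spanK _ X](_ : _ =
      (w ^+ n)^-1 * \sum_(j < size fs) (i fs`_j / i g) * i (c j)); last first.
    rewrite (_ : \sum_(j < _) _ = w ^+ n / i g); first by rewrite mulKf // wX_neq0.
    rewrite -rmorphXn e rmorph_sum mulr_suml; apply: eq_bigr => j _.
    by rewrite rmorphM mulrAC.
  apply: spanK_M; first exact: spanK_w.
  apply: big_ind => [|h k|j _]; [exact: spanK_0|exact: spanK_D|].
  apply: spanK_M; last exact: spanK_i.
  by apply: spanK_span; apply: span_u; apply/mapP; exists fs`_j => //; exact: mem_nth.
split=> //; apply/seteqP; split=> x.
  move=> xU; have xg := uset_den ad xU; split=> // f ffs.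
  by apply/(ext_div1 f xg); apply: xU; apply/mapP; exists f.
by move=> [h xg] u /mapP[f ffs ->]; apply/ext_div1 => //; exact: h.
Qed.

Lemma rational0 (fs : seq A) : rational_set fs 0 = set0 :> set X.
Proof. by apply/seteqP; split=> x //= [_]; apply; exact: xrefl. Qed.

Lemma rational_rat U : rational_subset U -> rat U.
Proof.
move=> [fs [g [op ->]]]; have [->|g0] := eqVneq g 0.
  by rewrite rational0; exact: rat0.
by have [ad e] := adata_rational op g0; exists [seq i f / i g | f <- fs], g.
Qed.

(** Index 0 is the denominator. A power of pi lying below it is listed among the numerators; this
    does not change the set, and it makes the numerators generate the unit ideal. *)
Lemma rat_repr U : rat U -> exists (f : nat -> A) m M,
  [/\ f 0%N != 0, forall j, (m < j)%N -> f j = 0,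
      (exists2 j, (j <= m)%N & f j = pi ^+ M)
    & U = [set x | (forall j, x (f j) (f 0%N)) /\ ~ x (f 0%N) 0]].
Proof.
move=> [us [d [ad ->]]]; have [M hM] := adata_bb ad; have [d0 hus _] := ad.
have /choice[nu nuE] : forall u, exists a, u \in us -> u = i a / i d.
  move=> u; have [/hus[a e]|_] := boolP (u \in us); last by exists 0.
  by exists a.
pose s := [:: d, pi ^+ M & [seq nu u | u <- us]].
exists (fun j => s`_j), (size us).+1, M; split=> //.
- by move=> j hj; rewrite nth_default //= size_map.
- by exists 1%N.
apply/seteqP; split=> x.
  move=> xU; have xd := uset_den ad xU; split=> // -[|[|j]] /=; first exact: xrefl.
    exact: hM.
  have [js|js] := ltnP j (size us); last by rewrite nth_default ?size_map //; exact: x00.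
  rewrite (nth_map 0) //; have uj := mem_nth 0 js.
  by apply/(ext_div1 (nu us`_j) xd); rewrite -nuE //; exact: xU.
move=> [h xd] u uus; rewrite (nuE u uus); apply/ext_div1 => //.
have := h (index u us).+2; rewrite /= (nth_map 0) ?index_mem //.
by rewrite nth_index.
Qed.

Lemma rat_rational U : rat U -> rational_subset U.
Proof.
move=> hU; have [f [m [M [f0 fm [j jm fj] ->]]]] := rat_repr hU.
exists [seq f j | j <- iota 0 m.+1], (f 0%N); split.
  apply: (@open_idealT _ _ (pi ^+ M) (kpi' K ^+ M)).
    by apply/mapP; exists j => //; rewrite mem_iota add0n ltnS.
  by rewrite -exprMn kpiV expr1n.
apply/seteqP; split=> x [h1 h2]; split=> //.
  by move=> _ /mapP[k _ ->]; exact: h1.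
move=> k; have [km|/fm ->] := leqP k m; last exact: x00.
by apply: h1; apply/mapP; exists k => //; rewrite mem_iota add0n ltnS.
Qed.

Lemma rat_open U : rat U -> open U.
Proof. by move=> /rat_rational[fs [g [_ ->]]]; exact: open_rational. Qed.

(** A condition |a| <= |b| with b nonzero at [x] becomes rational after first imposing |b| >=
    |pi|^n, with n taken from the value of b at [x]. *)
Lemma rat_basis W x : open W -> W x -> exists U, [/\ rat U, U x & U `<=` W].
Proof.
move=> oW Wx; have [l [xl lW]] := spa_nbhs oW Wx.
suff [U [rU Ux Ul]] : exists U, [/\ rat U, U x
    & forall y, U y -> forall q, q \in l -> y q.1 q.2 /\ ~ y q.2 0].
  by exists U; split=> // y /Ul /lW.
elim: l xl {lW} => [|q l IH] xl; first by exists setT; split=> //; exact: ratT.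
have [|U [rU Ux Ul]] := IH; first by move=> r rl; apply: xl; rewrite inE rl orbT.
have [xq xq0] := xl q (mem_head _ _); have [n hn] := spa_bounded_below xq0.
have rV : rat (U `&` [set y | y (pi ^+ n) q.2]).
  apply: (@rat_ge K U _ _ n) => //; first by rewrite exp_neq0 // pi_neq0.
  by move=> y _; exact: xrefl.
have rW : rat (U `&` [set y | y (pi ^+ n) q.2] `&` [set y | y q.1 q.2]).
  by apply: (@rat_le K _ _ _ n) => //; [exact: xneq0 xq0|move=> y []].
exists (U `&` [set y | y (pi ^+ n) q.2] `&` [set y | y q.1 q.2]); split=> //.
move=> y [[Uy yn] y1] r; rewrite inE => /orP[/eqP->|/(Ul y Uy)//].
by split=> //; exact: bb_neq0 yn.
Qed.

(* Quasi-compactness: an ultrafilter of points defines a valuation relation, which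
   becomes continuous once the elements smaller than all powers of [pi] are
   declared to be zero. *)
Lemma rat_compact U (S : set (set X)) : rat U -> (forall V, S V -> rat V) ->
  (forall x, U x -> exists2 V, S V & V x) ->
  exists l : seq (set X), (forall V, V \in l -> S V) /\
    forall x, U x -> exists2 V, V \in l & V x.
Proof.
move=> rU rS cov; apply: contrapT => nfin.
(* The filter generated by U and the complements of members of S; it is proper because there is no
   finite subcover. *)
pose G : set_system X := [set Z | exists l : seq (set X), (forall V, V \in l -> S V) /\
    forall x, U x -> (forall V, V \in l -> ~ V x) -> Z x].
have PG : ProperFilter G.
  apply: Build_ProperFilter_ex.
    move=> Z [l [lS lZ]]; apply: contrapT => nZ; apply: nfin; exists l; split=> // x Ux.
    apply: contrapT => nV; apply: nZ; exists x; apply: lZ => // V Vl Vx.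
    by apply: nV; exists V.
  split.
  - by exists nil.
  - move=> P Q [l [lS lP]] [l' [lS' lQ]]; exists (l ++ l'); split.
      by move=> V; rewrite mem_cat => /orP[/lS|/lS'].
    by move=> x Ux h; split; [apply: lP|apply: lQ] => // V Vl; apply: h;
      rewrite mem_cat Vl ?orbT.
  - by move=> P Q PQ [l [lS lP]]; exists l; split=> // x Ux h; apply: PQ; exact: lP.
have [H [UH GH]] := ultraFilterLemma PG.
have FH : ProperFilter H by exact: ultra_proper.
have HU : H U by apply: GH; exists nil; split.
have HV V : S V -> H (~` V).
  by move=> SV; apply: GH; exists [:: V]; split=> [W|x _ h]; [rewrite mem_seq1 => /eqP->|apply: h; rewrite mem_seq1].
have Hno V : S V -> ~ H V.
  by move=> SV hV; have [x [xV]] := filter_ex (filterI hV (HV V SV)); exact.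
pose R0 a b := H [set x : X | x a b].
have R0all a b : (forall x : X, x a b) -> R0 a b by move=> h; apply: filterS (@filterT _ H _) => x _; exact: h.
have R0mp a b c d : (forall x : X, x a b -> x c d) -> R0 a b -> R0 c d.
  by move=> h; apply: filterS => x; exact: h.
have R0mp2 a b c d e f : (forall x : X, x a b -> x c d -> x e f) -> R0 a b -> R0 c d -> R0 e f.
  by move=> h h1 h2; apply: filterS (filterI h1 h2) => x [? ?]; exact: h.
have R0tr b a c : R0 a b -> R0 b c -> R0 a c by apply: R0mp2 => x; exact: xtr.
have R0n a b : ~ R0 a b -> H [set x : X | ~ x a b].
  by move=> h; have [//|] := in_ultra_setVsetC [set x : X | x a b] UH.
have R0f a b : (forall x : X, ~ x a b) -> ~ R0 a b.
  by move=> h h'; have [x /h] := filter_ex h'.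
have R0nle a b : ~ R0 a b -> R0 b a by move=> /R0n; apply: filterS => x; exact: xnle.
have R0pi m n : R0 (pi ^+ m) (pi ^+ n) -> (n <= m)%N.
  by move=> h; have [x /xpi_ltn] := filter_ex h.
(* The elements that lie below every power of pi along the ultrafilter; they form the support of the
   limit point. *)
pose inf a := forall n, R0 a (pi ^+ n).
pose R a b := R0 a b \/ inf a.
have inf_le a b : R0 a b -> inf b -> inf a by move=> ab hb n; exact: R0tr ab (hb n).
have inf0 a : R0 a 0 -> inf a by move=> a0 n; apply: R0tr a0 _; apply: R0all => x; exact: x00.
have ninf a : ~ inf a -> exists n, R0 (pi ^+ n) a.
  by move=> /existsNP[n /R0nle]; exists n.
have bnd a : exists n, R0 (pi ^+ n * a) 1.
  by have [n hn] := spa_bounded a; exists n; exact: R0all.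
have infM a b : inf a -> inf (a * b).
  move=> ha n; have [m hm] := bnd b.
  apply: R0mp2 (ha (n + m)%N) hm => x h1 h2; apply: xtr (xmul b h1) _.
  by rewrite exprD -mulrA -[X in _ _ X]mulr1; exact: xmull.
have R0can a b c : (exists n, R0 (pi ^+ n) c) -> R0 (a * c) (b * c) -> R0 a b.
  by move=> [n hn]; apply: R0mp2 hn => x h; apply: xcan; exact: bb_neq0 h.
have Rz b : R b 0 <-> inf b by split=> [[/inf0|]|]//; right.
have vR : vrel setT R.
  split=> //.
  - move=> a b _ _; have [ab|/R0nle ba] := pselect (R0 a b); [by left; left|by right; left].
  - move=> b a c _ _ _ [ab|ha] [bc|hb]; [left; exact: R0tr ab bc|right|by right..].
    exact: inf_le ab hb.
  - move=> /Rz /(_ 1%N); rewrite -(expr0 pi) => /R0pi; by [].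
  - by move=> a _; left; apply: R0all => x; exact: x00.
  - move=> c a b _ _ _ [ab|ha]; last by right; exact: infM.
    by left; apply: R0mp ab => x; exact: xmul.
  - move=> c a b _ _ _ /Rz /ninf hc [ab|ha]; first by left; exact: R0can ab.
    right => n; have [m hm] := hc; apply: R0mp2 hm (ha (n + m)%N) => x h1 h2.
    apply: (@xcan _ _ (pi ^+ m)); first exact: xpiX0.
    by rewrite -exprD; apply: xtr h2; exact: xmull.
  - move=> a b _ _; have [ab|/R0nle ba] := pselect (R0 a b).
      by right; left; apply: R0mp ab => x h; apply: xD => //; exact: xrefl.
    by left; left; apply: R0mp ba => x h; apply: xD => //; exact: xrefl.
have [||| y yE] := spa_of_vrel vR.
- by move=> a ha; left; apply: R0all => x; exact: spa_pb.
- move=> [|/(_ 1%N)]; first by apply: R0f => x; exact: xpi_lt1.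
  by rewrite expr1; apply: R0f => x; exact: xpi_lt1.
- by move=> b; rewrite Rz => /ninf[n hn]; exists n; left.
have yR a b : y a b <-> R a b by rewrite yE.
have Rinf a b : R a b -> ~ inf b -> R0 a b.
  move=> [//|ha] /ninf[n hn]; exact: R0tr (ha n) hn.
have [V SV Vy] : exists2 V, S V & V y.
  apply: cov; have [us [d [ad UE]]] := rU; have [n hn] := adata_bb ad.
  have hd : R0 (pi ^+ n) d by apply: filterS HU => x; rewrite UE => /hn.
  have dinf : ~ inf d by move=> /(_ n.+1) /(R0tr _ _ _ hd) /R0pi; rewrite ltnn.
  have yd : ~ y d 0 by rewrite yR Rz.
  rewrite UE => u uus; have [_ hus _] := ad; have [a ua] := hus u uus.
  rewrite ua; apply/(ext_div1 a yd); rewrite yR; left.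
  apply: filterS HU => x; rewrite UE => xU; apply/(ext_div1 a (uset_den ad xU)).
  by rewrite -ua; exact: xU.
(* The limit point lies in some V of the cover. Its finitely many inequalities, with a denominator
   bounded below, then hold along the ultrafilter, although the ultrafilter contains the complement
   of V. *)
apply: (Hno V SV); have [us [d [ad VE]]] := rS V SV; rewrite VE in Vy *.
have yd := uset_den ad Vy; have dinf : ~ inf d by rewrite -Rz -yR.
have [n hn] := ninf d dinf; have [_ hus _] := ad.
have hu u : u \in us -> H [set x : X | ext x u 1].
  move=> uus; have [a ua] := hus u uus.
  have : R0 a d by apply: Rinf => //; rewrite -yR; apply/(ext_div1 a yd); rewrite -ua; exact: Vy.
  move=> h; apply: filterS (filterI h hn) => x [xa xn] /=.
  by rewrite ua; apply/ext_div1 => //; exact: bb_neq0 xn.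
have -> : uset us = \big[setI/setT]_(u <- us) [set x : X | ext x u 1].
  elim: (us) => [|v vs IH]; first by rewrite big_nil; apply/seteqP; split.
  rewrite big_cons -IH; apply/seteqP; split=> x /= h.
    by split=> [|u us']; apply: h; rewrite inE ?eqxx // us' orbT.
  by case: h => h1 h2 u; rewrite inE => /orP[/eqP->|/h2].
rewrite big_seq; apply: big_ind => [|P Q|u]; [exact: filterT|exact: filterI|exact: hu].
Qed.

Lemma max_list (T : eqType) (R : T -> T -> Prop) (s : seq T) :
  (forall u t v, R t u -> R u v -> R t v) -> (forall t, R t t) ->
  {in s &, forall t u, R t u \/ R u t} -> s != [::] ->
  exists2 t, t \in s & forall u, u \in s -> R u t.
Proof.
move=> tr rf; elim: s => [//|a s IH] tot _.
have [->|s0] := eqVneq s [::].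
  by exists a => [|u]; rewrite mem_seq1 // => /eqP ->.
have [|m ms hm] := IH _ s0.
  by move=> t u ts us; apply: tot; rewrite inE ?ts ?us orbT.
have [am|ma] : R a m \/ R m a by apply: tot; rewrite inE ?eqxx ?ms ?orbT.
  by exists m => [|u]; rewrite inE ?ms ?orbT // => /orP[/eqP->|/hm].
exists a => [|u]; rewrite inE ?eqxx // => /orP[/eqP->//|/hm um]; exact: tr ma.
Qed.

Section Splitting.
Variable c : X -> nat -> F.

(** Laurent gluing is used twice for each pair: for |h| against |pi|^M and then, where h is bounded
    below, for |f| against |h|. What remains are pieces on which every comparison is decided. *)
Lemma appr_split (L : seq (A * A)) M U : rat U ->
  (forall Z, rat Z -> Z `<=` U -> (forall q, q \in L ->
     [\/ Z `<=` [set x | x q.1 q.2], Z `<=` [set x | x q.2 q.1]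
       | Z `<=` [set x | x q.2 (pi ^+ M)]]) -> appr c Z) -> appr c U.
Proof.
elim: L U => [|[f h] L IH] U rU H; first by apply: H.
have piM0 : pi ^+ M != 0 by rewrite exp_neq0 // pi_neq0.
have piMb : forall x, U x -> x (pi ^+ M) (pi ^+ M) by move=> x _; exact: xrefl.
have rle := rat_le h rU piM0 piMb; have rge := rat_ge h rU piM0 piMb.
have step Z0 : rat Z0 -> Z0 `<=` U ->
    [\/ Z0 `<=` [set x | x f h], Z0 `<=` [set x | x h f]
      | Z0 `<=` [set x | x h (pi ^+ M)]] -> appr c Z0.
  move=> rZ0 Z0U d; apply: IH => // Z rZ ZZ0 hZ; apply: H => //.
    by move=> x /ZZ0 /Z0U.
  move=> q; rewrite inE => /orP[/eqP->|/hZ//] /=.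
  by case: d => d; [apply: Or31|apply: Or32|apply: Or33] => x /ZZ0 /d.
apply: (appr_laurent rU piM0 piMb (f := h)).
  by apply: step; [exact: rle|move=> x []|apply: Or33 => x []].
have [h0|h0] := eqVneq h 0.
  apply: step; [exact: rge|by move=> x []|].
  by apply: Or33 => x _; rewrite /= h0; exact: x00.
have hb x : (U `&` [set x | x (pi ^+ M) h]) x -> x (pi ^+ M) h by case.
apply: (appr_laurent rge h0 hb (f := f)); apply: step.
- exact: rat_le hb.
- by move=> x [[]].
- by apply: Or31 => x [].
- exact: rat_ge hb.
- by move=> x [[]].
- by apply: Or32 => x [].
Qed.

(** On a decided piece the generators that are not uniformly small are totally ordered by size, and
    the largest of them also dominates the small ones. The piece thus lies in one member of the
    standard cover. *)
Lemma appr_standard (H : seq A) M U : rat U ->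
  (forall x, U x -> exists2 h, h \in H & x (pi ^+ M) h) ->
  (forall h, h \in H -> appr c (U `&` [set x | forall h', h' \in H -> x h' h])) ->
  appr c U.
Proof.
move=> rU cov H1; pose L := [seq (f, h) | f <- H, h <- H].
(* The threshold M + 1 ensures that a generator with |h| >= |pi|^M at some point is not discarded as
   small. *)
apply: (@appr_split L M.+1) => // Z rZ ZU dec.
have [[z0 Zz0]|Z0] := pselect (exists z, Z z); last first.
  by move=> n; exists 0; [exact: FU_0|move=> x Zx; case: Z0; exists x].
pose big h := `[< ~ (Z `<=` [set x | x h (pi ^+ M.+1)]) >].
have bigP x h : Z x -> x (pi ^+ M) h -> big h.
  move=> Zx xh; apply/asboolP => /(_ x Zx) /= h'.
  by have := xpi_ltn (xtr xh h'); rewrite ltnn.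
pose H' := [seq h <- H | big h].
have H'0 : H' != [::].
  have [h hH xh] := cov z0 (ZU z0 Zz0).
  have : h \in H' by rewrite mem_filter hH (bigP z0).
  by case: (H').
have [] := @max_list A (fun f h => Z `<=` [set x | x f h]) H' _ _ _ H'0.
- by move=> g f h fg gh x Zx; exact: xtr (fg x Zx) (gh x Zx).
- by move=> h x _; exact: xrefl.
- move=> f h; rewrite !mem_filter => /andP[/asboolP fb fH] /andP[/asboolP hb hH].
  have Lfh : (f, h) \in L by apply/allpairsP; exists (f, h).
  by case: (dec _ Lfh) => d; [left|right|case: hb].
move=> m; rewrite mem_filter => /andP[mb mH] hm.
apply: appr_sub (H1 m mH) => x Zx; split=> [|h hH]; first exact: ZU.
have [hb|/asboolPn/contrapT/(_ x Zx) /= h1] := boolP (big h).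
  by apply: hm => //; rewrite mem_filter hb.
have [g gH xg] := cov x (ZU x Zx).
have gH2 : g \in H' by rewrite mem_filter gH (bigP x g Zx xg).
apply: xtr h1 _; apply: xtr (xpi_le x (leqnSn M)) _; apply: xtr xg _.
exact: (hm g gH2 x Zx).
Qed.

(* A finite rational cover {V_i} is refined by the
   standard cover generated by the products of one generator for each [i], at least
   one of which is the denominator. *)
Theorem appr_local U : rat U ->
  (forall x, U x -> exists V, [/\ rat V, V x & appr c V]) -> appr c U.
Proof.
move=> rU loc.
have [||l [lS lcov]] := @rat_compact U [set V | rat V /\ appr c V] rU.
- by move=> V [].
- by move=> x /loc[V [rV Vx aV]]; exists V.
pose r := size l.
have /choice[fM fMP] : forall j, exists q : (nat -> A) * nat * nat, (j < r)%N ->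
    [/\ forall k, (q.1.2 < k)%N -> q.1.1 k = 0,
        (exists2 k, (k <= q.1.2)%N & q.1.1 k = pi ^+ q.2)
      & nth set0 l j = [set x | (forall k, x (q.1.1 k) (q.1.1 0%N)) /\ ~ x (q.1.1 0%N) 0]].
  move=> j; have [jr|jr] := ltnP j r; last by exists ((fun=> 0), 0%N, 0%N).
  have [rV _] := lS _ (mem_nth set0 jr).
  by have [f [m [M [_ h1 h2 h3]]]] := rat_repr rV; exists (f, m, M).
pose m := \max_(j < r) (fM j).1.2.
pose M := \sum_(j < r) (fM j).2.
pose f (j : 'I_r) (k : 'I_m.+1) := (fM j).1.1 k.
pose hE (e : {ffun 'I_r -> 'I_m.+1}) := \prod_(j < r) f j (e j).
pose E := [pred e : {ffun 'I_r -> 'I_m.+1} | [exists j, e j == ord0]].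
have VP (j : 'I_r) : nth set0 l j =
    [set x | (forall k, x (f j k) (f j ord0)) /\ ~ x (f j ord0) 0].
  have [h1 _ ->] := fMP j (ltn_ord j).
  apply/seteqP; split=> x [h2 h3]; split=> // k; first exact: h2.
  have [km|km] := ltnP k m.+1; first by have := h2 (Ordinal km).
  rewrite h1 //; first exact: x00.
  by apply: leq_trans km; rewrite ltnS /m (leq_bigmax j).
have below (j : 'I_r) x : exists k : 'I_m.+1, x (pi ^+ (fM j).2) (f j k).
  have [_ [k km e] _] := fMP j (ltn_ord j).
  have km' : (k < m.+1)%N by rewrite ltnS (leq_trans km) // /m (leq_bigmax j).
  by exists (Ordinal km'); rewrite /f /= e; exact: xrefl.
have cov x : U x -> exists2 h, h \in [seq hE t | t <- enum E] & x (pi ^+ M) h.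
  move=> /lcov[V Vl Vx].
  have jr : (index V l < r)%N by rewrite index_mem.
  pose j0 := Ordinal jr.
  have := VP j0; rewrite /= nth_index // => VE; move: Vx; rewrite VE => -[h1 h2].
  have /choice[e0 he0] : forall j : 'I_r, exists k : 'I_m.+1, x (pi ^+ (fM j).2) (f j k).
    by move=> j; exact: below.
  pose e := [ffun j => if j == j0 then ord0 else e0 j].
  exists (hE e).
    apply/mapP; exists e => //; rewrite mem_enum inE.
    by apply/existsP; exists j0; rewrite ffunE eqxx.
  rewrite /M /hE; elim: (index_enum _) => [|j s IH].
    by rewrite !big_nil; exact: xrefl.
  rewrite !big_cons exprD; apply: xmul2 => //; rewrite ffunE.
  by case: eqP => [->|_]; [exact: xtr (he0 j0) (h1 _)|exact: he0].
apply: (@appr_standard [seq hE t | t <- enum E] M) => //.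
move=> _ /mapP[e + ->]; rewrite mem_enum => /existsP[i0 /eqP ei0].
have [_ ai0] := lS _ (mem_nth set0 (ltn_ord i0)).
apply: appr_sub ai0 => x [Ux hx]; rewrite VP.
have hn0 : ~ x (hE e) 0.
  by have [h hH xh] := cov x Ux; exact: bb_neq0 (xtr xh (hx h hH)).
have hEi0 (e' : {ffun 'I_r -> 'I_m.+1}) :
    hE e' = f i0 (e' i0) * \prod_(j < r | j != i0) f j (e' j).
  by rewrite /hE (bigD1 i0).
have fi0 : ~ x (f i0 ord0) 0 by move: hn0; rewrite hEi0 ei0 => /xnzl.
split=> // k.
have [V Vl Vx] := lcov x Ux.
have jr : (index V l < r)%N by rewrite index_mem.
pose j1 := Ordinal jr.
have := VP j1; rewrite /= nth_index // => VE; move: Vx; rewrite VE => -[h1 h2].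
have [j10|j10] := eqVneq j1 i0; first by rewrite -j10; exact: h1.
(* Taking generator k at i0 and the denominator at j1 gives another admissible product, bounded by
   the maximal one. After cancelling the common factors and the denominator of j1, this bounds
   generator k of i0 by the denominator of i0. *)
pose e' := [ffun j => if j == i0 then k else if j == j1 then ord0 else e j].
have : x (hE e') (hE e).
  apply: hx; apply/mapP; exists e' => //; rewrite mem_enum inE; apply/existsP; exists j1.
  by rewrite ffunE (negPf j10) eqxx.
rewrite (hEi0 e') (hEi0 e) ei0 ffunE eqxx.
rewrite (bigD1 j1) //= [X in x _ (_ * X)](bigD1 j1) //= ffunE (negPf j10) eqxx.
set P := \prod_(j < r | _) f j (e j).
have -> : \prod_(j < r | (j != i0) && (j != j1)) f j (e' j) = P.
  by apply: eq_bigr => j /andP[/negPf ji /negPf jj]; rewrite ffunE ji jj.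
have nz : ~ x (f j1 (e j1) * P) 0.
  by move: hn0; rewrite hEi0 (bigD1 j1) //= => /xnzr.
have P0 : ~ x P 0 := xnzr nz.
rewrite !mulrA => /(xcan P0) h3.
apply: (xcan h2); apply: xtr h3 _; exact/xmull/h1.
Qed.

End Splitting.

End Covers.

(** * Sections of the structure sheaf *)

Section Action.
Variable K : fsplit.
Local Notation A := (kA K).
Local Notation F := (kF K).
Local Notation i := (@ki K).
Local Notation pi := (@kpi K).
Local Notation pb := (@power_bounded A).
Local Notation X := (spa pb).
Local Notation w := (i pi).
Local Notation G := (kG K).
Local Notation tau := (@kact K).
Implicit Types (a b : A) (x y : X) (h k : F) (us : seq F) (U V W : set X) (m n : nat) (g : G).

Lemma tauB g a b : tau g (a - b) = tau g a - tau g b.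
Proof. by have [H _] := kact_hom g; exact: H. Qed.
Lemma tau0 g : tau g 0 = 0. Proof. by rewrite -{1}(subrr 0) tauB subrr. Qed.
Lemma tauN g a : tau g (- a) = - tau g a.
Proof. by rewrite -(sub0r a) tauB tau0 sub0r. Qed.
Lemma tauD g a b : tau g (a + b) = tau g a + tau g b.
Proof. by rewrite -[b]opprK tauB tauN !opprK. Qed.
Lemma tau1 g : tau g 1 = 1. Proof. by have [_ [H _]] := kact_hom g; exact: H. Qed.
Lemma tauM g a b : tau g (a * b) = tau g a * tau g b.
Proof. by have [_ [_ H]] := kact_hom g; exact: H. Qed.
Lemma tauX g a n : tau g (a ^+ n) = tau g a ^+ n.
Proof. by elim: n => [|n IH]; rewrite ?expr0 ?tau1 // !exprS tauM IH. Qed.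
Lemma tau_piX g n : tau g (pi ^+ n) = pi ^+ n.
Proof. by rewrite tauX kact_pi. Qed.
Lemma tauK g : cancel (tau g) (tau g^-1%g).
Proof. by move=> a; rewrite -kactM mulVg kact1. Qed.
Lemma tau_neq0 g a : (tau g a != 0) = (a != 0).
Proof.
congr negb; apply/eqP/eqP => [h|->]; last exact: tau0.
by rewrite -(tauK g a) h tau0.
Qed.

Lemma gX_subproof g x : exists y : X, y = (fun a b => x (tau g^-1%g a) (tau g^-1%g b)) :> (A -> A -> Prop).
Proof.
apply: spa_of_vrel.
- split=> //.
  + by move=> a b _ _; exact: (vr_tot (spa_vrel x)).
  + by move=> b a c _ _ _; exact: xtr.
  + by rewrite tau0 tau1; exact: x10.
  + by move=> a _; rewrite tau0; exact: x00.
  + by move=> c a b _ _ _; rewrite !tauM; exact: xmul.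
  + by move=> c a b _ _ _; rewrite !tauM tau0; exact: xcan.
  + by move=> a b _ _; rewrite tauD; exact: (vr_add (spa_vrel x)).
- by move=> a ha; rewrite tau1; apply: spa_pb; exact: kact_pb.
- by rewrite tau1 kact_pi; exact: xpi_lt1.
- by move=> b; rewrite tau0 => /spa_bounded_below[n hn]; exists n; rewrite tau_piX.
Qed.

Definition gX g x : X := sval (cid (gX_subproof g x)).

Lemma gXE g x a b : gX g x a b <-> x (tau g^-1%g a) (tau g^-1%g b).
Proof. by rewrite /gX; case: cid => y /= ->. Qed.

Lemma gX1 x : gX 1%g x = x.
Proof. by apply: spa_eqP => a b; rewrite gXE invg1 !kact1. Qed.
Lemma gXM g1 g2 x : gX (g1 * g2)%g x = gX g1 (gX g2 x).
Proof. by apply: spa_eqP => a b; rewrite !gXE invMg !kactM. Qed.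
Lemma gXK g : cancel (gX g) (gX g^-1%g).
Proof. by move=> x; rewrite -gXM mulVg gX1. Qed.
Lemma gXKV g : cancel (gX g^-1%g) (gX g).
Proof. by move=> x; rewrite -gXM mulgV gX1. Qed.

Definition tF g h : F := i (tau g (sval (frac_of h)).1) / i (tau g (sval (frac_of h)).2).

Lemma tFE g a b : b != 0 -> tF g (i a / i b) = i (tau g a) / i (tau g b).
Proof.
move=> b0; rewrite /tF; case: frac_of => -[c d] /= [d0 /eqP].
rewrite eqr_div ?i_neq0 // -!rmorphM => /eqP/(@ki_inj K) e.
apply/eqP; rewrite eqr_div ?i_neq0 ?tau_neq0 // -!rmorphM -!tauM; apply/eqP.
by rewrite e.
Qed.

Lemma tF_i g a : tF g (i a) = i (tau g a).
Proof.
by have := @tFE g a 1 (one_neq0 K); rewrite tau1 rmorph1 !divr1.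
Qed.

Lemma tFB g h k : tF g (h - k) = tF g h - tF g k.
Proof.
have [a [b [b0 ->]]] := ki_frac h; have [c [d [d0 ->]]] := ki_frac k.
have e0 := mul_neq0 b0 d0.
have -> : i a / i b - i c / i d = i (a * d - c * b) / i (b * d).
  by rewrite rmorphB !rmorphM; field; rewrite !i_neq0 b0 d0.
rewrite !tFE // !(tauB, tauM) !(rmorphB, rmorphM); field.
by rewrite !i_neq0 !tau_neq0 b0 d0.
Qed.
Lemma tF0 g : tF g 0 = 0. Proof. by rewrite -{1}(subrr 0) tFB subrr. Qed.
Lemma tFD g h k : tF g (h + k) = tF g h + tF g k.
Proof. by rewrite -[k]opprK -[- k]sub0r !tFB tF0 !sub0r !opprK. Qed.
Lemma tFM g h k : tF g (h * k) = tF g h * tF g k.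
Proof.
have [a [b [b0 ->]]] := ki_frac h; have [c [d [d0 ->]]] := ki_frac k.
by rewrite mulf_div -!rmorphM !tFE ?mul_neq0 // mulf_div -!rmorphM -!tauM.
Qed.
Lemma tF1 h : tF 1%g h = h.
Proof. by have [a [b [b0 ->]]] := ki_frac h; rewrite tFE // !kact1. Qed.
Lemma tFgM g1 g2 h : tF (g1 * g2)%g h = tF g1 (tF g2 h).
Proof. by have [a [b [b0 ->]]] := ki_frac h; rewrite !tFE ?tau_neq0 // !kactM. Qed.
Lemma tFK g : cancel (tF g) (tF g^-1%g).
Proof. by move=> h; rewrite -tFgM mulVg tF1. Qed.
Lemma tFone g : tF g 1 = 1. Proof. by rewrite -(rmorph1 i) tF_i tau1. Qed.
Lemma tF_w g n : tF g (w ^+ n) = w ^+ n.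
Proof. by rewrite -rmorphXn tF_i tau_piX. Qed.
Lemma tFV g h : h != 0 -> tF g h^-1 = (tF g h)^-1.
Proof.
move=> h0; have h0' : tF g h != 0.
  by apply: contraNneq h0 => e; rewrite -(tFK g h) e tF0.
by apply: (mulfI h0'); rewrite -tFM !mulfV // tFone.
Qed.

Lemma gX_ext g x h k : ext (gX g x) h k <-> ext x (tF g^-1%g h) (tF g^-1%g k).
Proof.
suff H g' y h' k' : ext (gX g' y) h' k' -> ext y (tF g'^-1%g h') (tF g'^-1%g k').
  split=> [|hh]; first exact: H.
  rewrite -(gXK g x) in hh; have := H _ _ _ _ hh.
  by rewrite invgK -!tFgM mulgV !tF1.
move=> [a [b [d [d0 -> -> hab]]]].
exists (tau g'^-1%g a), (tau g'^-1%g b), (tau g'^-1%g d).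
have d0' := xneq0 d0.
split; [|by rewrite tFE..|by rewrite -gXE].
by move: d0; rewrite gXE tau0.
Qed.

Lemma gX_lvl g x n h : lvl (gX g x) n h <-> lvl x n (tF g^-1%g h).
Proof. by rewrite /lvl gX_ext tF_w. Qed.

Lemma span_tF g us h : span us h -> span (map (tF g) us) (tF g h).
Proof.
elim=> [a ha|y z _ h1 _ h2|u y uus _ h1].
- by rewrite tF_i; apply: span_pb; exact: kact_pb.
- by rewrite tFD; exact: span_add.
- by rewrite tFM; apply: span_mul => //; exact: map_f.
Qed.

Lemma rat_gX g U : rat U -> rat (gX g @^-1` U).
Proof.
move=> [us [d [[d0 hus [N hN]] ->]]]; set t := g^-1%g.
exists (map (tF t) us), (tau t d); split.
  split; first by rewrite tau_neq0.
    by move=> _ /mapP[u /hus [a ->] ->]; exists (tau t a); rewrite tFE.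
  exists N; have := span_tF t hN.
  by rewrite tFM tF_w tFV ?i_neq0 // tF_i.
apply/seteqP; split=> x /= h.
  by move=> _ /mapP[u uus ->]; have /gX_ext := h u uus; rewrite tFone.
by move=> u uus; apply/gX_ext; rewrite tFone; apply: h; exact: map_f.
Qed.

Lemma gX_preimage g W : gX g @^-1` (gX g^-1%g @^-1` W) = W.
Proof. by apply/seteqP; split=> x /=; rewrite gXK. Qed.

Lemma FU_gX g U h : FU U h -> FU (gX g @^-1` U) (tF g^-1%g h).
Proof.
move=> [a [b [n [b0 -> hb]]]]; exists (tau g^-1%g a), (tau g^-1%g b), n.
split; [by rewrite tau_neq0|by rewrite tFE|].
by move=> x /= /hb; rewrite gXE tau_piX.
Qed.

Lemma gX_continuous g : continuous (gX g).
Proof.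
apply/continuousP => W oW; rewrite openE => x Wx.
have [U [rU Ux UW]] := rat_basis oW Wx.
have := rat_open (rat_gX g rU); rewrite openE => /(_ x Ux).
by apply: filterS => y; exact: UW.
Qed.

Lemma gX_open g W : open W -> open (gX g @^-1` W).
Proof. by move: W; apply/continuousP; exact: gX_continuous. Qed.

Local Notation E := (X -> nat -> F).
Implicit Types (c d : E).

Lemma eB c d x n : (c - d) x n = c x n - d x n. Proof. by []. Qed.
Lemma eM c d x n : (c * d) x n = c x n * d x n. Proof. by []. Qed.

(** Pullback of functions along [gX g]: the values are moved by the inverse to match the point. It
    reverses products, as [cact_comp] records. *)
Definition cact g c : E := fun x n => tF g^-1%g (c (gX g x) n).

Lemma cactB g c d : cact g (c - d) = cact g c - cact g d.
Proof. by apply/funext => x; apply/funext => n; exact: tFB. Qed.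
Lemma cactM g c d : cact g (c * d) = cact g c * cact g d.
Proof. by apply/funext => x; apply/funext => n; exact: tFM. Qed.
Lemma cact_one g : cact g 1 = 1.
Proof. by apply/funext => x; apply/funext => n; exact: tFone. Qed.
Lemma cact1 c : cact 1%g c = c.
Proof. by apply/funext => x; apply/funext => n; rewrite /cact invg1 tF1 gX1. Qed.
Lemma cact_comp g1 g2 c : cact g2 (cact g1 c) = cact (g1 * g2)%g c.
Proof. by apply/funext => x; apply/funext => n; rewrite /cact invMg tFgM gXM. Qed.

Lemma lev_cact g U n c : lev U n c -> lev (gX g @^-1` U) n (cact g c).
Proof.
by move=> hc x /hc [N hN]; exists N => k /hN; rewrite gX_lvl.
Qed.

Lemma appr_cact g U c : appr c U -> appr (cact g c) (gX g @^-1` U).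
Proof.
move=> hc n; have [h hh hl] := hc n; exists (tF g^-1%g h); first exact: FU_gX.
by move=> x /hl [N hN]; exists N => k /hN; rewrite gX_lvl tFB.
Qed.

Lemma lev_0 U n : lev U n (0 : E).
Proof. by move=> x _; exists 0%N => k _; exact: lvl_0. Qed.
Lemma lev_B U n c d : lev U n c -> lev U n d -> lev U n (c - d).
Proof.
move=> hc hd x Ux; have [N hN] := hc x Ux; have [M hM] := hd x Ux.
exists (maxn N M) => k; rewrite geq_max => /andP[/hN h1 /hM h2]; exact: lvl_B.
Qed.
Lemma lev_N U n c : lev U n c -> lev U n (- c).
Proof. by move=> hc; rewrite -sub0r; apply: lev_B => //; exact: lev_0. Qed.
Lemma lev_D U n c d : lev U n c -> lev U n d -> lev U n (c + d).
Proof. by move=> hc hd; rewrite -[d]opprK; apply: lev_B => //; exact: lev_N. Qed.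
Lemma lev_M U m n c d : lev U m c -> lev U n d -> lev U (m + n) (c * d).
Proof.
move=> hc hd x Ux; have [N hN] := hc x Ux; have [M hM] := hd x Ux.
exists (maxn N M) => k; rewrite geq_max => /andP[/hN h1 /hM h2]; exact: lvl_M.
Qed.
Lemma lev_le U m n c : (m <= n)%N -> lev U n c -> lev U m c.
Proof. by move=> mn hc x /hc [N hN]; exists N => k /hN; exact: lvl_le. Qed.

Definition cst h : E := fun _ _ => h.

(** An approximation at level 0 is a fraction bounded by |pi|^(-m) on [U], and the remainder is
    eventually integral; so multiplication by the family shifts levels by at most m. *)
Lemma appr_bounded U c : appr c U -> exists m, forall n d, lev U (m + n) d -> lev U n (c * d).
Proof.
move=> /(_ 0%N)[h hh hl]; have [m hm] := FU_bounded hh.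
exists m => n d hd x Ux; have [N hN] := hl x Ux; have [M hM] := hd x Ux.
exists (maxn N M) => k; rewrite geq_max => /andP[/hN h1 /hM h2].
rewrite eM; have -> : c x k * d x k = (c x k - h) * d x k + h * d x k by ring.
apply: lvl_D.
  by rewrite -[n]add0n; apply: lvl_M => //; apply: lvl_le h2; exact: leq_addl.
by rewrite -(lvl_wM x m) mulrA -[(m + n)%N]add0n; apply: lvl_M => //; exact: hm.
Qed.

Lemma appr_cst U h : FU U h -> appr (cst h) U.
Proof.
move=> hh n; exists h => // x _; exists 0%N => k _; rewrite /cst subrr; exact: lvl_0.
Qed.

Lemma appr_B U c d : appr c U -> appr d U -> appr (c - d) U.
Proof.
move=> hc hd n; have [h hh hl] := hc n; have [k kh kl] := hd n.
exists (h - k); first exact: FU_B.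
have -> : (fun x q => (c - d) x q - (h - k)) = (c - cst h) - (d - cst k).
  apply/funext => x; apply/funext => q.
  by transitivity ((c x q - h) - (d x q - k)) => //; rewrite eB; ring.
exact: lev_B.
Qed.

Lemma appr_M U c d : appr c U -> appr d U -> appr (c * d) U.
Proof.
move=> hc hd n; have [m hm] := appr_bounded hc; have [k kh kl] := hd (m + n)%N.
have [m' hm'] := appr_bounded (appr_cst kh).
have [h hh hl] := hc (m' + n)%N.
exists (h * k); first exact: FU_M.
have -> : (fun x q => (c * d) x q - h * k) = c * (d - cst k) + cst k * (c - cst h).
  apply/funext => x; apply/funext => q.
  by transitivity (c x q * (d x q - k) + k * (c x q - h)) => //; rewrite eM; ring.
by apply: lev_D; [exact: hm|exact: hm'].
Qed.

Definition eqon W c d := forall n, lev W n (c - d).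

Lemma appr_eqon U c d : eqon U c d -> appr c U -> appr d U.
Proof.
move=> cd hc n; have [h hh hl] := hc n; exists h => //.
have -> : (fun x q => d x q - h) = (c - cst h) - (c - d).
  apply/funext => x; apply/funext => q.
  by transitivity ((c x q - h) - (c x q - d x q)) => //; ring.
by apply: lev_B => //; exact: cd.
Qed.

Lemma eqon_refl W c : eqon W c c.
Proof. by move=> n; rewrite subrr; exact: lev_0. Qed.
End Action.

(** * Rings of sections, with and without invariance *)

Section SectionRings.
Variable K : fsplit.
Local Notation A := (kA K).
Local Notation F := (kF K).
Local Notation i := (@ki K).
Local Notation pi := (@kpi K).
Local Notation pb := (@power_bounded A).
Local Notation X := (spa pb).
Local Notation w := (i pi).
Local Notation G := (kG K).
Local Notation E := (X -> nat -> F).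
Implicit Types (c d : E) (U V W : set X) (g : G) (inv : bool).

Definition secJ W := {U : set X | rat U /\ U `<=` W}.

(* Sections over [W]: families of Cauchy sequences that are uniformly approximable
   by fractions on every rational subset of [W]; with [inv], only those that are
   invariant under the group. *)
Definition secS inv W : set E := [set c |
  (forall j : secJ W, appr c (sval j)) /\
  (inv -> forall g (j : secJ W) n, lev (sval j) n (cact g c - c))].

(** One chain of levels for each rational subset, measuring the supremum there. The resulting
    topology over a general open set is the limit topology over its rational subsets. *)
Definition sec_lev W (j : secJ W) (n : nat) : set E := [set c | lev (sval j) n c].

Lemma secS_1 inv W : secS inv W 1.
Proof.
split=> [j|_ g j n]; last by rewrite cact_one subrr; exact: lev_0.
by apply: appr_cst; exact: FU_1.
Qed.

Lemma secS_B inv W c d : secS inv W c -> secS inv W d -> secS inv W (c - d).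
Proof.
move=> [hc ic] [hd id]; split=> [j|b g j n]; first exact: appr_B.
rewrite cactB (_ : _ - _ = (cact g c - c) - (cact g d - d)); last by ring.
by apply: lev_B; [exact: ic|exact: id].
Qed.

Lemma secS_M inv W c d : secS inv W c -> secS inv W d -> secS inv W (c * d).
Proof.
move=> [hc ic] [hd id]; split=> [j|b g j n]; first exact: appr_M.
have [m hm] := appr_bounded (hc j); have [m' hm'] := appr_bounded (hd j).
rewrite cactM (_ : _ - _ = (cact g c - c) * (cact g d - d) + c * (cact g d - d)
   + d * (cact g c - c)); last by ring.
apply: lev_D; last by apply: hm'; exact: ic.
apply: lev_D; last by apply: hm; exact: id.
by rewrite -[n]addn0; apply: lev_M; [exact: ic|exact: id].
Qed.

Lemma sec_lev_SM inv W j n c : secS inv W c ->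
  exists m, forall d, secS inv W d -> sec_lev (W := W) j m d -> sec_lev j n (c * d).
Proof. by move=> [hc _]; have [m hm] := appr_bounded (hc j); exists (m + n)%N => d _; exact: hm. Qed.

Lemma sec_lev_M W j n c d :
  sec_lev (W := W) j n c -> sec_lev j n d -> sec_lev j n (c * d).
Proof. by move=> hc hd; apply: lev_le (lev_M hc hd); exact: leq_addr. Qed.

Lemma sec_lev_W W j n c : sec_lev (W := W) j n.+1 c -> sec_lev j n c.
Proof. exact: lev_le. Qed.

Definition secf inv W : filt_ring :=
  @FiltRing E (secS inv W) (secJ W) (@sec_lev W) (secS_1 inv W) (@secS_B inv W)
    (@secS_M inv W) (fun j n => @lev_0 K (sval j) n) (fun j n => @lev_B K (sval j) n)
    (@sec_lev_W W) (@sec_lev_M W) (@sec_lev_SM inv W).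

Definition secR inv W : topComRingType := filtq (secf inv W).

End SectionRings.

Section SectionTheory.
Variable K : fsplit.
Local Notation A := (kA K).
Local Notation F := (kF K).
Local Notation i := (@ki K).
Local Notation pi := (@kpi K).
Local Notation pb := (@power_bounded A).
Local Notation X := (spa pb).
Local Notation w := (i pi).
Local Notation G := (kG K).
Local Notation E := (X -> nat -> F).
Implicit Types (c d : E) (U V W : set X) (g : G) (inv : bool) (x : X) (u v : nat -> F).

(** Equality of limits in the completion of the local ring at [x], expressed on sequences. *)
Definition peq x u v := forall n, exists N, forall k, (N <= k)%N -> lvl x n (u k - v k).

Lemma eqonP W c d : eqon W c d <-> forall x, W x -> peq x (c x) (d x).
Proof. by split=> [h x Wx n|h n x Wx]; [exact: (h n x Wx)|exact: (h x Wx n)]. Qed.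

Lemma peq_refl x u : peq x u u.
Proof. by move=> n; exists 0%N => k _; rewrite subrr; exact: lvl_0. Qed.
Lemma peq_sym x u v : peq x u v -> peq x v u.
Proof. by move=> h n; have [N hN] := h n; exists N => k /hN; rewrite -opprB => /lvl_N; rewrite opprK. Qed.
Lemma peq_tr x v u u' : peq x u v -> peq x v u' -> peq x u u'.
Proof.
move=> h1 h2 n; have [N hN] := h1 n; have [M hM] := h2 n.
exists (maxn N M) => k; rewrite geq_max => /andP[/hN k1 /hM k2].
by rewrite (_ : u k - u' k = (u k - v k) + (v k - u' k)); [exact: lvl_D|ring].
Qed.

Lemma peq_cact g x c d : peq (gX g x) (c (gX g x)) (d (gX g x)) ->
  peq x (cact g c x) (cact g d x).
Proof.
move=> h n; have [N hN] := h n; exists N => k /hN.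
by rewrite gX_lvl tFB.
Qed.

Lemma lev_cover U n c (l : seq (set X)) : (forall x, U x -> exists2 V, V \in l & V x) ->
  (forall V, V \in l -> lev V n c) -> lev U n c.
Proof. by move=> cov h x /cov[V /h hV Vx]; exact: hV. Qed.

Lemma rat_refine (I : Type) (W : I -> set X) U : rat U -> (forall j, open (W j)) ->
  U `<=` \bigcup_j W j -> exists l : seq (set X),
    (forall V, V \in l -> rat V /\ exists j, V `<=` W j) /\
    forall x, U x -> exists2 V, V \in l & V x.
Proof.
move=> rU oW UW.
have [||l [lS lcov]] := @rat_compact K U [set V | rat V /\ exists j, V `<=` W j] rU.
- by move=> V [].
- move=> x /UW[j _ Wx]; have [V [rV Vx VW]] := rat_basis (oW j) Wx.
  by exists V => //; split=> //; exists j.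
- by exists l; split.
Qed.

Section Ring.
Variables (inv : bool) (W : set X).
Local Notation R := (secR inv W).
Implicit Types s t : R.

Lemma secj U : rat U -> U `<=` W -> exists j : secJ W, sval j = U.
Proof. by move=> rU UW; exists (exist _ U (conj rU UW)). Qed.

Lemma sec_appr s U : rat U -> U `<=` W -> appr (frep s) U.
Proof. by move=> rU UW; have [h _] := frepS s; have [j <-] := secj rU UW; exact: h. Qed.

Lemma sec_S s : secS inv W (frep s). Proof. exact: (frepS s). Qed.

Lemma sec_eq s t : s = t <-> forall U, rat U -> U `<=` W -> eqon U (frep s) (frep t).
Proof.
split=> [->|h]; first by move=> *; exact: eqon_refl.
by apply/fq_eqP => -[U [rU UW]] n; exact: (h U rU UW n).
Qed.

Lemma sec_fq (c : E) U : secS inv W c -> rat U -> U `<=` W -> eqon U (frep (fq (D := secf inv W) c)) c.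
Proof. by move=> cS rU UW n; have [j <-] := secj rU UW; exact: (@fqP (secf inv W) c cS j n). Qed.

Hypothesis oW : open W.

Lemma sec_eqP s t : s = t <-> forall x, W x -> peq x (frep s x) (frep t x).
Proof.
rewrite sec_eq; split=> [h x Wx|h U rU UW]; last first.
  by apply/eqonP => x /UW; exact: h.
have [U [rU Ux UW]] := rat_basis oW Wx.
by have /eqonP := h U rU UW; apply.
Qed.

Lemma sec_fqP (c : E) x : secS inv W c -> W x -> peq x (frep (fq (D := secf inv W) c) x) (c x).
Proof.
move=> cS Wx; have [U [rU Ux UW]] := rat_basis oW Wx.
by have /eqonP := sec_fq cS rU UW; apply.
Qed.

Lemma sec_invP s : inv -> forall g x, W x -> peq x (cact g (frep s) x) (frep s x).
Proof.
move=> b g x Wx n; have [U [rU Ux UW]] := rat_basis oW Wx.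
have [_ /(_ b g)] := frepS s; have [j jU] := secj rU UW.
by move=> /(_ j n x); rewrite jU; apply.
Qed.

(** Approximability is a local condition by [appr_local]; this is where uniformity enters the sheaf
    property. *)
Lemma secSP (c : E) : (forall x, W x -> exists U, [/\ rat U, U x & appr c U]) ->
  (inv -> forall g x, W x -> peq x (cact g c x) (c x)) -> secS inv W c.
Proof.
move=> h1 h2; split=> [[U [rU UW]] /=|b g [U [rU UW]] n x /= Ux].
  by apply: appr_local => // x /UW; exact: h1.
exact: h2 b g x (UW x Ux) n.
Qed.

End Ring.

(** A Cauchy filter yields a fraction h (j, n) for each rational subset and level. The limit family
    uses at x the fractions of one fixed rational set through x; those of another set agree with
    them up to the level, because a single section is close to both. *)
Lemma sec_complete inv W : (inv -> forall g x, W x -> W (gX g x)) ->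
  complete_ring (secR inv W).
Proof.
move=> st; apply: fq_complete => Fl PF FC.
have /choice[P PP] : forall jn : secJ W * nat, exists P : set (secR inv W),
    Fl P /\ forall s t, P s -> P t -> qlev (D := secf inv W) jn.1 jn.2 (s - t).
  by move=> [j n]; have [P FP hP] := FC j n; exists P.
have /choice[t tP] : forall jn, exists t, P jn t.
  by move=> jn; have [FP _] := PP jn; exact: filter_ex FP.
have /choice[h hP] : forall jn : secJ W * nat, exists h, FU (sval jn.1) h /\
    lev (sval jn.1) jn.2 (frep (t jn) - cst h).
  move=> [j n] /=; have [rj jW] := svalP j.
  by have [h h1 h2] := sec_appr (t (j, n)) rj jW n; exists h.
(* One rational subset through each point of W that has one; elsewhere the value is irrelevant. *)
have /choice[jx jxP] : forall x, exists j : secJ W, forall j' : secJ W, sval j' x -> sval j x.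
  move=> x; have [[j jx]|no] := pselect (exists j : secJ W, sval j x); first by exists j.
  have j0 : secJ W by exists set0; split; [exact: rat0|].
  by exists j0 => j' j'x; case: no; exists j'.
have near j n s x : P (j, n) s -> sval j x -> exists N, forall k, (N <= k)%N ->
    lvl x n (frep s x k - h (j, n)).
  move=> Ps jx0; have [_ hh] := PP (j, n); have := hh _ _ Ps (tP (j, n)) => /=.
  have := flev_eq (frepB s (t (j, n))) => H /(H j n) /(_ x jx0)[N hN].
  have [_ /(_ x jx0)[M hM]] := hP (j, n); exists (maxn N M) => k.
  rewrite geq_max => /andP[/hN k1 /hM k2].
  rewrite (_ : _ - _ = (frep s x k - frep (t (j, n)) x k) +
     (frep (t (j, n)) x k - h (j, n))); last by ring.
  exact: lvl_D.
pose c : E := fun x k => h (jx x, k).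
have cU (j : secJ W) n x k : sval j x -> (n <= k)%N -> lvl x n (c x k - h (j, n)).
  move=> jx0 nk; have [F1 _] := PP (jx x, k); have [F2 _] := PP (j, n).
  have [s [Ps1 Ps2]] := filter_ex (filterI F1 F2).
  have [N hN] := near _ _ _ _ Ps1 (jxP x j jx0); have [M hM] := near _ _ _ _ Ps2 jx0.
  have -> : c x k - h (j, n) = (frep s x (N + M)%N - h (j, n)) -
      (frep s x (N + M)%N - h (jx x, k)) by rewrite /c; ring.
  apply: lvl_B; first by apply: hM; exact: leq_addl.
  by apply: lvl_le nk _; apply: hN; exact: leq_addr.
have lim (j : secJ W) n s : P (j, n) s -> lev (sval j) n (frep s - c).
  move=> Ps x jx0; have [N hN] := near _ _ _ _ Ps jx0; exists (maxn N n) => k.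
  rewrite geq_max => /andP[/hN k1 nk]; rewrite eB.
  rewrite (_ : _ - _ = (frep s x k - h (j, n)) - (c x k - h (j, n))); last by ring.
  by apply: lvl_B => //; exact: cU.
have cS : secS inv W c.
  split=> [j n|b g j n].
    have [h1 _] := hP (j, n); exists (h (j, n)) => // x jx0.
    by exists n => k nk; exact: cU.
  have [rj jW] := svalP j.
  (* Invariance on [j] compares the limit on [j] with the limit on a translate of [j], which lies in
     [W] because [W] is stable under the group. *)
  have gj : rat (gX g^-1%g @^-1` sval j) /\ (gX g^-1%g @^-1` sval j) `<=` W.
    split; first exact: rat_gX.
    by move=> x /jW /(st b g); rewrite gXKV.
  pose j' : secJ W := exist _ _ gj.
  have [F1 _] := PP (j, n); have [F2 _] := PP (j', n).
  have [s [/lim s1 /lim s2]] := filter_ex (filterI F1 F2).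
  have s3 : lev (sval j) n (cact g (frep s) - frep s).
    by have [_ ] := frepS s; apply.
  have := @lev_cact K g _ _ _ s2; rewrite /= gX_preimage cactB => s4.
  rewrite (_ : _ - _ = (cact g (frep s) - frep s) + (frep s - c) -
    (cact g (frep s) - cact g c)); last by ring.
  by apply: lev_B => //; exact: lev_D.
exists (fq (D := secf inv W) c) => j n.
have [FP _] := PP (j, n); apply: filterS FP => s /lim hs.
change (flev (f := secf inv W) j n (frep (s - fq (D := secf inv W) c))).
apply: (@flev_eq (secf inv W) j n (frep s - c)) hs.
rewrite -opprB; apply: fnullN.
rewrite (_ : _ - _ = (frep (s - fq (D := secf inv W) c) - (frep s - frep (fq (D := secf inv W) c)))
   - (frep (fq (D := secf inv W) c) - c)); last by ring.
by apply: fnullB; [exact: frepB|exact: fqP].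
Qed.

Lemma secS_sub inv V W c : W `<=` V -> secS inv V c -> secS inv W c.
Proof.
move=> WV [h1 h2]; split=> [[U [rU UW]]|b g [U [rU UW]]].
  by have [j jE] := secj rU (subset_trans UW WV); have := h1 j; rewrite jE.
by have [j jE] := secj rU (subset_trans UW WV) => n; have := h2 b g j n; rewrite jE.
Qed.

(** Restriction keeps the representing family and forgets conditions on it. *)
Definition sres inv V W (s : secR inv V) : secR inv W := fq (D := secf inv W) (frep s).

Lemma sres_rep inv V W (s : secR inv V) : W `<=` V -> open W ->
  forall x, W x -> peq x (frep (sres W s) x) (frep s x).
Proof. by move=> WV oW x Wx; apply: sec_fqP => //; apply: secS_sub WV _; exact: sec_S. Qed.

Lemma sres_id inv W (s : secR inv W) : sres W s = s.
Proof. exact: fqK. Qed.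

Lemma fq_sres inv V W (c : E) : W `<=` V -> secS inv V c ->
  sres W (fq (D := secf inv V) c) = fq (D := secf inv W) c.
Proof.
move=> WV cS; apply/fq_eq.
- by apply: secS_sub WV _; exact: sec_S.
- exact: secS_sub cS.
move=> [U [rU UW]] n; exact: (sec_fq cS rU (subset_trans UW WV) n).
Qed.

Lemma sres_hom inv V W : W `<=` V -> tring_hom (@sres inv V W).
Proof.
move=> WV.
have S (s : secR inv V) : secS inv W (frep s) by apply: secS_sub WV _; exact: sec_S.
have hB : zmod_morphism (@sres inv V W).
  move=> s t; rewrite /sres -fqB; try exact: S.
  apply/fq_eq.
  - exact: S.
  - by apply: secS_B; exact: S.
  move=> [U [rU UW]] n; have [j jE] := secj rU (subset_trans UW WV).
  by have := @frepB (secf inv V) s t j n; rewrite /= /sec_lev /= jE.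
split=> //.
  split.
    apply/fq_eq; [exact: S|exact: secS_1|].
    move=> [U [rU UW]] n.
    exact: (sec_fq (secS_1 inv V) rU (subset_trans UW WV) n).
  move=> s t; rewrite /sres -fqM; try exact: S.
  apply/fq_eq.
  - exact: S.
  - by apply: secS_M; exact: S.
  move=> [U [rU UW]] n; have [j jE] := secj rU (subset_trans UW WV).
  by have := @frepM (secf inv V) s t j n; rewrite /= /sec_lev /= jE.
apply: zmod_continuous => // B [l [n hB']].
have /choice[f fE] : forall j : secJ W, exists j' : secJ V, sval j' = sval j.
  by move=> [U [rU UW]]; exact: secj rU (subset_trans UW WV).
exists [seq f j | j <- l], n => s hs; apply: hB' => j jl.
have := hs (f j) (List.in_map f _ _ jl); rewrite !subr0 => h.
by apply/qlev_fq => //=; rewrite /sec_lev /= -fE.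
Qed.

Lemma sres_comp inv U V W (s : secR inv U) : V `<=` U -> W `<=` V ->
  sres W (sres V s) = sres W s.
Proof. by move=> VU WV; exact: (fq_sres WV (secS_sub VU (sec_S s))). Qed.

(** At each point any one of the given families may serve as value, since all of them have the same
    limit there; approximability then holds locally. *)
Lemma sec_glue inv (I : Type) (U : I -> set X) (s : forall j, secR inv (U j)) :
  (forall j, open (U j)) -> (inv -> forall j g x, U j x -> U j (gX g x)) ->
  (forall j k x, U j x -> U k x -> peq x (frep (s j) x) (frep (s k) x)) ->
  exists2 c : E, secS inv (\bigcup_j U j) c &
    forall j x, U j x -> peq x (c x) (frep (s j) x).
Proof.
move=> oU st cmp.
have /choice[f fP] : forall x, exists u : nat -> F, forall j, U j x -> peq x u (frep (s j) x).
  move=> x; have [[j Ujx]|no] := pselect (exists j, U j x).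
    by exists (frep (s j) x) => k; exact: cmp.
  by exists (fun=> 0) => j Ujx; case: no; exists j.
have oW : open (\bigcup_j U j) by apply: bigcup_open => j _; exact: oU.
exists f; last by move=> j x Ux; exact: fP.
apply: secSP => //.
- move=> x [j _ Ujx]; have [V [rV Vx VU]] := rat_basis (oU j) Ujx.
  exists V; split=> //; apply: appr_eqon (sec_appr (s j) rV VU).
  by apply/eqonP => y /VU Uy; apply/peq_sym/fP.
- move=> b g x [j _ Ujx]; apply: (peq_tr (v := cact g (frep (s j)) x)).
    by apply: peq_cact; apply: fP; exact: st.
  apply: (peq_tr (v := frep (s j) x)); last by apply/peq_sym/fP.
  exact: sec_invP.
Qed.

Lemma sec_glue1 inv (I : Type) (U : I -> set X) (s : forall j, secR inv (U j)) :
  (forall j, open (U j)) -> (inv -> forall j g x, U j x -> U j (gX g x)) ->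
  (forall j k x, U j x -> U k x -> peq x (frep (s j) x) (frep (s k) x)) ->
  exists! t : secR inv (\bigcup_j U j), forall j, sres (U j) t = s j.
Proof.
move=> oU st cmp; have [c cS cE] := sec_glue oU st cmp.
have oW : open (\bigcup_j U j) by apply: bigcup_open => j _; exact: oU.
have UW j : U j `<=` \bigcup_j U j by move=> x Ux; exists j.
exists (fq (D := secf inv (\bigcup_j U j)) c); split=> [j|t ht].
  apply/(sec_eqP (oU j)) => x Ux; rewrite fq_sres //.
  apply: peq_tr (cE j x Ux); apply: sec_fqP => //; exact: secS_sub cS.
apply/(sec_eqP oW) => x Wx; have [j _ Ux] := Wx.
apply: (peq_tr (v := c x)); first exact: sec_fqP.
apply: (peq_tr (v := frep (s j) x)); first exact: cE.
by rewrite -ht; exact: sres_rep.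
Qed.

(** By quasi-compactness a level on a rational subset of the union follows from levels on finitely
    many rational sets, each contained in a member of the cover. *)
Lemma sec_initial inv (I : Type) (U : I -> set X) :
  (forall j, open (U j)) ->
  initial_for (fun j => @sres inv (\bigcup_j U j) (U j)).
Proof.
move=> oU Fl PF a hF B [l [n hB]].
have UW j : U j `<=` \bigcup_j U j by move=> x Ux; exists j.
suff : Fl [set t | forall J, List.In J l -> qlev (D := secf inv (\bigcup_j U j)) J n (t - a)].
  by apply: filterS => t; exact: hB.
elim: l {hB} => [|J l IH]; first by apply: filterS (@filterT _ Fl _) => t _ J [].
suff FJ : Fl [set t | qlev (D := secf inv (\bigcup_j U j)) J n (t - a)].
  by apply: filterS (filterI FJ IH) => t [h1 h2] J' /= [<-//|/h2].
have [rJ JW] := svalP J; have [m [mS mcov]] := rat_refine rJ oU JW.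
have : Fl [set t | forall V, V \in m -> lev V n (frep (t - a))].
  elim: (m) mS => [|V m' IHm] mS; first by apply: filterS (@filterT _ Fl _) => t _ V.
  have [rV [k VU]] := mS V (mem_head _ _).
  have FV : Fl [set t | lev V n (frep (t - a))].
    have [jk jkE] := secj rV VU.
    have h0 : Fl [set t | qlev (D := secf inv (U k)) jk n (sres (U k) t - sres (U k) a)].
      exact: (hF k _ (@fq_nbhs_lev (secf inv (U k)) jk n (sres (U k) a))).
    apply: filterS h0 => t h0.
    have [hs _ _] := @sres_hom inv _ _ (UW k).
    have h : lev V n (frep (sres (U k) (t - a))).
      rewrite -jkE; change (qlev (D := secf inv (U k)) jk n (sres (U k) (t - a))).
      by rewrite (hs t a).
    have h2 := @sec_fq inv (U k) _ V (secS_sub (UW k) (sec_S (t - a))) rV VU n.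
    by apply: (eq_ind _ (lev V n) (lev_B h h2)); exact: subKr.
  apply: filterS (filterI FV (IHm _)) => [t [h1 h2] V'|V' V'm].
    by rewrite inE => /orP[/eqP->|/h2].
  by apply: mS; rewrite inE V'm orbT.
by apply: filterS => t ht; exact: lev_cover mcov ht.
Qed.

End SectionTheory.

(** * Universal property of rational localizations *)

Section ExtendHom.
Context (B C : topComRingType) (D : set B) (f : B -> C).
Hypothesis Ccomplete : complete_ring C.
Hypothesis D1 : D 1.
Hypothesis DB : forall x y, D x -> D y -> D (x - y).
Hypothesis DM : forall x y, D x -> D y -> D (x * y).
Hypothesis Ddense : forall b U, nbhs (0 : B) U -> exists2 d, D d & U (b - d).
Hypothesis f1 : f 1 = 1.
Hypothesis fB : forall x y, D x -> D y -> f (x - y) = f x - f y.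
Hypothesis fM : forall x y, D x -> D y -> f (x * y) = f x * f y.
Hypothesis fcont : forall V, nbhs (0 : C) V ->
  exists2 U, nbhs (0 : B) U & forall d, D d -> U d -> V (f d).

Let hC : hausdorff_space C. Proof. by case: Ccomplete. Qed.

Let lim_filter (b : B) : set_system C := [set P | exists2 U, nbhs (0 : B) U &
  forall d, D d -> U (b - d) -> P (f d)].

Let lim_proper b : ProperFilter (lim_filter b).
Proof.
apply: Build_ProperFilter_ex.
  by move=> P [U hU hP]; have [d Dd Ud] := Ddense b hU; exists (f d); exact: hP.
split.
- by exists setT => //; exact: filterT.
- move=> P Q [U hU hP] [V hV hQ]; exists (U `&` V); first exact: filterI.
  by move=> d Dd [Ud Vd]; split; [exact: hP|exact: hQ].
- by move=> P Q PQ [U hU hP]; exists U => // d Dd Ud; apply: PQ; exact: hP.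
Qed.

Let lim_ex b : exists c : C, lim_filter b --> c.
Proof.
case: Ccomplete => _ /(_ (lim_filter b) (lim_proper b)); apply=> V /fcont[U hU hV].
have [P hP hPU] := nbhs0_sub hU.
exists (f @` [set d | D d /\ P (b - d)]).
  by exists P => // d Dd Pd; exists d.
move=> _ _ [d [Dd Pd] <-] [d' [Dd' Pd'] <-]; rewrite -fB //; apply: hV; first exact: DB.
have -> : d - d' = (b - d') - (b - d) by ring.
exact: hPU.
Qed.

Let F b : C := sval (cid (lim_ex b)).

Let FP b V : nbhs (F b) V -> exists2 U, nbhs (0 : B) U &
  forall d, D d -> U (b - d) -> V (f d).
Proof. by move=> hV; have := svalP (cid (lim_ex b)); apply. Qed.

Let nbhsN U : nbhs (0 : B) U -> nbhs (0 : B) [set z | U (- z)].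
Proof. by move=> h; apply: nbhs_opp; rewrite oppr0. Qed.

(** The value at [b] is the limit of the images of elements of [D] near [b]; algebraic identities
    pass to the limit by choosing approximations good for both sides at once. *)
Lemma extend_hom : exists F : B -> C, tring_hom F /\ forall d, D d -> F d = f d.
Proof.
exists F.
have FD d : D d -> F d = f d.
  move=> Dd; apply: hC => U V hU hV; exists (f d); split; last exact: nbhs_singleton hV.
  by have [P hP] := FP hU; apply=> //; rewrite subrr; exact: nbhs_singleton hP.
have FB b b' : F (b - b') = F b - F b'.
  apply: hC => U V hU hV.
  have [P hP hPU] := FP hU.
  have [Q [R [hQ hR QR]]] := nbhs_add hV.
  have {}hR := nbhs_opp hR.
  have [P1 hP1 Q1] := FP hQ; have [P2 hP2 Q2] := FP hR.
  have [P0 hP0 hPP] := nbhs0_sub hP.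
  have [d Dd [d1 d0]] := Ddense b (filterI hP1 hP0).
  have [d' Dd' [d1' d0']] := Ddense b' (filterI hP2 hP0).
  exists (f (d - d')); split.
    apply: hPU; first exact: DB.
    have -> : b - b' - (d - d') = (b - d) - (b' - d') by ring.
    exact: hPP.
  by rewrite fB //; apply: QR; [exact: Q1|exact: Q2].
have FM b b' : F (b * b') = F b * F b'.
  apply: hC => U V hU hV.
  have [P hP hPU] := FP hU.
  have [Q [R [hQ hR QR]]] := nbhs_mul hV.
  have [P1 hP1 Q1] := FP hQ; have [P2 hP2 Q2] := FP hR.
  have : nbhs (b * b') [set z | P (b * b' - z)].
    apply/nbhs_shift; apply: filterS (nbhsN hP) => z /=.
    by have -> : b * b' - (z + b * b') = - z by ring.
  move=> /nbhs_mul[S [T [hS hT ST]]].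
  have {}hS : nbhs (0 : B) [set z | S (b - z)].
    move/nbhs_shift: hS => /nbhsN; apply: filterS => z /=.
    by rewrite addrC.
  have {}hT : nbhs (0 : B) [set z | T (b' - z)].
    move/nbhs_shift: hT => /nbhsN; apply: filterS => z /=.
    by rewrite addrC.
  have [d Dd [d1 /= d0]] := Ddense b (filterI hP1 hS).
  have [d' Dd' [d1' /= d0']] := Ddense b' (filterI hP2 hT).
  exists (f (d * d')); split.
    apply: hPU; first exact: DM.
    by have := ST _ _ d0 d0'; rewrite !subKr.
  by rewrite fM //; apply: QR; [exact: Q1|exact: Q2].
split=> //; split=> //.
  by split=> //; rewrite FD.
apply: zmod_continuous => // V /nbhs0_sub[V' hV' VV].
have [U hU fU] := fcont hV'; have [U0 hU0 UU] := nbhs0_sub hU.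
apply: filterS (hU0) => b Ub /=.
have : nbhs (F b) [set z | V' (- (F b - z))].
  apply/nbhs_shift; apply: filterS hV' => z /=.
  by have -> : - (F b - (z + F b)) = z by ring.
move=> /FP[W hW fW].
have [d Dd [d1 d2]] := Ddense b (filterI hW hU0).
have h1 := fW d Dd d1.
have h2 : V' (f d).
  by apply: fU => //; have := UU _ _ Ub d2; rewrite subKr.
have -> : F b = f d - (- (F b - f d)) by ring.
exact: VV.
Qed.

Lemma dense_unique (F1 F2 : B -> C) : tring_hom F1 -> tring_hom F2 ->
  (forall d, D d -> F1 d = F2 d) -> F1 = F2.
Proof.
move=> [b1 _ c1] [b2 _ c2] e; apply/funext => b; apply: hC => U V hU hV.
have h1 : nbhs b (F1 @^-1` U) := c1 b _ hU.
have h2 : nbhs b (F2 @^-1` V) := c2 b _ hV.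
have : nbhs (0 : B) [set z | U (F1 (b - z)) /\ V (F2 (b - z))].
  have h3 : nbhs b (F1 @^-1` U `&` F2 @^-1` V) by exact: filterI.
  move/nbhs_shift: h3 => /nbhsN; apply: filterS => z /=.
  by rewrite [- z + b]addrC.
move=> /(Ddense b)[d Dd]; rewrite /= subKr => -[k1 k2]; exists (F1 d); split=> //.
by rewrite e.
Qed.

End ExtendHom.

Section BoundedSets.
Context (C : topComRingType).
Implicit Types S T : set C.

Lemma bounded_mul S T : bounded S -> bounded T ->
  bounded [set z | exists s t, [/\ S s, T t & z = s * t]].
Proof.
move=> hS hT U /hT[V hV VT]; have [W hW WS] := hS V hV; exists W => // w _ Ww [s [t [Ss Tt ->]]].
by rewrite mulrA; apply: VT => //; exact: WS.
Qed.

Lemma bounded_prod n (t : nat -> C) : (forall j, (j < n)%N -> power_bounded (t j)) ->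
  bounded [set z | exists e : nat -> nat, z = \prod_(j < n) t j ^+ e j].
Proof.
elim: n => [_ U hU|n IH ht].
  by exists U => // x _ Ux [e ->]; rewrite big_ord0 mulr1.
have h1 : bounded [set z | exists e : nat -> nat, z = \prod_(j < n) t j ^+ e j].
  by apply: IH => j jn; apply: ht; exact: ltnW.
move=> U hU; have [W hW WU] := bounded_mul h1 (ht n (ltnSn n)) hU.
exists W => // x _ Wx [e ->]; apply: WU => //; rewrite big_ord_recr /=.
by exists (\prod_(j < n) t j ^+ e j), (t n ^+ e n); split=> //; [exists e|exists (e n)].
Qed.

End BoundedSets.

Section StructurePresheafOf.
Variable K : fsplit.
Local Notation A := (kA K).
Local Notation F := (kF K).
Local Notation i := (@ki K).
Local Notation pi := (@kpi K).
Local Notation pi' := (@kpi' K).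
Local Notation pb := (@power_bounded A).
Local Notation X := (spa pb).
Local Notation w := (i pi).
Local Notation E := (X -> nat -> F).
Implicit Types (U V W : set X) (x : X) (a b : A) (h k : F) (us : seq F) (inv : bool).

Definition Opre : presheaf X :=
  @Presheaf X (fun W => secR false W) (fun V W => @sres K false V W).

Lemma secS_cst inv W a : (inv -> forall g, kact g a = a) -> secS inv W (cst (i a)).
Proof.
move=> ha; split=> [j|b g j n x _]; first by apply: appr_cst; exact: FU_i.
by exists 0%N => k _; rewrite eB /cact /cst tF_i ha // subrr; exact: lvl_0.
Qed.

Definition Orho (a : A) : Opre setT := fq (D := secf false setT) (cst (i a)).

Lemma secS_FU U h : FU U h -> secS false U (cst h).
Proof. by move=> hh; split=> // -[V [rV VU]]; apply: appr_cst; exact: FU_sub hh. Qed.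

Definition scst U h : secR false U := fq (D := secf false U) (cst h).

Lemma scst_lev U h (j : secJ U) n : FU U h ->
  qlev (D := secf false U) j n (scst U h) <-> forall x, sval j x -> lvl x n h.
Proof.
move=> hh; rewrite (qlev_fq (D := secf false U) j n (secS_FU hh)); split=> H x jx.
  by have [N hN] := H x jx; exact: hN (leqnn N).
by exists 0%N => k _; exact: H.
Qed.

Lemma scstB U h k : FU U h -> FU U k -> scst U (h - k) = scst U h - scst U k.
Proof. by move=> hh kk; rewrite /scst -fqB //; exact: secS_FU. Qed.
Lemma scstM U h k : FU U h -> FU U k -> scst U (h * k) = scst U h * scst U k.
Proof. by move=> hh kk; rewrite /scst -fqM //; exact: secS_FU. Qed.
Lemma scst1 U : scst U 1 = 1. Proof. exact: (fq1 (secf false U)). Qed.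

Lemma Orho_res U a : sres U (Orho a) = scst U (i a).
Proof. by apply: fq_sres => //; exact: secS_cst. Qed.

Lemma scst_i_hom U : tring_hom (fun a => scst U (i a)).
Proof.
have hB : zmod_morphism (fun a => scst U (i a)).
  by move=> a b; rewrite rmorphB scstB //; exact: FU_i.
split=> //.
  split; first by rewrite rmorph1 scst1.
  by move=> a b; rewrite rmorphM scstM //; exact: FU_i.
apply: zmod_continuous => // B [l [n hB']]; apply/knbhs; exists n => a ha.
apply: hB' => j _; rewrite subr0; apply/scst_lev; first exact: FU_i.
move=> x _; apply/lvl_i; rewrite -[X in _ X](mulr1 (pi ^+ n)).
exact/xmull/spa_pb.
Qed.

Lemma Opre_presheaf : is_presheaf Opre.
Proof.
split=> [U V _ _ VU|U _ s|U V W _ _ _ VU WV s].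
- exact: sres_hom.
- exact: sres_id.
- exact: sres_comp.
Qed.

Lemma sres_peq (U V : set X) (s : secR false U) (t : secR false V) W :
  open U -> open V -> open W -> W `<=` U -> W `<=` V ->
  sres W s = sres W t -> forall x, W x -> peq x (frep s x) (frep t x).
Proof.
move=> oU oV oW WU WV e x Wx.
apply: (peq_tr (v := frep (sres W s) x)); first by apply: peq_sym; exact: sres_rep.
by rewrite e; exact: sres_rep.
Qed.

Lemma Opre_sheaf : is_sheaf Opre.
Proof.
split=> [|I U oU W]; first exact: Opre_presheaf.
split=> [s hs|]; last exact: (sec_initial (inv := false)).
apply: (@sec_glue1 K false) => // j k x Ujx Ukx.
apply: (sres_peq (W := U j `&` U k)) => //; last exact: hs.
exact: openI.
Qed.

Section Localization.
Variables (fs : seq A) (g : A).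
Hypothesis op : open_ideal fs.
Local Notation U := (rational_set fs g : set X).

Lemma sec_zero W (s t : secR false W) : W = set0 -> s = t.
Proof.
move=> W0; apply/sec_eq => V rV VW n x Vx.
by have : (set0 : set X) x by rewrite -W0; exact: VW.
Qed.

Lemma lev_bounded W (S : set (secR false W)) m :
  (forall s, S s -> forall j : secJ W, lev (sval j) 0 (cst (w ^+ m) * frep s)) -> bounded S.
Proof.
move=> H B [l [n hB]].
exists [set t : secR false W | forall j, List.In j l -> qlev (D := secf false W) j (m + n) t].
  by exists l, (m + n)%N => t ht j jl; have := ht j jl; rewrite subr0.
move=> t s ht Ss; apply: hB => j jl; rewrite subr0.
apply: (flev_eq (D := secf false W) (x := frep t * frep s)).
  by rewrite -opprB; apply: fnullN; exact: frepM.
move=> x jx; have [N hN] := H s Ss j x jx; have [M hM] := ht j jl x jx.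
exists (maxn N M) => k; rewrite geq_max => /andP[/hN k1 /hM k2].
rewrite eM -(lvl_wM _ m) mulrCA -[(m + n)%N]addn0.
exact: lvl_M.
Qed.

Lemma unit_pb W h : FU W h -> (forall x, W x -> ext x h 1) ->
  @power_bounded (secR false W) (scst W h).
Proof.
move=> hh h1; apply: (@lev_bounded _ _ 0) => _ [n _ <-] j x jx.
have Wx : W x by have [_ ] := svalP j; apply.
have e : scst W h ^+ n = scst W (h ^+ n).
  elim: (n) => [|k IH]; first by rewrite !expr0 scst1.
  rewrite !exprS IH -scstM //; exact: FU_X.
have [N hN] := sec_fq (secS_FU (FU_X n hh)) (proj1 (svalP j)) (proj2 (svalP j)) 0%N jx.
exists N => k /hN; rewrite e eB eM /cst expr0 mul1r => hk.
rewrite -[frep (scst W (h ^+ n)) x k](subrK (h ^+ n)); apply: lvl_D => //.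
by rewrite /lvl expr0 -(expr1n _ n); apply: ext_exp; exact: h1.
Qed.

Lemma Oloc_inverts : inverts_rational fs g (fun a => scst U (i a)).
Proof.
(* A zero denominator gives the empty set, over which any two sections are equal. *)
have [g0|g0] := eqVneq g 0.
  exists 0; first by apply: sec_zero; rewrite g0 rational0.
  move=> f _; rewrite (_ : _ * _ = scst U 1); last by apply: sec_zero; rewrite g0 rational0.
  apply: unit_pb; first exact: FU_1.
  by move=> x _; apply: extR; exact: F1.
have [ad UE] := adata_rational op g0.
have gU : FU U (i g)^-1.
  by rewrite -UE; apply: spanK_FU (ad) _; case: ad.
exists (scst U (i g)^-1).
  rewrite -scstM //; last exact: FU_i.
  have -> : i g / i g = 1 by rewrite mulfV // i_neq0.
  exact: scst1.
move=> f ffs; rewrite -scstM //; last exact: FU_i.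
apply: unit_pb; first by apply: FU_M => //; exact: FU_i.
by move=> x [h1 h2]; apply/ext_div1 => //; exact: h1.
Qed.

Variables (C : topComRingType) (psi : A -> C).
Hypothesis Cc : complete_ring C.
Hypothesis Cna : nonarchimedean C.
Hypothesis hpsi : tring_hom psi.

Section Universal.
Variable hg : C.
Hypothesis hgE : psi g * hg = 1.
Hypothesis hgf : forall f, f \in fs -> power_bounded (psi f * hg).
Hypothesis g0 : g != 0.

Let us := [seq i f / i g | f <- fs].
Let ad : adata us g. Proof. by case: (adata_rational op g0). Qed.
Let UE : uset us = U. Proof. by case: (adata_rational op g0). Qed.

Let psiB a b : psi (a - b) = psi a - psi b. Proof. by case: hpsi => H _ _; exact: H. Qed.
Let psi0 : psi 0 = 0. Proof. by rewrite -{1}(subrr 0) psiB subrr. Qed.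
Let psi1 : psi 1 = 1. Proof. by case: hpsi => _ [H _] _; exact: H. Qed.
Let psiM a b : psi (a * b) = psi a * psi b. Proof. by case: hpsi => _ [_ H] _; exact: H. Qed.
Let psiX a n : psi (a ^+ n) = psi a ^+ n.
Proof. by elim: n => [|n IH]; rewrite ?expr0 ?psi1 // !exprS psiM IH. Qed.

(** In the algebraic localization every element has the form a / g^m, the powers of pi being units
    of [A]. *)
Let gfrac h : exists q : A * nat, spanK us h -> h = i q.1 / i g ^+ q.2.
Proof.
have [[n hn]|no] := pselect (spanK us h); last by exists (0, 0%N).
have [a [m e]] := span_frac ad hn; exists (pi' ^+ n * a, m) => _ /=.
rewrite rmorphM rmorphXn wV exprVn -mulrA -e mulKf // wX_neq0 //.
Qed.

Let gq h := sval (cid (gfrac h)).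
Let Psi h : C := psi (gq h).1 * hg ^+ (gq h).2.

Let ig0 n : i g ^+ n != 0. Proof. by rewrite expf_neq0 // i_neq0. Qed.

(** Two forms of one fraction give a relation a g^n = b g^m in [A], and the image of g is
    invertible. *)
Let PsiE a m : spanK us (i a / i g ^+ m) -> Psi (i a / i g ^+ m) = psi a * hg ^+ m.
Proof.
move=> hh; rewrite /Psi /gq; case: cid => -[b n] /= /(_ hh) /eqP.
rewrite eqr_div // -!rmorphXn -!rmorphM => /eqP/(@ki_inj K) e.
have e1 q : psi g ^+ q * hg ^+ q = 1 by rewrite -exprMn hgE expr1n.
have : psi (a * g ^+ n) * (hg ^+ n * hg ^+ m) = psi (b * g ^+ m) * (hg ^+ n * hg ^+ m).
  by rewrite e.
rewrite !psiM !psiX.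
have -> : psi a * psi g ^+ n * (hg ^+ n * hg ^+ m) =
  (psi a * hg ^+ m) * (psi g ^+ n * hg ^+ n) by ring.
have -> : psi b * psi g ^+ m * (hg ^+ n * hg ^+ m) =
  (psi b * hg ^+ n) * (psi g ^+ m * hg ^+ m) by ring.
by rewrite !e1 !mulr1.
Qed.

Let PsiB h k : spanK us h -> spanK us k -> Psi (h - k) = Psi h - Psi k.
Proof.
move=> hh kk; have [[n1 s1] [n2 s2]] := (hh, kk).
have eh := svalP (cid (gfrac h)) hh; have ek := svalP (cid (gfrac k)) kk.
rewrite -/(gq h) in eh; rewrite -/(gq k) in ek.
set a := (gq h).1 in eh; set m := (gq h).2 in eh.
set b := (gq k).1 in ek; set n := (gq k).2 in ek.
have e : h - k = i (a * g ^+ n - b * g ^+ m) / i g ^+ (m + n).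
  rewrite eh ek rmorphB !rmorphM !rmorphXn exprD; field.
  by rewrite !ig0.
have e1 q : psi g ^+ q * hg ^+ q = 1 by rewrite -exprMn hgE expr1n.
rewrite e PsiE; last by rewrite -e; exact: spanK_B.
rewrite /Psi -/a -/m -/b -/n psiB !psiM !psiX exprD.
have -> : (psi a * psi g ^+ n - psi b * psi g ^+ m) * (hg ^+ m * hg ^+ n) =
  psi a * hg ^+ m * (psi g ^+ n * hg ^+ n) - psi b * hg ^+ n * (psi g ^+ m * hg ^+ m) by ring.
by rewrite !e1 !mulr1.
Qed.

Let PsiM h k : spanK us h -> spanK us k -> Psi (h * k) = Psi h * Psi k.
Proof.
move=> hh kk.
have eh := svalP (cid (gfrac h)) hh; have ek := svalP (cid (gfrac k)) kk.
rewrite -/(gq h) in eh; rewrite -/(gq k) in ek.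
set a := (gq h).1 in eh; set m := (gq h).2 in eh.
set b := (gq k).1 in ek; set n := (gq k).2 in ek.
have e : h * k = i (a * b) / i g ^+ (m + n).
  by rewrite eh ek mulf_div -exprD rmorphM.
rewrite e PsiE; last by rewrite -e; exact: spanK_M.
by rewrite /Psi -/a -/m -/b -/n psiM exprD; ring.
Qed.

Let Psi_i a : Psi (i a) = psi a.
Proof.
have e : i a = i a / i g ^+ 0 by rewrite expr0 divr1.
have h : spanK us (i a / i g ^+ 0) by rewrite -e; exact: spanK_i.
by rewrite e PsiE // expr0 mulr1.
Qed.

Let PsiD h k : spanK us h -> spanK us k -> Psi (h + k) = Psi h + Psi k.
Proof.
move=> hh kk; have k0 : spanK us (- k) by rewrite -sub0r; apply: spanK_B => //; exact: spanK_0.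
have P0 : Psi 0 = 0 by rewrite -(rmorph0 i) Psi_i.
have := PsiB (spanK_0 us) kk; rewrite sub0r P0 sub0r => e.
by have := PsiB hh k0; rewrite opprK e opprK.
Qed.

Let fu f : f \in fs -> Psi (i f / i g) = psi f * hg.
Proof.
move=> ffs; rewrite -[i g]expr1 PsiE ?expr1 //; apply: spanK_span; apply: span_u.
by apply/mapP; exists f.
Qed.

Let psi_bounded : bounded (psi @` pb).
Proof.
move=> V; rewrite -{1}(mul0r (0 : C)) => /nbhs_mul[P [Q [hP hQ PQ]]].
have /knbhs[n hn] : nbhs (0 : A) (psi @^-1` Q).
  by case: hpsi => _ _ c; apply: c; rewrite psi0.
exists [set z | P (psi (pi' ^+ n) * z)]; first exact: nbhs0_mul.
move=> z _ Pz [a ha <-].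
have -> : z * psi a = (psi (pi' ^+ n) * z) * psi (pi ^+ n * a); last exact: PQ Pz (hn a ha).
have e : psi (pi' ^+ n) * psi (pi ^+ n) = 1.
  by rewrite -psiM -exprMn mulrC mulrC [pi' * _]mulrC kpiV expr1n psi1.
by rewrite psiM mulrACA -[LHS]mul1r -e; ring.
Qed.

(** Elements of [span us] are sums of integral multiples of monomials in the f / g, whose images all
    lie in one bounded set; in a nonarchimedean target, sums cost nothing. *)
Let Psi_bounded : bounded (Psi @` span us).
Proof.
pose t j := psi fs`_j * hg.
have tb j : (j < size fs)%N -> power_bounded (t j) by move=> jn; apply/hgf/mem_nth.
have H := bounded_mul psi_bounded (bounded_prod tb).
move=> V /Cna[S [hS S0 SB SV]]; have [W hW WS] := H S hS; exists W => // z _ Wz [h hh <-].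
have SN y : S y -> S (- y) by move=> ?; rewrite -sub0r; apply: SB.
have SD y y' : S y -> S y' -> S (y + y').
  by move=> h1 h2; rewrite -[y']opprK; apply: SB => //; exact: SN.
(* A monomial factor is carried along so that the induction can multiply by one more generator. *)
suff key : forall e : nat -> nat, S (z * (Psi h * \prod_(j < size fs) t j ^+ e j)).
  by apply: SV; have := key (fun=> 0%N); rewrite big1 ?mulr1.
elim: hh => [a ha e|y y' hy IHy hy' IHy' e|u y /mapP[f ffs ->] hy IHy e].
- apply: WS => //; exists (psi a), (\prod_(j < size fs) t j ^+ e j); split=> //.
  + by exists e.
  + by rewrite Psi_i.
- rewrite PsiD; try exact: spanK_span.
  by rewrite mulrDl mulrDr; apply: SD.
- have fj : (index f fs < size fs)%N by rewrite index_mem.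
  rewrite PsiM; try exact: spanK_span; last by apply/spanK_span/span_u/map_f.
  rewrite fu //.
  have -> : psi f * hg * Psi y * \prod_(j < size fs) t j ^+ e j =
     Psi y * \prod_(j < size fs) t j ^+ (e j + (j == index f fs :> nat)).
    rewrite (bigD1 (Ordinal fj)) //= [in RHS](bigD1 (Ordinal fj)) //= eqxx addn1 exprS.
    rewrite -[psi f * hg](_ : t (index f fs) = _); last by rewrite /t nth_index.
    rewrite (eq_bigr (fun j : 'I__ => t j ^+ (e j + (j == index f fs :> nat)))); first by ring.
    by move=> j; rewrite -val_eqE /= => /negPf ->; rewrite addn0.
  exact: (IHy (fun j => e j + (j == index f fs))%N).
Qed.

(** This is where uniformity is needed: smallness at all points of the rational set means membership
    in a small multiple of [span us], on which Psi is bounded. *)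
Let Psi_cont (V : set C) : nbhs (0 : C) V -> exists n, forall h, spanK us h ->
  (forall x, U x -> lvl x n h) -> V (Psi h).
Proof.
move=> /Psi_bounded[W hW WV]; have [N hN] := span_uniform ad.
have /knbhs[m /(_ 1 (@pb1 K))] : nbhs (0 : A) (psi @^-1` W).
  by case: hpsi => _ _ c; apply: c; rewrite psi0.
rewrite /= mulr1 => hm; exists (N + m)%N => h hh hl.
pose k := h / w ^+ (N + m).
have kK : spanK us k by apply: spanK_M => //; exact: spanK_w.
have kN : span us (w ^+ N * k).
  apply: hN => // x; rewrite UE => /hl; rewrite -(expr0 w) -/(lvl x 0 k) => hx.
  apply/(@lvl_wM _ _ (N + m)); rewrite addn0 /k mulrC divfK //; exact: wX_neq0.
have -> : h = i (pi ^+ m) * (w ^+ N * k).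
  by rewrite rmorphXn mulrA -exprD addnC /k mulrC divfK //; exact: wX_neq0.
rewrite PsiM; [|exact: spanK_i|exact: spanK_span].
by rewrite Psi_i; apply: WV => //; exists (w ^+ N * k).
Qed.

Let D : set (secR false U) := [set d | exists2 h, spanK us h & d = scst U h].
Let fD d : C := if pselect (D d) is left H then Psi (sval (cid2 H)) else 0.

Let uFU h : spanK us h -> FU U h.
Proof. by rewrite -UE; exact: spanK_FU ad. Qed.

Let rU : rat U. Proof. by exists us, g. Qed.

(** If two fractions define the same section, their difference is below every level on the rational
    set, so the image of the difference lies in every neighbourhood of 0. *)
Let fDE h : spanK us h -> fD (scst U h) = Psi h.
Proof.
move=> hh; rewrite /fD; case: pselect => [H|]; last by case; exists h.
case: cid2 => k kk /= e; apply/eqP; rewrite -subr_eq0 -PsiB //; apply/eqP.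
apply: hausdorff_sep => [|V /Psi_cont[n hn]]; first by case: Cc.
apply: hn => [|x Ux]; first exact: spanK_B.
have [j jE] := @secj _ U U rU (@subset_refl _ U).
have /(@scst_lev U _ j n) : FU U (k - h) by apply: uFU; exact: spanK_B.
have -> : scst U (k - h) = 0 by rewrite scstB ?e ?subrr //; exact: uFU.
by rewrite jE => -[H1 _]; apply: H1 => //; exact: (qlev0 (D := secf false U)).
Qed.

(** Algebraic fractions are dense among the sections by [span_dense], so Psi extends by
    continuity. *)
Lemma loc_exists : exists chi : secR false U -> C,
  tring_hom chi /\ forall a, chi (scst U (i a)) = psi a.
Proof.
have D1 : D 1 by exists 1; [exact: spanK_1|rewrite scst1].
have [F0 [hF FE]] : exists F0 : secR false U -> C, tring_hom F0 /\ forall d, D d -> F0 d = fD d.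
  apply: extend_hom => //.
  - move=> _ _ [h hh ->] [k kk ->]; exists (h - k); first exact: spanK_B.
    by rewrite scstB //; exact: uFU.
  - move=> _ _ [h hh ->] [k kk ->]; exists (h * k); first exact: spanK_M.
    by rewrite scstM //; exact: uFU.
  - move=> b S [l [n hS]].
    have [h hh hl] := sec_appr b rU (@subset_refl _ U) n.
    have hh' : FU (uset us) h by rewrite UE.
    have [k kk hk] := span_dense n ad hh'.
    exists (scst U k); first by exists k.
    have kS := secS_FU (uFU kk).
    apply: hS => j _; rewrite subr0 /scst -{1}(fqK b) -fqB //; try exact: (sec_S b).
    apply/(qlev_fq (D := secf false U)).
      by apply: (@fS_B (secf false U)); [exact: (sec_S b)|].
    apply: lev_sub (proj2 (svalP j)) _ => x Ux.
    have [N hN] := hl x Ux; exists N => q /hN h1.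
    have := hk x; rewrite UE => /(_ Ux) h2.
    rewrite eB /cst -[frep b x q](subrK h) -addrA; exact: lvl_D.
  - by rewrite -(scst1 U) fDE -?(rmorph1 i) ?Psi_i ?psi1 //; exact: spanK_i.
  - move=> _ _ [h hh ->] [k kk ->]; rewrite -scstB; try exact: uFU.
    by rewrite !fDE ?PsiB //; exact: spanK_B.
  - move=> _ _ [h hh ->] [k kk ->]; rewrite -scstM; try exact: uFU.
    by rewrite !fDE ?PsiM //; exact: spanK_M.
  - move=> V /Psi_cont[n hn]; have [j jE] := @secj _ U U rU (@subset_refl _ U).
    exists (qlev (D := secf false U) j n); first exact: (fq_nbhs0_lev (D := secf false U)).
    move=> _ [h hh ->]; rewrite fDE // => H; apply: hn => // x Ux.
    by move/(scst_lev j n (uFU hh)): H; apply; rewrite jE.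
exists F0; split=> // a; rewrite FE; first by rewrite fDE ?Psi_i //; exact: spanK_i.
by exists (i a) => //; exact: spanK_i.
Qed.

Lemma loc_unique (chi1 chi2 : secR false U -> C) : tring_hom chi1 -> tring_hom chi2 ->
  (forall a, chi1 (scst U (i a)) = psi a) -> (forall a, chi2 (scst U (i a)) = psi a) ->
  chi1 = chi2.
Proof.
move=> h1 h2 e1 e2; apply: (@dense_unique _ _ D Cc) => //.
  move=> b S [l [n hS]].
  have [h hh hl] := sec_appr b rU (@subset_refl _ U) n.
  have hh' : FU (uset us) h by rewrite UE.
  have [k kk hk] := span_dense n ad hh'.
  exists (scst U k); first by exists k.
  have kS := secS_FU (uFU kk).
  apply: hS => j _; rewrite subr0 /scst -{1}(fqK b) -fqB //; try exact: (sec_S b).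
  apply/(qlev_fq (D := secf false U)).
    by apply: (@fS_B (secf false U)); [exact: (sec_S b)|].
  apply: lev_sub (proj2 (svalP j)) _ => x Ux.
  have [N hN] := hl x Ux; exists N => q /hN h3.
  have := hk x; rewrite UE => /(_ Ux) h4.
  rewrite eB /cst -[frep b x q](subrK h) -addrA; exact: lvl_D.
suff H chi : tring_hom chi -> (forall a, chi (scst U (i a)) = psi a) ->
    forall h, spanK us h -> chi (scst U h) = Psi h.
  by move=> _ [h hh ->]; rewrite !H.
move=> [cB [c1 cM] _] ce h hh.
have eh := svalP (cid (gfrac h)) hh; rewrite -/(gq h) in eh.
have e : chi (scst U h) * psi (g ^+ (gq h).2) = psi (gq h).1.
  rewrite -!ce -cM -scstM; [|exact: uFU|exact: FU_i].
  by rewrite {1}eh rmorphXn divfK.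
by rewrite /Psi -e psiX -mulrA -exprMn hgE expr1n mulr1.
Qed.

End Universal.

Lemma Oloc_universal : inverts_rational fs g psi ->
  exists! chi : secR false U -> C, tring_hom chi /\ chi \o (fun a => scst U (i a)) = psi.
Proof.
move=> [hg hgE hgf]; have [g0|g0] := eqVneq g 0; last first.
  have [chi [h1 h2]] := loc_exists hgE hgf g0; exists chi; split.
    by split=> //; apply/funext.
  move=> chi' [h3 h4]; apply: (loc_unique (hg := hg)) => // a.
  by rewrite -h4.
(* When g = 0 becomes invertible, the target ring is zero. *)
have C0 (c : C) : c = 0.
  have psi0 : psi 0 = 0.
    by case: hpsi => H _ _; rewrite -{1}(subrr 0) H subrr.
  by rewrite -[c]mul1r -hgE g0 psi0 !mul0r.
exists (fun=> 0); split; last by move=> chi _; apply/funext => s; rewrite -(C0 (chi s)) .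
split; last by apply/funext => a /=; rewrite (C0 (psi a)).
split; first by move=> a b /=; rewrite subrr.
  by split=> [|a b] /=; [rewrite (C0 1)|rewrite mulr0].
exact: cst_continuous.
Qed.

End Localization.

Lemma Opre_localization (fs : seq A) g : open_ideal fs ->
  rational_localization fs g (fun a => res Opre setT (rational_set fs g) (Orho a)).
Proof.
move=> op.
have -> : (fun a => res Opre setT (rational_set fs g) (Orho a)) =
    (fun a => scst (rational_set fs g) (i a)).
  by apply/funext => a; exact: Orho_res.
split.
- by apply: (@sec_complete K false).
- exact: (fq_nonarchimedean (D := secf false _)).
- exact: scst_i_hom.
- exact: Oloc_inverts.
- by move=> C psi Cc Cna hpsi; exact: Oloc_universal.
Qed.

Lemma Opre_structure : structure_presheaf Orho.
Proof.
split; [exact: Opre_presheaf| |exact: Opre_localization|].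
  split.
  - move=> a b; rewrite /Orho rmorphB.
    by rewrite -fqB //; exact: (secS_cst (inv := false)).
  - split; first by rewrite /Orho rmorph1; exact: (fq1 (secf false setT)).
    by move=> a b; rewrite /Orho rmorphM -fqM //; exact: (secS_cst (inv := false)).
  - by have [] := scst_i_hom setT.
move=> W oW I.
(* Rational subsets form a basis stable under intersection, so the limit condition over them is a
   case of gluing. *)
have WE : W = \bigcup_(j : I) sval j.
  apply/seteqP; split=> x; last by move=> [[V [rV VW]] _ /VW].
  move=> /(rat_basis oW)[U [rU Ux UW]].
  by exists (exist _ U (conj (rat_rational rU) UW)).
have oI (j : I) : open (sval j) by have [rV _] := svalP j; exact/rat_open/rational_rat.
split; last first.
  have H (W' : set X) : W' = \bigcup_(j : I) sval j ->
      initial_for (fun j : I => @sres K false W' (sval j)).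
    by move=> ->; exact: sec_initial.
  exact: H.
move=> s hs.
have [|||c cS cE] := @sec_glue K false I sval s => //.
  move=> j k x jx kx.
  have rV : rat (sval j `&` sval k).
    by apply: rat_cap; apply: rational_rat; [case: (svalP j)|case: (svalP k)].
  have VW : sval j `&` sval k `<=` W.
    by move=> y [jy _]; case: (svalP j) => _; apply.
  pose l : I := exist _ _ (conj (rat_rational rV) VW).
  apply: (sres_peq (W := sval j `&` sval k)) => //; first exact: openI.
  by rewrite -[LHS]/(res Opre (sval j) (sval l) (s j)) -[RHS]/(res Opre (sval k) (sval l) (s k)) !hs // => y [].
rewrite -WE in cS.
exists (fq (D := secf false W) c); split.
  move=> j; apply/(sec_eqP (oI j)) => x jx.
  have jW : sval j `<=` W by case: (svalP j).
  apply: peq_tr (sres_rep _ jW (oI j) jx) _.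
  by apply: peq_tr (sec_fqP oW cS (jW x jx)) _; exact: cE.
move=> t ht; apply/(sec_eqP oW) => x Wx.
have : (\bigcup_(j : I) sval j) x by rewrite -WE.
move=> [j _ jx]; have jW : sval j `<=` W by case: (svalP j).
apply: peq_tr (sec_fqP oW cS Wx) _; apply: peq_tr (cE j x jx) _.
by rewrite -(ht j); exact: sres_rep.
Qed.

Lemma ideal_pow_pi n : ideal_pow pb [:: pi] n = [set z | exists2 a, pb a & z = pi ^+ n * a].
Proof.
elim: n => [|n IH] /=.
  apply/seteqP; split=> [z hz|z [a ha ->]]; last by rewrite expr0 mul1r.
  by exists z => //; rewrite expr0 mul1r.
rewrite IH; apply/seteqP; split=> [z [c hc ->]|_ [a ha ->]].
  rewrite big_ord1 /=; have [a ha ->] := hc 0%N.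
  by exists a => //; rewrite mulrA -exprS.
exists (fun=> pi ^+ n * a); first by move=> _; exists a.
by rewrite big_ord1 /= mulrA -exprS.
Qed.

Lemma pb_huber_ring : huber_ring A.
Proof.
exists pb, [:: pi]; split.
- exact: kpb.
- exact: open_pb.
- by move=> f; rewrite inE => /eqP ->; exact: kpi_pb.
- move=> U; rewrite knbhs; split=> -[n hn]; exists n.
    by rewrite ideal_pow_pi => _ [a ha ->]; exact: hn.
  by move=> a ha; apply: hn; rewrite ideal_pow_pi; exists a.
Qed.

Lemma pb_sum (J : Type) (r : seq J) (f : J -> A) : (forall j, pb (f j)) -> pb (\sum_(j <- r) f j).
Proof. by move=> h; apply: big_ind => //; [exact: pb0|exact: pbD]. Qed.

Lemma pb_of_bounded a N : (forall k : nat, pb (pi ^+ N * a ^+ k)) -> pb a.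
Proof.
move=> h U /knbhs[m hm]; exists [set z | exists2 b, pb b & z = pi ^+ (m + N) * b].
  exact: nbhs_piX.
move=> _ _ [b hb ->] [k _ <-].
rewrite exprD -!mulrA; apply: hm; rewrite mulrCA; exact: pbM.
Qed.

(** Choose N with pi^N a^j integral for j < n. The equation propagates this to all powers with the
    same N, so the powers of [a] are bounded. *)
Lemma pb_integrally_closed : integrally_closed pb.
Proof.
move=> a n c hc e.
have [N hN] : exists N, forall j, (j < n)%N -> pb (pi ^+ N * a ^+ j).
  elim: (n) => [|m [N IH]]; first by exists 0%N.
  have [M hM] := kabs (a ^+ m); exists (N + M)%N => j; rewrite ltnS leq_eqVlt => /orP[/eqP ->|jm].
    by rewrite exprD -mulrA; apply: pbM => //; apply/pbX/kpi_pb.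
  by rewrite addnC exprD -mulrA; apply: pbM; [apply/pbX/kpi_pb|exact: IH].
apply: (@pb_of_bounded a N); elim/ltn_ind => k IH.
have [/hN //|nk] := ltnP k n.
have an : a ^+ n = - \sum_(j < n) c j * a ^+ j by apply/eqP; rewrite -subr_eq0 opprK e.
rewrite -(subnK nk) exprD an mulrN mulrN; apply: pbN.
rewrite mulr_sumr mulr_sumr; apply: pb_sum => j.
have -> : pi ^+ N * (a ^+ (k - n) * (c j * a ^+ j)) = c j * (pi ^+ N * a ^+ (k - n + j)).
  by rewrite exprD; ring.
apply: pbM => //; apply: IH.
by have := ltn_ord j; move: nk; lia.
Qed.

Lemma pb_huber : huber_pair pb.
Proof.
split=> //; [exact: pb_huber_ring|exact: kpb|exact: open_pb|exact: pb_integrally_closed].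
Qed.

(** For a power-bounded s some pi^m s^n is integral for all n. At a point with |pi s| > 1, the
    identity (pi s)^(m+1) = pi (pi^m s^(m+1)) would bound a value above 1 by |pi|. So pi s is
    integral, with a bound independent of s. *)
Lemma Opre_uniform W : uniform_ring (Opre W).
Proof.
apply: (@lev_bounded W _ 1) => s hs j x jx.
have Wx : W x by have [_ ] := svalP j; apply.
have rj : rat (sval j) by case: (svalP j).
have jW : sval j `<=` W by case: (svalP j).
have [S [l [m hS]] SU] := hs _ (fq_nbhs0_lev (D := secf false W) j 0).
have H (n : nat) : exists N, forall k : nat, (N <= k)%N -> lvl x 0 (w ^+ m * frep s x k ^+ n).
  have h1 : qlev (D := secf false W) j 0 (scst W (w ^+ m) * s ^+ n).
    apply: SU; last by exists n.
    apply: hS => j' _; rewrite subr0; apply/scst_lev; first by rewrite -rmorphXn; exact: FU_i.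
    by move=> y _; apply/lvl_w.
  have e : s ^+ n = fq (D := secf false W) (frep s ^+ n) /\ secS false W (frep s ^+ n).
    elim: n {h1} => [|n [IH1 IH2]].
      by rewrite !expr0; split; [exact: (esym (fq1 (secf false W)))|exact: (fS_1 (secf false W))].
    rewrite !exprS; split; last by apply: (@fS_M (secf false W)) => //; exact: (sec_S s).
    by rewrite (fqM (D := secf false W)) ?IH1 ?fqK //; exact: (sec_S s).
  case: e => e eS; rewrite e /scst -fqM // in h1; last first.
    by apply: secS_FU; rewrite -rmorphXn; exact: FU_i.
  move/(qlev_fq (D := secf false W)): h1 => h1.
  have {}h1 := h1 (@fS_M (secf false W) _ _ (secS_FU (eq_ind _ (FU W) (FU_i W (pi ^+ m)) _ (rmorphXn i m pi))) eS).
  have [N hN] := h1 x jx; exists N => k /hN; rewrite eM /cst.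
  have -> // : (frep s ^+ n) x k = frep s x k ^+ n.
  by elim: (n) => [|q IH]; rewrite ?expr0 // !exprS eM IH.
have [h hh hl] := sec_appr s rj jW 0.
have [N1 hN1] := hl x jx; have [N2 hN2] := H m.+1.
have hF := FU_FX jx hh.
have w1 : lvl x 1 w by rewrite -[X in lvl x 1 X]expr1; apply/lvl_w.
have [wh|wh] := pselect (lvl x 0 (w * h)).
  exists N1 => k /hN1 h1; rewrite eM /cst expr1 -(subrK h (frep s x k)) mulrDr.
  apply: lvl_D => //; apply: (@lvl_le _ _ 0 1) => //.
  by rewrite -[1%N]addn0; apply: lvl_M.
have k1 := hN1 (maxn N1 N2) (leq_maxl _ _); have k2 := hN2 (maxn N1 N2) (leq_maxr _ _).
move: (frep s x (maxn N1 N2)) k1 k2 => c k1 k2.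
case: (@lvl_w K x 1 0) => + _; rewrite ltnn => h0; exfalso; suff: lvl x 1 (w ^+ 0) by move/h0.
have wc : ~ lvl x 0 (w * c).
  move=> wc; apply: wh; have -> : w * h = w * c - w * (c - h) by ring.
  apply: lvl_B => //; apply: (@lvl_le _ _ 0 1) => //.
  by rewrite -[1%N]addn0; apply: lvl_M.
have cF : FX x c by rewrite -(subrK h c); apply: FXD => //; exact: lvl_FX k1.
have wcF : FX x (w * c) by apply: FXM => //; exact: lvl_FX w1.
have := ext_exp m.+1 (ext_nle wcF (FXw x 0) wc); rewrite expr0 expr1n => h1.
apply: ext_tr h1 _; rewrite -/(lvl x 1 _).
have -> : (w * c) ^+ m.+1 = w * (w ^+ m * c ^+ m.+1) by rewrite exprMn exprS mulrA.
by rewrite -[1%N]addn0; apply: lvl_M.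
Qed.

Theorem spa_sheafy : sheafy pb.
Proof.
split; first exact: pb_huber.
by exists Opre, Orho; split; [exact: Opre_structure|exact: Opre_sheaf].
Qed.

Theorem spa_stably_uniform : stably_uniform pb.
Proof.
split; first exact: pb_huber.
by exists Opre, Orho; split; [exact: Opre_structure|move=> U _; exact: Opre_uniform].
Qed.

End StructurePresheafOf.

(** * Stalks *)

Section Valuations.
Context (A : comPzRingType) (Gam : ogroup0) (v : A -> Gam).
Hypothesis hv : is_valuation v.

Lemma val_unit a b : a * b = 1 -> v a <> og0.
Proof.
move=> e h; have [_ v1 vM _] := hv; apply: (@og_10 Gam).
by rewrite -v1 -e vM h og_mul0.
Qed.

Lemma val_add0 a b : v a = og0 -> v b = og0 -> v (a + b) = og0.
Proof.
move=> ha hb; have [_ _ _ vA] := hv.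
by have := vA a b; rewrite ha hb => -[h|h]; exact: (og_le_anti h (og_le0 _)).
Qed.

End Valuations.

Section PointValues.
Variable K : fsplit.
Local Notation A := (kA K).
Local Notation F := (kF K).
Local Notation i := (@ki K).
Local Notation pi := (@kpi K).
Local Notation pb := (@power_bounded A).
Local Notation X := (spa pb).
Local Notation w := (i pi).
Local Notation G := (kG K).
Local Notation E := (X -> nat -> F).
Implicit Types (c d : E) (U V W : set X) (g : G) (inv : bool) (x y : X) (u v : nat -> F)
  (h l : F) (k m n : nat).

Definition slt x h l := ext x h l /\ ~ ext x l h.

Lemma slt_FX x h l : slt x h l -> FX x h /\ FX x l.
Proof. by case=> /ext_FX. Qed.
Lemma le_slt_tr x h l h' : ext x h l -> slt x l h' -> slt x h h'.
Proof. by move=> h1 [h2 h3]; split=> [|h4]; [exact: ext_tr h2|apply: h3; exact: ext_tr h1]. Qed.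
Lemma slt_le_tr x h l h' : slt x h l -> ext x l h' -> slt x h h'.
Proof. by move=> [h2 h3] h1; split=> [|h4]; [exact: ext_tr h1|apply: h3; exact: ext_tr h4]. Qed.
Lemma slt_irr x h : ~ slt x h h. Proof. by case. Qed.
Lemma slt_nle x h l : FX x h -> FX x l -> ~ ext x l h -> slt x h l.
Proof. by move=> hh ll n; split=> //; exact: ext_nle n. Qed.
Lemma slt_neq0 x h l : slt x h l -> ~ ext x l 0.
Proof. by move=> hl l0; have [hh _] := slt_FX hl; case: hl => _; apply; exact: ext_tr (ext_0 hh). Qed.
Lemma slt_D x h l h' : slt x h h' -> slt x l h' -> slt x (h + l) h'.
Proof.
move=> [h1 h2] [l1 l2]; split=> [|H]; first exact: ext_D.
have [hh _] := ext_FX h1; have [ll _] := ext_FX l1.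
by have [H'|H'] := vr_add (ext_vrel x) hh ll; [apply: h2|apply: l2]; exact: ext_tr H'.
Qed.
Lemma slt_N x h l : slt x h l -> slt x (- h) l.
Proof.
move=> hl; apply: le_slt_tr (hl); apply: ext_N.
by apply: extR; have [] := slt_FX hl.
Qed.
Lemma slt_M x h l h' : slt x h l -> FX x h' -> ~ ext x h' 0 -> slt x (h * h') (l * h').
Proof.
move=> hl h'F h'0; have [hh ll] := slt_FX hl; case: hl => h1 h2.
split=> [|H]; first by apply: ext_mul => //; exact: extR.
by apply: h2; apply: ext_can H.
Qed.
Lemma lvlS_slt x m : slt x (w ^+ m.+1) (w ^+ m).
Proof. by split=> [|/(lvl_w x m.+1 m)]; [exact/(lvl_w x m m.+1)|rewrite ltnn]. Qed.

Definition evl x u l := exists N, forall k, (N <= k)%N -> ext x (u k) l.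

(* [h] is a value at [x] of the Cauchy sequence [u] *)
Definition near x u h := FX x h /\
  ((ext x h 0 /\ peq x u (fun=> 0)) \/
   exists N, forall k, (N <= k)%N -> slt x (u k - h) h).

(** The error is strictly smaller than |h|, so [h] and the late terms of [u] have the same size; a
    null sequence falls below any nonzero [l]. *)
Lemma near_le x u h l : near x u h -> FX x l -> ~ ext x l 0 -> ext x h l <-> evl x u l.
Proof.
move=> [hF [[h0 u0]|[N hN]]] lF l0.
  split=> _; last exact: ext_tr h0 (ext_0 lF).
  have [n hn] := ext_below lF l0; have [N hN] := u0 n; exists N => k /hN.
  by rewrite subr0 => h1; exact: ext_tr h1 hn.
split=> [hl|[M hM]].
  exists N => k /hN [h1 _]; rewrite -(subrK h (u k)).
  by apply: ext_D => //; exact: ext_tr h1 hl.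
apply: contrapT => nhl; have lh := slt_nle lF hF nhl.
have h1 := hN (maxn N M) (leq_maxl _ _); have h2 := hM (maxn N M) (leq_maxr _ _).
apply: (@slt_irr x h); have h3 := slt_D (le_slt_tr h2 lh) (slt_N h1).
by move: h3; rewrite subKr.
Qed.

Lemma near_zero x u h : near x u h -> ext x h 0 <-> peq x u (fun=> 0).
Proof.
move=> hu; have [hF hu'] := hu; split=> [h0|u0].
  case: hu' => [[]//|[N hN]]; have := slt_neq0 (hN N (leqnn N)); tauto.
apply: lvl_sep => // n; apply/(near_le hu); [exact: FXw|exact: lvlw|].
by have [N hN] := u0 n; exists N => k /hN; rewrite subr0.
Qed.

Lemma near_uniq x u h h' : near x u h -> near x u h' -> ext x h h'.
Proof.
move=> hu hu'; have [hF _] := hu'; have [h0|h0] := pselect (ext x h' 0).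
  have := (near_zero hu').1 h0 => /(near_zero hu) h1.
  exact: ext_tr h1 (ext_0 hF).
by apply/(near_le hu) => //; apply/(near_le hu') => //; exact: extR.
Qed.

Lemma near_peq x u v h : peq x u v -> near x u h -> near x v h.
Proof.
move=> uv [hF [[h0 u0]|[N hN]]]; split=> //.
  by left; split=> //; apply: peq_tr u0; exact: peq_sym.
right; have h0 := slt_neq0 (hN N (leqnn N)); have [n hn] := ext_below hF h0.
have [M hM] := uv n.+1; exists (maxn N M) => k; rewrite geq_max => /andP[/hN k1 /hM k2].
have -> : v k - h = (u k - h) + - (u k - v k) by ring.
apply: slt_D => //; apply: slt_N; apply: slt_le_tr hn.
exact: le_slt_tr k2 (lvlS_slt x n).
Qed.

Lemma near_cst x h : FX x h -> near x (fun=> h) h.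
Proof.
move=> hF; split=> //; have [h0|h0] := pselect (ext x h 0).
  left; split=> // n; exists 0%N => k _; rewrite subr0.
  exact: ext_tr h0 (ext_0 (FXw x n)).
by right; exists 0%N => k _; rewrite subrr; split=> //; exact: ext_0.
Qed.

Lemma near_ev x u h : near x u h -> exists N m, forall k, (N <= k)%N -> lvl x 0 (w ^+ m * u k).
Proof.
move=> hu; have [hF _] := hu; have [m hm] := FX_bounded hF.
have [wV _] := FXV (FXw x m) (@lvlw _ x m).
have wV0 : ~ ext x (w ^+ m)^-1 0 by case: (FXV (FXw x m) (@lvlw _ x m)).
have /(near_le hu wV wV0)[N hN] : ext x h (w ^+ m)^-1.
  apply: (@ext_can _ x (w ^+ m)) => //; [exact: FXw|exact: lvlw|].
  by rewrite mulVf ?wX_neq0 // mulrC -(expr0 w).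
exists N, m => k /hN h1; rewrite /lvl expr0 -(mulfV (wX_neq0 K m)).
by apply: ext_mul => //; apply: extR; exact: FXw.
Qed.

Lemma peq0_M x u v h : near x v h -> peq x u (fun=> 0) -> peq x (fun k => u k * v k) (fun=> 0).
Proof.
move=> /near_ev[N [m hN]] u0 n; have [M hM] := u0 (m + n)%N.
exists (maxn N M) => k; rewrite geq_max => /andP[/hN k1 /hM]; rewrite !subr0 => k2.
apply/(@lvl_wM _ _ m); rewrite mulrCA -[(m + n)%N]addn0; exact: lvl_M.
Qed.

Lemma near_M x u v h h' : near x u h -> near x v h' -> near x (fun k => u k * v k) (h * h').
Proof.
move=> hu hv; have [hF _] := hu; have [h'F _] := hv; split; first exact: FXM.
have mul0 a b : FX x b -> ext x a 0 -> ext x (a * b) 0.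
  by move=> bF a0; rewrite -[X in ext x _ X](mul0r b); apply: ext_mul => //; exact: extR.
have [h0|h0] := pselect (ext x h 0).
  left; split; first exact: mul0.
  exact: peq0_M hv ((near_zero hu).1 h0).
have [h'0|h'0] := pselect (ext x h' 0).
  left; split; first by rewrite mulrC; exact: mul0.
  have := peq0_M hu ((near_zero hv).1 h'0).
  by rewrite (_ : (fun k => v k * u k) = (fun k => u k * v k)) //; apply/funext => k; exact: mulrC.
right; case: hu => _ [[]//|[N hN]]; case: hv => _ [[]//|[M hM]].
exists (maxn N M) => k; rewrite geq_max => /andP[/hN k1 /hM k2].
have -> : u k * v k - h * h' = (u k - h) * h' + (v k - h') * h + (u k - h) * (v k - h') by ring.
have l1 := slt_M k1 h'F h'0; have l2 := slt_M k2 hF h0.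
rewrite [h' * h]mulrC in l2; apply: slt_D; first exact: slt_D.
apply: le_slt_tr (l1); apply: ext_mul; last by case: k2.
by apply: extR; have [] := slt_FX k1.
Qed.

Lemma near_D x u v h h' h'' : near x u h -> near x v h' -> near x (fun k => u k + v k) h'' ->
  ext x h'' h \/ ext x h'' h'.
Proof.
suff H u1 v1 h1 h1' h1'' : near x u1 h1 -> near x v1 h1' ->
    near x (fun k => u1 k + v1 k) h1'' -> ext x h1' h1 -> ext x h1'' h1.
  move=> hu hv hw; have [hF _] := hu; have [h'F _] := hv.
  have [h1|h1] := pselect (ext x h' h); first by left; exact: H hu hv hw h1.
  right; apply: H hv hu _ (ext_nle h'F hF h1).
  by rewrite (_ : (fun k => v k + u k) = (fun k => u k + v k)) //; apply/funext => k; exact: addrC.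
move=> hu hv hw h1h; have [hF _] := hu; have [h''F _] := hw.
have [h0|h0] := pselect (ext x h1 0).
  apply: ext_tr (ext_0 hF); apply/(near_zero hw) => n.
  have [N hN] := (near_zero hu).1 h0 n.
  have [M hM] := (near_zero hv).1 (ext_tr h1h h0) n.
  exists (maxn N M) => k; rewrite geq_max => /andP[/hN k1 /hM k2].
  by have := lvl_D k1 k2; rewrite !subr0.
apply/(near_le hw) => //.
have [N hN] := (near_le hu hF h0).1 (extR hF); have [M hM] := (near_le hv hF h0).1 h1h.
by exists (maxn N M) => k; rewrite geq_max => /andP[/hN k1 /hM k2]; exact: ext_D.
Qed.

(** A value can be found in [F] itself: a sequence that is not null stays above some level n
    infinitely often, and an approximation of level n then has error smaller than its own size. *)
Lemma near_ex x u : (forall n, exists2 h, FX x h & exists N, forall k, (N <= k)%N -> lvl x n (u k - h)) ->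
  exists h, near x u h.
Proof.
move=> H; have [u0|u0] := pselect (peq x u (fun=> 0)).
  by exists 0; split; [exact: F0|left; split=> //; apply: extR; exact: F0].
have [n hn] : exists n, ~ exists N, forall k, (N <= k)%N -> lvl x n (u k - 0) by exact/existsNP.
have [h hF [N hN]] := H n; exists h; split=> //; right; exists N => k /hN k1.
apply: (le_slt_tr k1); apply: slt_nle => //; first exact: FXw.
move=> hl; apply: hn; exists N => q /hN q1; rewrite subr0 -(subrK h (u q)).
exact: lvl_D.
Qed.

Definition hv x u : F := if pselect (exists h, near x u h) is left H then sval (cid H) else 0.

Lemma hvP x u h : near x u h -> near x u (hv x u).
Proof. by move=> hu; rewrite /hv; case: pselect => [H|[]]; [case: cid|exists h]. Qed.

Lemma sec_near inv W (s : secR inv W) x : open W -> W x -> near x (frep s x) (hv x (frep s x)).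
Proof.
move=> oW Wx; have [U [rU Ux UW]] := rat_basis oW Wx.
have [|h hh] := @near_ex x (frep s x); last exact: hvP hh.
move=> n; have [h hh hl] := sec_appr s rU UW n.
by exists h; [exact: FU_FX hh|exact: hl].
Qed.

Lemma near_cact g x c h : near (gX g x) (c (gX g x)) h -> near x (cact g c x) (tF g^-1%g h).
Proof.
have FXt l : FX (gX g x) l -> FX x (tF g^-1%g l).
  by move=> /extR/gX_ext/ext_FX[].
move=> [hF [[h0 u0]|[N hN]]]; split; try exact: FXt.
  left; split; first by rewrite -(tF0 g^-1%g); exact/gX_ext.
  have /= := @peq_cact K g x c (fun _ _ => 0) u0.
  by rewrite (_ : cact g (fun _ _ => 0) x = fun=> 0) //; apply/funext => k; exact: tF0.
right; exists N => k /hN [h1 h2]; rewrite /cact -tFB.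
by split; [exact/gX_ext|move=> /gX_ext].
Qed.

Definition vlex x u v := ext x (hv x u) (hv x v).

Lemma vlexE x u v h l : near x u h -> near x v l -> vlex x u v <-> ext x h l.
Proof.
move=> hu hl; rewrite /vlex; split=> H.
  by apply: ext_tr (near_uniq hu (hvP hu)) _; apply: ext_tr H _; exact: near_uniq (hvP hl) hl.
by apply: ext_tr (near_uniq (hvP hu) hu) _; apply: ext_tr H _; exact: near_uniq hl (hvP hl).
Qed.

(** The size of a limit is that of its value in [F]. The valuation of the local ring therefore
    extends to the sections over every open set around [x], compatibly with restriction and for both
    kinds of sections. *)
Lemma point_valuation x : exists (Gam : ogroup0) (v : F -> Gam),
  [/\ forall inv W, open W -> W x -> is_valuation (fun s : secR inv W => v (hv x (frep s x))),
      forall inv V W (s : secR inv V), open V -> open W -> W `<=` V -> W x ->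
        v (hv x (frep (sres W s) x)) = v (hv x (frep s x)),
      forall inv W (s : secR inv W), open W -> W x ->
        v (hv x (frep s x)) = og0 <-> peq x (frep s x) (fun=> 0)
    & forall inv W (s t : secR inv W), open W -> W x ->
        vlex x (frep s x) (frep t x) <-> og_le (v (hv x (frep s x))) (v (hv x (frep t x)))].
Proof.
have [Gam [v [v0 v1 vM vA vR]]] := vrel_valuation (ext_vrel x); exists Gam, v.
have veq h l : ext x h l -> ext x l h -> v h = v l.
  move=> h1 h2; have [hF lF] := ext_FX h1.
  by apply: og_le_anti; apply/vR.
have vnear u h : near x u h -> v (hv x u) = v h.
  by move=> hu; apply: veq; [exact: near_uniq (hvP hu) hu|exact: near_uniq hu (hvP hu)].
split.
- move=> inv W oW Wx; split.
  + rewrite -v0; apply: vnear; apply: near_peq (near_cst (F0 x)); apply: peq_sym.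
    exact: (@sec_fqP _ inv W oW 0 x (fS_0 (secf inv W)) Wx).
  + rewrite -v1; apply: vnear; apply: near_peq (near_cst (F1 x)); apply: peq_sym.
    exact: (@sec_fqP _ inv W oW 1 x (fS_1 (secf inv W)) Wx).
  + move=> s t; have hs := sec_near s oW Wx; have ht := sec_near t oW Wx.
    rewrite -vM; [|by case: hs|by case: ht].
    apply: vnear; apply: near_peq (near_M hs ht); apply: peq_sym.
    apply: (@sec_fqP _ inv W oW (frep s * frep t) x _ Wx).
    by apply: (@fS_M (secf inv W)); exact: sec_S.
  + move=> s t; have hs := sec_near s oW Wx; have ht := sec_near t oW Wx.
    have hst := sec_near (s + t) oW Wx.
    have : near x (fun k => frep s x k + frep t x k) (hv x (frep (s + t) x)).
      apply: near_peq hst.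
      apply: (@sec_fqP _ inv W oW (frep s + frep t) x _ Wx).
      by apply: (@fS_D (secf inv W)); exact: sec_S.
    have [sF _] := hs; have [tF _] := ht; have [stF _] := hst.
    by move=> /(near_D hs ht)[h|h]; [left|right]; apply/vR.
- move=> inv V W s oV oW WV Wx; apply: vnear.
  apply: near_peq (sec_near s oV (WV x Wx)); apply: peq_sym.
  exact: sres_rep.
- move=> inv W s oW Wx; have hs := sec_near s oW Wx; have [hF _] := hs.
  rewrite -(near_zero hs) -v0; split=> [h|h0]; first by apply/(vR _ _ hF (F0 x)); rewrite h; case: (og_le_total (v 0) (v 0)).
  by apply: veq => //; exact: ext_0.
- move=> inv W s t oW Wx; have hs := sec_near s oW Wx; have ht := sec_near t oW Wx.
  by rewrite /vlex vR //; [case: hs|case: ht].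
Qed.

Definition nzset inv W (s : secR inv W) : set X :=
  [set x | W x /\ ~ peq x (frep s x) (fun=> 0)].

Lemma below_pert x m h l : ext x (w ^+ m) h -> lvl x m.+1 (h - l) -> ext x (w ^+ m) l.
Proof.
move=> h1 h2; apply: contrapT => h3; have [_ hF] := ext_FX h1.
have lF : FX x l by rewrite -(subKr h l); apply: FXB => //; exact: lvl_FX h2.
have h4 := slt_nle lF (FXw x m) h3.
apply: (@slt_irr x h); apply: slt_le_tr h1; rewrite -(subrK l h).
by apply: slt_D => //; apply: le_slt_tr h2 (lvlS_slt x m).
Qed.

Lemma lvl0_inv x m h : ext x (w ^+ m) h -> lvl x 0 (w ^+ m * h^-1).
Proof.
move=> h1; have [_ hF] := ext_FX h1.
have h0 : ~ ext x h 0 by move=> h0; apply: (@lvlw _ x m); exact: ext_tr h0.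
have h0' : h != 0 by apply/eqP => e; apply: h0; rewrite e; exact: extR (F0 x).
have [hV _] := FXV hF h0.
by rewrite /lvl expr0 -(mulfV h0'); apply: ext_mul => //; exact: extR.
Qed.

(** A fraction a / b close to the section has size at least |pi|^m at [x]. The locus |pi^m b| <= |a|
    is rational, and an error of level m + 1 cannot destroy the lower bound there. *)
Lemma nz_local inv W (s : secR inv W) x : open W -> nzset s x -> exists V m,
  [/\ rat V, V x, V `<=` W & forall y, V y ->
     exists N, forall k, (N <= k)%N -> ext y (w ^+ m) (frep s y k)].
Proof.
move=> oW [Wx u0]; have hu := sec_near s oW Wx; set h := hv _ _ in hu.
have hF : FX x h by case: hu.
have h0 : ~ ext x h 0 by move/(near_zero hu).
have [m hm] := ext_below hF h0.
have [U [rU Ux UW]] := rat_basis oW Wx.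
have [h1 hh1 hl] := sec_appr s rU UW m.+1.
have h1F := FU_FX Ux hh1.
have h1m : ext x (w ^+ m) h1.
  apply: contrapT => n1; have l1 := slt_nle h1F (FXw x m) n1.
  case: hu => _ [[]//|[N hN]]; have [M hM] := hl x Ux.
  have k1 := hN (maxn N M) (leq_maxl _ _); have k2 := hM (maxn N M) (leq_maxr _ _).
  move: (frep s x (maxn N M)) k1 k2 => z k1 k2; apply: (@slt_irr x h).
  have e : h = ((z - h1) + h1) - (z - h) by ring.
  rewrite {1}e; apply: slt_D; last exact: slt_N.
  apply: slt_le_tr hm.
  by apply: slt_D => //; apply: le_slt_tr k2 (lvlS_slt x m).
have [a [b [n [b0 e hb]]]] := hh1.
have E y : U y -> ext y (w ^+ m) h1 <-> y (pi ^+ m * b) a.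
  move=> Uy; rewrite e -[w ^+ m]divr1 -(rmorph1 i) -rmorphXn extE ?mulr1 //; first exact: x10.
  exact: bb_neq0 (hb y Uy).
exists (U `&` [set y | y (pi ^+ m * b) a]), m; split.
- apply: (@rat_ge _ _ _ _ (m + n)) => //.
    by apply: mul_neq0 => //; apply: exp_neq0; exact: pi_neq0.
  by move=> y Uy; rewrite exprD; apply: xmull; exact: hb.
- by split=> //; exact/E.
- by move=> y [/UW].
- move=> y [Uy /(E y Uy) ym]; have [N hN] := hl y Uy; exists N => k /hN k1.
  by apply: below_pert ym _; rewrite -opprB; exact: lvl_N.
Qed.

Definition cinv c : E := fun x k => (c x k)^-1.

Lemma tFVE g h : tF g h^-1 = (tF g h)^-1.
Proof. by have [->|h0] := eqVneq h 0; [rewrite invr0 tF0 invr0|exact: tFV]. Qed.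

(** From 1/h - 1/l = (l - h) / (h l): each of the two inverses costs a factor |pi|^(-m). *)
Lemma cinv_lvl x m n h l : ext x (w ^+ m) h -> lvl x (m.+1 + m + n) (h - l) ->
  lvl x n (h^-1 - l^-1).
Proof.
move=> h1 h2; have h3 : ext x (w ^+ m) l.
  by apply: below_pert h1 _; apply: lvl_le h2; lia.
have nz h' : ext x (w ^+ m) h' -> h' != 0.
  by move=> h4; apply/eqP => e; apply: (@lvlw _ x m); rewrite e in h4.
apply/(@lvl_wM _ _ (m + m)).
have -> : w ^+ (m + m) * (h^-1 - l^-1) = (l - h) * ((w ^+ m * h^-1) * (w ^+ m * l^-1)).
  by rewrite exprD; field; rewrite !nz.
rewrite -[(m + m + n)%N]addn0 -[X in (_ + X)%N]addn0.
apply: lvl_M; last by apply: lvl_M; exact: lvl0_inv.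
by rewrite -opprB; apply: lvl_N; apply: lvl_le h2; lia.
Qed.

(** Near a point of nonvanishing the section is bounded below, so termwise inversion is approximated
    by inverses of approximations. This is what makes the stalks local. *)
Lemma nz_unit inv W (s : secR inv W) : open W ->
  (inv -> forall g x, W x -> W (gX g x)) ->
  [/\ open (nzset s), inv -> forall g x, nzset s x -> nzset s (gX g x)
    & is_unit (sres (nzset s) s)].
Proof.
move=> oW Wg.
have loc x : nzset s x -> exists V m, [/\ rat V, V x, V `<=` nzset s & forall y, V y ->
     exists N, forall k, (N <= k)%N -> ext y (w ^+ m) (frep s y k)].
  move=> sx; have [V [m [rV Vx VW hV]]] := nz_local oW sx.
  exists V, m; split=> // y Vy; split; first exact: VW.
  move=> /(_ m.+1)[N hN]; have [M hM] := hV y Vy.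
  have k1 := hN (maxn N M) (leq_maxl _ _); have k2 := hM (maxn N M) (leq_maxr _ _).
  rewrite subr0 in k1; exact: (@slt_irr y (w ^+ m)) (le_slt_tr k2 (le_slt_tr k1 (lvlS_slt y m))).
have oN : open (nzset s).
  rewrite openE => x /loc[V [m [rV Vx VN _]]]; apply: (filterS VN).
  by apply: open_nbhs_nbhs; split=> //; exact: rat_open.
have gN : inv -> forall g x, nzset s x -> nzset s (gX g x).
  move=> b g x [Wx u0]; split; first exact: Wg.
  move=> h1; apply: u0.
  have /= := @peq_cact K g x (frep s) (fun _ _ => 0) h1.
  rewrite (_ : cact g (fun _ _ => 0) x = fun=> 0); last by apply/funext => k; exact: tF0.
  by apply: peq_tr; apply: peq_sym; exact: sec_invP.
split=> //.
have iS : secS inv (nzset s) (cinv (frep s)).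
  apply: secSP => //.
    move=> x /loc[V [m [rV Vx VN hV]]]; exists V; split=> // n.
    have VW : V `<=` W by move=> y /VN[].
    have [h hh hl] := sec_appr s rV VW (m.+1 + m + n).
    have hm y : V y -> ext y (w ^+ m) h.
      move=> Vy; have [N hN] := hl y Vy; have [M hM] := hV y Vy.
      have k1 := hN (maxn N M) (leq_maxl _ _); have k2 := hM (maxn N M) (leq_maxr _ _).
      by apply: below_pert k2 _; apply: lvl_le k1; lia.
    have h0 : h != 0 by apply/eqP => e; apply: (@lvlw _ x m); have := hm x Vx; rewrite e.
    exists h^-1; first exact: FU_V hm.
    move=> y Vy; have [N hN] := hl y Vy; have [M hM] := hV y Vy.
    exists (maxn N M) => k; rewrite geq_max => /andP[/hN k1 /hM k2].
    exact: cinv_lvl k2 k1.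
  move=> b g x sx; have [V [m [rV Vx VN hV]]] := loc x sx.
  have Wx : W x by case: sx.
  move=> n; have [N hN] := sec_invP oW s b g Wx (m.+1 + m + n); have [M hM] := hV x Vx.
  exists (maxn N M) => k; rewrite geq_max => /andP[/hN k1 /hM k2].
  rewrite /cinv /cact tFVE -opprB; apply: lvl_N; apply: (cinv_lvl (m := m)) k2 _.
  by rewrite -opprB; apply: lvl_N.
exists (fq (D := secf inv (nzset s)) (cinv (frep s))).
have sS : secS inv (nzset s) (frep s) by apply: secS_sub (sec_S s) => x [].
rewrite /sres -fqM //; apply/(sec_eqP oN) => x sx.
apply: peq_tr (sec_fqP oN (@fS_M (secf inv (nzset s)) _ _ sS iS) sx) _.
apply: peq_tr (peq_sym (sec_fqP oN (@fS_1 (secf inv (nzset s))) sx)).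
have [V [m [rV Vx VN hV]]] := loc x sx; move=> n; have [N hN] := hV x Vx.
exists N => k /hN k1; rewrite eM /cinv mulfV ?subrr; first exact: lvl_0.
by apply/eqP => e; apply: (@lvlw _ x m); rewrite e in k1.
Qed.

End PointValues.

(** * The v-ringed structure on a quotient of the spectrum *)

Section QuotientStructure.
Variable K : fsplit.
Local Notation A := (kA K).
Local Notation F := (kF K).
Local Notation pb := (@power_bounded A).
Local Notation X := (spa pb).
Variables (inv : bool) (Y : topologicalType) (f : X -> Y) (r : Y -> X).
Hypothesis fr : forall y, f (r y) = y.
Hypothesis fo : forall V, open V <-> open (f @^-1` V).
Hypothesis finv : inv -> forall g x, f (gX g x) = f x.
Hypothesis fib : forall x x', f x = f x' -> x = x' \/ (inv /\ exists g, x' = gX g x).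

(** With [inv] false and [f] the identity this is the structure sheaf of the spectrum; with [inv]
    true and [f] the orbit map it is the sheaf of invariants. The section [r] of [f] only chooses
    the point at which germs are evaluated. *)
Definition qpre : presheaf Y :=
  @Presheaf Y (fun V => secR inv (f @^-1` V)) (fun V W => @sres K inv (f @^-1` V) (f @^-1` W)).
Definition qstr : vstructure Y :=
  @VStructure Y qpre (fun y V s t => vlex (r y) (frep s (r y)) (frep t (r y))).

Let fst (V : set Y) : inv -> forall g x, (f @^-1` V) x -> (f @^-1` V) (gX g x).
Proof. by move=> b g x /=; rewrite finv. Qed.

Let qsheaf : is_sheaf qpre.
Proof.
split.
  split=> [U V _ _ VU|U _ s|U V W _ _ _ VU WV s].
  - by apply: sres_hom => x /VU.
  - exact: sres_id.
  - by apply: sres_comp => x; [exact: VU|exact: WV].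
move=> I U oU W.
have WE : f @^-1` W = \bigcup_j (f @^-1` U j) by rewrite preimage_bigcup.
have oU' j : open (f @^-1` U j) by exact/fo.
split; last first.
  have H (W' : set X) : W' = \bigcup_j (f @^-1` U j) ->
      initial_for (fun j => @sres K inv W' (f @^-1` U j)).
    by move=> ->; exact: sec_initial.
  exact: H.
move=> s hs.
have H (W' : set X) : W' = \bigcup_j (f @^-1` U j) ->
    exists! t : secR inv W', forall j, sres (f @^-1` U j) t = s j.
  move=> ->; apply: sec_glue1 => //; first by move=> b j; exact: fst.
  move=> j k x Ujx Ukx.
  have oI : open (f @^-1` U j `&` f @^-1` U k) by exact: openI.
  have e := hs j k.
  apply: peq_tr (peq_sym (sres_rep (s j) _ oI (conj Ujx Ukx))) _; first by move=> y [].
  rewrite -[sres _ (s j)]/(res qpre (U j) (U j `&` U k) (s j)) e.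
  by apply: (sres_rep (s k) _ oI (conj Ujx Ukx)) => y [].
exact: H.
Qed.

(** The nonvanishing locus of [s] is open and saturated for [f], so its image is an open
    neighbourhood over which [s] is invertible. Conversely a unit has nonzero value. *)
Let qgerm y V (s : qstr V) : open V -> V y ->
  germ_unit y s <-> ~ peq (r y) (frep s (r y)) (fun=> 0).
Proof.
move=> oV Vy; have oV' := (fo V).1 oV; have Vr : V (f (r y)) by rewrite fr.
split=> [[W [oW Wy WV [t ht]]] h0|h0].
  have oW' := (fo W).1 oW; have Wr : W (f (r y)) by rewrite fr.
  have [Gam [v [v1 v2 v3 v4]]] := point_valuation (r y).
  apply: (val_unit (v1 inv _ oW' Wr) ht).
  rewrite -[LHS]/(v (hv (r y) (frep (sres (f @^-1` W) s) (r y)))) v2 //; last by move=> x /WV.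
  exact/v3.
have [oN gN uN] := nz_unit s oV' (@fst V).
pose N := f @` (nzset s).
have NE : f @^-1` N = nzset s.
  apply/seteqP; split=> [x [x' hx' e]|x hx]; last by exists x.
  have [<- //|[b [g ->]]] := fib e.
  exact: gN.
exists N; split.
- by apply/fo; rewrite NE.
- by exists (r y) => //; split.
- by move=> _ [x [Vx _] <-].
- have H (W' : set X) : W' = nzset s -> is_unit (sres W' s) by move=> ->.
  exact: H.
Qed.

Lemma qstr_residue y : residue_valuation qstr y.
Proof.
have [Gam [v [v1 v2 v3 v4]]] := point_valuation (r y).
exists Gam, (fun V (s : secR inv (f @^-1` V)) => v (hv (r y) (frep s (r y)))).
have fry V : V y -> (f @^-1` V) (r y) by rewrite /preimage /= fr.
split.
- by move=> V oV Vy; apply: v1; [exact/fo|exact: fry].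
- move=> U V oU oV Vy VU s; apply: v2; [exact/fo|exact/fo|by move=> x /VU|exact: fry].
- move=> U oU Uy s; have q := qgerm s oU Uy.
  have e := v3 inv _ s ((fo U).1 oU) (fry U Uy).
  split=> [/e h /q|h]; first by apply.
  by apply/e; apply: contrapT => h'; apply: h; exact/q.
- by move=> U oU Uy s t; apply: v4; [exact/fo|exact: fry].
Qed.

Lemma qstr_ringed : v_ringed qstr.
Proof.
split; first exact: qsheaf.
- by move=> V _; apply: sec_complete; exact: fst.
- move=> y U oU Uy; have [Gam [v [v1 v2 v3 v4]]] := qstr_residue y.
  have [e0 _ _ _] := v1 U oU Uy; split; first exact: ((v3 U oU Uy 0).1 e0).
  move=> s t hst; apply: contrapT => /not_orP[hs ht].
  have hs' : v U s = og0 by exact/v3.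
  have ht' : v U t = og0 by exact/v3.
  by move: hst; apply/(v3 U oU Uy); exact: (val_add0 (v1 U oU Uy)).
- exact: qstr_residue.
Qed.

End QuotientStructure.

(** * The spectrum as a v-ringed space and the induced action *)

Section SpaStructure.
Variable K : fsplit.
Local Notation A := (kA K).
Local Notation F := (kF K).
Local Notation i := (@ki K).
Local Notation pi := (@kpi K).
Local Notation pb := (@power_bounded A).
Local Notation X := (spa pb).
Local Notation w := (i pi).
Local Notation G := (kG K).
Local Notation E := (X -> nat -> F).
Implicit Types (c d : E) (U V W : set X) (g : G) (x y : X) (u v : nat -> F) (h l : F) (k m n : nat).

Definition Ostr : vstructure X :=
  @VStructure X (@Opre K) (fun x V s t => vlex x (frep s x) (frep t x)).

Lemma Ostr_ringed : v_ringed Ostr.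
Proof.
apply: (@qstr_ringed K false X id id) => //.
by move=> x x' e; left.
Qed.

Lemma near_Orho x a : near x (frep (Orho a) x) (i a).
Proof.
apply: near_peq (near_cst (FX_i x a)); apply: peq_sym.
by apply: (@sec_fqP K false setT openT (cst (i a)) x) => //; exact: secS_cst.
Qed.

(** A perturbation d with |d| < |b| / |c| does not affect |a c| < |b|, and such a bound on d follows
    from one level on a rational set around [x]. *)
Lemma vlex_continuous x W : open W -> W x ->
  continuous_class (fun s t : Opre K W => vlex x (frep s x) (frep t x)).
Proof.
move=> oW Wx; have [Gam [v [v1 v2 v3 v4]]] := point_valuation x.
pose vW (s : secR false W) := v (hv x (frep s x)).
have [e0 e1 eM eA] : is_valuation vW := v1 false W oW Wx.
have E (s t : secR false W) : vlex x (frep s x) (frep t x) <-> og_le (vW s) (vW t) by exact: v4.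
have [U [rU Ux UW]] := rat_basis oW Wx; have [j jE] := secj rU UW.
have main : forall b c : secR false W, ~ vlex x (frep b x) (frep (0 : secR false W) x) ->
    ~ vlex x (frep c x) (frep (0 : secR false W) x) -> exists m, forall a d : secR false W,
      ~ vlex x (frep b x) (frep (a * c) x) -> qlev (D := secf false W) j m.+1 d ->
      ~ vlex x (frep b x) (frep ((d + a) * c) x).
  move=> b c b0' c0'.
  have b0 : ~ og_le (vW b) og0 by move=> h; apply: b0'; apply/(E b 0); rewrite e0.
  have c0 : ~ og_le (vW c) og0 by move=> h; apply: c0'; apply/(E c 0); rewrite e0.
  have nz (s : secR false W) : ~ og_le (vW s) og0 -> ~ ext x (hv x (frep s x)) 0.
    move=> h /(near_zero (sec_near s oW Wx))/(v3 false W s oW Wx) h0.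
    by apply: h; rewrite /vW h0; exact: og_le0.
  have hb := sec_near b oW Wx; have hc := sec_near c oW Wx.
  have [bF _] := hb; have [cF _] := hc.
  have [cV cV0] := FXV cF (nz c c0).
  have bc0 : ~ ext x (hv x (frep b x) / hv x (frep c x)) 0.
    exact: (vr_nz (ext_vrel x)) (nz b b0) cV0.
  have [m hm] := ext_below (FXM bF cV) bc0.
  have nzc : hv x (frep c x) != 0.
    by apply/eqP => e; apply: (nz c c0); rewrite e; exact: extR (F0 x).
  exists m => a d ha hd /(E b ((d + a) * c)); rewrite mulrDl => H.
  have h1 : og_le (vW b) (vW (d * c)).
    case: (eA (d * c) (a * c)) => h; first exact: (og_le_trans H h).
    by case: ha; apply/(E b (a * c)); exact: (og_le_trans H h).
  have {}h1 := (E b (d * c)).2 h1.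
  have hdn := sec_near d oW Wx.
  have dm : ext x (hv x (frep d x)) (w ^+ m.+1).
    apply/(near_le hdn); [exact: FXw|exact: lvlw|].
    by have := hd x; rewrite jE => /(_ Ux).
  have dcS : secS false W (frep d * frep c) by apply: (@fS_M (secf false W)); exact: sec_S.
  have hdc : near x (frep (d * c) x) (hv x (frep d x) * hv x (frep c x)).
    by apply: near_peq (near_M hdn hc); apply: peq_sym; exact: (sec_fqP oW dcS Wx).
  have {}h1 := (vlexE hb hdc).1 h1.
  apply: (@slt_irr K x (hv x (frep b x) / hv x (frep c x))).
  apply: le_slt_tr (slt_le_tr (lvlS_slt x m) hm).
  apply: ext_tr dm; apply: (@ext_can _ x (hv x (frep c x))) => //; [exact: FXM|by case: hdn|exact: nz|].
  by rewrite divfK.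
move=> b c b0 c0; have [m hm] := main b c b0 c0; rewrite openE => a ha; apply/nbhs_shift.
by apply: filterS (fq_nbhs0_lev (D := secf false W) j m.+1) => d hd; exact: hm ha hd.
Qed.

Lemma Ostr_spa : spa_structure (O := Ostr) (@Orho K).
Proof.
split.
- exact: pb_huber.
- exact: Opre_structure.
- exact: Ostr_ringed.
- by move=> x a b; rewrite /= (vlexE (near_Orho x a) (near_Orho x b)) ext_i.
- by move=> x U oU Ux; exact: vlex_continuous.
Qed.

Lemma secB_peq inv W (s t : secR inv W) x : open W -> W x ->
  peq x (frep (s - t) x) ((frep s - frep t) x).
Proof.
move=> oW Wx; have -> : s - t = fq (D := secf inv W) (frep s - frep t).
  by rewrite fqB ?fqK //; exact: sec_S.
by apply: sec_fqP => //; apply: (@fS_B (secf inv W)); exact: sec_S.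
Qed.

Lemma secS_cact g V c : secS false V c -> secS false (gX g @^-1` V) (cact g c).
Proof.
move=> [h1 _]; split=> // -[U [rU UV]] /=.
have rU' := rat_gX g^-1%g rU.
have UV' : gX g^-1%g @^-1` U `<=` V by move=> x /UV; rewrite /preimage /= gXKV.
have [j jE] := secj rU' UV'; have := h1 j; rewrite jE => /(appr_cact g).
by rewrite gX_preimage.
Qed.

Definition pull g V (s : Ostr V) : Ostr (gX g @^-1` V) :=
  fq (D := secf false (gX g @^-1` V)) (cact g (frep s)).

Definition act g : vmor Ostr Ostr := @VMor X X Ostr Ostr (gX g) (@pull g).

Lemma pullP g V (s : Ostr V) x : open V -> V (gX g x) ->
  peq x (frep (pull g s) x) (cact g (frep s) x).
Proof.
move=> oV Vx; apply: (@sec_fqP K false _ (gX_open g oV)) => //.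
exact: secS_cact (sec_S s).
Qed.

Lemma pull_fq g V c : open V -> secS false V c ->
  pull g (fq (D := secf false V) c) = fq (D := secf false (gX g @^-1` V)) (cact g c).
Proof.
move=> oV cS; apply/(sec_eqP (gX_open g oV)) => x Vx.
apply: peq_tr (pullP _ oV Vx) _.
apply: peq_tr (peq_sym (sec_fqP (gX_open g oV) (secS_cact g cS) Vx)).
by apply: peq_cact; exact: sec_fqP.
Qed.

Lemma pull_hom g V : open V -> tring_hom (@pull g V).
Proof.
move=> oV; have S (s : Ostr V) := secS_cact g (sec_S s).
have pB : zmod_morphism (@pull g V).
  move=> s t; rewrite /pull -fqB; try exact: S.
  apply/(sec_eqP (gX_open g oV)) => x Vx.
  apply: peq_tr (pullP _ oV Vx) _; apply: peq_sym.
  apply: peq_tr (sec_fqP (gX_open g oV) (@fS_B (secf false _) _ _ (S s) (S t)) Vx) _.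
  rewrite -cactB; apply: peq_cact; apply: peq_sym.
  exact: secB_peq.
split=> //.
  split.
    have -> : (1 : Ostr V) = fq (D := secf false V) 1 by exact: (esym (fq1 _)).
    by rewrite (pull_fq g oV (fS_1 (secf false V))) cact_one; exact: (fq1 (secf false _)).
  move=> s t; rewrite /pull -fqM; try exact: S.
  apply/(sec_eqP (gX_open g oV)) => x Vx.
  apply: peq_tr (pullP _ oV Vx) _; apply: peq_sym.
  apply: peq_tr (sec_fqP (gX_open g oV) (@fS_M (secf false _) _ _ (S s) (S t)) Vx) _.
  rewrite -cactM; apply: peq_cact; apply: peq_sym.
  exact: (sec_fqP oV (@fS_M (secf false _) _ _ (sec_S s) (sec_S t)) Vx).
apply: zmod_continuous => // B [l [n hB]].
have tr (j : secJ (gX g @^-1` V)) : exists j' : secJ V, sval j' = gX g^-1%g @^-1` (sval j).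
  have [rj jV] := svalP j; apply: secj; first exact: rat_gX.
  by move=> x /jV; rewrite /preimage /= gXKV.
pose f j := sval (cid (tr j)).
exists (map f l), n => t ht; apply: hB => j jl; rewrite subr0.
have := ht (f j) (List.in_map f l j jl); rewrite subr0 /f; case: cid => j' /= j'E h1.
apply/(qlev_fq (D := secf false (gX g @^-1` V))); first exact: S.
by have := lev_cact (g := g) h1; rewrite j'E gX_preimage.
Qed.

Lemma vlex_cact g x c d : (exists h, near (gX g x) (c (gX g x)) h) ->
  (exists h, near (gX g x) (d (gX g x)) h) ->
  vlex x (cact g c x) (cact g d x) <-> vlex (gX g x) (c (gX g x)) (d (gX g x)).
Proof.
move=> [h hh] [l hl]; rewrite (vlexE hh hl) (vlexE (near_cact hh) (near_cact hl)).
by rewrite gX_ext.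
Qed.

Lemma vlex_peq x u v u' v' h l : near x u h -> near x v l -> peq x u u' -> peq x v v' ->
  vlex x u' v' <-> vlex x u v.
Proof.
move=> hh hl uu vv; rewrite (vlexE hh hl).
by rewrite (vlexE (near_peq uu hh) (near_peq vv hl)).
Qed.

Lemma act_vmor g : is_vmor (act g).
Proof.
split.
- exact: gX_continuous.
- by move=> V oV; exact: pull_hom.
- move=> V W oV oW WV s; apply/(sec_eqP (gX_open g oW)) => x Wx.
  apply: peq_tr (sres_rep _ _ (gX_open g oW) Wx) _; first by move=> z /WV.
  apply: peq_tr (pullP _ oV (WV _ Wx)) _; apply: peq_sym.
  apply: peq_tr (pullP _ oW Wx) _; apply: peq_cact; exact: sres_rep.
- move=> x V oV Vx s t.
  have hs := sec_near s oV Vx; have ht := sec_near t oV Vx.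
  have [h hh] : exists h, near (gX g x) (frep s (gX g x)) h by eexists; exact: hs.
  have [l hl] : exists h, near (gX g x) (frep t (gX g x)) h by eexists; exact: ht.
  have e := vlex_peq (near_cact hh) (near_cact hl)
    (peq_sym (pullP s oV Vx)) (peq_sym (pullP t oV Vx)).
  by rewrite /= e; apply: vlex_cact; [exists h|exists l].
Qed.

Lemma act_vaction : is_vaction act.
Proof.
split.
- exact: act_vmor.
- exact: gX1.
- exact: gXM.
- move=> V oV s; apply/(sec_eqP oV) => x Vx.
  apply: peq_tr (sres_rep _ _ oV Vx) _; first by move=> z; rewrite /preimage /= gX1.
  by apply: peq_tr (pullP _ oV _) _; rewrite ?gX1 // cact1; exact: peq_refl.
- move=> g h V oV s; have oV1 := gX_open g oV; have oV2 := gX_open h oV1.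
  have oV3 := gX_open (g * h)%g oV.
  apply/(sec_eqP oV3) => x Vx; have Vx' : V (gX g (gX h x)) by rewrite -gXM.
  apply: peq_tr (sres_rep _ _ oV3 Vx) _; first by move=> z; rewrite /preimage /= gXM.
  apply: peq_tr (pullP _ oV1 Vx') _; apply: peq_sym.
  apply: peq_tr (pullP _ oV Vx) _; rewrite -cact_comp; apply: peq_cact; apply: peq_sym.
  exact: pullP.
Qed.

Lemma act_induced : induced_action (@kact K) (O := Ostr) (@Orho K) act.
Proof.
move=> g; split=> [x a b|a]; first exact: gXE.
apply/(sec_eqP (gX_open g openT)) => x _; apply: peq_tr (pullP _ openT I) _.
apply: peq_sym; apply: peq_tr (sres_rep _ _ (gX_open g openT) I) _ => //.
apply: (peq_tr (v := cst (i (kact g^-1%g a)) x)).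
  by apply: (@sec_fqP K false setT openT) => //; exact: secS_cst.
have -> : cst (i (kact g^-1%g a)) = cact g (cst (i a)).
  by apply/funext => z; apply/funext => k; rewrite /cact /cst tF_i.
apply: peq_cact; apply: peq_sym.
by apply: (@sec_fqP K false setT openT) => //; exact: secS_cst.
Qed.

End SpaStructure.

(** * The quotient *)

Section OrbitSpace.
Variable K : fsplit.
Local Notation pb := (@power_bounded (kA K)).
Local Notation X := (spa pb).

(** Orbits are stored as subsets, so that points of the quotient are equal when their orbits are;
    the topology given to them below is the quotient topology. *)
Record orb : Type := Orb {
  orb_set : set X;
  orbP : exists x, orb_set = range (fun g : kG K => gX g x) }.

HB.instance Definition _ := gen_eqMixin orb.
HB.instance Definition _ := gen_choiceMixin orb.

Definition orb_of (x : X) : orb := Orb (ex_intro _ x erefl).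
Definition orb_rep (y : orb) : X := sval (cid (orbP y)).

Lemma orb_repK y : orb_of (orb_rep y) = y.
Proof.
rewrite /orb_rep; case: cid => x /=; case: y => S p /= e.
rewrite /orb_of; subst S; congr Orb; exact: Prop_irrelevance.
Qed.

Lemma orb_eqP x x' : orb_of x = orb_of x' <-> exists g, gX g x = x'.
Proof.
split=> [[/(congr1 (fun S : set X => S x')) e]|[g <-]].
  have [g _ h] : range (fun g : kG K => gX g x) x' by rewrite e; exists 1%g => //; exact: gX1.
  by exists g.
suff e : range (fun g0 : kG K => gX g0 x) = range (fun g0 : kG K => gX g0 (gX g x)).
  rewrite /orb_of; move: (ex_intro _ _ _) (ex_intro _ _ _); rewrite e => p q.
  by congr Orb; exact: Prop_irrelevance.
apply/seteqP; split=> _ [h _ <-].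
  by exists (h * g^-1)%g => //; rewrite -gXM mulgKV.
by exists (h * g)%g => //; rewrite gXM.
Qed.

Let orb_open : set_system orb := [set V | open (orb_of @^-1` V)].
Let orb_openT : orb_open setT. Proof. exact: openT. Qed.
Let orb_openI U V : orb_open U -> orb_open V -> orb_open (U `&` V).
Proof. exact: openI. Qed.
Let orb_open_bigU (I : Type) (f : I -> set orb) :
  (forall j, orb_open (f j)) -> orb_open (\bigcup_j f j).
Proof. by move=> h; rewrite /orb_open /= preimage_bigcup; by apply: bigcup_open => j _; exact: h. Qed.

HB.instance Definition _ := isOpenTopological.Build orb orb_openT orb_openI orb_open_bigU.

End OrbitSpace.

Section Quotient.
Variable K : fsplit.
Local Notation pb := (@power_bounded (kA K)).
Local Notation X := (spa pb).
Local Notation Y := (orb K).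
Local Notation q := (@orb_of K).

Definition Qstr : vstructure Y := qstr true q (@orb_rep K).
Definition qpull (V : set Y) (s : Qstr V) : Ostr K (q @^-1` V) :=
  fq (D := secf false (q @^-1` V)) (frep s).
Definition qmor : vmor (Ostr K) Qstr := @VMor X Y (Ostr K) Qstr q qpull.

Lemma orb_inv (g : kG K) x : q (gX g x) = q x.
Proof. by apply/esym/orb_eqP; exists g. Qed.

Lemma secS_forget (W : set X) c : secS true W c -> secS false W c.
Proof. by case. Qed.

Lemma qpullP V (s : Qstr V) x : open V -> V (q x) -> peq x (frep (qpull s) x) (frep s x).
Proof.
move=> oV Vx; apply: (@sec_fqP K false (q @^-1` V)) => //.
exact: secS_forget (sec_S s).
Qed.

Lemma qpull_hom V : open V -> tring_hom (@qpull V).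
Proof.
move=> oV; have S (s : Qstr V) := secS_forget (sec_S s).
have oV' : open (q @^-1` V) by [].
have pB : zmod_morphism (@qpull V).
  move=> s t; rewrite /qpull -fqB; try exact: S.
  apply/(sec_eqP oV') => x Vx.
  apply: peq_tr (qpullP _ oV Vx) _; apply: peq_sym.
  apply: peq_tr (sec_fqP oV' (@fS_B (secf false _) _ _ (S s) (S t)) Vx) _.
  apply: peq_sym; exact: secB_peq.
split=> //.
  split.
    apply/(sec_eqP oV') => x Vx; apply: peq_tr (qpullP _ oV Vx) _.
    apply: peq_tr (sec_fqP oV' (@fS_1 (secf true _)) Vx) _.
    by apply: peq_sym; exact: (sec_fqP oV' (@fS_1 (secf false _)) Vx).
  move=> s t; rewrite /qpull -fqM; try exact: S.
  apply/(sec_eqP oV') => x Vx.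
  apply: peq_tr (qpullP _ oV Vx) _; apply: peq_sym.
  apply: peq_tr (sec_fqP oV' (@fS_M (secf false _) _ _ (S s) (S t)) Vx) _.
  apply: peq_sym; exact: (sec_fqP oV' (@fS_M (secf true _) _ _ (sec_S s) (sec_S t)) Vx).
apply: zmod_continuous => // B [l [n hB]]; exists l, n => t ht; apply: hB => j jl.
rewrite subr0; apply/(qlev_fq (D := secf false (q @^-1` V))); first exact: S.
by have := ht j jl; rewrite subr0.
Qed.

Lemma qmor_vmor : is_vmor qmor.
Proof.
split.
- by apply/continuousP => V.
- exact: qpull_hom.
- move=> V W oV oW WV s; have oW' : open (q @^-1` W) by [].
  apply/(sec_eqP oW') => x Wx.
  apply: peq_tr (sres_rep _ _ oW' Wx) _; first by move=> z /WV.
  apply: peq_tr (qpullP _ oV (WV _ Wx)) _; apply: peq_sym.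
  apply: peq_tr (qpullP _ oW Wx) _; apply: (@sres_rep K true) => // z; exact: WV.
- move=> x V oV Vx s t; have oV' : open (q @^-1` V) by [].
  (* The valuation on the quotient is read at a chosen point of the orbit; invariance of the
     sections transports it to [x]. *)
  have [g ge] : exists g, gX g x = orb_rep (q x) by apply/orb_eqP; rewrite orb_repK.
  have Vg : (q @^-1` V) (gX g x) by rewrite /preimage /= orb_inv.
  have hs := sec_near s oV' Vg; have ht := sec_near t oV' Vg.
  have [h hh] : exists h, near (gX g x) (frep s (gX g x)) h by eexists; exact: hs.
  have [l hl] : exists h, near (gX g x) (frep t (gX g x)) h by eexists; exact: ht.
  have P (u : Qstr V) : peq x (cact g (frep u) x) (frep (qpull u) x).
    apply: peq_tr (peq_sym (qpullP u oV Vx)).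
    exact: (sec_invP oV' u isT g Vx).
  have e := vlex_peq (near_cact hh) (near_cact hl) (P s) (P t).
  by rewrite /= -ge e; apply: vlex_cact; [exists h|exists l].
Qed.

Lemma Qstr_ringed : v_ringed Qstr.
Proof.
apply: qstr_ringed => //.
- exact: orb_repK.
- by move=> _ g x; exact: orb_inv.
- by move=> x x' /orb_eqP[g <-]; right; split=> //; exists g.
Qed.

Lemma qmor_quotient : is_quotient (@act K) qmor.
Proof.
split; [exact: Qstr_ringed|exact: qmor_vmor| | |].
- split=> //; last by move=> x y; exact: orb_eqP.
  by apply/seteqP; split=> // y _; exists (orb_rep y) => //; exact: orb_repK.
- move=> V oV; have oV' : open (q @^-1` V) by [].
  split=> [s t e|Fl PF a Fa B [l [n hB]]].
    apply/(sec_eqP oV') => x Vx; apply: peq_tr (peq_sym (qpullP s oV Vx)) _.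
    by rewrite -[qpull s]/(vpull qmor V s) e; exact: qpullP.
  pose S := [set t | forall j, List.In j l ->
     qlev (D := secf false (q @^-1` V)) j n (t - qpull a)].
  have hS : nbhs (qpull a) S by exists l, n.
  have {}hS : Fl (@qpull V @^-1` S) := Fa tt S hS.
  apply: filterS hS => t ht; apply: hB => j jl.
  have [qB _ _] := qpull_hom oV; have := ht j jl; rewrite -qB.
  by move/(qlev_fq (D := secf false (q @^-1` V)) _ _ (secS_forget (sec_S (t - a)))).
- move=> V oV s; have oV' : open (q @^-1` V) by [].
  have Vg g x : V (q x) -> V (q (gX g x)) by rewrite orb_inv.
  have E : forall (t : Ostr K (q @^-1` V)) g,
      (forall x, V (q x) -> peq x (cact g (frep t) x) (frep t x)) <->
      res (Ostr K) (gX g @^-1` (q @^-1` V)) (q @^-1` V) (pull g t) = t.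
    move=> {}s g; split=> [h|e x Vx].
      apply/(sec_eqP oV') => x Vx; apply: peq_tr (sres_rep _ _ oV' Vx) _; first by move=> z; exact: Vg.
      by apply: peq_tr (pullP _ oV' (Vg g x Vx)) _; exact: h.
    apply: peq_tr (peq_sym (pullP s oV' (Vg g x Vx))) _; rewrite -{2}e; apply: peq_sym.
    by apply: (@sres_rep K false) => // z; exact: Vg.
  split=> [[t _ <-] g|H].
    apply/(E (qpull t) g) => x Vx; apply: peq_tr (peq_sym (qpullP t oV Vx)).
    apply: peq_tr (sec_invP oV' t isT g Vx).
    by apply: peq_cact; apply: qpullP => //; exact: Vg.
  (* An invariant section becomes a section of the quotient with the same representing family. *)
  have sS : secS true (q @^-1` V) (frep s).
    split; first by case: (sec_S s).
    move=> _ g j n x jx; have Vx : V (q x) by have [_ ] := svalP j; apply.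
    by have /(E s g) := H g; apply.
  exists (fq (D := secf true (q @^-1` V)) (frep s)) => //.
  apply/(sec_eqP oV') => x Vx; apply: peq_tr (qpullP _ oV Vx) _.
  exact: (sec_fqP oV' sS Vx).
Qed.

End Quotient.

(** * The perfectoid cover *)

Section PerfectoidCover.
Variable K : fsplit.
Local Notation A := (kA K).
Local Notation i := (@ki K).
Local Notation pi := (@kpi K).
Local Notation pi' := (@kpi' K).
Local Notation pb := (@power_bounded A).
Local Notation p := (@kp K).
Local Notation psi := (@kpsi K).
Implicit Types (a b : A) (c d : nat -> A) (e k m n : nat).

Let p_gt0 : (0 < p)%N. Proof. exact: prime_gt0 (kp_prime K). Qed.
Let p_gt1 : (1 < p)%N. Proof. exact: prime_gt1 (kp_prime K). Qed.

Lemma pi_inv n : pi ^+ n * pi' ^+ n = 1.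
Proof. by rewrite -exprMn kpiV expr1n. Qed.

Definition dv e a := pb (pi' ^+ e * a).

Lemma dvP e a : dv e a <-> exists2 b, pb b & a = pi ^+ e * b.
Proof.
split=> [h|[b hb ->]]; last by rewrite /dv mulrA [pi' ^+ e * _]mulrC pi_inv mul1r.
by exists (pi' ^+ e * a) => //; rewrite mulrA pi_inv mul1r.
Qed.
Lemma dv_B e a b : dv e a -> dv e b -> dv e (a - b).
Proof. by rewrite /dv mulrBr; exact: pbB. Qed.
Lemma dv_0 e : dv e 0. Proof. by rewrite /dv mulr0; exact: pb0. Qed.
Lemma dv_N e a : dv e a -> dv e (- a).
Proof. by move=> h; rewrite -sub0r; apply: dv_B => //; exact: dv_0. Qed.
Lemma dv_D e a b : dv e a -> dv e b -> dv e (a + b).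
Proof. by move=> ha hb; rewrite -[b]opprK; apply: dv_B => //; exact: dv_N. Qed.
Lemma dv_M e f a b : dv e a -> dv f b -> dv (e + f) (a * b).
Proof. by rewrite /dv exprD mulrACA; exact: pbM. Qed.
Lemma dv0 a : dv 0 a <-> pb a. Proof. by rewrite /dv expr0 mul1r. Qed.
Lemma dv_le e f a : (e <= f)%N -> dv f a -> dv e a.
Proof.
move=> /subnK <- /dvP[b hb ->]; apply/dvP; exists (pi ^+ (f - e) * b).
  by apply: pbM => //; apply: pbX; exact: kpi_pb.
by rewrite mulrA -exprD addnC.
Qed.
Lemma dv_X e a n : dv e a -> dv (e * n) (a ^+ n).
Proof. by move=> h; rewrite /dv exprM -exprMn; exact: pbX. Qed.
Lemma dv_pi e a f : dv (e + f) (pi ^+ e * a) <-> dv f a.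
Proof. by rewrite /dv exprD mulrACA [pi' ^+ e * _]mulrC pi_inv mul1r. Qed.
Lemma dv_nbhs U : nbhs (0 : A) U <-> exists e, forall a, dv e a -> U a.
Proof.
rewrite knbhs; split=> -[n h]; exists n => a; first by move=> /dvP[b hb ->]; exact: h.
by move=> ha; apply: h; apply/dvP; exists a.
Qed.
Lemma dv_sep a : (forall e, dv e a) -> a = 0.
Proof.
move=> h; apply: hausdorff_sep => [|U /dv_nbhs[e]]; last by apply.
by case: (kcomplete K).
Qed.

Lemma frobB n a b : (a - b) ^+ (p ^ n) = a ^+ (p ^ n) - b ^+ (p ^ n).
Proof.
apply: (@ki_inj K); rewrite rmorphB !rmorphXn rmorphB.
have hp : [pchar kF K].-nat (p ^ n)%N.
  by rewrite pnatX (pnatE _ (kp_prime K)) kchar.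
by rewrite exprDn_pchar // exprNn_pchar.
Qed.

Lemma charA : p%:R = 0 :> A.
Proof. by apply: (@ki_inj K); rewrite rmorph_nat rmorph0; exact: pcharf0 (kchar K). Qed.

Definition psiN n := iter n psi.

Lemma psiB a b : psi (a - b) = psi a - psi b.
Proof.
have N z : psi (- z) = - psi z.
  apply/eqP; rewrite -subr_eq0 opprK -kpsi_add addNr; apply/eqP.
  by apply: (addIr (psi 0)); rewrite -kpsi_add !addr0 add0r.
by rewrite kpsi_add N.
Qed.

Lemma psiNB n a b : psiN n (a - b) = psiN n a - psiN n b.
Proof. by elim: n => [//|n IH]; rewrite /psiN !iterS -!/(psiN n _) IH psiB. Qed.

Lemma psiN_lin n a b : psiN n (a ^+ (p ^ n) * b) = a * psiN n b.
Proof.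
elim: n a => [|n IH] a; first by rewrite expn0 expr1.
by rewrite /psiN !iterS -!/(psiN n _) expnSr exprM [(a ^+ _) ^+ p]exprAC IH kpsi_lin.
Qed.

Lemma psiN_exp n a : psiN n (a ^+ (p ^ n)) = a.
Proof.
have e1 : psiN n 1 = 1 by elim: n => [//|n IH]; rewrite /psiN iterS -/(psiN n _) IH kpsi1.
by rewrite -[X in psiN n X]mulr1 psiN_lin e1 mulr1.
Qed.

Lemma psiN_pb n a : pb a -> pb (psiN n a).
Proof. by move=> h; elim: n => [//|n IH]; rewrite /psiN iterS; exact: kpsi_pb. Qed.

Lemma dv_psiN e n a : dv (e * p ^ n) a -> dv e (psiN n a).
Proof. by rewrite /dv exprM => /(psiN_pb n); rewrite psiN_lin. Qed.

(* A sequence [c] stands for the limit of the p^n-th roots of [c n] *)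
Definition rootS : set (nat -> A) := [set c | forall k, exists N, forall n,
  (N <= n)%N -> dv (k * p ^ n.+1) (c n.+1 - c n ^+ p)].
(** Divisibility of c_n by pi^(k p^n) is divisibility of its p^n-th root by pi^k, which explains the
    scaling; a single chain of levels suffices. *)
Definition root_lev (j : unit) k : set (nat -> A) := [set c | exists N, forall n,
  (N <= n)%N -> dv (k * p ^ n) (c n)].

Let cB c d n : (c - d) n = c n - d n. Proof. by []. Qed.
Let cM c d n : (c * d) n = c n * d n. Proof. by []. Qed.
Let cX c e n : (c ^+ e) n = c n ^+ e.
Proof. by elim: e => [|e IH]; rewrite ?expr0 // !exprS cM IH. Qed.

(** From some N on, c_(n+1) equals c_n^p up to an integral element. A bound at N thus propagates,
    its exponent being multiplied by p at every step. *)
Lemma rootS_bounded c : rootS c -> exists m N, forall n, (N <= n)%N -> pb (pi ^+ (m * p ^ n) * c n).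
Proof.
move=> /(_ 0%N)[N hN]; have [m hm] := kabs (c N); exists m, N => n Nn.
rewrite -(subnK Nn); elim: (n - N)%N => [|q IH]; last first.
  rewrite addSn; set r := (q + N)%N in IH *.
  rewrite -(subrK (c r ^+ p) (c r.+1)) mulrDr; apply: pbD.
    apply: pbM; first by apply: pbX; exact: kpi_pb.
    by have := hN r (leq_addl _ _); rewrite mul0n dv0.
  by rewrite expnSr mulnA exprM -exprMn; apply: pbX.
have -> : (m * p ^ (0 + N))%N = (m * p ^ N - m + m)%N.
  by rewrite subnK // leq_pmulr // expn_gt0 p_gt0.
by rewrite exprD -mulrA; apply: pbM => //; apply: pbX; exact: kpi_pb.
Qed.

Lemma rootS_1 : rootS 1.
Proof. by move=> k; exists 0%N => n _; rewrite /= expr1n subrr; exact: dv_0. Qed.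
Lemma rootS_B c d : rootS c -> rootS d -> rootS (c - d).
Proof.
move=> hc hd k; have [N hN] := hc k; have [M hM] := hd k.
exists (maxn N M) => n; rewrite geq_max => /andP[/hN h1 /hM h2].
rewrite !cB; have := frobB 1 (c n) (d n); rewrite expn1 => ->.
have -> : c n.+1 - d n.+1 - (c n ^+ p - d n ^+ p) =
  (c n.+1 - c n ^+ p) - (d n.+1 - d n ^+ p) by ring.
exact: dv_B.
Qed.

Let mul_bdd k m (q : nat) a b : pb (pi ^+ (m * q) * a) -> dv ((k + m) * q) b -> dv (k * q) (a * b).
Proof.
move=> ha hb; apply/(@dv_pi (m * q)); rewrite mulrA -[(m * q + _)%N]add0n.
by apply: dv_M; [exact/dv0|rewrite -mulnDl addnC].
Qed.

Lemma rootS_M c d : rootS c -> rootS d -> rootS (c * d).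
Proof.
move=> hc hd k; have [mc [Nc hNc]] := rootS_bounded hc; have [md [Nd hNd]] := rootS_bounded hd.
have [N hN] := hc (k + md)%N; have [M hM] := hd (k + mc)%N.
exists (maxn (maxn N M) (maxn Nc Nd)) => n; rewrite !geq_max => /andP[/andP[h1 h2] /andP[h3 h4]].
have -> : (c * d) n.+1 - (c * d) n ^+ p =
   d n.+1 * (c n.+1 - c n ^+ p) + c n ^+ p * (d n.+1 - d n ^+ p).
  by rewrite !cM exprMn; ring.
apply: dv_D; first by apply: mul_bdd (hNd n.+1 _) (hN n h1); exact: leqW.
apply: mul_bdd _ (hM n h2); rewrite expnSr mulnA exprM -exprMn; apply: pbX.
exact: hNc.
Qed.

Lemma root_lev_0 j k : root_lev j k 0.
Proof. by exists 0%N => n _; exact: dv_0. Qed.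
Lemma root_lev_B j k c d : root_lev j k c -> root_lev j k d -> root_lev j k (c - d).
Proof.
move=> [N hN] [M hM]; exists (maxn N M) => n; rewrite geq_max => /andP[/hN h1 /hM h2].
exact: dv_B.
Qed.
Lemma root_lev_W j k c : root_lev j k.+1 c -> root_lev j k c.
Proof.
by move=> [N hN]; exists N => n /hN; apply: dv_le; rewrite leq_mul2r leqnSn orbT.
Qed.
Lemma root_lev_MD j k l c d : root_lev j k c -> root_lev j l d -> root_lev j (k + l) (c * d).
Proof.
move=> [N hN] [M hM]; exists (maxn N M) => n; rewrite geq_max => /andP[/hN h1 /hM h2].
by rewrite mulnDl; exact: dv_M.
Qed.
Lemma root_lev_M j k c d : root_lev j k c -> root_lev j k d -> root_lev j k (c * d).
Proof.
move=> hc hd; have [N hN] := root_lev_MD hc hd; exists N => n /hN.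
by apply: dv_le; rewrite leq_mul2r leq_addr orbT.
Qed.
Lemma root_lev_SM j k c : rootS c ->
  exists m, forall d, rootS d -> root_lev j m d -> root_lev j k (c * d).
Proof.
move=> /rootS_bounded[m [N hN]]; exists (k + m)%N => d _ [M hM].
exists (maxn N M) => n; rewrite geq_max => /andP[/hN h1 /hM h2].
exact: mul_bdd h1 h2.
Qed.

Definition rootf : filt_ring :=
  @FiltRing (nat -> A) rootS unit root_lev rootS_1 rootS_B rootS_M root_lev_0
    root_lev_B root_lev_W root_lev_M root_lev_SM.

Definition cover : topComRingType := filtq rootf.
Local Notation B := cover.
Local Notation fqB := (@fqB rootf).
Local Notation fqM := (@fqM rootf).
Implicit Types (x y z : B).
Local Notation lv := (@qlev rootf tt).

Let Sf x : rootS (frep x). Proof. exact: (@frepS rootf x). Qed.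
Let fq' c : B := fq (D := rootf) c.
Let lvE k c : rootS c -> lv k (fq' c) <-> root_lev tt k c.
Proof. exact: (@qlev_fq rootf tt k c). Qed.

Lemma cover_nbhs U : nbhs (0 : B) U <-> exists k, forall x, lv k x -> U x.
Proof.
split=> [[l [n h]]|[k h]].
  by exists n => x hx; apply: h => -[] _; rewrite subr0.
by exists [:: tt], k => t /(_ tt (or_introl erefl)); rewrite subr0; exact: h.
Qed.

Let rootS_X c e : rootS c -> rootS (c ^+ e).
Proof. by move=> h; elim: e => [|e IH]; rewrite ?expr0 ?exprS; [exact: rootS_1|exact: rootS_M]. Qed.

Let fqX c e : rootS c -> fq' c ^+ e = fq' (c ^+ e).
Proof.
move=> h; elim: e => [|e IH]; first by rewrite !expr0; exact: (esym (fq1 rootf)).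
by rewrite !exprS IH -fqM //; exact: rootS_X.
Qed.

Let lvM k l x y : lv k x -> lv l y -> lv (k + l) (x * y).
Proof.
rewrite -(fqK x) -(fqK y) -fqM; try exact: Sf.
move=> /(lvE _ (Sf x)) hx /(lvE _ (Sf y)) hy; apply/lvE; last exact: root_lev_MD.
by apply: rootS_M; exact: Sf.
Qed.

(** The element [a] is the constant limit of the p^n-th roots of a^(p^n). *)
Definition cov (a : A) : B := fq' (fun n => a ^+ (p ^ n)).

Lemma covS a : rootS (fun n => a ^+ (p ^ n)).
Proof. by move=> k; exists 0%N => n _; rewrite -exprM -expnSr subrr; exact: dv_0. Qed.

Lemma covB a b : cov (a - b) = cov a - cov b.
Proof. by rewrite /cov -fqB; try exact: covS; congr fq'; apply/funext => n; exact: frobB. Qed.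
Lemma covM a b : cov (a * b) = cov a * cov b.
Proof. by rewrite /cov -fqM; try exact: covS; congr fq'; apply/funext => n; exact: exprMn. Qed.
Lemma cov1 : cov 1 = 1.
Proof.
rewrite -[RHS](fq1 rootf) /cov; congr fq'; apply/funext => n; exact: expr1n.
Qed.
Lemma covX a e : cov (a ^+ e) = cov a ^+ e.
Proof. by elim: e => [|e IH]; rewrite ?expr0 ?cov1 // !exprS covM IH. Qed.
Lemma cov_lv k a : dv k a -> lv k (cov a).
Proof. by move=> h; apply/lvE; [exact: covS|exists 0%N => n _; exact: dv_X]. Qed.

Lemma cov_hom : tring_hom cov.
Proof.
split; [exact: covB|by split; [exact: cov1|exact: covM]|].
apply: zmod_continuous; first exact: covB.
move=> U /cover_nbhs[k h]; apply/dv_nbhs; exists k => a ha; apply: h; exact: cov_lv.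
Qed.

Local Notation w := (cov pi).
Local Notation w' := (cov pi').

Let wV e : w ^+ e * w' ^+ e = 1.
Proof. by rewrite -!covX -covM pi_inv cov1. Qed.
Let lv_w e : lv e (w ^+ e).
Proof. by rewrite -covX; apply: cov_lv; apply/dvP; exists 1; rewrite ?mulr1 //; exact: pb1. Qed.

Lemma lv_wM e k x : lv (e + k) (w ^+ e * x) <-> lv k x.
Proof.
split=> h; last exact: lvM.
move: h; set z := w ^+ e * x => h.
have -> : x = fq' ((fun n => (pi' ^+ e) ^+ (p ^ n)) * frep z).
  rewrite /fq' fqM; [|exact: covS|exact: Sf].
  by rewrite (fqK (D := rootf)) -[fq _]/(cov (pi' ^+ e)) covX /z mulrA [w' ^+ e * _]mulrC wV mul1r.
apply/lvE; first by apply: rootS_M; [exact: covS|exact: Sf].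
have [N hN] : root_lev tt (e + k) (frep z) := h.
exists N => n /hN h1; rewrite cM.
by apply/(@dv_pi (e * p ^ n)); rewrite mulrA -exprM pi_inv mul1r -mulnDl.
Qed.

Lemma lv_wE k x : lv k x <-> exists2 y, lv 0 y & x = w ^+ k * y.
Proof.
split=> [h|[y hy ->]]; last by rewrite -[k in lv k]addn0; apply/lv_wM.
exists (w' ^+ k * x); last by rewrite mulrA wV mul1r.
by apply/(@lv_wM k); rewrite addn0 mulrA wV mul1r.
Qed.

Lemma cover_huber : huber_ring B.
Proof.
have lv0 := @qlev0 rootf tt.
exists (lv 0), [:: w]; split.
- split; last exact: (@qlevM rootf tt 0); last exact: (@qlevB rootf tt 0).
  by rewrite -cov1; apply: cov_lv; apply/dv0; exact: pb1.
- rewrite openE => x hx; apply/nbhs_shift; apply/cover_nbhs; exists 0%N => y hy /=.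
  exact: (@qlevD rootf tt 0).
- by move=> f; rewrite inE => /eqP ->; apply: cov_lv; apply/dv0; exact: kpi_pb.
- have E n : ideal_pow (lv 0) [:: w] n = lv n.
    have S1 (c : nat -> B) : \sum_(j < size [:: w]) [:: w]`_j * c j = w * c 0%N.
      by rewrite big_ord1.
    elim: n => [//|n IH]; apply/seteqP; split=> [x [c hc0 ->]|x /lv_wE[y hy ->]].
      have hc q : lv n (c q) by rewrite -IH; exact: hc0.
      rewrite S1; have [y hy ->] := (lv_wE n (c 0%N)).1 (hc 0%N).
      by apply/lv_wE; exists y => //; rewrite mulrA -exprS.
    exists (fun=> w ^+ n * y); first by move=> _; rewrite IH; apply/lv_wE; exists y.
    by have /= -> := S1 (fun=> w ^+ n * y); rewrite mulrA -exprS.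
  by move=> U; rewrite cover_nbhs; split=> -[n hn]; exists n; move: hn; rewrite E.
Qed.

Lemma cover_pb x : power_bounded x <-> exists m, forall e, lv 0 (w ^+ m * x ^+ e).
Proof.
split=> [h|[m hm] U /cover_nbhs[k hU]].
  have [W /cover_nbhs[m hW] WU] := h _ (fq_nbhs0_lev (D := rootf) tt 0).
  by exists m => e; apply: WU; [exact: hW (lv_w m)|exists e].
exists (lv (m + k)); first exact: (fq_nbhs0_lev (D := rootf)).
move=> _ _ /lv_wE[y hy ->] [e _ <-]; apply: hU.
have -> : w ^+ (m + k) * y * x ^+ e = w ^+ k * (y * (w ^+ m * x ^+ e)).
  by rewrite exprD [w ^+ m * _]mulrC -!mulrA; congr (_ * _); rewrite mulrCA.
rewrite -[k in lv k]addn0; apply/lv_wM; rewrite -[0%N]addn0; exact: lvM.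
Qed.

Lemma cover_absorb x : exists m, lv 0 (w ^+ m * x).
Proof.
have [m [N hN]] := rootS_bounded (Sf x); exists m.
rewrite -(fqK (D := rootf) x) -covX -fqM; [|exact: covS|exact: Sf].
apply/lvE; first by apply: rootS_M; [exact: covS|exact: Sf].
by exists N => n /hN h; rewrite mul0n cM -exprM; exact/dv0.
Qed.

Lemma cover_frobB x y : (x - y) ^+ p = x ^+ p - y ^+ p.
Proof.
rewrite -(fqK (D := rootf) x) -(fqK (D := rootf) y) -fqB; try exact: Sf.
rewrite !fqX; try exact: Sf; last by apply: rootS_B; exact: Sf.
rewrite -fqB; try by apply: rootS_X; exact: Sf.
congr fq'; apply/funext => n; rewrite cB !cX cB.
by have := frobB 1 (frep x n) (frep y n); rewrite expn1.
Qed.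

Lemma cover_sep x : (forall k, lv k x) -> x = 0.
Proof. by move=> h; apply: (@qlev_sep rootf) => -[]. Qed.

(** The splitting recovers c_n from c_n^p and divides exponents of divisibility by p, so an element
    with zero p-th power lies in every level. *)
Lemma cover_reduced x : x ^+ p = 0 -> x = 0.
Proof.
move=> x0; apply: cover_sep => k; rewrite -(fqK (D := rootf) x); apply/lvE; first exact: Sf.
have [N hN] : root_lev tt (k * p) (frep x ^+ p).
  apply/(lvE _ (rootS_X p (Sf x))); rewrite -fqX; last exact: Sf.
  by rewrite /fq' (fqK (D := rootf)) x0; exact: (@qlev0 rootf).
exists N => n /hN; rewrite cX mulnAC -[X in dv (_ * X)]expn1 => /dv_psiN.
by have := psiN_exp 1 (frep x n); rewrite expn1 => ->.
Qed.

(** Delaying the sequence by one index takes one more p-th root of every term. *)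
Lemma cover_root x : exists y, y ^+ p = x.
Proof.
have hS := Sf x; pose c n := frep x n.-1.
have cS : rootS c.
  move=> k; have [N hN] := hS (k * p)%N; exists N.+1 => -[//|n] /hN.
  by rewrite -mulnA -expnS.
exists (fq' c); rewrite fqX // -[RHS](fqK (D := rootf)).
apply/(@fq_eq rootf); [exact: rootS_X|exact: hS|] => j k.
have [N hN] := hS k; exists N.+1 => -[//|n] /hN h.
by rewrite cB cX -opprB; exact: dv_N.
Qed.

(** Dividing exponents by p with remainder, every power of [x] is a power of x^p times one of
    finitely many x^r with r < p. *)
Lemma cover_root_pb x : power_bounded (x ^+ p) -> power_bounded x.
Proof.
move=> /cover_pb[m hm]; apply/cover_pb.
have [l hl] : exists l, forall e, (e < p)%N -> lv 0 (w ^+ l * x ^+ e).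
  elim: p => [|q [l hl]]; first by exists 0%N.
  have [l' hl'] := cover_absorb (x ^+ q); exists (l + l')%N => e.
  have lw k : lv 0 (w ^+ k) by apply: (@qlev_le rootf) (lv_w k).
  rewrite ltnS leq_eqVlt exprD => /orP[/eqP ->|/hl h]; rewrite ?[w ^+ l * _]mulrC -mulrA.
    by rewrite mulrCA -[0%N]addn0; exact: lvM.
  by rewrite -[0%N]addn0; exact: lvM.
exists (m + l)%N => e; rewrite (divn_eq e p) mulnC !exprD exprM mulrACA -[0%N]addn0.
apply: lvM; first exact: hm.
by apply: hl; rewrite ltn_mod.
Qed.

(** If pi^m x^e is integral for all e, take e = p^m. Applying psi^m to the n-th term leaves pi^(m
    p^(n-m)) c_n integral, and m <= p^m makes pi^(p^n) c_n integral. So pi x is integral, a bound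
    that does not involve m. *)
Lemma cover_uniform : uniform_ring B.
Proof.
move=> U /cover_nbhs[k hU]; exists (lv k.+1); first exact: (fq_nbhs0_lev (D := rootf)).
move=> _ x /lv_wE[y hy ->] /cover_pb[m hm]; apply: hU.
suff h : lv 0 (w * x).
  have -> : w ^+ k.+1 * y * x = w ^+ k * (y * (w * x)).
    by rewrite exprSr -!mulrA; congr (_ * _); rewrite mulrCA.
  rewrite -[k in lv k]addn0; apply/lv_wM; rewrite -[0%N]addn0; exact: lvM.
have [N hN] : root_lev tt 0 ((fun n => (pi ^+ m) ^+ (p ^ n)) * frep x ^+ (p ^ m)).
  apply/(lvE _ (rootS_M (covS _) (rootS_X _ (Sf x)))).
  rewrite /fq' fqM; [|exact: covS|by apply: rootS_X; exact: Sf].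
  rewrite -[fq (_ ^+ _)](fqX _ (Sf x)) /fq' (fqK (D := rootf)) -[fq _]/(cov _) covX.
  exact: hm.
have -> : w * x = fq' ((fun n => pi ^+ (p ^ n)) * frep x).
  by rewrite /fq' fqM ?(fqK (D := rootf)) //; [exact: covS|exact: Sf].
apply/lvE; first by apply: rootS_M; [exact: covS|exact: Sf].
exists (maxn N m) => n; rewrite geq_max => /andP[/hN h1 mn].
move: h1; rewrite !mul0n cM cX !dv0 cM.
have -> : pi ^+ m ^+ (p ^ n) * frep x n ^+ (p ^ m) = (pi ^+ (m * p ^ (n - m)) * frep x n) ^+ (p ^ m).
  by rewrite exprMn -!exprM -mulnA -expnD subnK.
move=> /(psiN_pb m); rewrite psiN_exp => h1.
have le : (m * p ^ (n - m) <= p ^ n)%N.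
  rewrite -{2}(subnK mn) expnD mulnC leq_pmul2l ?expn_gt0 ?p_gt0 //.
  by apply: ltnW; exact: ltn_expl.
rewrite -(subnK le) exprD -mulrA; apply: pbM => //; apply: pbX; exact: kpi_pb.
Qed.

(** A diagonal argument: s k approximates the limit to level k, but its estimates hold only from a
    k-dependent index on. At index n the limit takes the term of the best approximation whose
    estimates are already valid, of number kap n. *)
Lemma cover_complete : complete_ring B.
Proof.
apply: (@fq_complete rootf) => Fl PF FC.
have /choice[P hP] : forall k, exists P, Fl P /\ forall s t, P s -> P t -> lv k (s - t).
  by move=> k; have [P FP h] := FC tt k; exists P.
pose Q k := \bigcap_(j in [set j | (j <= k)%N]) P j.
have FQ k : Fl (Q k).
  elim: k => [|k IH].
    by apply: filterS (hP 0%N).1 => z Pz j /=; rewrite leqn0 => /eqP ->.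
  apply: filterS (filterI IH (hP k.+1).1) => z [Qz Pz] j /=.
  by rewrite leq_eqVlt => /orP[/eqP -> //|]; exact: Qz.
have /choice[s hs] : forall k, exists s, Q k s by move=> k; exact: filter_ex (FQ k).
have sP j k : (j <= k)%N -> P j (s k) by move=> jk; exact: hs.
pose c k := frep (s k).
have cc k : exists N, forall n, (N <= n)%N ->
    dv (k * p ^ n.+1) (c k n.+1 - c k n ^+ p) /\ dv (k * p ^ n) (c k n - c k.+1 n).
  have [N hN] := Sf (s k) k.
  have : lv k (s k - s k.+1) by apply: (hP k).2; exact: sP.
  rewrite -(fqK (D := rootf) (s k)) -(fqK (D := rootf) (s k.+1)) -fqB; try exact: Sf.
  move=> /(lvE _ (rootS_B (Sf _) (Sf _)))[M hM].
  exists (maxn N M) => n; rewrite geq_max => /andP[h1 h2].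
  by split; [exact: hN|exact: hM].
have {cc}/choice[N hN] := cc.
(* Beyond [M k] the estimates of all earlier approximations hold as well, so that their differences
   telescope. *)
pose M k := \max_(j < k.+1) N j.
have MN j k n : (j <= k)%N -> (M k <= n)%N -> (N j <= n)%N.
  by rewrite -ltnS => jk; apply: leq_trans; exact: (@leq_bigmax _ (fun j : 'I_k.+1 => N j) (Ordinal jk)).
pose ok n k := (k <= n)%N && (M k <= n)%N.
pose kap n := \max_(k < n.+1 | ok n k) k.
have kap_ok n k : (ok n k) -> (k <= kap n)%N.
  move=> h; have kn : (k < n.+1)%N by case/andP: h.
  exact: (@leq_bigmax_cond _ (fun k : 'I_n.+1 => ok n k) (fun k : 'I_n.+1 => k : nat) (Ordinal kn)).
have kap_M n k : ok n k -> ok n (kap n).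
  move=> h; have kn : (k < n.+1)%N by case/andP: h.
  have : (0 < #|[pred k : 'I_n.+1 | ok n k]|)%N by apply/card_gt0P; exists (Ordinal kn).
  by move=> /(eq_bigmax_cond (fun k : 'I_n.+1 => k : nat))[j jok e]; rewrite /kap e.
have tel k l n : (k <= l)%N -> (M l <= n)%N -> dv (k * p ^ n) (c k n - c l n).
  move=> kl; rewrite -(subnK kl); elim: (l - k)%N => [|q IH] h.
    by rewrite add0n subrr; exact: dv_0.
  have h' : (M (q + k) <= n)%N.
    apply: leq_trans h; apply/bigmax_leqP => j _.
    have jq : (j < (q.+1 + k).+1)%N by apply: leq_trans (ltn_ord j) _; rewrite ltnS addSn leqnSn.
    exact: (@leq_bigmax _ (fun j : 'I_(q.+1 + k).+1 => N j) (Ordinal jq)).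
  have -> : c k n - c (q.+1 + k)%N n = (c k n - c (q + k)%N n) + (c (q + k)%N n - c (q + k).+1 n).
    by rewrite addSn; ring.
  apply: dv_D; first exact: IH.
  have [_ h1] := hN (q + k)%N n (MN _ _ _ (leqnn _) h').
  by apply: dv_le h1; rewrite leq_mul2r leq_addl orbT.
pose d n := c (kap n) n.
have dc k n : ok n k -> dv (k * p ^ n) (d n - c k n).
  move=> h; rewrite -opprB; apply: dv_N; apply: tel; first exact: kap_ok.
  by case/andP: (kap_M n k h).
have okP k n : (maxn k (M k) <= n)%N -> ok n k by rewrite geq_max.
have dS : rootS d.
  move=> k; exists (maxn k (M k)) => n kn.
  have h1 := dc k n (okP k n kn); have h2 := dc k n.+1 (okP k n.+1 (leqW kn)).
  have [h3 _] := hN k n (MN k k n (leqnn _) (leq_trans (leq_maxr _ _) kn)).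
  have -> : d n.+1 - d n ^+ p = (d n.+1 - c k n.+1) + (c k n.+1 - c k n ^+ p) - (d n - c k n) ^+ p.
    by have := frobB 1 (d n) (c k n); rewrite expn1 => ->; ring.
  apply: dv_B; first exact: dv_D.
  by rewrite expnSr mulnA; exact: dv_X.
exists (fq' d) => -[] k; apply: filterS (hP k).1 => t Pt; change (lv k (t - fq' d)).
have -> : t - fq' d = (t - s k) + (s k - fq' d) by ring.
apply: (@qlevD rootf); first by apply: (hP k).2 => //; exact: sP.
rewrite -[s k](fqK (D := rootf)) -fqB //; last exact: Sf.
apply/lvE; first by apply: rootS_B => //; exact: Sf.
by exists (maxn k (M k)) => n /okP/dc h; rewrite cB -opprB; exact: dv_N.
Qed.

Lemma cover_pi : pseudo_uniformizer w.
Proof.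
split; first by exists w'; have := wV 1; rewrite !expr1.
move=> U /cover_nbhs[k h]; exists k => // n /= kn; apply: h.
by apply: (@qlev_le rootf) (lv_w n).
Qed.

Lemma cover_char : p%:R = 0 :> B.
Proof.
have e n : cov (n%:R) = n%:R.
  elim: n => [|n IH]; first by rewrite -[0%:R](subrr 0) covB subrr.
  have covD a b : cov (a + b) = cov a + cov b.
    have N (z : A) : cov (- z) = - cov z by rewrite -sub0r covB -(subrr 0) covB subrr sub0r.
    by have := covB a (- b); rewrite N !opprK.
  by rewrite -!natr1 covD IH cov1.
by rewrite -e charA -(subrr 0) covB subrr.
Qed.

(** In characteristic p the condition on p is trivial with c = 0. Exact p-th roots give surjectivity
    of Frobenius, and together with reducedness they turn x^p - y^p = w^p c into x - y = w z with
    z^p = c. *)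
Lemma cover_perfectoid : perfectoid_ring p B.
Proof.
have pb_zero : @power_bounded B 0.
  apply/cover_pb; exists 0%N => e; rewrite expr0 mul1r.
  case: e => [|e]; last by rewrite expr0n; exact: (@qlev0 rootf).
  by rewrite expr0 -(expr0 w); exact: lv_w.
split; [by split; [exact: cover_huber|exists w; exact: cover_pi]|exact: cover_complete
  |exact: cover_uniform|exists w; split; first exact: cover_pi].
- by exists 0 => //; rewrite cover_char mulr0.
- move=> x y _ _ [c hc e]; have [z hz] := cover_root c; exists z.
    by apply: cover_root_pb; rewrite hz.
  apply/eqP; rewrite -subr_eq0; apply/eqP/cover_reduced.
  by rewrite !cover_frobB e exprMn hz subrr.
- move=> y hy; have [x hx] := cover_root y; exists x, 0; split=> //.
    by apply: cover_root_pb; rewrite hx.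
  by rewrite hx mulr0 addr0.
Qed.

(** Since psi^n (c_n) = psi^(n+1) (c_n^p), consecutive terms differ by psi^(n+1) of c_(n+1) - c_n^p,
    which carries divisibility by pi^(k p^(n+1)) to divisibility by pi^k. *)
Let lim_ex c : rootS c -> exists a, forall k, exists N, forall n, (N <= n)%N -> dv k (psiN n (c n) - a).
Proof.
move=> hc; have [_ cA] := kcomplete K.
have step k : exists N, forall m n, (N <= m)%N -> (N <= n)%N ->
    dv k (psiN m (c m) - psiN n (c n)).
  have [N hN] := hc k; exists N.
  have H n q : (N <= n)%N -> dv k (psiN (q + n) (c (q + n)%N) - psiN n (c n)).
    move=> Nn; elim: q => [|q IH]; first by rewrite subrr; exact: dv_0.
    rewrite -(subrK (psiN (q + n) (c (q + n)%N)) (psiN (q.+1 + n) _)) -addrA.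
    apply: dv_D => //; rewrite addSn; set r := (q + n)%N.
    have e : psiN r (c r) = psiN r.+1 (c r ^+ p).
      rewrite /psiN iterSr -/(psiN r _); congr psiN.
      by have := psiN_exp 1 (c r); rewrite expn1.
    by rewrite e -psiNB; apply: dv_psiN; apply: hN; rewrite /r (leq_trans Nn) // leq_addl.
  move=> m n Nm Nn; have [mn|nm] := leqP m n.
    by rewrite -opprB; apply: dv_N; rewrite -(subnK mn); exact: H.
  by rewrite -(subnK (ltnW nm)); exact: H.
have [a ha] : exists a : A, (fun n => psiN n (c n)) @ \oo --> a.
  apply: cA => U /dv_nbhs[k hk]; have [N hN] := step k.
  exists ((fun n => psiN n (c n)) @` [set n | (N <= n)%N]).
    by exists N => // n /= Nn; exists n.
  by move=> _ _ [m Nm <-] [n Nn <-]; apply: hk; exact: hN.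
exists a => k.
have hU : nbhs a [set b | dv k (b - a)].
  by apply/nbhs_shift/dv_nbhs; exists k => b; rewrite /= addrK.
have [N _ hN] := ha _ hU; exists N => n Nn; exact: hN.
Qed.

Definition retr x : A := sval (cid (lim_ex (Sf x))).

Let retrP x k : exists N, forall n, (N <= n)%N -> dv k (psiN n (frep x n) - retr x).
Proof. by rewrite /retr; case: cid => a h /=; exact: h. Qed.

Let retr_fq c a : rootS c -> (forall k, exists N, forall n, (N <= n)%N -> dv k (psiN n (c n) - a)) ->
  retr (fq' c) = a.
Proof.
move=> hc ha; apply/eqP; rewrite -subr_eq0; apply/eqP/dv_sep => k.
have [N hN] := retrP (fq' c) k; have [M hM] := ha k.
have [L hL] : root_lev tt k (frep (fq' c) - c) by exact: (@fqP rootf c hc tt k).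
pose n := maxn N (maxn M L).
have h1 : dv k _ := hN n (leq_maxl _ _).
have h2 : dv k _ := hM n (leq_trans (leq_maxl _ _) (leq_maxr _ _)).
have h3 : dv _ _ := hL n (leq_trans (leq_maxr _ _) (leq_maxr _ _)).
move/dv_psiN: h3; rewrite cB psiNB => h3.
have -> : retr (fq' c) - a = (psiN n (c n) - a) - (psiN n (frep (fq' c) n) - retr (fq' c)) +
  (psiN n (frep (fq' c) n) - psiN n (c n)) by ring.
by apply: dv_D => //; apply: dv_B.
Qed.

Lemma retr_B : zmod_morphism retr.
Proof.
move=> x y; rewrite -{1}(fqK (D := rootf) x) -{1}(fqK (D := rootf) y) -fqB; try exact: Sf.
apply: retr_fq; first by apply: rootS_B; exact: Sf.
move=> k; have [N hN] := retrP x k; have [M hM] := retrP y k.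
exists (maxn N M) => n; rewrite geq_max => /andP[/hN h1 /hM h2].
rewrite cB psiNB.
have -> : psiN n (frep x n) - psiN n (frep y n) - (retr x - retr y) =
   (psiN n (frep x n) - retr x) - (psiN n (frep y n) - retr y) by ring.
exact: dv_B.
Qed.

(** The iterate psi^n is p^n-linear, and [cov a] has the terms a^(p^n). *)
Lemma retr_lin a x : retr (cov a * x) = a * retr x.
Proof.
rewrite -{1}(fqK (D := rootf) x) -fqM; [|exact: covS|exact: Sf].
apply: retr_fq; first by apply: rootS_M; [exact: covS|exact: Sf].
move=> k; have [m hm] := kabs a; have [N hN] := retrP x (m + k)%N.
exists N => n /hN h; rewrite cM psiN_lin -mulrBr.
apply/(@dv_pi m); rewrite mulrA -[(m + k)%N]add0n; apply: dv_M => //.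
exact/dv0.
Qed.

Lemma retrK : cancel cov retr.
Proof.
move=> a; apply: retr_fq; first exact: covS.
by move=> k; exists 0%N => n _; rewrite psiN_exp subrr; exact: dv_0.
Qed.

Lemma retr_cont : continuous retr.
Proof.
apply: zmod_continuous; first exact: retr_B.
move=> U /dv_nbhs[k hk]; apply/cover_nbhs; exists k => x hx; apply: hk.
have [N hN] := retrP x k; have [M hM] : root_lev tt k (frep x) by [].
pose n := maxn N M; have h1 := hN n (leq_maxl _ _); have h2 := hM n (leq_maxr _ _).
have -> : retr x = psiN n (frep x n) - (psiN n (frep x n) - retr x) by ring.
by apply: dv_B => //; exact: dv_psiN.
Qed.

Lemma pi_pseudo : pseudo_uniformizer pi.
Proof.
split; first by exists pi'; exact: kpiV.
move=> U /dv_nbhs[k h]; exists k => // n /= kn; apply: h.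
by apply: dv_le (kn) _; apply/dvP; exists 1; rewrite ?mulr1 //; exact: pb1.
Qed.

Theorem fsplit_sousperfectoid : sousperfectoid p A.
Proof.
split; [|exact: kcomplete|].
  by split; [exact: pb_huber_ring|exists pi; exact: pi_pseudo].
exists B, cov, retr; split.
- exact: cover_perfectoid.
- exact: cov_hom.
- exact: can_inj retrK.
- by split; [exact: retr_B|exact: retr_cont|exact: retr_lin].
- exact: retrK.
Qed.

End PerfectoidCover.

(** * Tate algebras *)

Section AbsvalMore.
Context (RR : realType) (K : fieldType) (v : absval RR K).

Lemma avX c n : v (c ^+ n) = v c ^+ n.
Proof. by elim: n => [|n IH]; rewrite ?expr0 ?av1 // !exprS avM IH. Qed.
Lemma av_eq0P c : (v c == 0) = (c == 0).
Proof. by apply/eqP/eqP => /(av_eq0 v). Qed.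
Lemma av_gt0 c : (0 < v c) = (c != 0).
Proof. by rewrite lt_def av_ge0 andbT av_eq0P. Qed.
Lemma av_le0 c : (forall e : RR, 0 < e -> v c <= e) -> c = 0.
Proof.
move=> h; apply/eqP; rewrite -av_eq0P eq_le av_ge0 andbT; apply/ler_addgt0Pl => e e0.
by rewrite addr0; exact: h.
Qed.

End AbsvalMore.

Lemma small_inv (RR : realType) (e : RR) : 0 < e -> exists n : nat, forall m, (n <= m)%N -> m.+1%:R^-1 < e.
Proof.
move=> e0; exists (Num.bound e^-1) => m nm; rewrite invf_plt ?posrE ?ltr0n //.
apply: lt_le_trans (archi_boundP _) _; first by rewrite invr_ge0 ltW.
by rewrite ler_nat; apply: leq_trans nm _.
Qed.

(** A Cauchy filter becomes a Cauchy sequence by picking the k-th point in the intersection of its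
    first k + 1 sets, the j-th of which has diameter below 1 / (j + 1). *)
Lemma seminorm_complete (RR : realType) (A : topComRingType) (sn : A -> RR) :
  (forall x U, nbhs x U <-> exists2 e : RR, 0 < e & forall y, sn (y - x) < e -> U y) ->
  sn 0 = 0 -> (forall x y, sn (x - y) <= Num.max (sn x) (sn y)) ->
  (forall x, sn x = 0 -> x = 0) -> (forall x, 0 <= sn x) ->
  (forall s : nat -> A, (forall e : RR, 0 < e -> exists N : nat, forall k l : nat,
      (N <= k)%N -> (N <= l)%N -> sn (s k - s l) < e) ->
    exists l, forall e : RR, 0 < e -> exists N : nat, forall k : nat, (N <= k)%N -> sn (s k - l) <= e) ->
  complete_ring A.
Proof.
move=> nbE sn0 snB sn_eq0 sn_ge0 sc.
have snN x : sn (- x) <= sn x.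
  by rewrite -sub0r (le_trans (snB _ _)) // sn0 ge_max sn_ge0 lexx.
have snD x y : sn (x + y) <= Num.max (sn x) (sn y).
  rewrite -[y in x + y]opprK (le_trans (snB _ _)) // ge_max !le_max lexx /=.
  by rewrite snN orbT.
split=> [x y xy|F PF FC].
  apply/eqP; rewrite -subr_eq0; apply/eqP/sn_eq0/eqP; rewrite eq_le sn_ge0 andbT leNgt.
  apply/negP => e0.
  have hx : nbhs x [set z | sn (z - x) < sn (x - y)] by apply/nbE; exists (sn (x - y)).
  have hy : nbhs y [set z | sn (z - y) < sn (x - y)] by apply/nbE; exists (sn (x - y)).
  have [z [/= h1 h2]] := xy _ _ hx hy.
  have := snB (z - y) (z - x); have -> : z - y - (z - x) = x - y by ring.
  by rewrite leNgt gt_max h1 h2.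
have /choice[P hP] : forall k : nat, exists P, F P /\ forall s t, P s -> P t -> sn (s - t) < k.+1%:R^-1.
  move=> k; have hU : nbhs (0 : A) [set z | sn z < k.+1%:R^-1].
    by apply/nbE; exists k.+1%:R^-1; [rewrite invr_gt0 ltr0n|move=> y; rewrite subr0].
  by have [P FP h] := FC _ hU; exists P.
pose Q k := \bigcap_(j in [set j | (j <= k)%N]) P j.
have FQ k : F (Q k).
  elim: k => [|k IH].
    by apply: filterS (hP 0%N).1 => z Pz j /=; rewrite leqn0 => /eqP ->.
  apply: filterS (filterI IH (hP k.+1).1) => z [Qz Pz] j /=.
  by rewrite leq_eqVlt => /orP[/eqP -> //|]; exact: Qz.
have /choice[s hs] : forall k, exists s, Q k s by move=> k; exact: filter_ex (FQ k).
have sP j k : (j <= k)%N -> P j (s k) by move=> jk; exact: hs.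
have [|l hl] := sc s.
  move=> e /small_inv[N hN]; exists N => k q Nk Nq.
  by apply: lt_trans (hN N (leqnn _)); apply: (hP N).2; exact: sP.
exists l => U /nbE[e e0 hU]; have [N hN] := small_inv e0.
have e20 : 0 < e / 2 by rewrite divr_gt0.
have [M hM] := hl _ e20.
apply: filterS (hP N).1 => t Pt; apply: hU.
have -> : t - l = (t - s (maxn N M)) + (s (maxn N M) - l) by ring.
apply: le_lt_trans (snD _ _) _; rewrite gt_max; apply/andP; split.
  by apply: lt_trans (hN N (leqnn _)); apply: (hP N).2 => //; apply: sP; exact: leq_maxl.
apply: le_lt_trans (hM _ (leq_maxr _ _)) _; lra.
Qed.

Section TateAlgebra.
Context (RR : realType) (K : fieldType) (v : absval RR K) (V : choiceType).
Local Notation C := (tate v V).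
Local Notation mono := (tate_mono v).
Implicit Types (x y z : C) (a b m n : {cmonom V}) (c d : K) (e : RR).

Lemma tate_nbhs x U : nbhs x U <-> exists2 e : RR, 0 < e & forall y, gauss (y - x) < e -> U y.
Proof. by []. Qed.

Lemma tcoef_sum (I : Type) (r : seq I) (F : I -> C) m : (\sum_(j <- r) F j) m = \sum_(j <- r) F j m.
Proof. by elim: r => [|j r IH]; rewrite ?big_nil ?tcoef0 // !big_cons tcoefD IH. Qed.

Lemma tmonoE c a m : mono c a m = c *+ (m == a). Proof. by []. Qed.

Lemma mono_mulE c a y m :
  (mono c a * y) m = if a \in mdivisors m then c * y (divcm m a) else 0.
Proof.
rewrite tcoefM; case: ifP => [am|/negP am].
  rewrite (big_fsetD1 a) //= eqxx mulr1n big_seq big1 ?addr0 // => b.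
  by rewrite in_fsetD1 => /andP[/negPf -> _]; rewrite mulr0n mul0r.
rewrite big_seq big1 // => b bm; rewrite tmonoE; case: eqVneq => [e|]; last by rewrite mulr0n mul0r.
by rewrite e in bm.
Qed.

Lemma mono_mono c a d b : mono c a * mono d b = mono (c * d) (mmul a b).
Proof.
apply/tateP => m; rewrite mono_mulE !tmonoE; case: mdivisorsP => [am|am].
  rewrite -mulrnAr; congr (_ * (_ *+ _)); congr nat_of_bool; apply/eqP/eqP => [<-|->].
    by rewrite divcmK.
  exact: mulcmK.
case: eqVneq => [e|]; last by rewrite mulr0n.
by case: am; rewrite e; exact: mdivides_mull.
Qed.

Lemma mono_cst c a : mono c a = tate_cst v V c * mono 1 a.
Proof. by rewrite mono_mono mulr1 mul1m. Qed.

Lemma monoB c d a : mono (c - d) a = mono c a - mono d a.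
Proof. by apply/tateP => m; rewrite tcoefB !tmonoE mulrnBl. Qed.

Lemma gauss_mono c a : gauss (mono c a) = v c.
Proof.
apply/eqP; rewrite eq_le; apply/andP; split.
  by apply: gauss_le => m; rewrite tmonoE; case: eqVneq; rewrite ?mulr1n ?mulr0n ?av0 ?av_ge0.
by apply: le_trans (gauss_ub _ a); rewrite tmonoE eqxx.
Qed.

Lemma cst_B c d : tate_cst v V (c - d) = tate_cst v V c - tate_cst v V d.
Proof. exact: monoB. Qed.
Lemma cst_M c d : tate_cst v V (c * d) = tate_cst v V c * tate_cst v V d.
Proof. by rewrite /tate_cst mono_mono mul1m. Qed.
Lemma cst_X c k : tate_cst v V (c ^+ k) = tate_cst v V c ^+ k.
Proof. by elim: k => [|k IH]; rewrite ?expr0 // !exprS cst_M IH. Qed.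

Lemma monom_ind (P : {cmonom V} -> Prop) : P mone ->
  (forall i m, P m -> P (mmul (ucm i) m)) -> forall m, P m.
Proof.
move=> P1 PU m; have [k] := ubnP (mdeg m); elim: k m => // k IH m mk.
have [->//|m1] := eqVneq m mone.
have [i im] : exists i, (0 < m i)%N.
  apply: contrapT => /forallNP h; move/eqP: m1; apply; apply/eqP/cmP => i.
  by rewrite cm1; apply/eqP; rewrite -leqn0 leqNgt; apply/negP.
have d : mdivides (ucm i) m by move=> j; rewrite cmU; case: eqVneq => [<-|].
rewrite -(divcmK d); apply: PU; apply: IH.
by rewrite -(divcmK d) mdegM mdegU in mk.
Qed.

(** Only finitely many coefficients are as large as a given nonzero one, so the supremum is a
    maximum. *)
Lemma gauss_att x : x != 0 -> exists m, v (x m) = gauss x.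
Proof.
move=> x0; have [m0 m00] : exists m, x m != 0.
  apply: contrapT => /forallNP h; move/eqP: x0; apply; apply/tateP => m.
  by rewrite tcoef0; apply/eqP/negbNE/negP; exact: h.
have c0 : 0 < v (x m0) by rewrite av_gt0.
pose S := fset_set [set m | v (x m0) <= v (x m)].
have inS m : (m \in S) = (v (x m0) <= v (x m)).
  by rewrite in_fset_set; [apply/idP/idP; rewrite inE|exact: coefP].
have mS : m0 \in S by rewrite inS.
have [||||m1 m1S hm] := @max_list _ (fun a b => v (x a) <= v (x b)) S.
- by move=> a b d; exact: le_trans.
- by move=> a.
- by move=> a b _ _; apply/orP; exact: le_total.
- by apply/eqP => S0; move: mS; rewrite -[m0 \in S]/(m0 \in (S : seq _)) S0.
exists m1; apply/eqP; rewrite eq_le gauss_ub; apply: gauss_le => m.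
have [/hm //|] := boolP (m \in S); rewrite inS -ltNge => /ltW h.
by apply: le_trans h _; rewrite -inS.
Qed.

Lemma gauss_eq0 x : gauss x = 0 -> x = 0.
Proof.
move=> h; apply/tateP => m; rewrite tcoef0; apply/eqP; rewrite -(av_eq0P v) eq_le av_ge0 andbT.
by rewrite -h gauss_ub.
Qed.

Lemma gauss_gt0 x : x != 0 -> 0 < gauss x.
Proof.
by move=> x0; rewrite lt_def gauss_ge0 andbT; apply: contra_neq x0; exact: gauss_eq0.
Qed.

(* Lexicographically maximal elements of A and B have a product with a unique
   decomposition. *)
Lemma extremal (L : seq V) (A B : seq {cmonom V}) : A != [::] -> B != [::] -> exists a b,
  [/\ a \in A, b \in B & forall a' b', a' \in A -> b' \in B -> mmul a' b' = mmul a b ->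
    forall i, i \in L -> a' i = a i].
Proof.
elim: L A B => [|i L IH] A B A0 B0.
  case: A A0 => // a A _; case: B B0 => // b B _.
  by exists a, b; split; rewrite ?mem_head // => a' b' _ _ _ i.
have mx (S : seq {cmonom V}) : S != [::] -> exists2 a, a \in S & forall b, b \in S -> (b i <= a i)%N.
  apply: max_list; [by move=> a b d; exact: leq_trans|by []|].
  by move=> a b _ _; apply/orP; exact: leq_total.
have [a0 a0A ha] := mx A A0; have [b0 b0B hb] := mx B B0.
pose A1 := [seq a : {cmonom V} <- A | a i == a0 i]; pose B1 := [seq b : {cmonom V} <- B | b i == b0 i].
have ne (S : seq {cmonom V}) a : a \in S -> S != [::] by case: S.
have [||a [b [aA bB hab]]] := IH A1 B1.
- by apply: (ne _ a0); rewrite mem_filter eqxx.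
- by apply: (ne _ b0); rewrite mem_filter eqxx.
move: aA bB; rewrite !mem_filter => /andP[/eqP ai aA] /andP[/eqP bi bB].
exists a, b; split=> // a' b' a'A b'B e.
have ei : (a' i + b' i = a i + b i)%N by rewrite -!cmM e.
have h1 := ha a' a'A; have h2 := hb b' b'B.
have a'i : a' i = a i by rewrite ai bi in ei *; lia.
have b'i : b' i = b i by lia.
move=> j; rewrite inE => /orP[/eqP -> //|jL].
by apply: (hab a' b') => //; rewrite mem_filter ?a'i ?ai ?b'i ?bi eqxx.
Qed.

(** Gauss's lemma. Among the monomials with coefficients of maximal size, [extremal] selects a pair
    whose product has no other such decomposition; every other contribution to that coefficient is
    strictly smaller. *)
Lemma gauss_mul x y : gauss (x * y) = gauss x * gauss y.
Proof.
have [->|x0] := eqVneq x 0; first by rewrite mul0r gauss0 mul0r.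
have [->|y0] := eqVneq y 0; first by rewrite mulr0 gauss0 mulr0.
apply/eqP; rewrite eq_le gaussM /=.
have gx := gauss_gt0 x0; have gy := gauss_gt0 y0.
pose M z := fset_set [set m | gauss z <= v (z m)].
have inM z m : z != 0 -> (m \in M z) = (gauss z <= v (z m)).
  move=> z0; rewrite in_fset_set; first by apply/idP/idP; rewrite inE.
  by apply: coefP; exact: gauss_gt0.
have neM z : z != 0 -> (M z : seq _) != [::].
  move=> z0; have [m hm] := gauss_att z0; have : m \in M z by rewrite inM // hm.
  by rewrite -[m \in M z]/(m \in (M z : seq _)); case: (M z : seq _).
pose L := flatten [seq (finsupp a : seq V) | a <- (M x : seq _)].
have [a [b [aM bM hab]]] := extremal L (neM x x0) (neM y y0).
have uniq a' b' : a' \in M x -> b' \in M y -> mmul a' b' = mmul a b -> a' = a.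
  move=> a'M b'M e; apply/eqP/cmP => i; have [iL|iL] := boolP (i \in L).
    exact: hab a'M b'M e i iL.
  have z a1 : a1 \in M x -> a1 i = 0%N.
    move=> h; apply: fsfun_dflt; apply: contraNN iL => h1; apply/flattenP.
    by exists (finsupp a1 : seq V) => //; apply/mapP; exists a1.
  by rewrite !z.
have aM' : gauss x <= v (x a) by rewrite -inM.
have bM' : gauss y <= v (y b) by rewrite -inM.
set g := gauss x * gauss y; have g0 : 0 < g by exact: mulr_gt0.
apply: le_trans (gauss_ub _ (mmul a b)); rewrite tcoefM (big_fsetD1 a) /=; last first.
  by apply/mdivisorsP; exact: mdivides_mull.
rewrite mulcmK; set rest := (X in _ + X).
have rg : v rest < g.
  rewrite ltNge; apply/negP; rewrite /rest => /(av_sum_ge g0)[a'].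
  rewrite in_fsetD1 avM => /andP[a'a /mdivisorsP a'm] h.
  have h1 := gauss_ub x a'; have h2 := gauss_ub y (divcm (mmul a b) a').
  have h3 := av_ge0 v (x a'); have h4 := av_ge0 v (y (divcm (mmul a b) a')).
  move/eqP: a'a; apply; apply: uniq (divcmK a'm); rewrite inM // leNgt; apply/negP => lt.
    have : v (x a') * v (y (divcm (mmul a b) a')) < g.
      by apply: le_lt_trans (_ : v (x a') * gauss y < _); [rewrite ler_wpM2l|rewrite ltr_pM2r].
    by rewrite ltNge h.
  have : v (x a') * v (y (divcm (mmul a b) a')) < g.
    by apply: le_lt_trans (_ : gauss x * v (y (divcm (mmul a b) a')) < _);
      [rewrite ler_wpM2r|rewrite ltr_pM2l].
  by rewrite ltNge h.
have : g <= v (x a * y b) by rewrite avM ler_pM // ltW.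
rewrite -[X in v X](addrK rest) => /le_trans /(_ (avB _ _ _)).
by rewrite le_max => /orP[//|]; rewrite leNgt rg.
Qed.

Lemma gaussX x k : gauss (x ^+ k) = gauss x ^+ k.
Proof.
elim: k => [|k IH]; last by rewrite !exprS gauss_mul IH.
by rewrite !expr0 -[1 : C]/(mono 1 mone) gauss_mono av1.
Qed.

Lemma tate_mul_eq0 x y : x * y = 0 -> x = 0 \/ y = 0.
Proof.
move=> h; have : gauss x * gauss y = 0 by rewrite -gauss_mul h gauss0.
by move=> /eqP; rewrite mulf_eq0 => /orP[/eqP/gauss_eq0|/eqP/gauss_eq0]; [left|right].
Qed.

Lemma gauss_N x : gauss (- x) = gauss x.
Proof.
have h z : gauss (- z) <= gauss z.
  by rewrite -sub0r (le_trans (gaussB _ _)) // gauss0 ge_max gauss_ge0 lexx.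
by apply/eqP; rewrite eq_le h /= -{1}[x]opprK h.
Qed.

Lemma gaussD x y : gauss (x + y) <= Num.max (gauss x) (gauss y).
Proof. by rewrite -[y in x + y]opprK (le_trans (gaussB _ _)) // gauss_N. Qed.

Definition trunc e x : C := \sum_(m <- fset_set [set m | e <= v (x m)]) mono (x m) m.

Lemma sum_monoE (S : {fset {cmonom V}}) (f : {cmonom V} -> K) m :
  (\sum_(n <- S) mono (f n) n) m = if m \in S then f m else 0.
Proof.
rewrite tcoef_sum; case: ifP => mS.
  rewrite (big_fsetD1 m) //= eqxx mulr1n big_seq big1 ?addr0 // => n.
  by rewrite in_fsetD1 => /andP[nm _]; rewrite eq_sym (negPf nm).
rewrite big_seq big1 // => n nS; rewrite tmonoE; case: eqVneq => // e.
by rewrite e nS in mS.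
Qed.

Lemma truncE e x m : 0 < e -> trunc e x m = if e <= v (x m) then x m else 0.
Proof.
move=> e0; rewrite /trunc sum_monoE in_fset_set; last exact: coefP.
by congr (if _ then _ else _); apply/idP/idP; rewrite inE.
Qed.

Lemma trunc_lt e x : 0 < e -> gauss (x - trunc e x) <= e.
Proof.
move=> e0; apply: gauss_le => m; rewrite tcoefB truncE //; case: ifP => h.
  by rewrite subrr av0 ltW.
by rewrite subr0 ltW // ltNge h.
Qed.

(** The polynomials: a dense subring on which continuous homomorphisms are defined and compared. *)
Definition fsup : set C := [set x | finite_set [set m | x m != 0]].
Definition tsupp x : {fset {cmonom V}} := fset_set [set m | x m != 0].

Lemma fsup_of x (S : {fset {cmonom V}}) : (forall m, x m != 0 -> m \in S) -> fsup x.
Proof.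
move=> h; apply: sub_finite_set (finite_fset S) => m /= /h; exact.
Qed.

Lemma tsuppE x m : fsup x -> (m \in tsupp x) = (x m != 0).
Proof. by move=> fx; rewrite in_fset_set //; apply/idP/idP; rewrite inE. Qed.

Lemma trunc_fsup e x : 0 < e -> fsup (trunc e x).
Proof.
move=> e0; apply: (fsup_of (S := fset_set [set m | e <= v (x m)])) => m.
rewrite truncE // in_fset_set; last exact: coefP.
by case: ifP; rewrite ?eqxx // inE.
Qed.

Lemma fsup_sum x : fsup x -> x = \sum_(m <- tsupp x) mono (x m) m.
Proof.
move=> fx; apply/tateP => m; rewrite sum_monoE tsuppE //.
by case: ifP => // /negbT; rewrite negbK => /eqP.
Qed.

Lemma fsup_mono c a : fsup (mono c a).
Proof.
apply: (fsup_of (S := [fset a]%fset)) => m; rewrite tmonoE in_fset1.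
by apply: contraNT => /negPf ->; rewrite mulr0n.
Qed.

Lemma fsup_B x y : fsup x -> fsup y -> fsup (x - y).
Proof.
move=> fx fy; apply: (fsup_of (S := (tsupp x `|` tsupp y)%fset)) => m.
rewrite tcoefB in_fsetU !tsuppE //; apply: contraNT.
by rewrite negb_or !negbK => /andP[/eqP -> /eqP ->]; rewrite subrr.
Qed.

Lemma fsup_0 : fsup 0. Proof. by rewrite -(subrr (mono 1 mone)); apply: fsup_B; exact: fsup_mono. Qed.

Lemma fsup_D x y : fsup x -> fsup y -> fsup (x + y).
Proof.
move=> fx fy; rewrite -[y]opprK; apply: fsup_B => //; rewrite -sub0r.
by apply: fsup_B => //; exact: fsup_0.
Qed.

Lemma fsup_Sum (I : Type) (r : seq I) (F : I -> C) : (forall j, fsup (F j)) -> fsup (\sum_(j <- r) F j).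
Proof. by move=> h; apply: big_ind => //; [exact: fsup_0|exact: fsup_D]. Qed.

Lemma fsup_dense x e : 0 < e -> exists2 y, fsup y & gauss (x - y) <= e.
Proof. by move=> e0; exists (trunc e x); [exact: trunc_fsup|exact: trunc_lt]. Qed.

Section Subst.
Context (B : topComRingType) (kc : K -> B) (X : V -> B).
Hypothesis Bc : complete_ring B.
Hypothesis Bna : nonarchimedean B.
Hypothesis kcB : forall c d, kc (c - d) = kc c - kc d.
Hypothesis kcM : forall c d, kc (c * d) = kc c * kc d.
Hypothesis kc1 : kc 1 = 1.

Definition mev m : B := \prod_(i <- finsupp m) X i ^+ m i.

Hypothesis mev_bounded : forall U, nbhs (0 : B) U -> exists2 e : RR, 0 < e &
  forall c m, v c < e -> U (kc c * mev m).

Lemma mevE (S : {fset V}) m : {subset finsupp m <= S} -> mev m = \prod_(i <- S) X i ^+ m i.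
Proof.
move=> h; apply: big_fset_incl; first by apply/fsubsetP => i; exact: h.
by move=> i _ im; rewrite fsfun_dflt // expr0.
Qed.

Lemma mev_mul a b : mev (mmul a b) = mev a * mev b.
Proof.
rewrite (@mevE (finsupp a `|` finsupp b)%fset a); last by move=> i; rewrite in_fsetU => ->.
rewrite (@mevE (finsupp a `|` finsupp b)%fset b); last by move=> i; rewrite in_fsetU orbC => ->.
rewrite -big_split /= (@mevE (finsupp a `|` finsupp b)%fset); last by move=> i; rewrite mdomD.
by apply: eq_bigr => i _; rewrite cmM exprD.
Qed.

Let kc0 : kc 0 = 0. Proof. by rewrite -{1}(subrr 0) kcB subrr. Qed.

Let f x : B := \sum_(m <- tsupp x) kc (x m) * mev m.

Let fE (S : {fset {cmonom V}}) x : (forall m, x m != 0 -> m \in S) ->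
  f x = \sum_(m <- S) kc (x m) * mev m.
Proof.
move=> h; have fx := fsup_of h; apply: big_fset_incl.
  by apply/fsubsetP => m; rewrite tsuppE //; exact: h.
by move=> m _; rewrite tsuppE // negbK => /eqP ->; rewrite kc0 mul0r.
Qed.

Let f_B x y : fsup x -> fsup y -> f (x - y) = f x - f y.
Proof.
move=> fx fy; pose S := (tsupp x `|` tsupp y)%fset.
have hx m : x m != 0 -> m \in S by rewrite in_fsetU -(tsuppE m fx) => ->.
have hy m : y m != 0 -> m \in S by rewrite in_fsetU -(tsuppE m fy) orbC => ->.
rewrite (fE hx) (fE hy) (@fE S) -?sumrB.
  by apply: eq_bigr => m _; rewrite tcoefB kcB mulrBl.
move=> m; rewrite tcoefB; apply: contraNT => mS.
have -> : x m = 0 by apply/eqP; apply: contraNT mS; exact: hx.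
by have -> : y m = 0; [apply/eqP; apply: contraNT mS; exact: hy|rewrite subrr].
Qed.

Let f_0 : f 0 = 0. Proof. by rewrite -{1}(subrr 0) f_B ?subrr //; exact: fsup_0. Qed.
Let f_D x y : fsup x -> fsup y -> f (x + y) = f x + f y.
Proof.
move=> fx fy; have f0y : fsup (0 - y) by apply: fsup_B => //; exact: fsup_0.
rewrite -[y in x + y]opprK -[- y]sub0r f_B // f_B ?f_0 //; first by rewrite sub0r opprK.
exact: fsup_0.
Qed.
Let f_sum (I : Type) (r : seq I) (F : I -> C) : (forall j, fsup (F j)) ->
  f (\sum_(j <- r) F j) = \sum_(j <- r) f (F j).
Proof.
move=> h; elim: r => [|j r IH]; first by rewrite !big_nil f_0.
by rewrite !big_cons f_D ?IH //; exact: fsup_Sum.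
Qed.

Let f_mono c a : f (mono c a) = kc c * mev a.
Proof.
rewrite (@fE [fset a]%fset).
  by rewrite big_seq_fset1 tmonoE eqxx.
by move=> m; rewrite tmonoE in_fset1; apply: contraNT => /negPf ->; rewrite mulr0n.
Qed.

Let f_M x y : fsup x -> fsup y -> fsup (x * y) /\ f (x * y) = f x * f y.
Proof.
move=> fx fy.
have e : x * y = \sum_(a <- tsupp x) \sum_(b <- tsupp y) mono (x a * y b) (mmul a b).
  rewrite {1}(fsup_sum fx) {1}(fsup_sum fy) mulr_suml; apply: eq_bigr => a _.
  by rewrite mulr_sumr; apply: eq_bigr => b _; rewrite mono_mono.
split; first by rewrite e; apply: fsup_Sum => a; apply: fsup_Sum => b; exact: fsup_mono.
rewrite e f_sum; last by move=> a; apply: fsup_Sum => b; exact: fsup_mono.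
rewrite /f mulr_suml; apply: eq_bigr => a _; rewrite -/(f _) f_sum; last by move=> b; exact: fsup_mono.
rewrite mulr_sumr; apply: eq_bigr => b _; rewrite f_mono kcM mev_mul; ring.
Qed.

(** On polynomials the map is a finite sum of images of terms. A bound uniform over all monomials
    and a nonarchimedean target make it continuous, and completeness extends it to series. *)
Lemma subst_hom : exists F : C -> B, tring_hom F /\ forall c a, F (mono c a) = kc c * mev a.
Proof.
have fc (U : set B) : nbhs (0 : B) U -> exists2 W, nbhs (0 : C) W & forall x, fsup x -> W x -> U (f x).
  move=> /Bna[H [hH H0 Hsub HU]]; have [e e0 he] := mev_bounded hH.
  exists [set x | gauss x < e].
    by apply/tate_nbhs; exists e => // y; rewrite subr0.
  move=> x fx xe; apply: HU; rewrite /f.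
  have HD u w : H u -> H w -> H (u + w).
    by move=> hu hw; rewrite -[w]opprK; apply: (Hsub) => //; rewrite -sub0r; exact: Hsub.
  elim: (tsupp x : seq _) => [|m r IH]; first by rewrite big_nil.
  rewrite big_cons; apply: HD => //; apply: he; exact: le_lt_trans (gauss_ub _ _) xe.
have [||||||||F [hF FE]] := @extend_hom C B fsup f Bc => //.
- exact: fsup_mono.
- exact: fsup_B.
- by move=> x y hx hy; have [] := f_M hx hy.
- move=> b U /tate_nbhs[e e0 hU]; have e20 : 0 < e / 2 by rewrite divr_gt0.
  have [y fy hy] := fsup_dense b e20; exists y => //; apply: hU; rewrite subr0.
  by apply: le_lt_trans hy _; lra.
- rewrite -[1 : C]/(mono 1 mone) f_mono kc1 mul1r (@mevE fset0%fset) ?big_seq_fset0 //.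
  by move=> i; rewrite mdom1.
- by move=> x y hx hy; have [] := f_M hx hy.
exists F; split=> // c a; rewrite FE ?f_mono //; exact: fsup_mono.
Qed.

End Subst.

Lemma hom_unique (B : topComRingType) (F1 F2 : C -> B) : complete_ring B ->
  tring_hom F1 -> tring_hom F2 ->
  (forall c, F1 (tate_cst v V c) = F2 (tate_cst v V c)) ->
  (forall i, F1 (tate_var v i) = F2 (tate_var v i)) -> F1 = F2.
Proof.
move=> Bc h1 h2 ec ev; apply: (@dense_unique C B fsup Bc _ _ _ h1 h2).
  move=> b U /tate_nbhs[e e0 hU]; have e20 : 0 < e / 2 by rewrite divr_gt0.
  have [y fy hy] := fsup_dense b e20; exists y => //; apply: hU; rewrite subr0.
  by apply: le_lt_trans hy _; lra.
have add (F : C -> B) : tring_hom F -> (F 0 = 0) * (forall x y, F (x + y) = F x + F y).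
  move=> [FB _ _]; have F0 : F 0 = 0 by rewrite -{1}(subrr 0) FB subrr.
  by split=> // x y; rewrite -[y in LHS]opprK -[- y]sub0r !FB F0 !sub0r opprK.
have [_ [m11 m12] _] := h1; have [_ [m21 m22] _] := h2.
move=> x /fsup_sum ->; elim: (tsupp x : seq _) => [|m r IH].
  by rewrite !big_nil !add.
rewrite !big_cons !add // IH; congr (_ + _); rewrite mono_cst m12 m22 ec; congr (_ * _).
elim/monom_ind: m => [|i m IHm]; first by rewrite -[mono 1 mone]/(1 : C) m11 m21.
have -> : mono 1 (mmul (ucm i) m) = tate_var v i * mono 1 m by rewrite mono_mono mulr1.
by rewrite m12 m22 ev IHm.
Qed.

Hypothesis Kc : forall u : nat -> K,
    (forall e : RR, 0 < e -> exists N : nat, forall m n : nat,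
       (N <= m)%N -> (N <= n)%N -> v (u m - u n) < e) ->
    exists l, forall e : RR, 0 < e -> exists N : nat, forall n : nat,
       (N <= n)%N -> v (u n - l) < e.

(** Coefficients converge by completeness of [K]. The convergence is uniform over monomials, so the
    limit has only finitely many coefficients above any bound. *)
Lemma tate_lim (s : nat -> C) : (forall e : RR, 0 < e -> exists N : nat, forall k l : nat,
      (N <= k)%N -> (N <= l)%N -> gauss (s k - s l) < e) ->
  exists l, forall e : RR, 0 < e -> exists N : nat, forall k : nat, (N <= k)%N -> gauss (s k - l) <= e.
Proof.
move=> hs.
have /choice[l hl] : forall m, exists l : K, forall e : RR, 0 < e -> exists N : nat, forall n : nat,
       (N <= n)%N -> v (s n m - l) < e.
  move=> m; apply: Kc => e /hs[N hN]; exists N => k q Nk Nq.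
  by apply: le_lt_trans (hN k q Nk Nq); rewrite -tcoefB; exact: gauss_ub.
have key e : 0 < e -> exists N : nat, forall k : nat, (N <= k)%N -> forall m, v (s k m - l m) <= e.
  move=> e0; have [N hN] := hs e e0; exists N => k Nk m; have [M hM] := hl m e e0.
  have h1 := hM _ (leq_maxr N M); have h2 := hN k _ Nk (leq_maxl N M).
  have -> : s k m - l m = (s k m - s (maxn N M) m) + (s (maxn N M) m - l m) by ring.
  apply: le_trans (av_ultra _ _ _) _; rewrite ge_max (ltW h1) andbT.
  by apply: ltW; apply: le_lt_trans h2; rewrite -tcoefB; exact: gauss_ub.
have rl : restricted v l.
  move=> e e0; have e20 : 0 < e / 2 by rewrite divr_gt0.
  have [N hN] := key _ e20; apply: sub_finite_set (coefP (s N) e0) => m /= h.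
  have h1 := hN N (leqnn _) m.
  move: h; rewrite -(subKr (s N m) (l m)) => /le_trans /(_ (avB _ _ _)).
  by rewrite le_max => /orP[//|h2]; exfalso; lra.
exists (Tate rl) => e /key[N hN]; exists N => k Nk; apply: gauss_le => m.
by rewrite tcoefB; exact: hN.
Qed.

Lemma tate_complete : complete_ring C.
Proof.
apply: (@seminorm_complete RR C (@gauss RR K v V)).
- exact: tate_nbhs.
- exact: gauss0.
- exact: gaussB.
- exact: gauss_eq0.
- exact: gauss_ge0.
- exact: tate_lim.
Qed.

Lemma tate_nonarch : nonarchimedean C.
Proof.
move=> U /tate_nbhs[e e0 hU]; exists [set x | gauss x < e]; split.
- by apply/tate_nbhs; exists e => // y; rewrite subr0.
- by rewrite /= gauss0.
- by move=> x y /= hx hy; apply: le_lt_trans (gaussB _ _) _; rewrite gt_max hx.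
- by move=> x /= hx; apply: hU; rewrite subr0.
Qed.

Variable p : nat.
Hypothesis pp : prime p.
Hypothesis charK : p \in [pchar K].
Let p_gt0 : (0 < p)%N. Proof. exact: prime_gt0. Qed.
Let p_gt1 : (1 < p)%N. Proof. exact: prime_gt1. Qed.

Definition mpow m : {cmonom V} := iter p (mmul m) mone.
Lemma mpowE m i : mpow m i = (p * m i)%N.
Proof.
rewrite /mpow; elim: p => [|k IH]; first by rewrite /= cm1.
by rewrite iterS cmM IH mulSn.
Qed.
Lemma mpow_inj : injective mpow.
Proof.
move=> a b h; apply/eqP/cmP => i; have := congr1 (fun m : {cmonom V} => m i) h.
by rewrite !mpowE => /eqP; rewrite eqn_pmul2l // => /eqP.
Qed.

Lemma tate_char : p%:R = 0 :> C.
Proof.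
have e k m : ((k%:R : C) m) = ((m == mone)%:R : K) *+ k.
  by elim: k => [|k IH]; rewrite ?tcoef0 ?mulr0n // -natr1 tcoefD IH tcoef1 mulrSr.
apply/tateP => m; rewrite e tcoef0; move: (_%:R) => z.
by rewrite -mulr_natl (pcharf0 charK) mul0r.
Qed.

Lemma frobD_gen (A : comPzRingType) (x y : A) : p%:R = 0 :> A -> (x + y) ^+ p = x ^+ p + y ^+ p.
Proof.
move=> p0; rewrite exprDn (bigD1 ord0) //= (bigD1 (Ordinal (ltnSn p))) /=; last by rewrite -val_eqE /= -lt0n.
rewrite subn0 expr0 mulr1 bin0 mulr1n subnn expr0 mul1r binn mulr1n big1 ?addr0 // => j.
rewrite -!val_eqE /= => /andP[j0 jp].
have /dvdnP[q ->] : (p %| 'C(p, j))%N.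
  by apply: prime_dvd_bin => //; rewrite lt0n j0 ltn_neqAle jp -ltnS ltn_ord.
by rewrite mulnC mulrnA -[X in X *+ q]mulr_natr p0 mulr0 mul0rn.
Qed.

Lemma tate_frobD x y : (x + y) ^+ p = x ^+ p + y ^+ p.
Proof. exact: frobD_gen tate_char. Qed.

Lemma K_frobD c d : (c + d) ^+ p = c ^+ p + d ^+ p.
Proof. by apply: frobD_gen; exact: pcharf0. Qed.

Lemma mono_X c a k : mono c a ^+ k = mono (c ^+ k) (iter k (mmul a) mone).
Proof. by elim: k => [|k IH]; rewrite ?expr0 // !exprS IH mono_mono. Qed.

(** Clear for a single term and preserved by sums in characteristic p, hence true for polynomials. A
    series differs from a polynomial by z with |z| <= e <= 1, and then |z^p| <= e as well. *)
Lemma frob_coef x : (forall b, (x ^+ p) (mpow b) = x b ^+ p) /\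
  (forall m, (forall b, m != mpow b) -> (x ^+ p) m = 0).
Proof.
pose P x := (forall b, (x ^+ p) (mpow b) = x b ^+ p) /\
  (forall m, (forall b, m != mpow b) -> (x ^+ p) m = 0).
have PD y z : P y -> P z -> P (y + z).
  move=> [y1 y2] [z1 z2]; rewrite /P tate_frobD; split=> [b|m hm].
    by rewrite !tcoefD y1 z1 K_frobD.
  by rewrite tcoefD y2 // z2 // addr0.
have P0 : P 0.
  have e : (0 : C) ^+ p = 0 by rewrite expr0n eqn0Ngt p_gt0.
  by rewrite /P e; split=> [b|m _]; rewrite !tcoef0 // expr0n eqn0Ngt p_gt0.
have Pm c a : P (mono c a).
  rewrite /P mono_X -/(mpow a); split=> [b|m hm]; rewrite !tmonoE; last by rewrite (negPf (hm a)).
  rewrite (inj_eq mpow_inj); case: eqVneq => // _.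
  by rewrite !mulr0n expr0n -[(p == 0)%N]negbK -lt0n p_gt0.
have Pf y : fsup y -> P y.
  by move=> /fsup_sum ->; apply: big_ind => //; exact: PD.
have le e : 0 < e -> e <= 1 -> exists2 y, P y & exists2 z, x = y + z & gauss z <= e.
  move=> e0 e1; have [y fy hy] := fsup_dense x e0.
  by exists y; [exact: Pf|exists (x - y) => //; rewrite addrC subrK].
have small z e (t : RR) : 0 <= t -> t <= gauss z ^+ p -> gauss z <= e -> e <= 1 -> t <= e.
  move=> t0 ht hz e1; apply: le_trans ht _; have gz := gauss_ge0 z.
  rewrite -(prednK p_gt0) exprS; apply: (le_trans _ hz); apply: ler_piMr => //.
  by apply: exprn_ile1 => //; exact: le_trans hz e1.
have min1 (Q : RR -> Prop) : (forall e e', e <= e' -> Q e -> Q e') ->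
    (forall e, 0 < e -> e <= 1 -> Q e) -> forall e, 0 < e -> Q e.
  move=> Qm h e e0; apply: (Qm (Num.min e 1)); first by rewrite ge_min lexx.
  by apply: h; [rewrite lt_min e0 ltr01|rewrite ge_min lexx orbT].
split=> [b|m hm].
  apply/eqP; rewrite -subr_eq0; apply/eqP/(av_le0 (v := v)).
  apply: min1 => [e e' ee h|e e0 e1]; first exact: le_trans ee.
  have [y [y1 _] [z -> hz]] := le e e0 e1; rewrite tate_frobD !tcoefD y1 K_frobD.
  have -> : y b ^+ p + (z ^+ p) (mpow b) - (y b ^+ p + z b ^+ p) = (z ^+ p) (mpow b) - z b ^+ p by ring.
  apply: le_trans (avB _ _ _) _; rewrite ge_max; apply/andP; split.
    by apply: (small z) => //; [exact: av_ge0|rewrite -gaussX; exact: gauss_ub].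
  apply: (small z) => //; [exact: av_ge0|rewrite avX].
  by apply: lerXn2r; rewrite ?nnegrE ?gauss_ge0 ?av_ge0 ?gauss_ub.
apply: (av_le0 (v := v)).
apply: min1 => [e e' ee h|e e0 e1]; first exact: le_trans ee.
have [y [_ y2] [z -> hz]] := le e e0 e1; rewrite tate_frobD tcoefD y2 // add0r.
by apply: (small z) => //; [exact: av_ge0|rewrite -gaussX; exact: gauss_ub].
Qed.

(* The splitting of Frobenius that extracts the coefficients of p-th powers *)
Variable rt : K -> K.
Hypothesis rtP : forall c, rt c ^+ p = c.

Lemma K_frob_inj c d : c ^+ p = d ^+ p -> c = d.
Proof.
move=> h; apply/eqP; rewrite -subr_eq0.
have : (c - d) ^+ p = 0.
  have := K_frobD (c - d) d; rewrite subrK h => /eqP.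
  by rewrite -subr_eq0 opprD addrCA subrr addr0 oppr_eq0 => /eqP.
by move=> /eqP; rewrite expf_eq0 => /andP[_].
Qed.

Lemma rt_D c d : rt (c + d) = rt c + rt d.
Proof. by apply: K_frob_inj; rewrite K_frobD !rtP. Qed.
Lemma rt_lin c d : rt (c ^+ p * d) = c * rt d.
Proof. by apply: K_frob_inj; rewrite exprMn !rtP. Qed.
Lemma rt_0 : rt 0 = 0.
Proof. by apply: K_frob_inj; rewrite rtP expr0n -[(p == 0)%N]negbK -lt0n p_gt0. Qed.
Lemma rt_1 : rt 1 = 1.
Proof. by apply: K_frob_inj; rewrite rtP expr1n. Qed.
Lemma av_rt c : v (rt c) ^+ p = v c. Proof. by rewrite -avX rtP. Qed.

Lemma tpsi_subproof x : restricted v (fun m => rt (x (mpow m))).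
Proof.
move=> e e0; have ep0 : 0 < e ^+ p by rewrite exprn_gt0.
pose g n := if pselect (exists m, mpow m = n) is left H then sval (cid H) else mone.
have gK m : g (mpow m) = m.
  by rewrite /g; case: pselect => [H|[]]; [apply: mpow_inj; case: cid|exists m].
apply: sub_finite_set (finite_image g (coefP x ep0)) => m /= h.
exists (mpow m); last exact: gK.
by rewrite /= -av_rt; apply: lerXn2r; rewrite ?nnegrE ?av_ge0 // ltW.
Qed.

Definition tpsi x : C := Tate (@tpsi_subproof x).

Lemma tpsiE x m : tpsi x m = rt (x (mpow m)). Proof. by []. Qed.

Lemma tpsi_D x y : tpsi (x + y) = tpsi x + tpsi y.
Proof. by apply/tateP => m; rewrite tcoefD !tpsiE tcoefD rt_D. Qed.

Lemma tpsi_1 : tpsi 1 = 1.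
Proof.
apply/tateP => m; rewrite tpsiE !tcoef1.
have -> : (mpow m == mone) = (m == mone).
  have {1}-> : mone = mpow mone :> {cmonom V} by apply/eqP/cmP => i; rewrite mpowE !cm1 muln0.
  by rewrite (inj_eq mpow_inj).
by case: eqP; rewrite ?rt_1 ?rt_0.
Qed.

(** Only p-th powers of monomials occur in x^p, so in the coefficient of m^p the contributing
    divisors are the p-th powers of divisors of m. *)
Lemma tpsi_lin x y : tpsi (x ^+ p * y) = x * tpsi y.
Proof.
have [f1 f2] := frob_coef x; apply/tateP => m; rewrite tpsiE !tcoefM.
have mdiv b : mdivides b m -> divcm (mpow m) (mpow b) = mpow (divcm m b).
  by move=> bm; apply/eqP/cmP => i; rewrite divcmE !mpowE divcmE mulnBr.
have -> : \sum_(a <- mdivisors (mpow m)) (x ^+ p) a * y (divcm (mpow m) a) =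
    \sum_(b <- mdivisors m) x b ^+ p * y (mpow (divcm m b)).
  rewrite -(@big_fset_incl _ _ _ _ [fset mpow b | b in mdivisors m]%fset).
  - rewrite big_imfset /=; last by move=> a b _ _; exact: mpow_inj.
    rewrite !big_seq; apply: eq_bigr => b /mdivisorsP bm; rewrite f1 mdiv //.
  - apply/fsubsetP => _ /imfsetP[b /= /mdivisorsP bm ->]; apply/mdivisorsP => i.
    by rewrite !mpowE leq_mul2l bm orbT.
  - move=> a /mdivisorsP am aN; rewrite f2 ?mul0r // => b; apply: contraNneq aN => ab.
    apply/imfsetP; exists b => //=; apply/mdivisorsP => i.
    by have := am i; rewrite ab !mpowE leq_pmul2l.
elim: (mdivisors m : seq _) => [|b r IH]; first by rewrite !big_nil rt_0.
by rewrite !big_cons rt_D IH rt_lin.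
Qed.

Lemma gauss_tpsi x : gauss x <= 1 -> gauss (tpsi x) <= 1.
Proof.
move=> h; apply: gauss_le => m; rewrite tpsiE leNgt; apply/negP => h1.
have : 1 < v (rt (x (mpow m))) ^+ p by rewrite exprn_egt1 // -lt0n.
by rewrite av_rt ltNge (le_trans (gauss_ub _ _) h).
Qed.

End TateAlgebra.

(** * The ring R *)

Section DomainField.
Variable A : comPzRingType.
Definition is_dom : Prop := (1 != 0 :> A) /\ forall a b : A, a * b = 0 -> a = 0 \/ b = 0.
(** A copy of [A] indexed by the proof of integrality, on which the structure of an integral domain
    and then the fraction field can be built. *)
Definition domof (h : is_dom) : Type := A.
Variable h : is_dom.
Local Notation D := (domof h).

HB.instance Definition _ := GRing.ComPzRing.copy D A.
HB.instance Definition _ := GRing.PzSemiRing_isNonZero.Build D (proj1 h).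

Let unit : {pred D} := fun a => `[< exists b : D, b * a = 1 >].
Let inv (a : D) : D := if pselect (exists b : D, b * a = 1) is left H then sval (cid H) else a.
Let mulVx : {in unit, left_inverse 1 inv *%R}.
Proof. by move=> a /asboolP H; rewrite /inv; case: pselect => [H'|//]; case: cid. Qed.
Let unitPl (x y : D) : y * x = 1 -> unit x.
Proof. by move=> e; apply/asboolP; exists y. Qed.
Let invr_out : {in [predC unit], inv =1 id}.
Proof. by move=> a /asboolP H; rewrite /inv; case: pselect => [H'|//]; case: H. Qed.
HB.instance Definition _ := GRing.ComNzRing_hasMulInverse.Build D mulVx unitPl invr_out.

Let dom_axiom : GRing.integral_domain_axiom D.
Proof. by move=> a b /(proj2 h)[->|->]; rewrite eqxx ?orbT. Qed.
HB.instance Definition _ := GRing.ComUnitRing_isIntegral.Build D dom_axiom.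

Definition dfield : fieldType := {fraction D}.
Definition dfrac (a : A) : dfield := @FracField.tofrac D a.

Let dfracB : zmod_morphism dfrac.
Proof. by move=> a b; exact: (@tofracB D a b). Qed.
Let dfracM : monoid_morphism dfrac.
Proof. by split=> [|a b]; [exact: tofrac1|exact: (@tofracM D a b)]. Qed.
HB.instance Definition _ := GRing.isZmodMorphism.Build A dfield dfrac dfracB.
HB.instance Definition _ := GRing.isMonoidMorphism.Build A dfield dfrac dfracM.

Lemma dfrac_inj : injective dfrac.
Proof. by move=> a b /eqP; rewrite /dfrac tofrac_eq => /eqP. Qed.

Lemma dfrac_frac (k : dfield) : exists a b : A, b != 0 /\ k = dfrac a / dfrac b.
Proof.
elim/quotW: k => r; exists (frac r).1, (frac r).2; split; first exact: denom_ratioP.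
have d0 : dfrac (frac r).2 != 0.
  by rewrite /dfrac tofrac_eq0; exact: denom_ratioP.
apply: (mulIf d0); rewrite divfK // /dfrac -[r in LHS]Ratio_numden.
have tE (a : D) : FracField.tofrac a = (\pi_(FracField.type D) (Ratio a 1))%qT.
  by rewrite piE.
rewrite !tE -[LHS]/(FracField.mul _ _) -FracField.pi_mul; apply/eqP.
rewrite FracField.equivf_def /FracField.mulf.
rewrite !numden_Ratio ?mulf_neq0 ?oner_neq0 ?denom_ratioP //.
by rewrite !mulr1 mulrC.
Qed.

End DomainField.

(** Bernoulli's inequality for the powers of 1 / t. *)
Lemma expr_small (RR : realType) (t e : RR) : 0 <= t < 1 -> 0 < e -> exists n : nat, t ^+ n < e.
Proof.
move=> /andP[t0 t1] e0; have [->|tn0] := eqVneq t 0.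
  by exists 1%N; rewrite expr1.
have {}t0 : 0 < t by rewrite lt_def tn0.
pose d := t^-1 - 1; have d0 : 0 < d by rewrite subr_gt0 invf_gt1.
have bern (n : nat) : 1 + n%:R * d <= t^-1 ^+ n.
  elim: n => [|n IH]; first by rewrite mul0r addr0 expr0.
  have tE : t^-1 = 1 + d by rewrite /d addrC subrK.
  rewrite exprS {1}tE; apply: le_trans (_ : (1 + d) * (1 + n%:R * d) <= _).
    have n0 : 0 <= n%:R :> RR by rewrite ler0n.
    by rewrite -natr1; nra.
  by rewrite ler_wpM2l // addr_ge0 // ltW.
exists (Num.bound (e^-1 / d)); set n := Num.bound _.
have hn : e^-1 / d < n%:R by apply: archi_boundP; rewrite divr_ge0 ?invr_ge0 // ltW.
rewrite ltr_pdivrMr // in hn.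
rewrite -[t ^+ n]invrK invf_plt ?posrE ?invr_gt0 ?exprn_gt0 // -exprVn.
by apply: lt_le_trans (bern n); lra.
Qed.

Section RingR.
Context (RR : realType) (K : fieldType) (v : absval RR K).
Local Notation C := (tate v var).
Local Notation R := (ringR v).
Local Notation mono := (tate_mono v).
Local Notation cst := (tate_cst v var).
Local Notation Rin := (@in_R RR K v).
Implicit Types (x y z : C) (m : {cmonom var}) (e : RR).

Definition okm m : bool := (zdeg m == 0%N) || (0 < m vars)%N.

Lemma zdegE m m' : (forall i, is_z i -> m i = m' i) -> (zdeg m == 0%N) = (zdeg m' == 0%N).
Proof.
by move=> h; apply/eqP/eqP => /zdeg_eq0 h1; apply/zdeg_eq0 => i iz; move: (h1 i iz); rewrite h.
Qed.

Lemma mdivides_ucm i m : mdivides (ucm i) m <-> (0 < m i)%N.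
Proof.
split=> [/(_ i)|h j]; first by rewrite cmUU.
by rewrite cmU; case: eqVneq => [<-|].
Qed.

Lemma s_mulE z m : (s_ v * z) m = if (0 < m vars)%N then z (divcm m (ucm vars)) else 0.
Proof.
rewrite /s_ /tate_var mono_mulE mul1r; case: mdivisorsP => [/mdivides_ucm -> //|].
by case: ifP => // h; case; exact/mdivides_ucm.
Qed.

(** R is cut out by a set of monomials, so its closedness and its stability under the splitting and
    the action become conditions on single coefficients. *)
Lemma in_R_coef x : x \in Rin <-> forall m, x m != 0 -> okm m.
Proof.
split=> [/in_RP[a [b [ha hb ->]]] m|h].
  rewrite tcoefD s_mulE /okm; case: ifP => [_ _|_]; first by rewrite orbT.
  by rewrite addr0 => /ha ->.
have ra : restricted v (fun m => if zdeg m == 0%N then x m else 0).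
  move=> e e0; apply: sub_finite_set (coefP x e0) => m /=.
  by case: ifP => // _; rewrite av0 leNgt e0.
have rb : restricted v (fun m => if zdeg m == 0%N then 0 else x (mmul (ucm vars) m)).
  pose g n : {cmonom var} := divcm n (ucm vars).
  move=> e e0; apply: sub_finite_set (finite_image g (coefP x e0)) => m /=.
  case: ifP => _; first by rewrite av0 leNgt e0.
  by exists (mmul (ucm vars) m) => //; rewrite /g mulcmK.
apply/in_RP; exists (Tate ra), (Tate rb); split.
- by move=> m /=; case: ifP => [/eqP //|]; rewrite eqxx.
- by move=> m /=; case: ifP => [_|/negbT]; [rewrite eqxx|rewrite lt0n].
- apply/tateP => m; rewrite tcoefD s_mulE /=.
  have zd : (0 < m vars)%N -> (zdeg (divcm m (ucm vars)) == 0%N) = (zdeg m == 0%N).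
    move=> _; apply: zdegE => i iz; rewrite divcmE cmU.
    by case: eqVneq iz => [<-|_ _]; rewrite ?subn0.
  case: ifP => hz; case: ifP => hs; rewrite ?zd // ?hz ?addr0 ?add0r //.
    by rewrite divcmK //; exact/mdivides_ucm.
  apply/eqP; apply: contraTT isT => /h; by rewrite /okm hz hs.
Qed.

Lemma RvalB (x y : R) : Rval (x - y) = Rval x - Rval y. Proof. exact: (raddfB val). Qed.
Lemma RvalM (x y : R) : Rval (x * y) = Rval x * Rval y. Proof. exact: (rmorphM val). Qed.
Lemma RvalD (x y : R) : Rval (x + y) = Rval x + Rval y. Proof. exact: (raddfD val). Qed.
Lemma Rval1 : Rval (1 : R) = 1. Proof. exact: (rmorph1 val). Qed.
Lemma Rval0 : Rval (0 : R) = 0. Proof. exact: (raddf0 val). Qed.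
Lemma RvalX (x : R) k : Rval (x ^+ k) = Rval x ^+ k. Proof. exact: (rmorphXn val). Qed.
Lemma Rval_inj : injective (@Rval RR K v). Proof. exact: val_inj. Qed.

Lemma ringR_nbhs (x : R) U : nbhs x U <-> exists2 e : RR, 0 < e & forall y : R, gaussR (y - x) < e -> U y.
Proof. by []. Qed.

Lemma gaussRE (x : R) : gaussR x = gauss (Rval x). Proof. by []. Qed.

Lemma cst_in_R c : cst c \in Rin.
Proof.
apply/in_R_coef => m; rewrite /tate_cst tmonoE /okm; case: (eqVneq m mone) => [-> _|_]; last first.
  by rewrite mulr0n eqxx.
by apply/orP; left; apply/eqP/zdeg_eq0 => i _; rewrite cm1.
Qed.
Definition Rcst c : R := RingR (cst_in_R c).

Lemma s_mul_in_R z : s_ v * z \in Rin.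
Proof. by apply/in_R_coef => m; rewrite s_mulE /okm; case: ifP; rewrite ?orbT ?eqxx. Qed.

Lemma T_in_R : T_ v \in Rin.
Proof.
apply/in_R_coef => m; rewrite /T_ /tate_var tmonoE; case: (eqVneq m (ucm varT)) => [-> _|_]; last first.
  by rewrite mulr0n eqxx.
by rewrite /okm; apply/orP; left; apply/eqP/zdeg_eq0 => -[] //= *; rewrite cmU; case: eqVneq.
Qed.
Definition R_T : R := RingR T_in_R.

Variables (p : nat) (pi : K).
Hypothesis pp : prime p.
Hypothesis charK : p \in [pchar K].
Hypothesis Kp : perfectoid_field p v.
Hypothesis pi1 : 0 < v pi < 1.

Lemma pi_lt1 : v pi < 1. Proof. by case/andP: pi1. Qed.
Lemma pi_gt0 : 0 < v pi. Proof. by case/andP: pi1. Qed.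
Lemma piK_neq0 : pi != 0. Proof. by rewrite -(av_gt0 v) pi_gt0. Qed.
Lemma piX_le1 j : v (pi ^+ j) <= 1.
Proof. by rewrite avX exprn_ile1 ?ltW ?pi_lt1 ?pi_gt0. Qed.

Lemma ringR_complete : complete_ring R.
Proof.
apply: (@seminorm_complete RR R (@gaussR RR K v)).
- exact: ringR_nbhs.
- by rewrite gaussRE Rval0 gauss0.
- by move=> x y; rewrite !gaussRE RvalB; exact: gaussB.
- by move=> x /gauss_eq0 h; apply: Rval_inj; rewrite [LHS]h Rval0.
- by move=> x; exact: gauss_ge0.
- move=> s hs; have [|l hl] := @tate_lim RR K v var (pf_complete Kp) (fun k => Rval (s k)).
    by move=> e /hs[N hN]; exists N => k q Nk Nq; rewrite -RvalB; exact: hN.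
  have lR : l \in Rin.
    apply/in_R_coef => m; apply: contraNT => okF; apply/eqP/(av_le0 (v := v)) => e /hl[N hN].
    have e1 : Rval (s N) m = 0.
      by apply/eqP; apply: contraNT okF; move: m; apply/in_R_coef; exact: RvalP.
    have h := le_trans (gauss_ub (Rval (s N) - l) m) (hN N (leqnn _)).
    by rewrite tcoefB e1 sub0r avN in h.
  exists (RingR lR) => e /hl[N hN]; exists N => k Nk.
  by rewrite gaussRE RvalB; exact: hN.
Qed.

Lemma scale_small (g e : RR) : 0 <= g -> 0 < e -> exists n : nat, v (pi ^+ n) * g < e.
Proof.
move=> g0 e0; have h : 0 < e / (1 + g) by apply: divr_gt0 => //; lra.
have [|n hn] := @expr_small RR (v pi) _ _ h; first by rewrite ltW ?pi_gt0 ?pi_lt1.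
exists n; rewrite avX; have := hn; rewrite ltr_pdivlMr; last by lra.
apply: le_lt_trans; apply: ler_wpM2l; last by lra.
by rewrite exprn_ge0 // ltW // pi_gt0.
Qed.

Lemma gauss_power_le (z : C) (c : RR) : (forall k : nat, gauss (z ^+ k) <= c) -> gauss z <= 1.
Proof.
move=> h; rewrite leNgt; apply/negP => g1; have g0 := lt_trans ltr01 g1.
have c0 : 0 < c by apply: lt_le_trans (h 0%N); rewrite gaussX expr0.
have [||n] := @expr_small RR (gauss z)^-1 c^-1.
- by rewrite invr_ge0 ltW //= invf_lt1.
- by rewrite invr_gt0.
by rewrite exprVn ltf_pV2 ?posrE ?exprn_gt0 // ltNge -gaussX h.
Qed.

(** The Gauss norm is multiplicative, so powers of an element of norm above 1 are unbounded. *)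
Lemma pb_gaussR (x : R) : power_bounded x <-> gaussR x <= 1.
Proof.
split=> [h|h U /ringR_nbhs[e e0 hU]]; last first.
  exists [set y | gaussR y < e]; first by apply/ringR_nbhs; exists e => // y; rewrite subr0.
  move=> w _ /= we [k _ <-]; apply: hU; rewrite subr0 gaussRE RvalM gauss_mul RvalX gaussX.
  apply: le_lt_trans we; rewrite ler_piMr ?gauss_ge0 //.
  by apply: exprn_ile1 => //; exact: gauss_ge0.
have [W /ringR_nbhs[e e0 hW] WU] : exists2 W, nbhs (0 : R) W &
    forall w y : R, W w -> range (fun n : nat => x ^+ n) y -> gaussR (w * y) < 1.
  have h1 : nbhs (0 : R) [set y : R | gaussR y < 1].
    by apply/ringR_nbhs; exists 1; [exact: ltr01|move=> y; rewrite subr0].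
  exact: h _ h1.
have [n hn] := @scale_small 1 e ler01 e0; rewrite mulr1 in hn.
have pin : 0 < v (pi ^+ n) by rewrite av_gt0 expf_neq0 // piK_neq0.
apply: (@gauss_power_le _ (v (pi ^+ n))^-1) => k.
rewrite -[leRHS]mul1r ler_pdivlMr // mulrC.
have : gaussR (Rcst (pi ^+ n) * x ^+ k) < 1.
  apply: WU; last by exists k.
  by apply: hW; rewrite subr0 gaussRE /= /tate_cst gauss_mono.
by rewrite gaussRE RvalM gauss_mul RvalX /= /tate_cst gauss_mono => /ltW.
Qed.

Lemma ringR_dom : is_dom R.
Proof.
split.
  apply/eqP => /(congr1 (fun x : R => Rval x mone)); rewrite Rval1 Rval0 tcoef1 tcoef0 eqxx.
  by move/eqP; rewrite oner_eq0.
move=> a b /(congr1 (@Rval RR K v)); rewrite RvalM Rval0 => /tate_mul_eq0[h|h].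
  by left; apply: Rval_inj; rewrite h Rval0.
by right; apply: Rval_inj; rewrite h Rval0.
Qed.

(** In characteristic p the surjectivity of Frobenius on the unit ball modulo p is exact; an element
    of norm above 1 is handled through its inverse. *)
Lemma K_root (c : K) : exists d, d ^+ p = c.
Proof.
have H c' : v c' <= 1 -> exists d, d ^+ p = c'.
  move=> /(pf_frobenius Kp)[y [z [_ _ ->]]]; exists y.
  by rewrite (pcharf0 charK) mul0r addr0.
have [/H //|lt] := leP (v c) 1.
have [|d hd] := H c^-1; last by exists d^-1; rewrite exprVn hd invrK.
have c0 : c != 0 by rewrite -(av_gt0 v) (lt_trans ltr01).
have e : v c * v c^-1 = 1 by rewrite -avM mulfV // av1.
have := av_ge0 v c^-1; nra.
Qed.

Definition rt c : K := sval (cid (K_root c)).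
Lemma rtE c : rt c ^+ p = c. Proof. by rewrite /rt; case: cid. Qed.

(** If m^p is free of z-variables or divisible by s, then so is m; the extracted coefficients
    therefore belong to monomials of R. *)
Lemma tpsi_in_R (x : R) : tpsi pp rtE (Rval x) \in Rin.
Proof.
apply/in_R_coef => m; rewrite tpsiE => h.
have : okm (mpow p m).
  have := RvalP x; rewrite in_R_coef; apply; apply: contraNneq h => ->.
  by rewrite (rt_0 pp charK rtE).
have p0 := prime_gt0 pp.
rewrite /okm mpowE muln_gt0 p0 /= => /orP[/eqP/zdeg_eq0 hz|->]; last by rewrite orbT.
apply/orP; left; apply/eqP/zdeg_eq0 => i /hz/eqP; rewrite mpowE muln_eq0.
by case/orP=> /eqP // e; rewrite e in p0.
Qed.
Definition rpsi (x : R) : R := RingR (tpsi_in_R x).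

Lemma subst_var (B : topComRingType) (kc : K -> B) (X : var -> B) :
  complete_ring B -> nonarchimedean B ->
  (forall c d, kc (c - d) = kc c - kc d) -> (forall c d, kc (c * d) = kc c * kc d) -> kc 1 = 1 ->
  (forall U, nbhs (0 : B) U -> exists2 e : RR, 0 < e &
    forall c m, v c < e -> U (kc c * mev X m)) ->
  exists F : C -> B, [/\ tring_hom F, forall c, F (cst c) = kc c & forall i, F (tate_var v i) = X i].
Proof.
move=> Bc Bna kB kM k1 hb; have [F [hF FE]] := subst_hom Bc Bna kB kM k1 hb.
exists F; split=> // [c|i]; rewrite /tate_cst /tate_var FE /mev.
  by rewrite mdom1 big_seq_fset0 mulr1.
by rewrite mdomU big_seq_fset1 cmUU expr1 k1 mul1r.
Qed.

Lemma mev_le1 (X : var -> C) m : (forall i, gauss (X i) <= 1) -> gauss (mev X m) <= 1.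
Proof.
move=> h; apply: (big_ind (fun z => gauss z <= 1)).
- by rewrite -[1 : C]/(mono 1 mone) gauss_mono av1.
- by move=> x y hx hy; rewrite gauss_mul mulr_ile1 // gauss_ge0.
- by move=> i _; rewrite gaussX exprn_ile1 // gauss_ge0.
Qed.

Lemma subst_tate (X : var -> C) : (forall i, gauss (X i) <= 1) ->
  exists F : C -> C, [/\ tring_hom F, forall c, F (cst c) = cst c & forall i, F (tate_var v i) = X i].
Proof.
move=> hX; apply: subst_var.
- exact: tate_complete (pf_complete Kp).
- exact: tate_nonarch.
- exact: cst_B.
- exact: cst_M.
- by [].
- move=> U /tate_nbhs[e e0 hU]; exists e => // c m ce; apply: hU.
  rewrite subr0 gauss_mul /tate_cst gauss_mono; apply: le_lt_trans ce.
  by rewrite ler_piMr ?av_ge0 //; exact: mev_le1.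
Qed.

Definition sigX (i : var) : C := match i with
  | varxs j => xs_ v j - cst (pi ^+ j) * y_ v j 0
  | varx j n => x_ v j n + cst (pi ^+ j) * y_ v j n - T_ v * y_ v j n.+1
  | i => tate_var v i end.

Lemma gauss_var (i : var) : gauss (tate_var v i) = 1.
Proof. by rewrite /tate_var gauss_mono av1. Qed.

Lemma sigX_le1 i : gauss (sigX i) <= 1.
Proof.
have hc j z : gauss z <= 1 -> gauss (cst (pi ^+ j) * z) <= 1.
  by move=> h; rewrite gauss_mul /tate_cst gauss_mono mulr_ile1 ?av_ge0 ?gauss_ge0 ?piX_le1.
case: i => [||j|j n|j n] /=; rewrite ?gauss_var //.
- apply: le_trans (gaussB _ _) _; rewrite ge_max [X in X <= _]gauss_var lexx /=.
  by apply: hc; rewrite gauss_var.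
- apply: le_trans (gaussB _ _) _; rewrite ge_max; apply/andP; split.
    apply: le_trans (gaussD _ _) _; rewrite ge_max [X in X <= _]gauss_var lexx /=.
    by apply: hc; rewrite gauss_var.
  by rewrite gauss_mul ![gauss (_ v)]gauss_var [gauss (y_ _ _ _)]gauss_var mulr1.
Qed.

Definition sig : C -> C := sval (cid (subst_tate sigX_le1)).
Lemma sig_hom : tring_hom sig. Proof. by rewrite /sig; case: cid => F []. Qed.
Lemma sig_cst c : sig (cst c) = cst c. Proof. by rewrite /sig; case: cid => F []. Qed.
Lemma sig_var i : sig (tate_var v i) = sigX i. Proof. by rewrite /sig; case: cid => F []. Qed.

Lemma hom_facts (A B : topComRingType) (F : A -> B) : tring_hom F ->
  [/\ forall x y : A, F (x - y) = F x - F y, forall x y : A, F (x * y) = F x * F y, F 1 = 1,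
      F 0 = 0 & forall x y : A, F (x + y) = F x + F y].
Proof.
move=> [FB [F1 FM] _]; have F0 : F 0 = 0 by rewrite -{1}(subrr 0) FB subrr.
split=> // x y; rewrite -[y in LHS]opprK -[- y]sub0r !FB F0 !sub0r opprK //.
Qed.

Lemma sigB x y : sig (x - y) = sig x - sig y. Proof. by have [] := hom_facts sig_hom. Qed.
Lemma sigM x y : sig (x * y) = sig x * sig y. Proof. by have [] := hom_facts sig_hom. Qed.
Lemma sigD x y : sig (x + y) = sig x + sig y. Proof. by have [] := hom_facts sig_hom. Qed.

Lemma comp_hom (A B D : topComRingType) (F : A -> B) (H : B -> D) :
  tring_hom F -> tring_hom H -> tring_hom (H \o F).
Proof.
move=> [FB [F1 FM] Fc] [HB_ [H1 HM] Hc]; split.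
- by move=> x y /=; rewrite FB HB_.
- by split=> [|x y] /=; rewrite ?F1 // FM HM.
- by move=> x; apply: continuous_comp; [exact: Fc|exact: Hc].
Qed.

Lemma id_hom (A : topComRingType) : tring_hom (@id A).
Proof. by split=> // x U. Qed.

Lemma iter_hom n : tring_hom (iter n sig).
Proof.
elim: n => [|n IH]; first exact: id_hom.
exact: comp_hom IH sig_hom.
Qed.

Lemma iter_cst n c : iter n sig (cst c) = cst c.
Proof. by elim: n => [//|n IH]; rewrite iterS IH sig_cst. Qed.
Lemma iter_fix n i : sigX i = tate_var v i -> iter n sig (tate_var v i) = tate_var v i.
Proof. by move=> h; elim: n => [//|n IH]; rewrite iterS IH sig_var. Qed.

Lemma iter_shift n x z : sig x = x + z -> sig z = z -> iter n sig x = x + z *+ n.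
Proof.
move=> hx hz; elim: n => [|n IH]; first by rewrite mulr0n addr0.
rewrite iterS IH sigD hx.
have -> : sig (z *+ n) = z *+ n.
  elim: n {IH} => [|n IH]; first by rewrite !mulr0n -(subrr x) sigB !subrr.
  by rewrite !mulrS sigD IH hz.
by rewrite -addrA -mulrS.
Qed.

Lemma sig_y j n : sig (y_ v j n) = y_ v j n. Proof. exact: sig_var. Qed.
Lemma sig_T : sig (T_ v) = T_ v. Proof. exact: sig_var. Qed.
(** Each variable is moved by the addition of a fixed element, and p such additions cancel in
    characteristic p. Continuous homomorphisms that agree on constants and variables are equal. *)
Lemma iter_p : iter p sig =1 id.
Proof.
have kp z : z *+ p = 0 by rewrite -mulr_natl (tate_char v var charK) mul0r.
have E1 c : iter p sig (cst c) = cst c by exact: iter_cst.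
suff E2 i : iter p sig (tate_var v i) = tate_var v i.
  have H := hom_unique (@tate_complete _ _ v var (pf_complete Kp)) (iter_hom p) (id_hom C) E1 E2.
  by move=> x; rewrite [iter p sig]H.
case: i => [||j|j n|j n]; try exact: iter_fix.
- rewrite (@iter_shift _ _ (- (cst (pi ^+ j) * y_ v j 0))); first by rewrite mulNrn kp oppr0 addr0.
    exact: sig_var.
  by rewrite -sub0r sigB sigM sig_cst sig_y -{1}(subrr (0 : C)) sigB subrr.
- rewrite (@iter_shift _ _ (cst (pi ^+ j) * y_ v j n - T_ v * y_ v j n.+1)); first by rewrite kp addr0.
    by rewrite sig_var /= addrA.
  by rewrite sigB !sigM sig_cst !sig_y sig_T.
Qed.

Lemma iter_mod n : iter (n %% p) sig =1 iter n sig.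
Proof.
move=> x; rewrite {2}(divn_eq n p) addnC iterD; congr iter.
by elim: (n %/ p)%N => [//|q IH]; rewrite mulSn iterD iter_p.
Qed.

Variables (G : finGroupType) (sigma : G).
Hypothesis cardG : #|G| = p.
Hypothesis sigma_gen : forall g : G, g \in <[sigma]>%g.

Lemma order_sigma : #[sigma]%g = p.
Proof.
rewrite -cardG /order; apply: eq_card => g; by rewrite sigma_gen.
Qed.

Lemma gexp_ex g : exists n, g = (sigma ^+ n)%g. Proof. exact/cycleP. Qed.
Definition gexp g : nat := sval (cid (gexp_ex g)).
Lemma gexpP g : (sigma ^+ gexp g)%g = g. Proof. by rewrite /gexp; case: cid. Qed.

(** The exponent of [g] is chosen arbitrarily; by [iter_p] only its class modulo p matters. *)
Definition rho (g : G) : C -> C := iter (gexp g) sig.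

Lemma rhoE g n : g = (sigma ^+ n)%g -> rho g =1 iter n sig.
Proof.
move=> e x; rewrite /rho -iter_mod -(iter_mod n); congr (iter _ sig x).
have /eqP := gexpP g; rewrite {2}e eq_expg_mod_order order_sigma => /eqP; exact.
Qed.

Lemma rho1 x : rho 1%g x = x. Proof. by rewrite (@rhoE 1%g 0). Qed.
Lemma rhoM g h x : rho (g * h)%g x = rho g (rho h x).
Proof. by rewrite (@rhoE _ (gexp g + gexp h)%N) ?iterD // expgD !gexpP. Qed.
Lemma rho_sigma x : rho sigma x = sig x.
Proof. by rewrite (@rhoE _ 1%N) // expg1. Qed.
Lemma rho_hom g : tring_hom (rho g). Proof. exact: iter_hom. Qed.

Lemma rho_action : is_Cp_action pi sigma rho.
Proof.
split.
- exact: rho_hom.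
- exact: rho1.
- exact: rhoM.
- by move=> g; split=> [c||]; [exact: iter_cst|exact: iter_fix..].
- by move=> j n; rewrite !rho_sigma; split; [exact: sig_var..|exact: sig_y].
Qed.

(** A monomial divisible by s goes to a multiple of s, and one without z-variables is fixed. Series
    follow by polynomial approximation, coefficient by coefficient. *)
Lemma hom_in_R (F : C -> C) : tring_hom F -> (forall c, F (cst c) = cst c) ->
  (forall i, ~~ is_z i -> F (tate_var v i) = tate_var v i) ->
  forall x, x \in Rin -> F x \in Rin.
Proof.
move=> hF Fc Fv x xR; have [FB FM F1 F0 FD] := hom_facts hF.
have Fm c n : okm n -> F (mono c n) \in Rin.
  rewrite /okm; case: (posnP (n vars)) => [_|ns _]; last first.
    have -> : mono c n = s_ v * mono c (divcm n (ucm vars)).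
      by rewrite /s_ /tate_var mono_mono mul1r divcmK //; exact/mdivides_ucm.
    by rewrite FM Fv //; exact: s_mul_in_R.
  rewrite orbF mono_cst FM Fc => zn.
  suff H : forall n, zdeg n == 0%N -> F (mono 1 n) = mono 1 n.
    rewrite H // -mono_cst; apply/in_R_coef => m; rewrite tmonoE /okm.
    by case: (eqVneq m n) => [->|]; rewrite ?zn // mulr0n eqxx.
  elim/monom_ind => [_|i m IH /eqP/zdeg_eq0 hz]; first by rewrite -[mono 1 mone]/(1 : C).
  have -> : mono 1 (mmul (ucm i) m) = tate_var v i * mono 1 m by rewrite mono_mono mulr1.
  rewrite FM IH ?Fv //.
    by apply/negP => iz; have := hz i iz; rewrite cmM cmUU.
  by apply/eqP/zdeg_eq0 => j jz; have := hz j jz; rewrite cmM => /eqP; rewrite addn_eq0 => /andP[_ /eqP].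
apply/in_R_coef => m; apply: contraNT => okF; apply/eqP/(av_le0 (v := v)) => e e0.
have : nbhs (0 : C) (F @^-1` [set z | gauss z < e]).
  case: hF => _ _ c; apply: c; rewrite F0; apply/tate_nbhs; exists e => // y; rewrite subr0 //.
move=> /tate_nbhs[d d0 hd]; have d20 : 0 < d / 2 by rewrite divr_gt0.
set t := trunc (d / 2) x.
have -> : F x m = F (x - t) m.
  rewrite FB tcoefB; suff -> : F t m = 0 by rewrite subr0.
  apply/eqP; apply: contraNT okF; move: m; apply/in_R_coef.
  rewrite /t /trunc; elim: (fset_set _ : seq _) => [|n r IH].
    by rewrite big_nil F0; apply/in_R_coef => n; rewrite tcoef0 eqxx.
  rewrite big_cons FD; have [xn|xn] := eqVneq (x n) 0.
    rewrite xn (_ : mono 0 n = 0) ?F0 ?add0r //.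
    by apply/tateP => q; rewrite tmonoE mul0rn tcoef0.
  have h1 : F (mono (x n) n) \in Rin by apply: Fm; move/in_R_coef: xR; apply.
  apply/in_R_coef => q; rewrite tcoefD; apply: contraNT => qF.
  have -> : F (mono (x n) n) q = 0.
    by apply/eqP; apply: contraNT qF; move: (q); apply/in_R_coef.
  by rewrite add0r; apply: contraNT qF; move: (q); apply/in_R_coef.
apply: le_trans (gauss_ub _ _) _; apply/ltW/hd; rewrite subr0.
by apply: le_lt_trans (trunc_lt _ d20) _; lra.
Qed.

Lemma rho_in_R g (x : R) : rho g (Rval x) \in Rin.
Proof.
apply: hom_in_R (RvalP x); [exact: rho_hom|exact: iter_cst|].
by move=> i iz; apply: iter_fix; case: i iz.
Qed.
Definition rhoR g (x : R) : R := RingR (rho_in_R g x).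

(** Continuity and the fixed constants carry bounded powers to bounded powers, and these mean norm
    at most 1. *)
Lemma hom_gauss (F : C -> C) : tring_hom F -> (forall c, F (cst c) = cst c) ->
  forall x, gauss x <= 1 -> gauss (F x) <= 1.
Proof.
move=> hF Fc x x1; have [FB FM F1 F0 FD] := hom_facts hF.
have : nbhs (0 : C) (F @^-1` [set z | gauss z < 1]).
  by case: hF => _ _ c; apply: c; rewrite F0; apply/tate_nbhs; exists 1 => // y; rewrite subr0.
move=> /tate_nbhs[d d0 hd]; have [n hn] := @scale_small 1 d ler01 d0; rewrite mulr1 in hn.
have pin : 0 < v (pi ^+ n) by rewrite av_gt0 expf_neq0 // piK_neq0.
apply: (@gauss_power_le _ (v (pi ^+ n))^-1) => k.
rewrite -[leRHS]mul1r ler_pdivlMr // mulrC.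
have FX : F (x ^+ k) = F x ^+ k by elim: k => [|k IH]; rewrite ?expr0 // !exprS FM IH.
have : gauss (F (cst (pi ^+ n) * x ^+ k)) < 1.
  apply: hd; rewrite subr0 gauss_mul /tate_cst gauss_mono gaussX; apply: le_lt_trans hn.
  by rewrite ler_piMr ?av_ge0 // exprn_ile1 // gauss_ge0.
by rewrite FM Fc FX gauss_mul /tate_cst gauss_mono => /ltW.
Qed.

Let pbv (x : R) : gauss (Rval x) <= 1 -> power_bounded x.
Proof. by move=> h; exact/pb_gaussR. Qed.
Let vpb (x : R) : power_bounded x -> gauss (Rval x) <= 1.
Proof. by move=> /pb_gaussR. Qed.

(** The instance has to compute: its ring, its action and its uniformizer are later identified with
    R, [rhoR] and the constant pi. *)
Definition Rfs : fsplit.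
Proof.
refine (@FSplit RR R (dfield ringR_dom) (@dfrac R ringR_dom : {rmorphism R -> dfield ringR_dom})
  (@dfrac_inj _ _) (@dfrac_frac _ _) (Rcst pi) (Rcst pi^-1) _ _ _ _ _ ringR_complete
  p pp _ rpsi _ _ _ _ G rhoR _ _ _ _ _).
- by apply: pbv; rewrite /= /tate_cst gauss_mono ltW // pi_lt1.
- by apply: Rval_inj; rewrite RvalM /= -cst_M mulfV ?Rval1 // piK_neq0.
- move=> U; rewrite ringR_nbhs; split=> [[e e0 hU]|[n hn]].
    have [n hn] := @scale_small 1 e ler01 e0; exists n => a /vpb a1; apply: hU.
    rewrite subr0 gaussRE RvalM RvalX gauss_mul /= -cst_X /tate_cst gauss_mono.
    apply: le_lt_trans hn; rewrite ler_wpM2l ?av_ge0 //.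
  have pin : 0 < v (pi ^+ n) by rewrite av_gt0 expf_neq0 // piK_neq0.
  exists (v (pi ^+ n)) => // y; rewrite subr0 => hy.
  have -> : y = Rcst pi ^+ n * (Rcst (pi ^- n) * y).
    apply: Rval_inj; rewrite !RvalM RvalX /= mulrA -cst_X -cst_M mulfV ?mul1r //.
    by rewrite expf_neq0 // piK_neq0.
  apply: hn; apply: pbv; rewrite RvalM gauss_mul /= /tate_cst gauss_mono.
  have e : v (pi ^+ n) * v (pi ^- n) = 1 by rewrite -avM mulfV ?av1 // expf_neq0 // piK_neq0.
  have h0 : 0 <= v (pi ^- n) by exact: av_ge0.
  by rewrite -e mulrC; apply: ler_wpM2r => //; exact: ltW.
- move=> a; have [n hn] := scale_small (gauss_ge0 (Rval a)) (ltr01 : 0 < (1 : RR)).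
  exists n; apply: pbv; rewrite RvalM RvalX gauss_mul /= -cst_X /tate_cst gauss_mono.
  exact: ltW.
- split.
  + by apply: pbv; rewrite Rval1 -[1 : C]/(mono 1 mone) gauss_mono av1.
  + move=> x y /vpb hx /vpb hy; apply: pbv; rewrite RvalB; apply: le_trans (gaussB _ _) _.
    by rewrite ge_max hx.
  + move=> x y /vpb hx /vpb hy; apply: pbv; rewrite RvalM gauss_mul.
    by rewrite mulr_ile1 // gauss_ge0.
- have Rn k : Rval (k%:R : R) = k%:R.
    by elim: k => [|k IH]; rewrite ?Rval0 // -!natr1 RvalD IH Rval1.
  rewrite inE /= pp /=; apply/eqP; rewrite -(rmorph_nat (@dfrac R ringR_dom)).
  suff -> : p%:R = 0 :> R by rewrite rmorph0.
  by apply: Rval_inj; rewrite Rn Rval0 (tate_char v var charK).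
- by move=> x y; apply: Rval_inj; rewrite RvalD -[LHS]/(tpsi pp rtE (Rval (x + y))) RvalD (tpsi_D pp charK).
- by move=> x y; apply: Rval_inj; rewrite RvalM -[LHS]/(tpsi pp rtE (Rval (x ^+ p * y))) RvalM RvalX (tpsi_lin pp charK).
- by apply: Rval_inj; rewrite Rval1 -[LHS]/(tpsi pp rtE (Rval 1)) Rval1 (tpsi_1 v var pp charK).
- by move=> x /vpb hx; apply: pbv; exact: gauss_tpsi hx.
- move=> g; have [FB FM F1 _ _] := hom_facts (rho_hom g); split.
    by move=> x y; apply: Rval_inj; rewrite RvalB -[LHS]/(rho g (Rval (x - y))) RvalB FB.
  split; first by apply: Rval_inj; rewrite Rval1 -[LHS]/(rho g (Rval 1)) Rval1.
  by move=> x y; apply: Rval_inj; rewrite RvalM -[LHS]/(rho g (Rval (x * y))) RvalM FM.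
- by move=> x; apply: Rval_inj; exact: rho1.
- by move=> g h x; apply: Rval_inj; exact: rhoM.
- by move=> g x /vpb hx; apply: pbv; apply: hom_gauss hx; [exact: rho_hom|exact: iter_cst].
- by move=> g; apply: Rval_inj; exact: iter_cst.
Defined.

(* T is not a p-th power modulo topologically nilpotent elements *)
Lemma ringR_not_perfectoid : ~ perfectoid_ring p R.
Proof.
move=> [_ _ _ [w [[_ wn] _ _ surj]]].
have w1 : gaussR w < 1.
  have [N _ hN] : ((fun n : nat => w ^+ n) @ \oo) [set y : R | gaussR y < 1].
    by apply: wn; apply/ringR_nbhs; exists 1; [exact: ltr01|move=> y; rewrite subr0].
  have := hN N (leqnn N); rewrite /= gaussRE RvalX gaussX; apply: contraTT; rewrite -!leNgt => h.
  exact: exprn_ege1.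
have Tpb : power_bounded R_T by apply/pb_gaussR; rewrite gaussRE /= gauss_var.
have [x [c [_ /pb_gaussR hc e]]] := surj _ Tpb.
have := congr1 (fun z : R => Rval z (ucm varT)) e; rewrite RvalD RvalX tcoefD.
have [_ f2] := frob_coef pp charK (Rval x); rewrite f2 ?add0r; last first.
  move=> b; apply/eqP => /(congr1 (fun m : {cmonom var} => m varT)); rewrite cmUU mpowE.
  by move=> h; have := prime_gt1 pp; case: (b varT) h => [|k]; rewrite ?muln0 // mulnS; lia.
rewrite -[Rval R_T]/(T_ v) /T_ /tate_var tmonoE eqxx mulr1n => h1.
have := gauss_ub (Rval (w ^+ p * c)) (ucm varT); rewrite -h1 av1 leNgt => /negP; apply.
rewrite RvalM gauss_mul RvalX gaussX.
apply: le_lt_trans (_ : gaussR w ^+ p < 1).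
  by rewrite ler_piMr // exprn_ge0 // gauss_ge0.
rewrite -(prednK (prime_gt0 pp)) exprS; apply: (le_lt_trans _ w1).
rewrite ler_piMr ?gauss_ge0 // exprn_ile1 ?gauss_ge0 // ltW //.
Qed.

End RingR.

(** * Linear parts of invariants *)

Section DualNumbers.
Context (RR : realType) (K : fieldType) (v : absval RR K).
Local Notation C := (tate v var).

(** Dual numbers over the Tate algebra, with eps^2 = 0. A homomorphism into them is a homomorphism
    together with a derivation along it, which gives access to linear coefficients through universal
    properties. *)
Definition dual : Type := (C * C)%type.
HB.instance Definition _ := GRing.Zmodule.on dual.

Definition dual_one : dual := (1, 0).
Definition dual_mul (x y : dual) : dual := (x.1 * y.1, x.1 * y.2 + x.2 * y.1).

Lemma dualP (x y : dual) : x.1 = y.1 -> x.2 = y.2 -> x = y.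
Proof. by case: x y => [a b] [c d] /= -> ->. Qed.

Let dmulA : associative dual_mul.
Proof. by move=> x y z; apply: dualP => /=; ring. Qed.
Let dmulC : commutative dual_mul.
Proof. by move=> x y; apply: dualP => /=; ring. Qed.
Let dmul1 : left_id dual_one dual_mul.
Proof. by move=> x; apply: dualP => /=; ring. Qed.
Let dmulDl : left_distributive dual_mul +%R.
Proof.
by move=> x y z; apply: dualP;
  rewrite /dual_mul -?[(_ + _).1]/(_.1 + _.1) -?[(_ + _).2]/(_.2 + _.2) /=; ring.
Qed.
HB.instance Definition _ := GRing.Zmodule_isComPzRing.Build dual dmulA dmulC dmul1 dmulDl.

Definition dnorm (x : dual) : RR := Num.max (gauss x.1) (gauss x.2).

Let dnorm_ge0 x : 0 <= dnorm x. Proof. by rewrite le_max gauss_ge0. Qed.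
Let dnorm0 : dnorm 0 = 0. Proof. by rewrite /dnorm !gauss0 maxxx. Qed.
Let dnormB x y : dnorm (x - y) <= Num.max (dnorm x) (dnorm y).
Proof.
rewrite ge_max; apply/andP; split; apply: le_trans (gaussB _ _) _;
  by rewrite ge_max !le_max !lexx ?orbT.
Qed.
Lemma dnormM x y : dnorm (x * y) <= dnorm x * dnorm y.
Proof.
have h (a b c d : RR) : 0 <= a -> 0 <= b -> a <= c -> b <= d -> a * b <= c * d.
  by move=> *; exact: ler_pM.
have m1 z : gauss z.1 <= dnorm z by rewrite le_max lexx.
have m2 z : gauss z.2 <= dnorm z by rewrite le_max lexx orbT.
rewrite ge_max; apply/andP; split; first by rewrite gauss_mul; apply: h; rewrite ?gauss_ge0.
apply: le_trans (gaussD _ _) _; rewrite ge_max !gauss_mul.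
by apply/andP; split; apply: h; rewrite ?gauss_ge0.
Qed.

HB.instance Definition _ := NASeminorm_isTopologicalComRing.Build RR dual
  dnorm_ge0 dnorm0 dnormB dnormM.

Lemma dual_nbhs (x : dual) U : nbhs x U <-> exists2 e : RR, 0 < e & forall y : dual, dnorm (y - x) < e -> U y.
Proof. by []. Qed.

Lemma dual_nonarch : nonarchimedean dual.
Proof.
move=> U /dual_nbhs[e e0 hU]; exists [set x : dual | dnorm x < e]; split.
- by apply/dual_nbhs; exists e => // y; rewrite subr0.
- by rewrite /= dnorm0.
- by move=> x y /= hx hy; apply: le_lt_trans (dnormB _ _) _; rewrite gt_max hx.
- by move=> x /= hx; apply: hU; rewrite subr0.
Qed.

Lemma dual_complete p : perfectoid_field p v -> complete_ring dual.
Proof.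
move=> Kp; apply: (@seminorm_complete RR dual dnorm).
- exact: dual_nbhs.
- exact: dnorm0.
- exact: dnormB.
- move=> x x0; have h1 : gauss x.1 <= 0 by rewrite -x0 le_max lexx.
  have h2 : gauss x.2 <= 0 by rewrite -x0 le_max lexx orbT.
  by apply: dualP; apply: gauss_eq0; apply/eqP; rewrite eq_le gauss_ge0 andbT.
- exact: dnorm_ge0.
- move=> s hs.
  have [|l1 hl1] := @tate_lim RR K v var (pf_complete Kp) (fun k => (s k).1).
    move=> e /hs[N hN]; exists N => k q Nk Nq; apply: le_lt_trans (hN k q Nk Nq).
    by rewrite -[_ - _]/((s k - s q).1) le_max lexx.
  have [|l2 hl2] := @tate_lim RR K v var (pf_complete Kp) (fun k => (s k).2).
    move=> e /hs[N hN]; exists N => k q Nk Nq; apply: le_lt_trans (hN k q Nk Nq).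
    by rewrite -[_ - _]/((s k - s q).2) le_max lexx orbT.
  exists (l1, l2) => e e0; have [N hN] := hl1 e e0; have [M hM] := hl2 e e0.
  exists (maxn N M) => k; rewrite geq_max => /andP[/hN h1 /hM h2].
  by rewrite ge_max; apply/andP; split.
Qed.

Lemma dual_mk_hom (F : C -> dual) (g : C -> C) : tring_hom F ->
  (forall x y, g (x - y) = g x - g y) ->
  (forall x y, g (x * y) = (F x).1 * g y + g x * (F y).1) -> g 1 = 0 ->
  (forall e : RR, 0 < e -> nbhs (0 : C) [set x | gauss (g x) < e]) ->
  tring_hom (fun x => ((F x).1, g x) : dual).
Proof.
move=> hF gB gM g1 gc; have [FB FM F1 F0 _] := hom_facts hF; split.
- by move=> x y; rewrite FB gB.
- split; first by rewrite F1 g1.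
  by move=> x y; rewrite FM gM.
- apply: zmod_continuous; first by move=> x y; rewrite FB gB.
  move=> U /dual_nbhs[e e0 hU].
  have h : nbhs (0 : C) (F @^-1` [set y : dual | dnorm y < e]).
    case: hF => _ _ c; apply: c; rewrite F0; apply/dual_nbhs; exists e => // y.
    by rewrite subr0.
  apply: filterS (filterI h (gc e e0)) => x [/= h1 h2]; apply: hU; rewrite subr0.
  rewrite gt_max h2 andbT; apply: le_lt_trans h1; by rewrite le_max lexx.
Qed.

Lemma fst_hom : tring_hom (fun x : dual => x.1 : C).
Proof.
split; [by []|by []|apply: zmod_continuous => // U /tate_nbhs[e e0 hU]].
apply/dual_nbhs; exists e => // y; rewrite subr0 => h; apply: hU; rewrite subr0.
by apply: le_lt_trans h; rewrite le_max lexx.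
Qed.

Lemma hom_cont (F : C -> dual) e : tring_hom F -> 0 < e ->
  nbhs (0 : C) [set x | dnorm (F x) < e].
Proof.
move=> hF e0; have [_ _ _ F0 _] := hom_facts hF.
have h : nbhs (0 : C) (F @^-1` [set y : dual | dnorm y < e]); last exact: h.
case: hF => _ _ c; apply: c; rewrite F0; apply/dual_nbhs; exists e => // y.
by rewrite subr0.
Qed.

End DualNumbers.

Section DualSubst.
Context (RR : realType) (K : fieldType) (v : absval RR K).
Local Notation C := (tate v var).
Local Notation cst := (tate_cst v var).
Local Notation mono := (tate_mono v).
Local Notation D := (dual v).
Variables (p : nat) (pi : K).
Hypothesis pp : prime p.
Hypothesis charK : p \in [pchar K].
Hypothesis Kp : perfectoid_field p v.
Hypothesis pi1 : 0 < v pi < 1.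
Implicit Types (x y z : C) (c : var -> C) (i : var).

Let Dc : complete_ring D := dual_complete Kp.
Let Cc : complete_ring C := @tate_complete _ _ v var (pf_complete Kp).

(** The variables T and s are kept and the z-variable i goes to c i times eps, so the second
    component of the substitution is the derivative at z = 0 in the direction [c]. *)
Definition dX c i : D := match i with
  | varT => (T_ v, 0) | vars => (s_ v, 0) | i => (0, c i) end.
Definition dk (a : K) : D := (cst a, 0).

Lemma dX_z c i : is_z i -> dX c i = (0, c i). Proof. by case: i. Qed.
Lemma dX_nz c i : ~~ is_z i -> dX c i = (tate_var v i, 0). Proof. by case: i. Qed.

Let dnX c i : (forall i, gauss (c i) <= 1) -> dnorm (dX c i) <= 1.
Proof.
by move=> h; case: i => [||j|j n|j n]; rewrite ge_max ?gauss0 ?ler01 ?h ?andbT //=; rewrite gauss_var.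
Qed.

Lemma dsub_ex c : (forall i, gauss (c i) <= 1) -> exists F : C -> D,
  [/\ tring_hom F, forall a, F (cst a) = dk a & forall i, F (tate_var v i) = dX c i].
Proof.
move=> hc; apply: subst_var.
- exact: Dc.
- exact: dual_nonarch.
- move=> a b; apply: dualP; first exact: cst_B.
  by rewrite -[RHS]/(0 - 0) subr0.
- move=> a b; apply: dualP; first exact: cst_M.
  by rewrite -[RHS]/(cst a * 0 + 0 * cst b) mulr0 mul0r addr0.
- by [].
- move=> U /dual_nbhs[e e0 hU]; exists e => // a m ae; apply: hU; rewrite subr0.
  have m1 : dnorm (mev (dX c) m) <= 1.
    apply: (big_ind (fun z : D => dnorm z <= 1)).
    + by rewrite ge_max gauss0 ler01 andbT -[(1 : D).1]/(mono 1 mone) gauss_mono av1.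
    + move=> x y hx hy; apply: le_trans (dnormM _ _) _; apply: mulr_ile1 => //; by rewrite le_max gauss_ge0.
    + move=> i _; elim: (m i) => [|n IH].
        by rewrite expr0 ge_max gauss0 ler01 andbT -[(1 : D).1]/(mono 1 mone) gauss_mono av1.
      rewrite exprS; apply: le_trans (dnormM _ _) _; apply: mulr_ile1 => //; last exact: dnX.
        by rewrite le_max gauss_ge0.
      by rewrite le_max gauss_ge0.
  apply: le_lt_trans (dnormM _ _) _; apply: le_lt_trans ae.
  have -> : dnorm (dk a) = v a.
    by rewrite /dnorm gauss0 /tate_cst gauss_mono; apply/max_idPl; exact: av_ge0.
  by rewrite ler_piMr // av_ge0.
Qed.

Definition dsub c (hc : forall i, gauss (c i) <= 1) : C -> D := sval (cid (dsub_ex hc)).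
Lemma dsub_hom c hc : tring_hom (@dsub c hc). Proof. by rewrite /dsub; case: cid => F []. Qed.
Lemma dsub_cst c hc a : @dsub c hc (cst a) = dk a. Proof. by rewrite /dsub; case: cid => F []. Qed.
Lemma dsub_var c hc i : @dsub c hc (tate_var v i) = dX c i. Proof. by rewrite /dsub; case: cid => F []. Qed.

Lemma dsub_fst c hc c' hc' x : (@dsub c hc x).1 = (@dsub c' hc' x).1.
Proof.
have h1 := comp_hom (dsub_hom hc) (fst_hom v); have h2 := comp_hom (dsub_hom hc') (fst_hom v).
have H := hom_unique Cc h1 h2; rewrite -[LHS]/(((fun x : D => x.1 : C) \o dsub hc) x) H //.
- by move=> a /=; rewrite !dsub_cst.
- by move=> i /=; rewrite !dsub_var; case: i.
Qed.

Lemma dsub_eq c hc (F : C -> D) : tring_hom F -> (forall a, F (cst a) = dk a) ->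
  (forall i, F (tate_var v i) = dX c i) -> F = @dsub c hc.
Proof.
move=> hF Fc Fv; apply: (hom_unique Dc hF (dsub_hom hc)) => [a|i].
  by rewrite Fc dsub_cst.
by rewrite Fv dsub_var.
Qed.

Let d2B c hc x y : (@dsub c hc (x - y)).2 = (dsub hc x).2 - (dsub hc y).2.
Proof. by have [FB _ _ _ _] := hom_facts (dsub_hom hc); rewrite FB. Qed.
Let d2M c hc x y : (@dsub c hc (x * y)).2 = (dsub hc x).1 * (dsub hc y).2 + (dsub hc x).2 * (dsub hc y).1.
Proof. by have [_ FM _ _ _] := hom_facts (dsub_hom hc); rewrite FM. Qed.
Let d21 c hc : (@dsub c hc 1).2 = 0.
Proof. by have [_ _ F1 _ _] := hom_facts (dsub_hom hc); rewrite F1. Qed.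

(** Linearity of the derivative in its direction. The sum of two derivations along the same first
    component again defines a homomorphism to the dual numbers, and this is determined on the
    variables. *)
Lemma dsub_add c hc c1 hc1 c2 hc2 : (forall i, is_z i -> c i = c1 i + c2 i) ->
  forall x, (@dsub c hc x).2 = (@dsub c1 hc1 x).2 + (@dsub c2 hc2 x).2.
Proof.
move=> e; pose g x := (@dsub c1 hc1 x).2 + (@dsub c2 hc2 x).2.
have H : (fun x => ((dsub hc1 x).1, g x) : D) = dsub hc.
  apply: dsub_eq.
  - apply: dual_mk_hom; first exact: dsub_hom.
    + by move=> x y; rewrite /g !d2B; ring.
    + by move=> x y; rewrite /g !d2M (dsub_fst hc2 hc1 x) (dsub_fst hc2 hc1 y); ring.
    + by rewrite /g !d21 addr0.
    + move=> e0 e00; apply: filterS (filterI (hom_cont (dsub_hom hc1) e00) (hom_cont (dsub_hom hc2) e00)).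
      move=> x [/= h1 h2]; apply: le_lt_trans (gaussD _ _) _; rewrite gt_max.
      by apply/andP; split; [apply: le_lt_trans h1|apply: le_lt_trans h2]; rewrite le_max lexx orbT.
  - by move=> a; rewrite /g !dsub_cst /= addr0.
  - move=> i; rewrite /g !dsub_var; case: (boolP (is_z i)) => iz.
      by rewrite !dX_z //= -e.
    by rewrite !dX_nz //= addr0.
by move=> x; rewrite -H.
Qed.

Lemma dsub_scale u c hc c1 hc1 : (forall i, is_z i -> c i = u * c1 i) ->
  forall x, (@dsub c hc x).2 = u * (@dsub c1 hc1 x).2.
Proof.
move=> e; pose g x := u * (@dsub c1 hc1 x).2.
have H : (fun x => ((dsub hc1 x).1, g x) : D) = dsub hc.
  apply: dsub_eq.
  - apply: dual_mk_hom; first exact: dsub_hom.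
    + by move=> x y; rewrite /g !d2B; ring.
    + by move=> x y; rewrite /g !d2M; ring.
    + by rewrite /g !d21 mulr0.
    + move=> e0 e00; have u0 := gauss_ge0 u.
      have e10 : 0 < e0 / (1 + gauss u) by rewrite divr_gt0 //; lra.
      apply: filterS (hom_cont (dsub_hom hc1) e10) => x /= h.
      rewrite /g gauss_mul; have h2 : gauss (dsub hc1 x).2 < e0 / (1 + gauss u).
        by apply: le_lt_trans h; rewrite le_max lexx orbT.
      move: h2; rewrite ltr_pdivlMr; last by lra.
      apply: le_lt_trans; rewrite mulrC; apply: ler_wpM2l; first exact: gauss_ge0.
      by lra.
  - by move=> a; rewrite /g !dsub_cst /= mulr0.
  - move=> i; rewrite /g !dsub_var; case: (boolP (is_z i)) => iz.
      by rewrite !dX_z //= -e.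
    by rewrite !dX_nz //= mulr0.
by move=> x; rewrite -H.
Qed.

(** A bound valid for all directions of norm at most 1 at once; it bounds the coefficients along all
    x_{j,n} uniformly in n. *)
Lemma dsub_norm c hc x : dnorm (@dsub c hc x) <= gauss x.
Proof.
have hF := dsub_hom hc; have [FB FM F1 F0 FD] := hom_facts hF.
have d0 (z : D) : 0 <= dnorm z by rewrite le_max gauss_ge0.
have nD (y z : D) : dnorm (y + z) <= Num.max (dnorm y) (dnorm z).
  rewrite ge_max; apply/andP; split; apply: le_trans (gaussD _ _) _;
    by rewrite ge_max !le_max !lexx ?orbT.
have m1 m : dnorm (dsub hc (mono 1 m)) <= 1.
  elim/monom_ind: m => [|i m IH].
    by rewrite -[mono 1 mone]/(1 : C) F1 ge_max gauss0 ler01 andbT -[(1 : D).1]/(mono 1 mone) gauss_mono av1.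
  have -> : mono 1 (mmul (ucm i) m) = tate_var v i * mono 1 m by rewrite mono_mono mulr1.
  rewrite FM dsub_var; apply: le_trans (dnormM _ _) _; apply: mulr_ile1 => //; exact: dnX.
have mc a m : dnorm (dsub hc (mono a m)) <= v a.
  rewrite mono_cst FM dsub_cst; apply: le_trans (dnormM _ _) _.
  have -> : dnorm (dk a) = v a.
    by rewrite /dnorm gauss0 /tate_cst gauss_mono; apply/max_idPl; exact: av_ge0.
  by rewrite ler_piMr // av_ge0.
apply/ler_addgt0Pl => e e0.
have [d d00 hd] : exists2 d, 0 < d & forall y, gauss y < d -> dnorm (dsub hc y) < e.
  have /tate_nbhs[d d00 hd] := hom_cont hF e0; exists d => // y yd; apply: hd.
  by rewrite subr0.
have d20 : 0 < d / 2 by rewrite divr_gt0.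
set t := trunc (d / 2) x; rewrite -(subrK t x) FD; apply: le_trans (nD _ _) _.
have gx := gauss_ge0 x; rewrite subrK ge_max; apply/andP; split.
  have : dnorm (dsub hc (x - t)) < e.
    by apply: hd; apply: le_lt_trans (trunc_lt _ d20) _; lra.
  by move=> h; lra.
have : dnorm (dsub hc t) <= gauss x.
  rewrite /t /trunc; elim: (fset_set _ : seq _) => [|m r IH].
    by rewrite big_nil F0 /dnorm !gauss0 maxxx.
  rewrite big_cons FD; apply: le_trans (nD _ _) _; rewrite ge_max IH andbT.
  by apply: le_trans (mc _ _) _; exact: gauss_ub.
by move=> h; lra.
Qed.

(* The action of sigma after T is scaled by pi^k *)
Definition sigXk (k : nat) i : C := match i with
  | varxs j => xs_ v j - cst (pi ^+ j) * y_ v j 0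
  | varx j n => x_ v j n + cst (pi ^+ j) * y_ v j n - cst (pi ^+ k) * T_ v * y_ v j n.+1
  | i => tate_var v i end.

Let cst_le j z : gauss z <= 1 -> gauss (cst (pi ^+ j) * z) <= 1.
Proof.
by move=> h; rewrite gauss_mul /tate_cst gauss_mono mulr_ile1 ?av_ge0 ?gauss_ge0 ?(piX_le1 pi1).
Qed.

Lemma sigXk_le1 k i : gauss (sigXk k i) <= 1.
Proof.
have g1 i' : gauss (tate_var v i') <= 1 by rewrite gauss_var.
case: i => [||j|j n|j n] /=; try exact: g1.
- by apply: le_trans (gaussB _ _) _; rewrite ge_max g1 /=; apply: cst_le; exact: g1.
- apply: le_trans (gaussB _ _) _; rewrite ge_max; apply/andP; split.
    by apply: le_trans (gaussD _ _) _; rewrite ge_max g1 /=; apply: cst_le; exact: g1.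
  rewrite -mulrA; apply: cst_le; rewrite gauss_mul; apply: mulr_ile1; rewrite ?gauss_ge0 //; exact: g1.
Qed.

Definition sigk k : C -> C := sval (cid (subst_tate Kp (sigXk_le1 k))).
Lemma sigk_hom k : tring_hom (sigk k). Proof. by rewrite /sigk; case: cid => F []. Qed.
Lemma sigk_cst k a : sigk k (cst a) = cst a. Proof. by rewrite /sigk; case: cid => F []. Qed.
Lemma sigk_var k i : sigk k (tate_var v i) = sigXk k i. Proof. by rewrite /sigk; case: cid => F []. Qed.

Definition ind i : var -> C := fun i' => if i' == i then 1 else 0.
Let g1 : gauss (1 : C) = 1.
Proof. by rewrite -[1 : C]/(mono 1 mone) gauss_mono av1. Qed.
Lemma ind_le1 i i' : gauss (ind i i') <= 1.
Proof. by rewrite /ind; case: ifP; rewrite ?g1 ?gauss0. Qed.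
Lemma ind0 i' : gauss ((fun=> 0 : C) i' : C) <= 1. Proof. by rewrite gauss0. Qed.

(** For a z-variable [i] this is the series in T and s that multiplies it in the part of x linear in
    the z-variables. *)
Definition lin i x : C := (dsub (ind_le1 i) x).2.

Lemma lin_B i x y : lin i (x - y) = lin i x - lin i y. Proof. exact: d2B. Qed.
(** The chain rule: deriving sigma(x) in a direction is deriving x in the direction transported by
    sigma. *)
Lemma dsub_sigk k c hc c' hc' : (forall i, is_z i -> (@dsub c hc (sigXk k i)) = (0, c' i)) ->
  forall x, dsub hc (sigk k x) = @dsub c' hc' x.
Proof.
move=> e x; have hF := comp_hom (sigk_hom k) (dsub_hom hc).
have H : dsub hc \o sigk k = dsub hc'; last by rewrite -H.
apply: dsub_eq => // [a|i] /=; first by rewrite sigk_cst dsub_cst.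
rewrite sigk_var; case: (boolP (is_z i)) => iz; first by rewrite e // dX_z.
by case: i iz => //= _; rewrite dsub_var.
Qed.

Section Recurrence.
Variables (j k : nat) (x : C).
Hypothesis inv : sigk k x = x.

(** The transport of the direction y_{j,0}, which enters sigma(x_{j,0}) with coefficient pi^j and
    sigma(x_{j,*}) with coefficient -pi^j. *)
Let c0 i : C := ind (vary j 0) i + cst (pi ^+ j) * (ind (varx j 0) i + cst (-1) * ind (varxs j) i).
(** The transport of the direction y_{j,n+1}, which enters sigma(x_{j,n+1}) with coefficient pi^j
    and sigma(x_{j,n}) with coefficient -pi^k T. *)
Let c1 n i : C := ind (vary j n.+1) i +
  (cst (pi ^+ j) * ind (varx j n.+1) i + (cst (- pi ^+ k) * T_ v) * ind (varx j n) i).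

Let cN1 z : cst (-1) * z = - z.
Proof.
have -> : cst (-1) = - 1 by rewrite -[-1 in LHS]sub0r cst_B -[cst 1]/(1 : C) -{1}(subrr 0) cst_B subrr sub0r.
by rewrite mulN1r.
Qed.
Let cN a z : cst (- a) * z = - (cst a * z).
Proof. by rewrite -mulN1r cst_M -mulrA cN1. Qed.

Let cNle z : gauss z <= 1 -> gauss (cst (-1) * z) <= 1.
Proof. by rewrite cN1 gauss_N. Qed.
Let add_le z z' : gauss z <= 1 -> gauss z' <= 1 -> gauss (z + z') <= 1.
Proof. by move=> h h'; apply: le_trans (gaussD _ _) _; rewrite ge_max h. Qed.

Let b0 i : gauss (ind (varx j 0) i + cst (-1) * ind (varxs j) i) <= 1.
Proof. by apply: add_le; [|apply: cNle]; exact: ind_le1. Qed.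
Let hb0 i : gauss (cst (pi ^+ j) * (ind (varx j 0) i + cst (-1) * ind (varxs j) i)) <= 1.
Proof. by apply: cst_le; exact: b0. Qed.
Let hc0 i : gauss (c0 i) <= 1. Proof. by apply: add_le; [exact: ind_le1|exact: hb0]. Qed.
Let hxs i : gauss (cst (-1) * ind (varxs j) i) <= 1. Proof. by apply: cNle; exact: ind_le1. Qed.

Let hx n i : gauss (cst (pi ^+ j) * ind (varx j n.+1) i) <= 1.
Proof. by apply: cst_le; exact: ind_le1. Qed.
Let hT n i : gauss ((cst (- pi ^+ k) * T_ v) * ind (varx j n) i) <= 1.
Proof.
rewrite -mulrA cN gauss_N; apply: cst_le; rewrite gauss_mul.
by apply: mulr_ile1; rewrite ?gauss_ge0 ?ind_le1 // gauss_var.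
Qed.
Let hb1 n i : gauss (cst (pi ^+ j) * ind (varx j n.+1) i + (cst (- pi ^+ k) * T_ v) * ind (varx j n) i) <= 1.
Proof. by apply: add_le; [exact: hx|exact: hT]. Qed.
Let hc1 n i : gauss (c1 n i) <= 1. Proof. by apply: add_le; [exact: ind_le1|exact: hb1]. Qed.

Let indE i i' : ind i i' = (i' == i)%:R. Proof. by rewrite /ind; case: ifP. Qed.
Let e_y j1 n1 j2 n2 : (vary j1 n1 == vary j2 n2) = (j1 == j2) && (n1 == n2).
Proof. by apply/eqP/andP => [[-> ->]|[/eqP -> /eqP ->]]. Qed.
Let e_x j1 n1 j2 n2 : (varx j1 n1 == varx j2 n2) = (j1 == j2) && (n1 == n2).
Proof. by apply/eqP/andP => [[-> ->]|[/eqP -> /eqP ->]]. Qed.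
Let e_xs j1 j2 : (varxs j1 == varxs j2) = (j1 == j2).
Proof. by apply/eqP/eqP => [[->]|->]. Qed.
Let ne_xy j1 n1 j2 n2 : (varx j1 n1 == vary j2 n2) = false. Proof. exact/eqP. Qed.
Let ne_yx j1 n1 j2 n2 : (vary j1 n1 == varx j2 n2) = false. Proof. exact/eqP. Qed.
Let ne_sy j1 j2 n2 : (varxs j1 == vary j2 n2) = false. Proof. exact/eqP. Qed.
Let ne_sx j1 j2 n2 : (varxs j1 == varx j2 n2) = false. Proof. exact/eqP. Qed.
Let ne_ys j1 j2 n2 : (vary j2 n2 == varxs j1) = false. Proof. exact/eqP. Qed.
Let ne_xs j1 j2 n2 : (varx j2 n2 == varxs j1) = false. Proof. exact/eqP. Qed.
Let nes := (ne_xy, ne_yx, ne_sy, ne_sx, ne_ys, ne_xs, e_y, e_x, e_xs).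

Let dval m i : is_z i -> dsub (ind_le1 (vary j m)) (sigXk k i) = (0, match i with
  | varxs j' => - (cst (pi ^+ j') * ((j' == j) && (0%N == m))%:R)
  | varx j' n => cst (pi ^+ j') * ((j' == j) && (n == m))%:R -
      cst (pi ^+ k) * T_ v * ((j' == j) && (n.+1 == m))%:R
  | i => ind (vary j m) i end).
Proof.
have [FB FM _ _ FD] := hom_facts (dsub_hom (ind_le1 (vary j m))).
have dy j' n' : dsub (ind_le1 (vary j m)) (y_ v j' n') = (0, ((j' == j) && (n' == m))%:R).
  by rewrite dsub_var /dX indE e_y.
have dT : dsub (ind_le1 (vary j m)) (T_ v) = (T_ v, 0) by rewrite dsub_var.
case: i => //= [j'|j' n|j' n] _; last by rewrite dsub_var.
- rewrite FB FM dsub_cst dy dsub_var /dX indE ne_sy.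
  apply: dualP.
    by rewrite -[LHS]/(0 - cst (pi ^+ j') * 0) mulr0 subr0.
  rewrite -[LHS]/(0 - (cst (pi ^+ j') * ((j' == j) && (0%N == m))%:R + 0 * 0)).
  by rewrite mul0r addr0 sub0r.
- have hx' : dsub (ind_le1 (vary j m)) (x_ v j' n) = 0.
    by rewrite (dsub_var (ind_le1 (vary j m)) (varx j' n)) /dX indE ne_xy.
  have hcy : dsub (ind_le1 (vary j m)) (cst (pi ^+ j') * y_ v j' n) =
      (0, cst (pi ^+ j') * ((j' == j) && (n == m))%:R).
    rewrite (FM (cst (pi ^+ j'))) dsub_cst dy; apply: dualP.
      by rewrite -[LHS]/(cst (pi ^+ j') * 0) mulr0.
    rewrite -[LHS]/(cst (pi ^+ j') * ((j' == j) && (n == m))%:R + 0 * 0).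
    by rewrite mul0r addr0.
  have hcT : dsub (ind_le1 (vary j m)) (cst (pi ^+ k) * T_ v) = (cst (pi ^+ k) * T_ v, 0).
    rewrite (FM (cst (pi ^+ k))) dsub_cst dT; apply: dualP => //.
    by rewrite -[LHS]/(cst (pi ^+ k) * 0 + 0 * T_ v) mulr0 mul0r addr0.
  have hTy : dsub (ind_le1 (vary j m)) (cst (pi ^+ k) * T_ v * y_ v j' n.+1) =
      (0, cst (pi ^+ k) * T_ v * ((j' == j) && (n.+1 == m))%:R).
    rewrite (FM (cst (pi ^+ k) * T_ v)) hcT dy; apply: dualP.
      by rewrite -[LHS]/(cst (pi ^+ k) * T_ v * 0) mulr0.
    rewrite -[LHS]/(cst (pi ^+ k) * T_ v * ((j' == j) && (n.+1 == m))%:R + 0 * 0).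
    by rewrite mul0r addr0.
  rewrite FB FD hx' hcy hTy add0r; apply: dualP => //.
  by rewrite -[LHS]/(0 - 0 : C) subr0.
Qed.

(** Invariance equates the derivative along y_{j,0} with that along its transport [c0]. Their
    difference is pi^j times the difference of the two coefficients, and pi^j cancels. *)
Lemma lin_rec0 : lin (varx j 0) x = lin (varxs j) x.
Proof.
have E1 : dsub (ind_le1 (vary j 0)) x = dsub hc0 x.
  rewrite -{1}inv; apply: dsub_sigk => i iz; rewrite dval //; congr (_, _).
  rewrite /c0 cN1 !indE; case: i iz => //= [j'|j' n|j' n] _; rewrite ?nes /=.
  - by case: eqVneq => [->|_]; rewrite ?andbF ?mulr0 /=; ring.
  - by case: eqVneq => [->|_]; rewrite ?andbF ?mulr0 /=; ring.
  - by ring.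
have := congr1 (fun z : D => z.2) E1.
rewrite (dsub_add hc0 (ind_le1 (vary j 0)) hb0 (fun _ _ => erefl)).
rewrite (dsub_scale hb0 b0 (fun _ _ => erefl)).
rewrite (dsub_add b0 (ind_le1 (varx j 0)) hxs (fun _ _ => erefl)).
rewrite (dsub_scale hxs (ind_le1 (varxs j)) (fun _ _ => erefl)) cN1 => /esym/eqP.
rewrite -subr_eq0 [X in X - _]addrC addrK => /eqP/tate_mul_eq0[h|h].
  have : gauss (cst (pi ^+ j)) = 0 by rewrite h gauss0.
  rewrite /tate_cst gauss_mono => /eqP; rewrite gt_eqF // av_gt0 expf_neq0 //.
  exact: piK_neq0 pi1.
by apply/eqP; rewrite -subr_eq0; apply/eqP.
Qed.

Lemma lin_recS n : cst (pi ^+ j) * lin (varx j n.+1) x = cst (pi ^+ k) * T_ v * lin (varx j n) x.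
Proof.
have E1 : dsub (ind_le1 (vary j n.+1)) x = dsub (hc1 n) x.
  rewrite -{1}inv; apply: dsub_sigk => i iz; rewrite dval //; congr (_, _).
  rewrite /c1 -[cst (- pi ^+ k) * T_ v * _]mulrA (cN (pi ^+ k)) !indE.
  case: i iz => //= [j'|j' n'|j' n'] _; rewrite ?nes /=.
  - by rewrite -[0%N == n.+1]/false andbF mulr0n !mulr0 !oppr0 !addr0.
  - case: (eqVneq j' j) => [->|_] /=; last by ring.
    by rewrite eqSS; ring.
  - by ring.
have := congr1 (fun z : D => z.2) E1.
rewrite (dsub_add (hc1 n) (ind_le1 (vary j n.+1)) (hb1 n) (fun _ _ => erefl)).
rewrite (dsub_add (hb1 n) (hx n) (hT n) (fun _ _ => erefl)).
rewrite (dsub_scale (hx n) (ind_le1 (varx j n.+1)) (fun _ _ => erefl)).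
rewrite (dsub_scale (hT n) (ind_le1 (varx j n)) (fun _ _ => erefl)) => /esym/eqP.
rewrite -subr_eq0 [X in X - _]addrC addrK -[cst (- pi ^+ k) * _ * _]mulrA (cN (pi ^+ k)).
by rewrite subr_eq0 mulrA => /eqP.
Qed.

(** Along the recurrence, norms shrink by |pi|^(j - k) < 1 from n + 1 to n, while all of them are
    bounded by the norm of x. The initial coefficient is thus arbitrarily small. *)
Lemma lin_inv : (k < j)%N -> lin (varxs j) x = 0.
Proof.
move=> kj; have v0 := pi_gt0 pi1; have v1 := pi_lt1 pi1.
pose t := v pi ^+ (j - k).
have t01 : 0 <= t < 1.
  by rewrite exprn_ge0 ?ltW //= exprn_ilt1 ?ltW // -lt0n subn_gt0.
have rec n : t * gauss (lin (varx j n.+1) x) = gauss (lin (varx j n) x).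
  have := congr1 (@gauss _ _ v var) (lin_recS n); rewrite !gauss_mul /tate_cst !gauss_mono !avX.
  rewrite av1 mulr1 -{1}(subnK (ltnW kj)) exprD [_ * v pi ^+ k]mulrC -mulrA.
  by move/mulfI; apply; rewrite expf_neq0 // gt_eqF.
have all n : t ^+ n * gauss (lin (varx j n) x) = gauss (lin (varxs j) x).
  elim: n => [|n IH]; first by rewrite expr0 mul1r lin_rec0.
  by rewrite exprSr -mulrA rec.
have bd n : gauss (lin (varx j n) x) <= gauss x.
  by apply: le_trans (dsub_norm (ind_le1 (varx j n)) x); rewrite le_max lexx orbT.
apply: gauss_eq0; apply/eqP; rewrite eq_le gauss_ge0 andbT; apply/ler_addgt0Pl => e e0.
rewrite addr0; have gx := gauss_ge0 x.
have e10 : 0 < e / (1 + gauss x) by rewrite divr_gt0 //; lra.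
have [n hn] := expr_small t01 e10; rewrite -(all n).
move: hn; rewrite ltr_pdivlMr; last by lra.
move=> /ltW; apply: le_trans; apply: ler_wpM2l; first by rewrite exprn_ge0 //; case/andP: t01.
by have := bd n; lra.
Qed.

End Recurrence.

End DualSubst.

(** * The quotient is not adic *)

Section HuberBasis.
Context (A : topComRingType) (Ap : set A).
Implicit Types (x : spa Ap) (a b c g : A) (fs ds : seq A).

Let vr x := spa_point_vrel x.

(** Several conditions are merged by taking the product of their denominators as common denominator,
    which can be cancelled where it does not vanish. *)
Lemma spa_rational_nbhs (W : set (spa Ap)) x : open W -> W x ->
  exists fs g, rational_set fs g x /\ rational_set fs g `<=` W.
Proof.
move=> oW Wx; have [l [xl lW]] := spa_nbhs oW Wx.
suff [fs [g [h1 h2]]] : exists fs g, rational_set fs g x /\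
    forall y : spa Ap, rational_set fs g y -> forall q, q \in l -> y q.1 q.2 /\ ~ y q.2 0.
  by exists fs, g; split=> // y /h2 /lW.
elim: l xl {lW} => [|[a b] l IH] xl.
  by exists [::], 1; split=> //; split=> //; exact: (vr_10 (vr x)).
have [|fs [g [[xf xg] h2]]] := IH; first by move=> r rl; apply: xl; rewrite inE rl orbT.
have [xab xb] := xl (a, b) (mem_head _ _).
exists (a * g :: [seq f * b | f <- fs]), (b * g); split.
  split; last exact: (vr_nz (vr x)).
  move=> f; rewrite inE => /orP[/eqP->|/mapP[f' ff' ->]]; first exact: (vr_mul (vr x)).
  by rewrite mulrC; apply: (vr_mull (vr x)) => //; exact: xf.
move=> y [yf ybg].
have yb : ~ y b 0.
  by move=> h; apply: ybg; rewrite -(mul0r g); exact: (vr_mul (vr y)).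
have yg : ~ y g 0.
  by move=> h; apply: ybg; rewrite -(mulr0 b); exact: (vr_mull (vr y)).
move=> q; rewrite inE => /orP[/eqP -> /=|].
  by split=> //; apply: (vr_cancel (vr y) (yf (a * g) (mem_head _ _))).
apply: h2; split=> // f ff; apply: (@vr_cancel _ _ _ (vr y) f g b) => //.
by rewrite [g * b]mulrC; apply: yf; rewrite inE; apply/orP; right; apply/mapP; exists f.
Qed.

Lemma gen_idealB fs a b : ideal_pow setT fs 1 a -> ideal_pow setT fs 1 b ->
  ideal_pow setT fs 1 (a - b).
Proof.
move=> [c _ ->] [d _ ->]; exists (fun j => c j - d j) => //.
by rewrite -sumrB; apply: eq_bigr => j _; rewrite mulrBr.
Qed.

Lemma gen_idealM fs a b : ideal_pow setT fs 1 a -> ideal_pow setT fs 1 (a * b).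
Proof.
move=> [c _ ->]; exists (fun j => c j * b) => //.
by rewrite mulr_suml; apply: eq_bigr => j _; rewrite mulrA.
Qed.

Lemma gen_ideal_mem fs f : f \in fs -> ideal_pow setT fs 1 f.
Proof.
move=> ffs; have fi : (index f fs < size fs)%N by rewrite index_mem.
exists (fun j => if j == index f fs then 1 else 0) => //.
rewrite (bigD1 (Ordinal fi)) //= eqxx nth_index // mulr1 big1 ?addr0 //.
by move=> j; rewrite -(inj_eq val_inj) /= => /negPf ->; rewrite mulr0.
Qed.

Lemma gen_ideal0 fs : ideal_pow setT fs 1 0.
Proof. by exists (fun=> 0) => //; rewrite big1 // => j _; rewrite mulr0. Qed.

Lemma gen_ideal_open fs (U : set A) : nbhs (0 : A) U -> U `<=` ideal_pow setT fs 1 ->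
  open_ideal fs.
Proof.
move=> hU US; rewrite /open_ideal openE => a ha; apply/nbhs_shift.
apply: filterS hU => z /US hz; change (ideal_pow setT fs 1 (z + a)).
have -> : z + a = z - (0 - a) by rewrite sub0r opprK.
by apply: gen_idealB => //; apply: gen_idealB => //; exact: gen_ideal0.
Qed.

Fixpoint prods ds n : seq A :=
  if n is n'.+1 then [seq d * a | d <- ds, a <- prods ds n'] else [:: 1].

Lemma prods_ideal (A0 : set A) ds n fs u : (forall a, a \in prods ds n -> ideal_pow setT fs 1 (u * a)) ->
  forall a, ideal_pow A0 ds n a -> ideal_pow setT fs 1 (u * a).
Proof.
elim: n u => [|n IH] u h a.
  by move=> _; have := h 1 (mem_head _ _); rewrite mulr1; exact: gen_idealM.
move=> [c hc ->]; rewrite mulr_sumr.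
apply: big_ind => [|b d hb hd|j _]; first exact: gen_ideal0.
  have -> : b + d = b - (0 - d) by rewrite sub0r opprK.
  by apply: gen_idealB => //; apply: gen_idealB => //; exact: gen_ideal0.
rewrite mulrA; apply: IH (hc j) => b hb; rewrite -mulrA; apply: h.
by apply/allpairsP; exists (ds`_j, b); split=> //; exact: mem_nth.
Qed.

Lemma prods_pow (A0 : set A) ds n : is_subring A0 -> (forall d, d \in ds -> A0 d) ->
  ideal_pow A0 ds n 0 /\ forall a, a \in prods ds n -> ideal_pow A0 ds n a.
Proof.
move=> [A1 AB AM] hd; elim: n => [|n [IH0 IH]].
  by split=> [|a]; [rewrite -(subrr 1); exact: AB|rewrite mem_seq1 => /eqP ->].
split; first by exists (fun=> 0) => //; rewrite big1 // => j _; rewrite mulr0.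
move=> _ /allpairsP[[d a] [/= dd /IH ha ->]].
have di : (index d ds < size ds)%N by rewrite index_mem.
exists (fun j => if j == index d ds then a else 0); first by move=> j; case: ifP.
rewrite (bigD1 (Ordinal di)) //= eqxx nth_index // big1 ?addr0 //.
by move=> j; rewrite -(inj_eq val_inj) /= => /negPf ->; rewrite mulr0.
Qed.

(** A chart is only known to be a Huber ring, so an ideal of definition takes the place of pi. The
    open set |a| < |g| contains one of its powers, and adding the finitely many generators of that
    power to the numerators makes the ideal open. *)
Lemma spa_rational_basis (W : set (spa Ap)) x : huber_ring A -> open W -> W x ->
  exists fs g, [/\ open_ideal fs, rational_set fs g x & rational_set fs g `<=` W].
Proof.
move=> [A0 [ds [sA0 _ hd hb]]] oW Wx.
have [fs [g [[xf xg] gW]]] := spa_rational_nbhs oW Wx.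
have /hb[n hn] : nbhs (0 : A) [set a | ~ x g (a * 1)].
  apply: open_nbhs_nbhs; split; last by rewrite /= mul0r.
  have [cx _] := spa_leP x; apply: cx => //; exact: (vr_10 (vr x)).
have [_ pn] := prods_pow n sA0 hd.
exists (fs ++ prods ds n), g; split.
- apply: (@gen_ideal_open _ (ideal_pow A0 ds n)); first by apply/hb; exists n.
  move=> a; rewrite -[a in ideal_pow setT _ _ a]mul1r; apply: prods_ideal => b bp.
  by rewrite mul1r; apply: gen_ideal_mem; rewrite mem_cat bp orbT.
- split=> // f; rewrite mem_cat => /orP[/xf //|/pn/hn /=].
  by rewrite mulr1 => /(vr_nle (vr x)); exact.
- by move=> y [yf yg]; apply: gW; split=> // f ffs; apply: yf; rewrite mem_cat ffs.
Qed.

End HuberBasis.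

(** In the source a bounded set is absorbed by some power u^n; since u is a unit, its image can be
    inverted and the absorption carried over to the target. *)
Lemma hom_bounded (B D : topComRingType) (F : B -> D) (S : set B) (u : B) :
  tring_hom F -> pseudo_uniformizer u -> bounded S -> bounded (F @` S).
Proof.
move=> hF [[u' uu] un] hS U; have [FB FM F1 F0 FD] := hom_facts hF.
rewrite -{1}(mul0r (0 : D)) => /nbhs_mul[P [Q [hP hQ PQ]]].
have hQ' : nbhs (0 : B) (F @^-1` Q) by case: hF => _ _ c; apply: c; rewrite F0.
have [W hW WS] := hS _ hQ'.
have [n _ hn] : (\forall n \near \oo, W (u ^+ n)) by exact: un W hW.
have {}hn : W (u ^+ n) by apply: hn => /=.
have FX (a : B) m : F (a ^+ m) = F a ^+ m.
  by elim: m => [|m IH]; rewrite ?expr0 // !exprS FM IH.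
exists [set w | P (F u' ^+ n * w)]; first exact: nbhs0_mul.
move=> w _ Pw [s Ss <-].
have -> : w * F s = (F u' ^+ n * w) * F (u ^+ n * s); last by apply: PQ Pw _; exact: WS.
rewrite FM FX mulrACA [F u' ^+ n * _]mulrC -exprMn -FM uu F1 expr1n mul1r //.
Qed.

Lemma hom_pseudo_uniformizer (B D : topComRingType) (F : B -> D) (u : B) :
  tring_hom F -> pseudo_uniformizer u -> pseudo_uniformizer (F u).
Proof.
move=> hF [[u' uu] un]; have [FB FM F1 F0 FD] := hom_facts hF.
have FX (a : B) m : F (a ^+ m) = F a ^+ m.
  by elim: m => [|m IH]; rewrite ?expr0 // !exprS FM IH.
split; first by exists (F u'); rewrite -FM uu.
move=> U hU; have hU' : nbhs (0 : B) (F @^-1` U) by case: hF => _ _ c; apply: c; rewrite F0.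
have := un _ hU'; rewrite /nbhs /= => -[n _ hn]; exists n => // m nm /=.
by rewrite -FX; exact: hn.
Qed.

Lemma hom_power_bounded (B D : topComRingType) (F : B -> D) (u a : B) :
  tring_hom F -> pseudo_uniformizer u -> power_bounded a -> power_bounded (F a).
Proof.
move=> hF hu ha; have [FB FM F1 F0 FD] := hom_facts hF.
rewrite /power_bounded /= (_ : range _ = F @` range (fun n : nat => a ^+ n)).
  exact: hom_bounded hu ha.
have FX m : F (a ^+ m) = F a ^+ m.
  by elim: m => [|m IH]; rewrite ?expr0 // !exprS FM IH.
apply/seteqP; split=> [_ [n _ <-]|_ [_ [n _ <-] <-]].
  by exists (a ^+ n); [exists n|exact: FX].
by exists n => //; rewrite FX.
Qed.

(* Around y, the functions on a fixed affinoid neighbourhood V0 are epimorphic in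
   the functions on arbitrarily small neighbourhoods. *)
Lemma adic_dense (Y : topologicalType) (O : vstructure Y) (y : Y) : adic_space O ->
  exists V0 : set Y, [/\ open V0, V0 y & forall N, open N -> N y ->
    exists V : set Y, [/\ open V, V y, V `<=` N, V `<=` V0 &
      forall (D : topComRingType) (F1 F2 : O V -> D), complete_ring D -> nonarchimedean D ->
        tring_hom F1 -> tring_hom F2 -> (exists u : O V, pseudo_uniformizer u) ->
        (forall t, F1 (res O V0 V t) = F2 (res O V0 V t)) -> F1 = F2]].
Proof.
move=> [_ /(_ y)[A [Ap [S [rho [m [spaS [[mc mh mr _] mi mo mk] [z _ mz]]]]]]]].
have [[hA _ _ _ _] [Spre _ loc _] _ _ _] := spaS.
have oV0 : open (range m) by apply: mo; exact: openT.
exists (range m); split=> //; first by exists z.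
move=> N oN Ny.
have oN' : open (m @^-1` N) by move/continuousP: mc; apply.
have [|fs [g [op gz gN]]] := spa_rational_basis hA oN' (x := z); first by rewrite /preimage /= mz.
set U := rational_set fs g in gz gN; pose V := m @` U.
have oV : open V by apply: mo; exact: open_rational.
have VV0 : V `<=` range m by move=> _ [u _ <-]; exists u.
have mV : m @^-1` V = U.
  by apply/seteqP; split=> [u [u' Uu' /mi <-]|u Uu] //; exists u.
have loc' W : W = U -> rational_localization fs g (fun a => res S setT W (rho a)).
  by move=> ->; exact: loc.
have {loc' loc} [_ _ hphi [h h1 h2] univ] := loc' _ mV.
set phi := (fun a => _) in hphi h1 h2 univ.
have [k0 k0c [k0K k0K']] := mk _ oV0 (@subset_refl _ _).
have [k kc [kK kK']] := mk _ oV VV0.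
have [pB [p1 pM] _] := mh _ oV.
have hk : tring_hom k.
  split=> //.
  - by move=> s t; apply: (can_inj kK); rewrite pB !kK'.
  - split; first by apply: (can_inj kK); rewrite p1 kK'.
    by move=> s t; apply: (can_inj kK); rewrite pM !kK'.
exists V; split=> //; [by exists z|by move=> _ [u /gN Nu <-]|].
move=> D F1 F2 Dc Dna hF1 hF2 [u hu] e.
have hu' : pseudo_uniformizer (vpull m V u) := hom_pseudo_uniformizer (mh _ oV) hu.
(* Through the chart, the localization map becomes restriction of functions from the fixed
   neighbourhood to V. *)
have kphi a : exists t, k (phi a) = res O (range m) V t.
  exists (k0 (res S setT (m @^-1` range m) (rho a))).
  apply: (can_inj kK); rewrite kK'.
  have oW1 : open (m @^-1` range m) by move/continuousP: mc; apply.
  have oW2 : open (m @^-1` V) by move/continuousP: mc; apply.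
  rewrite -(mr _ _ oV0 oV VV0) k0K'.
  case: Spre => _ _ rr; rewrite rr //; [exact: openT|by move=> t; exact: VV0].
have hF1k := comp_hom hk hF1; have hF2k := comp_hom hk hF2.
have inv : inverts_rational fs g ((F1 \o k) \o phi).
  exists ((F1 \o k) h).
    have [_ FM E1 _ _] := hom_facts hF1k; rewrite -[LHS](FM (phi g) h) h1 E1 //.
  move=> f /h2 hf; have [_ FM _ _ _] := hom_facts hF1k.
  rewrite -[X in power_bounded X](FM (phi f) h).
  exact: hom_power_bounded hF1k hu' hf.
have [chi [_ chiU]] := univ D _ Dc Dna (comp_hom hphi hF1k) inv.
have e1 : F1 \o k = F2 \o k.
  rewrite -(chiU (F1 \o k)); last by [].
  apply: chiU; split=> //; apply/funext => a /=.
  by have [t ->] := kphi a; rewrite e.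
by apply/funext => s; rewrite -(kK s); exact: (congr1 (fun f => f (vpull m V s)) e1).
Qed.

(** * Evaluating sections and constructing invariant ones *)

Section Evaluation.
Variable K : fsplit.
Local Notation A := (kA K).
Local Notation F := (kF K).
Local Notation i := (@ki K).
Local Notation pi := (@kpi K).
Local Notation pi' := (@kpi' K).
Local Notation pb := (@power_bounded A).
Local Notation X := (spa pb).
Local Notation w := (i pi).
Local Notation G := (kG K).
Local Notation tau := (@kact K).
Local Notation E := (X -> nat -> F).
Local Notation q := (@orb_of K).
Implicit Types (x : X) (a b : A) (g : G) (h : F) (W : set X) (V : set (orb K)).

Section Hom.
Variables (fs : seq A) (b : A) (D : topComRingType) (psi : A -> D).
Hypothesis op : open_ideal fs.
Hypothesis Dc : complete_ring D.
Hypothesis Dna : nonarchimedean D.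
Hypothesis hpsi : tring_hom psi.
Hypothesis inv : inverts_rational fs b psi.
Local Notation U := (rational_set fs b : set X).

Lemma loc_hom : exists chi : secR false U -> D,
  tring_hom chi /\ forall a, chi (scst U (i a)) = psi a.
Proof.
have [chi [[h1 h2] _]] := Oloc_universal op Dc Dna hpsi inv.
by exists chi; split=> // a; rewrite -h2.
Qed.

Lemma loc_hom_unique (chi1 chi2 : secR false U -> D) : tring_hom chi1 -> tring_hom chi2 ->
  (forall a, chi1 (scst U (i a)) = psi a) -> (forall a, chi2 (scst U (i a)) = psi a) ->
  chi1 = chi2.
Proof.
move=> h1 h2 e1 e2; have [chi [_ u]] := Oloc_universal op Dc Dna hpsi inv.
rewrite -(u chi1); last by split=> //; apply/funext.
by apply: u; split=> //; apply/funext.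
Qed.

End Hom.

Lemma pull_qpull g V W (t : Qstr K V) : open V -> open W -> W `<=` q @^-1` V ->
  W `<=` gX g @^-1` W ->
  sres W (pull g (sres W (qpull t) : Ostr K W)) = sres W (qpull t).
Proof.
move=> oV oW WV Wg; apply/(sec_eqP oW) => x Wx.
have Wgx := Wg x Wx; have Vx := WV x Wx; have Vgx := WV _ Wgx.
apply: peq_tr (sres_rep _ Wg oW Wx) _.
apply: peq_tr (pullP _ oW Wgx) _.
apply: peq_tr (peq_cact (sres_rep _ WV oW Wgx)) _.
apply: peq_tr (peq_cact (qpullP t oV Vgx)) _.
apply: peq_tr (sec_invP (inv := true) (W := q @^-1` V) oV t isT g Vx) _.
apply: peq_tr (peq_sym (qpullP t oV Vx)) _.
by apply: peq_sym; exact: (sres_rep _ WV oW Wx).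
Qed.

Lemma pull_scst g W a : open W -> W `<=` gX g @^-1` W ->
  sres W (pull g (scst W (i a) : Ostr K W)) = scst W (i (tau g^-1%g a)).
Proof.
move=> oW Wg; have S := secS_FU (FU_i W a).
rewrite [pull g _](pull_fq g oW S) (fq_sres Wg (secS_cact g S)).
congr (fq _); apply/funext => x; apply/funext => n.
by rewrite /cact /cst tF_i.
Qed.

Lemma sres_scst (V W : set X) h : W `<=` V -> FU V h -> sres W (scst V h) = scst W h.
Proof. by move=> WV hh; exact: fq_sres WV (secS_FU hh). Qed.

(** The group fixes pi and hence its inverse, so both are sections of the quotient sheaf. *)
Lemma Qstr_uniformizer V : exists u : Qstr K V, pseudo_uniformizer u.
Proof.
have tpi g : tau g pi' = pi'.
  rewrite -[RHS]mulr1 -(tau1 g) -(kpiV K) tauM kact_pi mulrA [pi' * _]mulrC kpiV mul1r //.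
have S1 : secS true (q @^-1` V) (cst w) by apply: secS_cst => _ g; exact: kact_pi.
have S2 : secS true (q @^-1` V) (cst (i pi')) by apply: secS_cst => _ g; exact: tpi.
exists (fq (D := secf true (q @^-1` V)) (cst w)); split.
  exists (fq (D := secf true (q @^-1` V)) (cst (i pi'))).
  rewrite -[LHS](fqM (D := secf true (q @^-1` V)) S1 S2) -[RHS](fq1 (secf true (q @^-1` V))).
  congr (fq _); apply/funext => x; apply/funext => n.
  by rewrite eM /cst -rmorphM kpiV rmorph1.
have e (n : nat) : (fq (D := secf true (q @^-1` V)) (cst w)) ^+ n =
    fq (D := secf true (q @^-1` V)) (cst (w ^+ n)) /\ secS true (q @^-1` V) (cst (w ^+ n)).
  elim: n => [|n [IH1 IH2]].
    by rewrite !expr0; split; [exact: (esym (fq1 (secf true (q @^-1` V))))|exact: (fS_1 (secf true _))].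
  rewrite !exprS IH1 -(fqM (D := secf true (q @^-1` V)) S1 IH2).
  have -> : cst (w * w ^+ n) = cst w * cst (w ^+ n) :> E by [].
  by split=> //; exact: (@fS_M (secf true (q @^-1` V))).
move=> B [l [n hB]]; exists n => // k /= nk; apply: hB => j _.
rewrite subr0; have [-> S] := e k; apply/(qlev_fq (D := secf true (q @^-1` V)) _ _ S).
by move=> x _; exists 0%N => m _; apply/lvl_w.
Qed.

(* The invariant section \sum_n (T / pi^j)^n a_n on the set |T| <= |pi|^(j+1) *)
Section PowerSum.
Variables (j : nat) (T a0 : A) (a y : nat -> A) (sg : G).
Hypothesis sgen : forall g, g \in <[sg]>%g.
Hypothesis tT : tau sg T = T.
Hypothesis pba : forall n, pb (a n).
Hypothesis pby : forall n, pb (y n).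
Hypothesis ta0 : tau sg a0 = a0 - pi ^+ j * y 0.
Hypothesis ta : forall n, tau sg (a n) = a n + pi ^+ j * y n - T * y n.+1.

Let t : F := i T / w ^+ j.
Definition psum n : F := i a0 + \sum_(k < n) t ^+ k * i (a k).

Lemma psumS n : psum n.+1 = psum n + t ^+ n * i (a n).
Proof. by rewrite /psum big_ord_recr /= addrA. Qed.

Lemma psum_FU W n : FU W (psum n).
Proof.
have tF : FU W t by apply: FU_M; [exact: FU_i|exact: FU_wV].
elim: n => [|n IH]; first by rewrite /psum big_ord0 addr0; exact: FU_i.
by rewrite psumS; apply: FU_D => //; apply: FU_M; [exact: FU_X|exact: FU_i].
Qed.

Let t_lvl x n b : x T (pi ^+ j.+1) -> pb b -> lvl x n (t ^+ n * i b).
Proof.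
move=> hx hb; have h1 : lvl x 1 t.
  apply/(@lvl_wM _ x j 1); rewrite mulrC divfK; last exact: wX_neq0.
  by rewrite addn1; apply/lvl_i.
rewrite -[X in lvl x X _]addn0; apply: lvl_M (lvl_pb x hb).
elim: n => [|n IH]; first by rewrite expr0 -(expr0 w); apply/lvl_w.
by rewrite exprS -add1n; exact: lvl_M.
Qed.

Lemma psum_lvl x (m n : nat) : x T (pi ^+ j.+1) -> (m <= n)%N -> lvl x m (psum n - psum m).
Proof.
move=> hx; elim: n => [|n IH]; first by rewrite leqn0 => /eqP ->; rewrite subrr; exact: lvl_0.
rewrite leq_eqVlt => /orP[/eqP <-|]; first by rewrite subrr; exact: lvl_0.
rewrite ltnS => mn; rewrite psumS addrAC; apply: lvl_D; first exact: IH.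
by apply: lvl_le mn _; exact: t_lvl.
Qed.

(** Clearing the denominator pi^(j n) returns the partial sum to [A], where homomorphisms out of the
    section ring are known. *)
Lemma psum_clear n : w ^+ (j * n) * psum n =
  i (pi ^+ (j * n) * a0 + \sum_(k < n) pi ^+ (j * (n - k)) * T ^+ k * a k).
Proof.
rewrite /psum mulrDr rmorphD rmorphM rmorphXn; congr (_ + _).
rewrite mulr_sumr rmorph_sum; apply: eq_bigr => k _.
rewrite !rmorphM !rmorphXn /t expr_div_n -exprM mulrA; congr (_ * _).
rewrite -{1}(subnK (ltnW (ltn_ord k))) mulnDr exprD -!mulrA; congr (_ * _).
by rewrite mulrC divfK // wX_neq0.
Qed.

(** With the weights (T / pi^j)^n, the term -T y_{n+1} of one step cancels the term pi^j y_{n+1} of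
    the next; only the last term survives. *)
Lemma psum_sig n : tF sg (psum n) = psum n - w ^+ j * t ^+ n * i (y n).
Proof.
have tt : tF sg t = t.
  rewrite /t tFM tF_i tT; congr (_ * _).
  by rewrite tFV ?tF_w // wX_neq0.
have tX k : tF sg (t ^+ k) = t ^+ k by elim: k => [|k IH]; rewrite ?expr0 ?tFone // !exprS tFM tt IH.
elim: n => [|n IH].
  by rewrite /psum big_ord0 addr0 tF_i ta0 rmorphB rmorphM rmorphXn expr0 mulr1.
rewrite !psumS tFD tFM tX IH tF_i ta rmorphB rmorphD !rmorphM rmorphXn.
have -> : i T = w ^+ j * t by rewrite /t mulrC divfK // wX_neq0.
by rewrite exprS; ring.
Qed.

Definition csum : E := fun _ n => psum n.

(** Where |T| <= |pi|^(j+1), both the tail and the defect of invariance of the n-th partial sum have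
    level n. Invariance under the generator propagates to the cyclic group. *)
Lemma csum_sec V : open V -> (forall x, V (q x) -> x T (pi ^+ j.+1)) ->
  secS true (q @^-1` V) csum.
Proof.
move=> oV hV; apply: secSP => //.
- move=> x Vx; have [U [rU Ux UV]] := rat_basis (oV : open (q @^-1` V)) Vx.
  exists U; split=> // n; exists (psum n); first exact: psum_FU.
  by move=> z Uz; exists n => k nk; apply: psum_lvl nk; exact/hV/UV.
- move=> _; pose P g := forall x, V (q x) -> peq x (cact g csum x) (csum x).
  have P1 : P sg^-1%g.
    move=> x Vx n; exists n => k nk; rewrite /cact invgK /csum psum_sig addrAC subrr sub0r.
    apply: lvl_N; apply: lvl_le nk _; rewrite -mulrA.
    rewrite -[k]add0n; apply: lvl_M; last by rewrite add0n; apply: t_lvl (pby k); exact: hV.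
    by apply/lvl_w.
  have PM g g' : P g -> P g' -> P (g * g')%g.
    move=> hg hg' x Vx; rewrite -cact_comp; apply: peq_tr (hg' x Vx).
    by apply: peq_cact; apply: hg; rewrite orb_inv.
  move=> g; have /cycleP[n gn] := sgen g^-1%g.
  have -> : g = (sg^-1 ^+ n)%g by rewrite expgVn -gn invgK.
  elim: n {g gn} => [|n IH]; first by rewrite expg0 => x Vx; rewrite cact1; exact: peq_refl.
  by rewrite expgS; exact: PM.
Qed.

Lemma csum_lim V W B : open V -> (forall x, V (q x) -> x T (pi ^+ j.+1)) ->
  open W -> W `<=` q @^-1` V -> nbhs (0 : secR false W) B ->
  exists n, B (sres W (qpull (fq (D := secf true (q @^-1` V)) csum : Qstr K V)) - scst W (psum n)).
Proof.
move=> oV hV oW WV [l [n hB]]; exists n; apply: hB => k _; rewrite subr0.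
have S := csum_sec oV hV; have S1 := secS_sub WV (secS_forget S).
have -> : sres W (qpull (fq (D := secf true (q @^-1` V)) csum : Qstr K V)) =
    fq (D := secf false W) csum.
  apply/(sec_eqP oW) => x Wx; apply: peq_tr (sres_rep _ WV oW Wx) _.
  apply: peq_tr (qpullP _ oV (WV x Wx)) _.
  apply: peq_tr (sec_fqP (oV : open (q @^-1` V)) S (WV x Wx)) _.
  by apply: peq_sym; exact: sec_fqP.
have S2 := secS_FU (psum_FU W n).
rewrite /scst -(fqB (D := secf false W) S1 S2).
apply/(qlev_fq (D := secf false W) _ _ (@fS_B (secf false W) _ _ S1 S2)) => x kx.
exists n => m nm; apply: psum_lvl nm; apply/hV/WV.
by have [_ ] := svalP k; apply.
Qed.

End PowerSum.

Lemma ball_rational_op (T s : A) k : open_ideal [:: T; s; pi ^+ k].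
Proof.
apply: (@open_idealT _ _ (pi ^+ k) (pi' ^+ k)); first by rewrite !inE eqxx !orbT.
by rewrite -exprMn kpiV expr1n.
Qed.

Lemma ball_rationalE (T s : A) k x :
  rational_set [:: T; s; pi ^+ k] (pi ^+ k) x <-> x T (pi ^+ k) /\ x s (pi ^+ k).
Proof.
split=> [[h _]|[h1 h2]]; first by split; apply: h; rewrite !inE eqxx ?orbT.
split; last exact: xpiX0.
by move=> f; rewrite !inE => /or3P[] /eqP ->; [| |exact: xrefl].
Qed.

End Evaluation.

(** A nontrivial monomial of R is divisible by s, or else is a power of T. The terms without s give
    a cofactor in R, whereas the cofactor of s lies only in the big algebra. *)
Lemma in_R_split (RR : realType) (K : fieldType) (v : absval RR K) (x : ringR v) :
  Rval x mone = 0 -> exists (f1 : ringR v) (f2 : tate v var),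
    Rval x = T_ v * Rval f1 + s_ v * f2.
Proof.
move=> x0; have xR := (in_R_coef (Rval x)).1 (RvalP x).
have r1 : restricted v (fun m => if (m vars == 0)%N then Rval x (mmul (ucm varT) m) else 0).
  pose g (n : {cmonom var}) : {cmonom var} := divcm n (ucm varT).
  move=> e e0; apply: sub_finite_set (finite_image g (coefP (Rval x) e0)) => m /=.
  case: ifP => _; last by rewrite av0 leNgt e0.
  by exists (mmul (ucm varT) m) => //; rewrite /g mulcmK.
have r2 : restricted v (fun m => Rval x (mmul (ucm vars) m)).
  pose g (n : {cmonom var}) : {cmonom var} := divcm n (ucm vars).
  move=> e e0; apply: sub_finite_set (finite_image g (coefP (Rval x) e0)) => m /= h.
  by exists (mmul (ucm vars) m) => //; rewrite /g mulcmK.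
have R1 : Tate r1 \in @in_R RR K v.
  apply/in_R_coef => m /=; case: ifP => [/eqP ms|_]; last by rewrite eqxx.
  move/xR; rewrite /okm cmM ms addn0 cmU /= orbF => h.
  have e : (varT == vars) = false by apply/eqP.
  rewrite e orbF in h; rewrite -(zdegE (m := mmul (ucm varT) m)) // => i iz.
  by rewrite cmM cmU; case: eqVneq iz => [<-|_ _] //; rewrite add0n.
exists (RingR R1), (Tate r2); apply/tateP => m; rewrite tcoefD s_mulE.
rewrite /T_ /tate_var mono_mulE mul1r /=.
have dT : divcm m (ucm varT) vars = m vars by rewrite divcmE cmU (_ : (varT == vars) = false) ?subn0 //; exact/eqP.
case: (posnP (m vars)) => ms; last first.
  rewrite dT eqn0Ngt ms /= divcmK; last by exact/mdivides_ucm.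
  by case: ifP; rewrite add0r.
rewrite dT ms eqxx addr0; case: ifP => [/mdivisorsP h|/mdivisorsP h]; first by rewrite divcmK.
apply/eqP; apply: contraTT isT => xm; have := xR m xm; rewrite /okm ms orbF => /eqP/zdeg_eq0 hz.
case/eqP: xm; suff -> : m = mone by [].
apply/eqP/cmP => i; rewrite cm1; case: i => [||j|j n|j n]; try exact: hz.
- by apply/eqP; apply: contra_notT h; rewrite -lt0n => ?; exact/mdivides_ucm.
- exact: ms.
Qed.

Lemma tcoefM_mone (RR : realType) (K : fieldType) (v : absval RR K) (V : choiceType)
  (x y : tate v V) : (x * y) mone = x mone * y mone.
Proof.
rewrite tcoefM (big_fsetD1 mone) /=; last by apply/mdivisorsP.
have -> : divcm mone mone = mone :> {cmonom V} by apply/eqP/cmP => i; rewrite divcmE cm1.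
rewrite big_seq big1 ?addr0 // => a; rewrite in_fsetD1 => /andP[a1 /mdivisorsP h].
case/eqP: a1; apply/eqP/cmP => i; have := h i; rewrite cm1 leqn0; exact/eqP.
Qed.

(** * Failure of adicity at the image of the origin *)

Section NonAdic.
Context (RR : realType) (K : fieldType) (v : absval RR K) (p : nat) (pi : K).
Context (G : finGroupType) (sigma : G).
Hypothesis pp : prime p.
Hypothesis charK : p \in [pchar K].
Hypothesis Kp : perfectoid_field p v.
Hypothesis pi1 : 0 < v pi < 1.
Hypothesis cardG : #|G| = p.
Hypothesis sigma_gen : forall g : G, g \in <[sigma]>%g.
Local Notation FS := (Rfs pp charK Kp pi1 cardG sigma_gen).
Local Notation C := (tate v var).
Local Notation cst := (tate_cst v var).
Local Notation D := (dual v).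
Local Notation A := (kA FS).
Local Notation i := (@ki FS).
Local Notation ϖ := (@kpi FS).
Local Notation X := (spa (@power_bounded A)).
Local Notation q := (@orb_of FS).
Implicit Types (a b : A) (x : X) (z : C).

Let Cc : complete_ring C := @tate_complete _ _ v var (pf_complete Kp).
Let Cna : nonarchimedean C := @tate_nonarch _ _ v var.
Let Dc : complete_ring D := dual_complete Kp.

Let ev a : C := Rval (a : ringR v).
Let evB a b : ev (a - b) = ev a - ev b. Proof. exact: RvalB. Qed.
Let evD a b : ev (a + b) = ev a + ev b. Proof. exact: RvalD. Qed.
Let evM a b : ev (a * b) = ev a * ev b. Proof. exact: RvalM. Qed.
Let ev1 : ev 1 = 1. Proof. exact: Rval1. Qed.
Let ev0 : ev 0 = 0. Proof. exact: Rval0. Qed.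
Let evX a (n : nat) : ev (a ^+ n) = ev a ^+ n. Proof. exact: RvalX. Qed.
Let evpi (n : nat) : ev (ϖ ^+ n) = cst (pi ^+ n).
Proof. by rewrite evX cst_X. Qed.
Let ev_tau g a : ev (kact g a) = rho Kp pi1 sigma_gen g (ev a). Proof. by []. Qed.
Let ev_pb a : power_bounded a <-> gauss (ev a) <= 1.
Proof. exact: (pb_gaussR pi1). Qed.
Let ev_inj a b : ev a = ev b -> a = b. Proof. exact: Rval_inj. Qed.

Let ev_hom : tring_hom ev.
Proof.
split; [exact: evB|by split; [exact: ev1|exact: evM]|].
apply: zmod_continuous; first exact: evB.
by move=> U /tate_nbhs[e e0 hU]; exists e => // y; rewrite subr0 => h; apply: hU; rewrite subr0.
Qed.

Let T : A := R_T v.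
Let S (z : C) : A := RingR (s_mul_in_R z).
Let evS z : ev (S z) = s_ v * z. Proof. by []. Qed.
Let Cst (c : K) : A := Rcst v c.
Let evC c : ev (Cst c) = cst c. Proof. by []. Qed.
Let evT : ev T = T_ v. Proof. by []. Qed.

Let W (k : nat) : set X := rational_set [:: T; S 1; ϖ ^+ k] (ϖ ^+ k).
Let WE k x : W k x <-> x T (ϖ ^+ k) /\ x (S 1) (ϖ ^+ k). Proof. exact: ball_rationalE. Qed.
Let oW k : open (W k). Proof. exact: open_rational. Qed.
Let W_mono (k l : nat) : (k <= l)%N -> W l `<=` W k.
Proof.
by move=> kl x /WE[h1 h2]; apply/WE; split; apply: xtr (xpi_le x kl).
Qed.

(* The point T = s = 0 *)
Let origin_ex : exists x, x = (fun a b => v (ev a mone) <= v (ev b mone)) :> (A -> A -> Prop).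
Proof.
have vM a b : v (ev (a * b) mone) = v (ev a mone) * v (ev b mone).
  by rewrite evM tcoefM_mone avM.
have v0 : v (ev 0 mone) = 0 by rewrite ev0 tcoef0 av0.
have v1 : v (ev 1 mone) = 1 by rewrite ev1 tcoef1 eqxx av1.
apply: (@spa_of_vrel FS).
- split=> //.
  + by move=> a b _ _; apply/orP; exact: le_total.
  + by move=> b a c _ _ _; exact: le_trans.
  + by rewrite v0 v1 leNgt ltr01.
  + by move=> a _; rewrite v0; exact: av_ge0.
  + by move=> c a b _ _ _ h; rewrite !vM; apply: ler_wpM2r => //; exact: av_ge0.
  + move=> c a b _ _ _; rewrite v0 => c0; rewrite !vM ler_pM2r // ltNge; exact/negP.
  + move=> a b _ _; apply/orP; rewrite -le_max evD tcoefD; exact: av_ultra.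
- by move=> a /ev_pb h; rewrite v1; apply: le_trans h; exact: gauss_ub.
- rewrite v1 -[ϖ]expr1 evpi expr1 /tate_cst tmonoE eqxx mulr1n.
  by apply/negP; rewrite -ltNge; case/andP: pi1.
- move=> b; rewrite v0 => /negP; rewrite -ltNge => hb.
  have [|n hn] := expr_small (t := v pi) _ hb; first by case/andP: pi1 => /ltW ->.
  exists n; rewrite evpi /tate_cst tmonoE eqxx mulr1n avX; exact: ltW.
Qed.
Let x0 : X := sval (cid origin_ex).
Let x0E a b : x0 a b <-> v (ev a mone) <= v (ev b mone).
Proof. by rewrite /x0; case: cid => y /= ->. Qed.

Let sqr_le x a b : x (a * a) (b * b) -> x a b.
Proof.
move=> h; have [//|n] := pselect (x a b); have ba := xnle n.
apply: (@xcan FS x a).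
  by move=> a0; apply: n; apply: xtr a0 _; exact: x00.
by apply: xtr h _; exact: xmull.
Qed.

(** In a = T f1 + s f2 the first term is bounded directly. The second is bounded through its square
    s (s f2^2), whose cofactor belongs to R and is therefore bounded. *)
Let small a n : ev a mone = 0 -> exists k, forall x, W k x -> x a (ϖ ^+ n).
Proof.
move=> /in_R_split[f1 [f2 e]]; pose b : A := S (f2 * f2).
have [m1 hm1] := spa_bounded (f1 : A); have [m2 hm2] := spa_bounded b.
(* The exponent n is doubled since the estimate for s f2 passes through the square. *)
exists (m1 + m2 + (n + n))%N => x /WE[hT hS].
have -> : a = T * (f1 : A) + S f2 by apply: ev_inj; rewrite evD evM evS; exact: e.
have bd m f : x (ϖ ^+ m * f) 1 -> forall t l, x t (ϖ ^+ (m + l)) -> x (t * f) (ϖ ^+ l).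
  move=> h t l ht; apply: (@xcan FS x (ϖ ^+ m)); first exact: xpiX0.
  have -> : t * f * ϖ ^+ m = (ϖ ^+ m * f) * t by ring.
  by rewrite -exprD addnC -[ϖ ^+ (m + l)]mul1r; exact: xmul2.
apply: xD.
  apply: bd (hm1 x) _ _ _; apply: xtr hT _; apply: xpi_le; lia.
apply: sqr_le; have -> : S f2 * S f2 = S 1 * b.
  by apply: ev_inj; rewrite !evM /b !evS; ring.
rewrite -exprD; apply: bd (hm2 x) _ _ _; apply: xtr hS _; apply: xpi_le; lia.
Qed.

(** At the origin |a| <= |b| compares constant terms. Choose n with |pi|^n below the constant term
    of b; on a small W k both elements differ from their constants by less than |pi|^n, so the
    comparison persists. *)
Let W_nbhs (V : set X) : open V -> V x0 -> exists k, W k `<=` V.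
Proof.
move=> oV Vx; have [l [xl lV]] := spa_nbhs oV Vx.
suff [k hk] : exists k, forall x, W k x -> forall r, r \in l -> x r.1 r.2 /\ ~ x r.2 0.
  by exists k => x /hk /lV.
elim: l xl {lV} => [|[a b] l IH] xl; first by exists 0%N.
have [|k hk] := IH; first by move=> r rl; apply: xl; rewrite inE rl orbT.
have [/x0E ab /x0E b0] := xl (a, b) (mem_head _ _).
change (is_true (v (ev a mone) <= v (ev b mone))) in ab.
change (~ is_true (v (ev b mone) <= v (ev 0 mone))) in b0.
rewrite ev0 tcoef0 av0 in b0; move/negP: b0; rewrite -ltNge => b0.
set a0 := ev a mone in ab; set c0 := ev b mone in ab b0.
have c00 : c0 != 0 by rewrite -(av_gt0 v).
have pbC c : v c <= 1 -> power_bounded (Cst c).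
  by move=> h; apply/ev_pb; rewrite evC /tate_cst gauss_mono.
have CM c d : Cst (c * d) = Cst c * Cst d by apply: ev_inj; rewrite evM !evC cst_M.
have CX n : Cst (pi ^+ n) = ϖ ^+ n by apply: ev_inj; rewrite evpi.
have le_c c x : v c <= v c0 -> x (Cst c) (Cst c0).
  move=> h; have -> : c = (c / c0) * c0 by rewrite divfK.
  rewrite CM -[X in _ _ X]mul1r; apply: xmul; apply: spa_pb; apply: pbC.
  by rewrite avM -(ler_pM2r b0) -mulrA -avM mulVf // av1 mulr1 mul1r.
have [n hn] : exists n, v (pi ^+ n) <= v c0.
  have [|n hn] := expr_small (t := v pi) _ b0; first by case/andP: pi1 => /ltW ->.
  by exists n; rewrite avX; exact: ltW.
have z0 c : ev (c - Cst (ev c mone)) mone = 0.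
  by rewrite evB tcoefB evC /tate_cst tmonoE eqxx mulr1n subrr.
have [k1 h1] := small n.+1 (z0 a); have [k2 h2] := small n.+1 (z0 b).
exists (k + k1 + k2)%N => x Wx r.
have {}h1 := h1 x (W_mono (_ : (k1 <= k + k1 + k2)%N) Wx).
have {}h2 := h2 x (W_mono (_ : (k2 <= k + k1 + k2)%N) Wx).
have {}hk := hk x (W_mono (_ : (k <= k + k1 + k2)%N) Wx) r.
rewrite inE => /orP[/eqP -> /=|rl]; last by apply: hk => //; lia.
have {}h1 : x (a - Cst a0) (ϖ ^+ n.+1) by apply: h1; lia.
have {}h2 : x (b - Cst c0) (ϖ ^+ n.+1) by apply: h2; lia.
have pc : x (ϖ ^+ n) (Cst c0) by rewrite -CX; exact: le_c.
have c0n : ~ x (Cst c0) 0 by apply: xnz_le pc; exact: xpiX0.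
have cb : x (Cst c0) b.
  have [//|nb] := pselect (x (Cst c0) b); exfalso.
  have h3 : x (Cst c0) (ϖ ^+ n.+1).
    have eC : b + (Cst c0 - b) = Cst c0 by rewrite addrC subrK.
    have [h|h] := vr_add (spa_vrel x) (Logic.I : setT b) (Logic.I : setT (Cst c0 - b)); rewrite eC in h.
      by case: nb.
    by apply: xtr h _; apply: xtr h2; rewrite -opprB; exact: xN.
  by have := xpi_lt (xtr pc h3).
split; last by move=> h; apply: c0n; exact: xtr cb h.
rewrite -(subrK (Cst a0) a); apply: xD; last by apply: xtr cb; exact: le_c.
by apply: xtr h1 _; apply: xtr cb; apply: xtr pc; apply: xpi_le.
Qed.

(* Restriction to W k, in the coordinates T / pi^k and s / pi^k *)
Let subX (k : nat) (j : var) : C := match j with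
  | varT => cst (pi ^+ k) * T_ v | vars => cst (pi ^+ k) * s_ v | j => tate_var v j end.

Let subX_le1 k j : gauss (subX k j) <= 1.
Proof.
have h z : gauss z = 1 -> gauss (cst (pi ^+ k) * z) <= 1.
  by move=> z1; rewrite gauss_mul z1 mulr1 /tate_cst gauss_mono (piX_le1 pi1).
case: j => [||j|j n|j n]; try by rewrite /subX gauss_var.
- exact: h (gauss_var v varT).
- exact: h (gauss_var v vars).
Qed.

Let sub (k : nat) : C -> C := sval (cid (subst_tate Kp (subX_le1 k))).
Let sub_hom k : tring_hom (sub k). Proof. by rewrite /sub; case: cid => F []. Qed.
Let sub_cst k c : sub k (cst c) = cst c. Proof. by rewrite /sub; case: cid => F []. Qed.
Let sub_var k j : sub k (tate_var v j) = subX k j. Proof. by rewrite /sub; case: cid => F []. Qed.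
Let sub_T k : sub k (T_ v) = cst (pi ^+ k) * T_ v. Proof. exact: sub_var. Qed.
Let sub_s k : sub k (s_ v) = cst (pi ^+ k) * s_ v. Proof. exact: sub_var. Qed.
Let subM k z z' : sub k (z * z') = sub k z * sub k z'.
Proof. by have [_ FM _ _ _] := hom_facts (sub_hom k); exact: FM. Qed.

Let gauss_pb z : gauss z <= 1 -> power_bounded z.
Proof.
move=> h U /tate_nbhs[e e0 hU]; exists [set y | gauss y < e].
  by apply/tate_nbhs; exists e => // y; rewrite subr0.
move=> y _ /= ye [n _ <-]; apply: hU; rewrite subr0 gauss_mul gaussX.
apply: le_lt_trans ye; rewrite ler_piMr ?gauss_ge0 //.
by apply: exprn_ile1 => //; exact: gauss_ge0.
Qed.

Let inv_k k (F : C -> C) : tring_hom F -> (forall c, F (cst c) = cst c) ->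
  gauss (F (T_ v)) <= 1 -> gauss (F (s_ v)) <= 1 ->
  inverts_rational [:: T; S 1; ϖ ^+ k] (ϖ ^+ k) (F \o (sub k \o ev)).
Proof.
move=> hF Fc FT Fs; have [_ FM _ _ _] := hom_facts hF.
have e : cst (pi ^+ k) * cst (pi ^- k) = 1.
  by rewrite -cst_M mulfV // expf_neq0 // (piK_neq0 pi1).
have Fpi : F (sub k (ev (ϖ ^+ k))) = cst (pi ^+ k) by rewrite evpi sub_cst Fc.
exists (cst (pi ^- k)); first by rewrite [X in X * _]Fpi.
move=> f; rewrite !inE => /or3P[] /eqP ->.
- have -> : (F \o (sub k \o ev)) T * cst (pi ^- k) = F (T_ v).
    rewrite [X in X * _](_ : _ = cst (pi ^+ k) * F (T_ v)); last by rewrite -[LHS]/(F (sub k (T_ v))) sub_T FM Fc.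
    by rewrite mulrAC e mul1r.
  exact: gauss_pb.
- have -> : (F \o (sub k \o ev)) (S 1) * cst (pi ^- k) = F (s_ v).
    rewrite [X in X * _](_ : _ = cst (pi ^+ k) * F (s_ v)); last by rewrite -[LHS]/(F (sub k (s_ v * 1))) mulr1 sub_s FM Fc.
    by rewrite mulrAC e mul1r.
  exact: gauss_pb.
- rewrite [X in X * _]Fpi e; apply: gauss_pb.
  by rewrite -[1 : C]/(tate_mono v 1 mone) gauss_mono av1.
Qed.

Let op k : open_ideal [:: T; S 1; ϖ ^+ k]. Proof. exact: ball_rational_op. Qed.
Let psi_hom k : tring_hom (sub k \o ev). Proof. exact: comp_hom ev_hom (sub_hom k). Qed.

Let chi_ex k : exists chi : secR false (W k) -> C,
  tring_hom chi /\ forall a, chi (scst (W k) (i a)) = sub k (ev a).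
Proof.
have := @inv_k k id (id_hom C) (fun _ => erefl).
rewrite ![gauss (id _)]gauss_var => /(_ (lexx _) (lexx _)) inv.
have H := loc_hom (@op k) Cc Cna (psi_hom k) inv.
exact: H.
Qed.
(** Sections over W k as series in the rescaled coordinates, obtained from the universal
    property. *)
Let chi k : secR false (W k) -> C := sval (cid (chi_ex k)).
Let chi_hom k : tring_hom (@chi k). Proof. by rewrite /chi; case: cid => F []. Qed.
Let chiE k a : chi (scst (W k) (i a)) = sub k (ev a). Proof. by rewrite /chi; case: cid => F []. Qed.

Let tau_T g : kact g T = T.
Proof. by apply: ev_inj; rewrite ev_tau; exact: iter_fix. Qed.
Let tau_S1 g : kact g (S 1) = S 1.
Proof. by apply: ev_inj; rewrite ev_tau !evS mulr1; exact: iter_fix. Qed.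

Let W_stable k g : W k `<=` gX g @^-1` W k.
Proof.
by move=> x /WE[h1 h2]; apply/WE; rewrite !gXE tau_T tau_S1 (@tau_piX FS).
Qed.

(** Applying the rescaled sigma after [chi], or [chi] after the pullback, gives homomorphisms that
    agree on R; the universal property identifies them. A section from the quotient is fixed by the
    pullback. *)
Let chi_inv k (V : set (orb FS)) (t : Qstr FS V) : open V -> W k `<=` q @^-1` V ->
  sigk Kp pi1 k (chi (sres (W k) (qpull t))) = chi (sres (W k) (qpull t)).
Proof.
move=> oV WV; pose sg : kG FS := sigma; have Wg := W_stable (k := k) sg^-1%g.
pose F2 (u : secR false (W k)) : C := chi (sres (W k) (pull sg^-1%g (u : Ostr FS (W k)))).
have e : sigk Kp pi1 k \o @chi k = F2.
  have ss : sigk Kp pi1 k \o sub k = sub k \o sig Kp pi1.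
    apply: (hom_unique Cc (comp_hom (sub_hom k) (sigk_hom Kp pi1 k)) (comp_hom (sig_hom Kp pi1) (sub_hom k))).
      by move=> c; rewrite /= sub_cst sigk_cst sig_cst sub_cst.
    have [SB SM _ _ SD] := hom_facts (sub_hom k).
    have [_ GM _ _ _] := hom_facts (sigk_hom Kp pi1 k).
    have fix_ j : subX k j = tate_var v j -> sigXk v pi k j = sub k (sigX v pi j) ->
        sigk Kp pi1 k (sub k (tate_var v j)) = sub k (sig Kp pi1 (tate_var v j)).
      by move=> h1 h2; rewrite sub_var h1 sigk_var sig_var.
    case=> [||j|j n|j n] /=.
    + have h1 : sig Kp pi1 (T_ v) = T_ v := sig_var Kp pi1 varT.
      have h2 : sigk Kp pi1 k (T_ v) = T_ v := sigk_var Kp pi1 k varT.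
      change (sigk Kp pi1 k (sub k (T_ v)) = sub k (sig Kp pi1 (T_ v))).
      by rewrite h1 sub_T GM sigk_cst h2.
    + have h1 : sig Kp pi1 (s_ v) = s_ v := sig_var Kp pi1 vars.
      have h2 : sigk Kp pi1 k (s_ v) = s_ v := sigk_var Kp pi1 k vars.
      change (sigk Kp pi1 k (sub k (s_ v)) = sub k (sig Kp pi1 (s_ v))).
      by rewrite h1 sub_s GM sigk_cst h2.
    + apply: fix_ => //.
      by rewrite /sigXk /sigX SB SM sub_cst !sub_var.
    + apply: fix_ => //.
      by rewrite /sigXk /sigX SB SD !SM sub_cst sub_T !sub_var.
    + by apply: fix_ => //; rewrite /sigXk /sigX sub_var.
  have hs (j : var) : ~~ is_z j -> gauss (sigk Kp pi1 k (tate_var v j)) <= 1.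
    by case: j => // _; rewrite sigk_var gauss_var.
  have inv := inv_k k (sigk_hom Kp pi1 k) (sigk_cst Kp pi1 k) (hs varT isT) (hs vars isT).
  apply: (loc_hom_unique (@op k) Cc Cna (comp_hom (psi_hom k) (sigk_hom Kp pi1 k)) inv).
  - exact: comp_hom (chi_hom k) (sigk_hom Kp pi1 k).
  - exact: comp_hom (comp_hom (pull_hom sg^-1%g (oW k)) (sres_hom false Wg)) (chi_hom k).
  - by move=> a; rewrite /= chiE.
  - move=> a; rewrite /F2 (pull_scst a (oW k) Wg) chiE invgK ev_tau (rho_sigma charK _ _ cardG).
    by rewrite -[LHS]/((sub k \o sig Kp pi1) (ev a)) -ss.
rewrite -[LHS]/((sigk Kp pi1 k \o @chi k) (sres (W k) (qpull t))) e /F2.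
exact: (congr1 (@chi k) (pull_qpull t oV (oW k) WV Wg)).
Qed.

Let chi_res k d (u : secR false (W k)) : chi (sres (W (k + d)) u) = sub d (chi u).
Proof.
have WW := W_mono (leq_addr d k).
have e : @chi (k + d) \o sres (W (k + d)) = sub d \o @chi k; last first.
  by rewrite -[LHS]/((@chi (k + d) \o sres (W (k + d))) u) e.
have ss : sub d \o sub k = sub (k + d).
  apply: (hom_unique Cc (comp_hom (sub_hom k) (sub_hom d)) (sub_hom (k + d))).
    by move=> c; rewrite /= !sub_cst.
  case=> [||j|j n|j n] /=; rewrite !sub_var /subX ?sub_var // subM sub_cst sub_var /subX mulrA -cst_M exprD //.
have hs j : gauss (sub d (tate_var v j)) <= 1 by rewrite sub_var; exact: subX_le1.
have inv := inv_k k (sub_hom d) (sub_cst d) (hs varT) (hs vars).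
apply: (loc_hom_unique (@op k) Cc Cna (comp_hom (psi_hom k) (sub_hom d)) inv).
- exact: comp_hom (sres_hom false WW) (chi_hom (k + d)).
- exact: comp_hom (chi_hom k) (sub_hom d).
- move=> a; rewrite /= (sres_scst WW (FU_i _ a)) chiE.
  by rewrite -[RHS]/((sub d \o sub k) (ev a)) ss.
- by move=> a; rewrite /= chiE.
Qed.

(** Rescaling T and s leaves the z-variables fixed, so it commutes with taking coefficients along
    them. *)
Let lin_sub j d z : lin Kp j z = 0 -> lin Kp j (sub d z) = 0.
Proof.
set P := dsub Kp (ind_le1 v j); have hP : tring_hom P := dsub_hom Kp _.
have [PB PM P1 P0 PD] := hom_facts hP; have [SB SM S1 S0 SD] := hom_facts (sub_hom d).
have Pc c : P (cst c) = dk v c := dsub_cst Kp _ c.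
have Pv k : P (tate_var v k) = dX (ind v j) k := dsub_var Kp _ k.
have hPS := comp_hom (sub_hom d) hP.
have PT : P (T_ v) = (T_ v, 0) := Pv varT.
have Ps : P (s_ v) = (s_ v, 0) := Pv vars.
have Pm c y : P y = (y, 0) -> P (cst c * y) = (cst c * y, 0).
  move=> h; rewrite PM Pc h; apply: dualP => //.
  by rewrite -[LHS]/(cst c * 0 + 0 * y) mulr0 mul0r addr0.
have E1 : (fun y => (P (sub d y)).1) = (fun y => sub d (P y).1).
  apply: (hom_unique Cc (comp_hom hPS (fst_hom v)) (comp_hom (comp_hom hP (fst_hom v)) (sub_hom d))).
    by move=> c /=; rewrite sub_cst Pc /= sub_cst.
  case=> [||k|k n|k n].
  - change ((P (sub d (T_ v))).1 = sub d (P (T_ v)).1).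
    by rewrite sub_T (Pm _ _ PT) PT -[RHS]/(sub d (T_ v)) sub_T.
  - change ((P (sub d (s_ v))).1 = sub d (P (s_ v)).1).
    by rewrite sub_s (Pm _ _ Ps) Ps -[RHS]/(sub d (s_ v)) sub_s.
  - change ((P (sub d (xs_ v k))).1 = sub d (P (xs_ v k)).1).
    by rewrite [sub d (xs_ _ _)]sub_var /subX [P _]Pv /= S0.
  - change ((P (sub d (x_ v k n))).1 = sub d (P (x_ v k n)).1).
    by rewrite [sub d (x_ _ _ _)]sub_var /subX [P _]Pv /= S0.
  - change ((P (sub d (y_ v k n))).1 = sub d (P (y_ v k n)).1).
    by rewrite [sub d (y_ _ _ _)]sub_var /subX [P _]Pv /= S0.
pose Q y : D := ((P (sub d y)).1, sub d (P y).2).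
have QE : Q = P \o sub d.
  apply: (hom_unique Dc) => //.
  - apply: (dual_mk_hom hPS).
    + by move=> x y; rewrite PB -[(_ - _).2]/((P x).2 - (P y).2) SB.
    + move=> x y; rewrite PM -[(P x * P y).2]/((P x).1 * (P y).2 + (P x).2 * (P y).1) SD !SM.
      have E2 u : (P (sub d u)).1 = sub d (P u).1 by exact: (congr1 (fun f => f u) E1).
      by rewrite -!E2.
    + by rewrite P1 -[(1 : D).2]/(0 : C) S0.
    + move=> e e0.
      have : nbhs (0 : C) (sub d @^-1` [set y | gauss y < e]).
        have [_ _ c] := sub_hom d; apply: c; rewrite S0.
        by apply/tate_nbhs; exists e => // y; rewrite subr0.
      move=> /tate_nbhs[e' e'0 he']; apply: filterS (hom_cont hP e'0) => y /= h.
      apply: he'; rewrite subr0; apply: le_lt_trans h; by rewrite le_max lexx orbT.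
  - by move=> c; rewrite /Q /= sub_cst Pc /= S0.
  - have ind_fix k : sub d (ind v j k) = ind v j k by rewrite /ind; case: ifP.
    case=> [||k|k n|k n]; rewrite /Q /= sub_var /subX Pv.
    + by rewrite (Pm _ _ PT) /= S0.
    + by rewrite (Pm _ _ Ps) /= S0.
    + by rewrite /= ind_fix.
    + by rewrite /= ind_fix.
    + by rewrite /= ind_fix.
move=> h; rewrite -[LHS]/((P \o sub d) z).2 -QE /Q.
by rewrite -[LHS]/(sub d (lin Kp j z)) h S0.
Qed.

Let lin0 z : (dsub Kp (ind0 v) z).2 = 0.
Proof.
rewrite (dsub_scale Kp (u := 0) (ind0 v) (ind0 v)) ?mul0r //.
Qed.

(** Only the term s x_{j,*} contributes along x_{j,*}, and s reads pi^l s in the coordinates of W l.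
    Powers of pi in the denominators are cleared first and cancelled at the end. *)
Let lin_psum j l (n : nat) : lin Kp (varxs j) (chi (scst (W l)
    (psum (K := FS) j T (S (xs_ v j)) (fun k => S (x_ v j k)) n))) = cst (pi ^+ l) * s_ v.
Proof.
set h := psum _ _ _ _ _; set P := dsub Kp (ind_le1 v (varxs j)).
have hP : tring_hom P := dsub_hom Kp _.
have [_ PM _ P0 _] := hom_facts hP.
have Pc c : P (cst c) = dk v c := dsub_cst Kp _ c.
have Pv k : P (tate_var v k) = dX (ind v (varxs j)) k := dsub_var Kp _ k.
have hF := comp_hom (psi_hom l) hP; set F := P \o (sub l \o ev) in hF.
have [_ FM _ F0 FD] := hom_facts hF.
have FC k : F (ϖ ^+ k) = dk v (pi ^+ k) by rewrite /F /= evpi sub_cst Pc.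
have ck c (y : D) : (dk v c * y).2 = cst c * y.2.
  by rewrite -[LHS]/(cst c * y.2 + 0 * y.1) mul0r addr0.
have Fx k : F (S (x_ v j k)) = 0.
  rewrite -[LHS]/(P (sub l (s_ v * x_ v j k))) subM [sub l (x_ v j k)]sub_var /subX PM [P (tate_var v _)]Pv /=.
  have -> : (0, ind v (varxs j) (varx j k)) = 0 :> D.
    by apply: dualP => //=; rewrite /ind; case: eqP.
  by rewrite mulr0.
have F0' : F (S (xs_ v j)) = (0, cst (pi ^+ l) * s_ v).
  rewrite -[LHS]/(P (sub l (s_ v * xs_ v j))) subM [sub l (xs_ v j)]sub_var /subX PM [P (tate_var v _)]Pv /=.
  rewrite sub_s PM Pc [P (s_ v)](Pv vars) /=; apply: dualP.
    by rewrite -[LHS]/(cst (pi ^+ l) * s_ v * 0) mulr0.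
  rewrite -[LHS]/(cst (pi ^+ l) * s_ v * ind v (varxs j) (varxs j) + (cst (pi ^+ l) * 0 + 0 * s_ v) * 0).
  by rewrite mulr0 addr0 /ind eqxx mulr1.
have [_ CM _ _ _] := hom_facts (chi_hom l).
have hFU : FU (W l) h by exact: psum_FU.
pose an : A := ϖ ^+ (j * n) * S (xs_ v j) + \sum_(k < n) ϖ ^+ (j * (n - k)) * T ^+ k * S (x_ v j k).
have clr : i ϖ ^+ (j * n) * h = i an by exact: psum_clear.
have e1 : cst (pi ^+ (j * n)) * chi (scst (W l) h) = sub l (ev an).
  rewrite -chiE -clr -(rmorphXn i) (scstM (FU_i _ _) hFU) (CM (scst (W l) (i (ϖ ^+ (j * n)))) (scst (W l) h)).
  by rewrite chiE evpi sub_cst.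
have : cst (pi ^+ (j * n)) * (P (chi (scst (W l) h))).2 = cst (pi ^+ (j * n)) * (cst (pi ^+ l) * s_ v).
  rewrite -ck -Pc -PM e1 -[P (sub l _)]/(F an) /an FD FM F0' FC.
  have -> : F (\sum_(k < n) ϖ ^+ (j * (n - k)) * T ^+ k * S (x_ v j k)) = 0.
    apply: (big_ind (fun a => F a = 0)) => [|a b ha hb|k _]; first exact: F0.
      by rewrite FD ha hb addr0.
    by rewrite FM Fx mulr0.
  by rewrite addr0 ck.
move=> /eqP; rewrite -subr_eq0 -mulrBr => /eqP/tate_mul_eq0[h0|h0]; last by apply/eqP; rewrite -subr_eq0; apply/eqP.
have : gauss (cst (pi ^+ (j * n))) = 0 by rewrite h0 gauss0.
rewrite /tate_cst gauss_mono => /eqP; rewrite gt_eqF // av_gt0 expf_neq0 //.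
exact: piK_neq0 pi1.
Qed.

Theorem non_adic : ~ adic_space (Qstr FS).
Proof.
move=> ad; have [V0 [oV0 V0x H]] := adic_dense (q x0) ad.
have [k hk] := W_nbhs (oV0 : open (q @^-1` V0)) V0x.
(* The first index out of reach of the chart; N is the image of the set on which the invariant
   series for this j converges. *)
pose j := k.+1; pose N : set (orb FS) := q @` [set x : X | x T (ϖ ^+ j.+1)].
have qN x : N (q x) <-> x T (ϖ ^+ j.+1).
  split=> [[x' hx' /orb_eqP[g <-]]|h]; last by exists x.
  by rewrite /= gXE tau_T (@tau_piX FS).
have oN : open N.
  have : open (rational_set [:: T] (ϖ ^+ j.+1) : set X) by exact: open_rational.
  rewrite -[open N]/(open (q @^-1` N)); congr open; apply/seteqP; split=> x.
    by move=> [h _]; apply/qN; apply: h; rewrite inE.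
  by move=> /qN h; split; [move=> f; rewrite inE => /eqP ->|exact: xpiX0].
have Nx : N (q x0).
  apply/qN/x0E; rewrite evT /T_ /tate_var tmonoE (_ : (mone == _) = false) ?mulr0n ?av0 ?av_ge0 //.
  by apply/eqP => /(congr1 (fun m : {cmonom var} => m varT)); rewrite cm1 cmUU.
have [V [oV Vx VN VV0 dns]] := H N oN Nx.
have [l0 hl0] := W_nbhs (oV : open (q @^-1` V)) Vx.
(* W l lies in the small set V as well as in W k, so both kinds of functions can be evaluated on
   it. *)
pose l := (k + l0)%N.
have WlV : W l `<=` q @^-1` V by apply: subset_trans hl0; apply: W_mono; exact: leq_addl.
have WlWk : W l `<=` W k by apply: W_mono; exact: leq_addr.
pose f (u : Qstr FS V) : C := chi (sres (W l) (qpull u)).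
have hf : tring_hom f.
  exact: comp_hom (comp_hom (qpull_hom oV) (sres_hom false WlV)) (chi_hom l).
pose P := dsub Kp (ind_le1 v (varxs j)); pose P0 := dsub Kp (ind0 v).
(* On functions from the chart the coefficient along x_{j,*} vanishes by [lin_inv]; density then
   forces it to vanish for all functions on V. *)
have E : P \o f = P0 \o f.
  apply: (dns D) => //.
  - exact: dual_nonarch.
  - exact: comp_hom hf (dsub_hom Kp _).
  - exact: comp_hom hf (dsub_hom Kp _).
  - exact: Qstr_uniformizer.
  - move=> t; apply: dualP; first exact: dsub_fst.
    rewrite [RHS]lin0 -[LHS]/(lin Kp (varxs j) (f (res (Qstr FS) V0 V t))).
    have -> : f (res (Qstr FS) V0 V t) = sub l0 (chi (sres (W k) (qpull t))).
      rewrite -chi_res /f; congr chi; apply/(sec_eqP (oW l)) => x Wx.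
      have Vqx := WlV x Wx; have V0qx := VV0 _ Vqx.
      apply: peq_tr (sres_rep _ WlV (oW l) Wx) _.
      apply: peq_tr (qpullP _ oV Vqx) _.
      apply: (peq_tr (v := frep t x)).
        by apply: (@sres_rep FS true (q @^-1` V0) (q @^-1` V)) => // z; exact: VV0.
      apply: peq_sym; apply: peq_tr (sres_rep _ WlWk (oW l) Wx) _.
      apply: peq_tr (sres_rep _ hk (oW k) (WlWk x Wx)) _.
      exact: qpullP.
    apply: lin_sub; exact: (lin_inv (chi_inv t oV0 hk) (ltnSn k)).
pose a0 : A := S (xs_ v j); pose a (n : nat) : A := S (x_ v j n); pose y (n : nat) : A := S (y_ v j n).
have Spb z : gauss z <= 1 -> power_bounded (S z).
  by move=> h; apply/ev_pb; rewrite evS gauss_mul gauss_var mul1r.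
pose sg : kG FS := sigma.
have sE z : ev (kact sg (S z)) = s_ v * sig Kp pi1 z.
  rewrite ev_tau (rho_sigma charK _ _ cardG) evS.
  by have [_ SM _ _ _] := hom_facts (sig_hom Kp pi1); rewrite SM sig_var.
have ta0 : kact sg a0 = a0 - ϖ ^+ j * y 0%N.
  by apply: ev_inj; rewrite sE evB evM evpi !evS sig_var /sigX; ring.
have ta n : kact sg (a n) = a n + ϖ ^+ j * y n - T * y n.+1.
  by apply: ev_inj; rewrite sE evB evD !evM evpi evT !evS sig_var /sigX; ring.
have pba n : power_bounded (a n) by apply: Spb; rewrite gauss_var.
have pby n : power_bounded (y n) by apply: Spb; rewrite gauss_var.
have hV x : V (q x) -> x T (ϖ ^+ j.+1) by move=> /VN/qN.
set e : Qstr FS V := fq (D := secf true (q @^-1` V)) (csum (K := FS) j T a0 a).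
have e0 : 0 < v (pi ^+ l) by rewrite av_gt0 expf_neq0 // (piK_neq0 pi1).
(* The coefficients of all partial sums have norm exactly |pi|^l, so within this neighbourhood the
   coefficient of the limit cannot be 0. *)
pose B := [set u : secR false (W l) | dnorm (P (chi u)) < v (pi ^+ l)].
have hB : nbhs (0 : secR false (W l)) B.
  have [_ _ _ c0 _] := hom_facts (chi_hom l).
  have h : nbhs (chi (0 : secR false (W l))) [set z | dnorm (P z) < v (pi ^+ l)].
    rewrite c0; exact: hom_cont (dsub_hom Kp _) e0.
  by case: (chi_hom l) => _ _ c; exact: c h.
have [n] := csum_lim (sg := sg) sigma_gen (tau_T sg) pba pby ta0 ta oV hV (oW l) WlV hB.
have [CB _ _ _ _] := hom_facts (chi_hom l).
rewrite /B /= CB => hn; have {hn} : gauss (lin Kp (varxs j) (chi (sres (W l) (qpull e)) -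
   chi (scst (W l) (psum (K := FS) j T a0 a n)))) < v (pi ^+ l).
  by apply: le_lt_trans hn; rewrite le_max lexx orbT.
rewrite lin_B lin_psum.
have -> : lin Kp (varxs j) (chi (sres (W l) (qpull e))) = 0.
  rewrite -[LHS]/((P \o f) e).2 E; exact: lin0.
by rewrite sub0r gauss_N gauss_mul gauss_var mulr1 /tate_cst gauss_mono ltxx.
Qed.

End NonAdic.

Theorem corollary1p2 (RR : realType) (p : nat) (K : fieldType)
    (v : absval RR K) (pi : K) (G : finGroupType) (sigma : G)
    (p_prime : prime p) (charK : p \in [pchar K])
    (K_perfectoid : perfectoid_field p v) (pi_lt1 : 0 < v pi < 1)
    (cardG : #|G| = p) (sigma_gen : forall g : G, g \in <[sigma]>%g) :
  let R := ringR v in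
  let Rcirc := @power_bounded R in
  exists (rho : G -> tate v var -> tate v var) (rhoR : G -> R -> R),
    [/\ is_Cp_action pi sigma rho,
        forall g r, Rval (rhoR g r) = rho g (Rval r),
        [/\ sousperfectoid p R, stably_uniform Rcirc & sheafy Rcirc],
        exists (O : vstructure (spa Rcirc)) (iota : R -> O setT)
               (act : G -> vmor O O)
               (Y : topologicalType) (Q : vstructure Y) (q : vmor O Q),
          [/\ spa_structure iota, is_vaction act,
              induced_action rhoR iota act, is_quotient act q
            & ~ adic_space Q]
      & ~ perfectoid_ring p R].
Proof.
move=> R Rcirc; pose FS := Rfs p_prime charK K_perfectoid pi_lt1 cardG sigma_gen.
exists (rho K_perfectoid pi_lt1 sigma_gen), (rhoR K_perfectoid pi_lt1 sigma_gen); split.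
- exact: (rho_action charK K_perfectoid pi_lt1 cardG sigma_gen).
- by [].
- split; [exact: (fsplit_sousperfectoid FS)|exact: (spa_stably_uniform FS)|exact: (spa_sheafy FS)].
- exists (Ostr FS), (@Orho FS), (@act FS), (orb FS), (Qstr FS), (@qmor FS); split.
  + exact: (Ostr_spa FS).
  + exact: (act_vaction FS).
  + exact: (act_induced (K := FS)).
  + exact: (qmor_quotient FS).
  + exact: (non_adic (pp := p_prime) (charK := charK) (Kp := K_perfectoid) (pi1 := pi_lt1) (cardG := cardG) (sigma_gen := sigma_gen)).
- exact: (ringR_not_perfectoid p_prime charK pi_lt1 cardG).
Qed.
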